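(* Let $\mathcal H$ be a regular unitarily invariant space on $\mathbb B_d$, and let $\mathcal J$ be a (norm) closed ideal in $A(\mathcal H)$. Let $E=Z(\mathcal J)\cap\partial\mathbb B_d$, and let $\tilde{\mathcal J}$ be the weak-$*$ closure of $\mathcal J$ in $\operatorname{Mult}(\mathcal H)$. Then $$\mathcal J=\tilde{\mathcal J}\cap\mathcal I(E).$$
   Context: Let $d\in\mathbb N$, let $\mathbb B_d\subset\mathbb C^d$ be the Euclidean open unit ball and $\partial\mathbb B_d$ the unit sphere. A regular unitarily invariant space on $\mathbb B_d$ is a reproducing kernel Hilbert space $\mathcal H$ on $\mathbb B_d$ with kernel $K(z,w)=\sum_{n=0}^\infty a_n\langle z,w\rangle^n$, where $a_0=1$, $a_n>0$ for all $n$, and $\lim_{n\to\infty} a_n/a_{n+1}=1$. $\operatorname{Mult}(\mathcal H)$ is the multiplier algebra, normed by $\|f\|_{\operatorname{Mult}(\mathcal H)}=\|M_f\|_{B(\mathcal H)}$, where $M_f$ is multiplication by $f$. Via $f\mapsto M_f$ it is a WOT-closed subalgebra of $B(\mathcal H)$, and its weak-$*$ topology is that of the dual of $\mathcal T(\mathcal H)/\operatorname{Mult}(\mathcal H)_\perp$, where $\mathcal T(\mathcal H)$ is the trace class. $A(\mathcal H)$ is the norm closure of $\mathbb C[z_1,\dots,z_d]$ in $\operatorname{Mult}(\mathcal H)$; its elements extend uniquely to continuous functions on $\overline{\mathbb B_d}$. For an ideal $\mathcal J$ of $A(\mathcal H)$, $Z(\mathcal J)=\{z\in\overline{\mathbb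 B_d}: f(z)=0\text{ for all }f\in\mathcal J\}$. For a closed set $E\subset\overline{\mathbb B_d}$, $\mathcal I(E)=\{f\in A(\mathcal H): f|_E=0\}$. *)

(* Defs.v *)
From HB Require Import structures.
From mathcomp Require Import all_boot all_order all_algebra.
From mathcomp Require Import sesquilinear complex.
From mathcomp Require Import all_classical all_reals all_analysis.
From mathcomp Require mpoly.

Set Implicit Arguments.
Unset Strict Implicit.
Unset Printing Implicit Defensive.

Import Order.TTheory GRing.Theory Num.Theory.
Import numFieldNormedType.Exports.

Local Open Scope classical_set_scope.
Local Open Scope complex_scope.
Local Open Scope ring_scope.

(* A complex Hilbert space whose elements are identified, through [hev], with
   functions on [X]. The inner product is linear in its first argument, and
   completeness is that of the underlying Banach space, whose norm is the one
   of the inner product. *)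
Record hilbertFunctionSpace (R : realType) (X : Type) := HilbertFunctionSpace {
  hsort :> completeNormedModType R[i] ;
  hdot : {dot hsort for (@Num.conj R[i])} ;
  hdot_norm : forall u : hsort, `|u| ^+ 2 = hdot u u ;
  hev : {linear hsort -> (X -> R[i]^o)} ;
  hev_inj : injective hev }.

Section HilbertFunctionSpaces.
Context {R : realType} {X : Type}.
Variable H : hilbertFunctionSpace R X.
Local Notation C := R[i].

Definition reproducing_kernel (K : X -> X -> C) :=
  forall w, exists k : H,
    (forall z, hev H k z = K z w) /\ (forall u, hev H u w = hdot H u k).

Definition multiplier : set (X -> C) :=
  [set f | forall u : H, exists v : H, hev H v = f * hev H u].

(* The operator M_f; the value of [xget] is unique by injectivity of [hev], and
   it is only meaningful when [f] is a multiplier. *)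
Definition mult_op (f : X -> C) (u : H) : H :=
  xget 0 [set v : H | hev H v = f * hev H u].

Definition mult_norm (f : X -> C) : \bar R :=
  ereal_sup [set (complex.Re `|mult_op f u|)%:E | u in [set u : H | `|u| <= 1]].

Definition mult_norm_closure (S : set (X -> C)) : set (X -> C) :=
  [set f | multiplier f /\
     forall eps : R, 0 < eps ->
       exists2 g, S g & (mult_norm (f - g)%R < eps%:E)%E].

(* Orthonormal bases are indexed by [nat]: the spaces of interest are separable
   and infinite dimensional. [onb] chooses one of them; traces do not depend on the
   choice. *)
Definition orthonormal_basis (e : nat -> H) :=
  (forall m n, hdot H (e m) (e n) = (m == n)%:R) /\
  (forall u, (forall n, hdot H u (e n) = 0) -> u = 0).

Definition onb : nat -> H := xget (fun=> 0) orthonormal_basis.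

(* [P] is the absolute value of [T], i.e. P >= 0 and P^2 = T^* T; the last
   equation is written weakly, using that a positive [P] is self-adjoint. *)
Definition operator_abs (T P : {linear H -> H}) :=
  [/\ continuous P, forall u, 0 <= hdot H (P u) u &
      forall u v, hdot H (P u) (P v) = hdot H (T u) (T v)].

Definition trace_class (T : {linear H -> H}) :=
  continuous T /\ exists2 P, operator_abs T P &
    cvgn (series (fun n => hdot H (P (onb n)) (onb n) : C^o)).

Definition trace (A : H -> H) : C :=
  limn (series (fun n => hdot H (A (onb n)) (onb n) : C^o)).

(* [f |-> (T |-> tr (M_f T))], the pairing of multipliers with the trace
   class; it identifies Mult(H) with the dual of the trace class modulo the
   annihilator of Mult(H). *)
Definition trace_pairing (f : X -> C) :
    {ptws {T : {linear H -> H} | trace_class T} -> C^o} :=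
  fun T => trace (mult_op f \o sval T).

Definition weak_star_closure (S : set (X -> C)) : set (X -> C) :=
  multiplier `&` closure (S : set (initial_topology trace_pairing)).

End HilbertFunctionSpaces.

Section UnitBall.
Variables (R : realType) (d : nat).
Local Notation C := R[i].
(* [C^o] carries the topology of [C]. *)
Local Notation Cd := 'rV[C^o]_d.

Definition cdot (z w : Cd) : C := \sum_(i < d) z 0 i * (w 0 i)^*.

Definition unit_ball : set Cd := [set z | cdot z z < 1].
Definition closed_unit_ball : set Cd := [set z | cdot z z <= 1].
Definition unit_sphere : set Cd := [set z | cdot z z = 1].

Definition regular_unitarily_invariant
    (H : hilbertFunctionSpace R unit_ball) :=
  exists (a : R ^nat) (K : unit_ball -> unit_ball -> C),
    [/\ a 0%N = 1, forall n, 0 < a n,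
        (fun n => a n / a n.+1) @ \oo --> (1 : R),
        forall z w, series (fun n => (a n)%:C * cdot (val z) (val w) ^+ n : C^o)
                      @ \oo --> (K z w : C^o) &
        reproducing_kernel H K].

Definition polynomial_functions : set (unit_ball -> C) :=
  [set f | exists p : mpoly.mpoly d C,
     f = fun z : unit_ball => mpoly.meval (fun i => val z 0 i) p].

Variable H : hilbertFunctionSpace R unit_ball.

Definition A_alg : set (unit_ball -> C) :=
  mult_norm_closure H polynomial_functions.

Definition closed_ideal (J : set (unit_ball -> C)) :=
  [/\ J `<=` A_alg, J 0, forall f g, J f -> J g -> J (f + g),
      forall f g, A_alg f -> J g -> J (f * g) &
      A_alg `&` mult_norm_closure H J `<=` J].

(* The continuous extension of [f] to the closed ball; its values off the
   closed ball are irrelevant. *)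
Definition ball_ext (f : unit_ball -> C) : Cd -> C^o :=
  xget (fun=> 0) [set g : Cd -> C^o | {within closed_unit_ball, continuous g} /\
                          forall z : unit_ball, g (val z) = f z].

Definition zero_set (J : set (unit_ball -> C)) : set Cd :=
  [set z | closed_unit_ball z /\ forall f, J f -> ball_ext f z = 0].

Definition vanishing_ideal (E : set Cd) : set (unit_ball -> C) :=
  [set f | A_alg f /\ forall z, E z -> ball_ext f z = 0].

End UnitBall.

Arguments unit_ball : clear implicits.
Arguments unit_sphere : clear implicits.
Arguments closed_unit_ball : clear implicits.

(* Main.v *)
Require Import Defs.
From HB Require Import structures.
From mathcomp Require Import all_boot all_order all_algebra.
From mathcomp Require Import sesquilinear complex polyrcf.
From mathcomp Require Import all_classical all_reals all_analysis.
From mathcomp Require Import ring lra zify.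
From mathcomp Require Import cyclic separable cyclotomic.
From mathcomp Require Import -(notations) mpoly.

Set Implicit Arguments.
Unset Strict Implicit.
Unset Printing Implicit Defensive.

Import Order.TTheory GRing.Theory Num.Theory.
Import numFieldNormedType.Exports.

Local Open Scope classical_set_scope.
Local Open Scope complex_scope.
Local Open Scope ring_scope.

(** Let [f] lie in the weak star closure of the ideal [J] and vanish on [E], and
    suppose that [f] is not in [J]. Hahn-Banach gives a functional [phi] on
    polynomials, bounded by the multiplier norm, that annihilates [J] but not [f]
    ([separating_functional]). The proof splits [phi] into a weak star continuous
    part and a part that lives on [E], and each of them vanishes at [f].

    By [monomial_model] the space is a weighted space of power series, in which
    monomials are orthogonal; the ratios of weights in successive degrees are
    asymptotically those of the Hardy space of the sphere. On the Hardy space the multiplier norm is the sup norm on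
    the sphere ([hardy_bound]), and conjugating by the diagonal operator that
    compares the two spaces changes a multiplication operator by a compact
    perturbation only. Hence [phi = mu + kap], where [mu] is a functional on bounded
    functions on the sphere, in effect a measure, and [kap] is bounded by the norm of
    the compact perturbation ([boundary_part]). A gliding hump argument ([hump])
    shows that [kap] is small on polynomials of high order.

    Smallness on polynomials of high order is what weak star continuity amounts to.
    Such a functional is a norm convergent sum of functionals of finite degree,
    by de la Vallee Poussin cutoffs, each of which is of finite rank with control
    of the trace norm; hence it is given by a trace class operator
    ([trace_class_repr]), and it annihilates the weak star closure of [J] as soon as
    it annihilates [J] ([weak_star_vanish]).

    It remains to treat [mu]. For [g] in [J] the functional [g mu] is small on
    polynomials of high order, because [phi] annihilates [J] ([ideal_tail]).
    Functionals with this property form a band ([band], Henkin's theorem): they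
    are stable under multiplication by functions of a self-adjoint algebra that
    contains the boundary values of [A(H)]. This uses the fact that the product
    of a polynomial of high order with a conjugate coordinate is uniformly close to a
    polynomial ([coordJ_approx]). Consequently the part of [mu] off the common zero
    set [E] of [J] is small on polynomials of high order; cut-offs built from the
    moduli of members of [J] converge, in the mean with respect to a positive
    functional dominating [mu], to the indicator of [E] ([exhaustion],
    [singular_part]). The limit [M] of the cut-off functionals is the part carried by
    [E]: by compactness of the sphere it vanishes at [f], and at members of [J].
    Therefore [phi - M] annihilates [J] and is weak star continuous, so it vanishes
    at [f] as well ([ideal_membership]).

    Measures are replaced by functionals on all bounded functions throughout:
    domination by a positive functional, approximate Radon-Nikodym densities and
    Cauchy-Schwarz inequalities take the place of integration theory. *)

(** * Real-valued norms *)

Section RealNorm.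
Variable R : realType.
Local Notation C := R[i].

(** The norms of complex normed spaces take values in [R[i]]; inequalities are
    more convenient between real numbers. *)
Definition nr (V : normedZmodType C) (v : V) : R := complex.Re `|v|.

Lemma nat_gt (x : R) : exists n, x < n%:R.
Proof. by exists (Num.trunc x).+1; rewrite real_truncnS_gt ?num_real. Qed.

Section NormedZmod.
Variable V : normedZmodType C.
Implicit Types u v : V.

Lemma nrE v : `|v| = (nr v)%:C.
Proof. by rewrite /nr RRe_real // ger0_real. Qed.

Lemma nr_ge0 v : 0 <= nr v.
Proof. by rewrite -ler0c -nrE. Qed.

Lemma nrD u v : nr (u + v) <= nr u + nr v.
Proof. by rewrite -lecR rmorphD /= -!nrE ler_normD. Qed.

Lemma nrN v : nr (- v) = nr v.
Proof. by rewrite /nr normrN. Qed.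

Lemma nrB u v : nr (u - v) <= nr u + nr v.
Proof. by rewrite -(nrN v) nrD. Qed.

Lemma nr_dist u v : nr (u - v) = nr (v - u).
Proof. by rewrite -nrN opprB. Qed.

Lemma nr_ler_dist u v : nr u <= nr v + nr (u - v).
Proof. by rewrite -{1}(subrKC v u) nrD. Qed.

Lemma nr0 : nr (0 : V) = 0.
Proof. by rewrite /nr normr0. Qed.

Lemma nr_eq0 v : nr v = 0 -> v = 0.
Proof. by move=> h; apply/eqP; rewrite -normr_eq0 nrE h. Qed.

Lemma nr_le v c : (nr v <= c) = (`|v| <= c%:C).
Proof. by rewrite nrE lecR. Qed.

Lemma nr_lt v c : (nr v < c) = (`|v| < c%:C).
Proof. by rewrite nrE ltcR. Qed.

Lemma nr_sum (I : Type) (s : seq I) (P : pred I) (F : I -> V) :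
  nr (\sum_(i <- s | P i) F i) <= \sum_(i <- s | P i) nr (F i).
Proof.
elim/big_ind2: _ => [|a b a' b' h h'|//]; first by rewrite nr0.
exact: le_trans (nrD _ _) (lerD h h').
Qed.

End NormedZmod.

Lemma nrM (a b : C) : nr (a * b) = nr a * nr b.
Proof. by apply: complexI; rewrite rmorphM /= -!nrE normrM. Qed.

Lemma nrX (a : C) n : nr (a ^+ n) = nr a ^+ n.
Proof. by apply: complexI; rewrite rmorphXn /= -!nrE normrX. Qed.

Lemma nrV (a : C) : nr a^-1 = (nr a)^-1.
Proof. by apply: complexI; rewrite fmorphV /= -!nrE normfV. Qed.

Lemma nr1 : nr (1 : C) = 1.
Proof. by apply: complexI; rewrite -nrE normr1. Qed.

Lemma nrC (c : R) : nr c%:C = `|c|.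
Proof. by apply: complexI; rewrite -nrE normc_def /= expr0n addr0 sqrtr_sqr. Qed.

Lemma nr_nat n : nr (n%:R : C) = n%:R.
Proof. by apply: complexI; rewrite -nrE normr_nat rmorph_nat. Qed.

Lemma nr_conj (a : C) : nr (a^*)%C = nr a.
Proof. by case: a => a b; rewrite /nr !normc_def /= sqrrN. Qed.

Lemma nrZ (V : normedModType C) (a : C) (v : V) : nr (a *: v) = nr a * nr v.
Proof. by apply: complexI; rewrite rmorphM /= -!nrE normrZ. Qed.

Lemma nr_sqr (a : C) : nr a ^+ 2 = complex.Re a ^+ 2 + complex.Im a ^+ 2.
Proof. by apply: complexI; rewrite add_Re2_Im2 nrE rmorphXn. Qed.

Lemma Re_le_nr (a : C) : complex.Re a <= nr a.
Proof.
have [h|h] := ltP (complex.Re a) 0; first by rewrite (le_trans (ltW h)) ?nr_ge0.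
rewrite -(@ler_pXn2r _ 2) ?nnegrE ?nr_ge0 // nr_sqr.
by rewrite lerDl sqr_ge0.
Qed.

Lemma conjcE (a : C) : Num.conj a = (a^*)%C.
Proof. by []. Qed.

Lemma mulcJ (a : C) : a * (a^*)%C = ((nr a) ^+ 2)%:C.
Proof. by rewrite -conjcE -normCK nrE rmorphXn. Qed.

Lemma Re_conjc (a : C) : complex.Re (a^*)%C = complex.Re a.
Proof. by case: a. Qed.

Lemma ReD (a b : C) : complex.Re (a + b) = complex.Re a + complex.Re b.
Proof. by case: a; case: b. Qed.

Lemma ReN (a : C) : complex.Re (- a) = - complex.Re a.
Proof. by case: a. Qed.

Lemma ReZ (c : R) (a : C) : complex.Re (c%:C * a) = c * complex.Re a.
Proof. by case: a => a b /=; rewrite mul0r subr0. Qed.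

Lemma Re_sum (I : Type) (s : seq I) (P : pred I) (F : I -> C) :
  complex.Re (\sum_(i <- s | P i) F i) = \sum_(i <- s | P i) complex.Re (F i).
Proof. by elim/big_rec2: _ => // i y1 y2 _ <-; rewrite ReD. Qed.

(** Rotating a number onto the positive axis reduces bounds of moduli to bounds
    of real parts. *)
Lemma nr_phase (a : C) : exists u : C, nr u = 1 /\ u * a = (nr a)%:C.
Proof.
have [->|a0] := eqVneq a 0; first by exists 1; rewrite nr1 mulr0 nr0.
have n0 : (nr a)%:C != 0 :> C by rewrite -nrE normr_eq0.
exists ((a^*)%C / (nr a)%:C); split.
  rewrite nrM nr_conj nrV nrC ger0_norm ?nr_ge0 // divff //.
  by apply: contra_neq n0 => ->.
by rewrite mulrAC (mulrC _ a) mulcJ rmorphXn expr2 mulfK.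
Qed.

End RealNorm.

(** * Hahn-Banach *)

Section HahnBanach.
Variables (R : realType) (V : lmodType R[i]).
Local Notation C := R[i].

(** A consistent cone of prescribed upper bounds: [G (v, c)] asks for a functional
    whose real part at [v] is at most [c]. Symmetry of the set of constrained
    vectors excludes bounds on a half-space that force the value minus infinity. *)
Definition bound_cone (G : set (V * R)) :=
  [/\ G (0, 0),
      forall x y, G x -> G y -> G (x.1 + y.1, x.2 + y.2),
      forall t x, 0 < t -> G x -> G (t%:C *: x.1, t * x.2),
      forall c, G (0, c) -> 0 <= c &
      forall x, G x -> exists c, G (- x.1, c)].

(** Zorn's lemma applies to the cones that contain [G], to which the empty set is
    added as the union of the empty chain. *)
Lemma bound_cone_maximal (G : set (V * R)) : bound_cone G ->
  exists K, [/\ G `<=` K, bound_cone K &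
    forall K', bound_cone K' -> K `<=` K' -> K' `<=` K].
Proof.
move=> hG; pose P (A : set (V * R)) := A = set0 \/ (G `<=` A /\ bound_cone A).
have [|K [PK maxK]] := @Zorn_bigcup _ P.
  move=> F FP Ftot.
  have [[A FA A0]|F0] := pselect (exists2 A, F A & A !=set0); last first.
    left; rewrite -subset0 => x [A FA Ax]; exfalso; apply: F0.
    by exists A => //; exists x.
  have good B x : F B -> B x -> G `<=` B /\ bound_cone B.
    by move=> FB Bx; case: (FP _ FB) => // B0; rewrite B0 in Bx.
  have both x y : (\bigcup_(X in F) X) x -> (\bigcup_(X in F) X) y ->
      exists B, [/\ F B, B x & B y].
    move=> [B FB Bx] [B' FB' By].
    by case: (Ftot _ _ FB FB') => /(_ _ _) h; [exists B'|exists B]; split => //; apply: h.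
  right; split.
    by case: A0 => x Ax; move=> y Gy; exists A => //; apply: (good _ _ FA Ax).1.
  split.
  - case: A0 => x Ax; exists A => //.
    by have [_ []] := good _ _ FA Ax.
  - move=> x y Ux Uy; have [B [FB Bx By]] := both _ _ Ux Uy.
    by exists B => //; have [_ [_ h _ _ _]] := good _ _ FB Bx; apply: h.
  - move=> t x t0 [B FB Bx]; exists B => //.
    by have [_ [_ _ h _ _]] := good _ _ FB Bx; apply: h.
  - by move=> c [B FB Bx]; have [_ [_ _ _ h _]] := good _ _ FB Bx; apply: h.
  - move=> x [B FB Bx]; have [_ [_ _ _ _ h]] := good _ _ FB Bx.
    by have [c Bc] := h _ Bx; exists c, B.
case: PK => [K0|[GK cK]].
  have [G0 _ _ _ _] := hG.
  exfalso; apply: (maxK G); last by right; split.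
  by rewrite K0; split; [exact: sub0set|move=> /(_ _ G0)].
exists K; split => // K' cK' KK'.
apply: contrapT => nK; apply: (maxK K'); first by split.
by right; split => //; apply: subset_trans KK'.
Qed.

(** Hahn-Banach in the form used below. In a maximal cone each pair [(v, c)] is
    present or excluded by a bound on [- v]; hence the least bound is linear. *)
Lemma hahn_banach (G : set (V * R)) : bound_cone G ->
  exists L : {scalar V}, forall v c, G (v, c) -> complex.Re (L v) <= c.
Proof.
move=> /bound_cone_maximal [K [GK cK maxK]].
have [K0 KD KZ Kpos Ksym] := cK.
have KD' v c w b : K (v, c) -> K (w, b) -> K (v + w, c + b).
  by move=> h h'; apply: (KD (v, c) (w, b)).
have KZ' t v c : 0 < t -> K (v, c) -> K (t%:C *: v, t * c).
  by move=> t0 h; apply: (KZ _ (v, c)).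
have Kdom v : exists c, K (v, c).
  pose K' := [set x : V * R | exists w b (s : R), [/\ K (w, b), x.1 = w + s%:C *: v & x.2 = b]].
  have [[c h]|nv] := pselect (exists c, K (v, c)); first by exists c.
  suff: K' `<=` K.
    move=> /(_ (v, 0)) h; exists 0; apply: h; exists 0, 0, 1; split => //=.
    by rewrite add0r scale1r.
  have nv' (s : R) (w : V) b : K (w, b) -> w + s%:C *: v = 0 -> s = 0.
    move=> Kw wv; apply: contrapT => /eqP s0.
    have [s_gt0|s_lt0] : 0 < s \/ 0 < - s by rewrite oppr_gt0; move: s0; rewrite neq_lt => /orP[]; [right|left].
      have [b' Kw'] := Ksym _ Kw; apply: nv; exists (s^-1 * b').
      have := KZ' s^-1 _ _ _ Kw'; rewrite invr_gt0 => /(_ s_gt0).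
      suff -> : (s^-1)%:C *: - w = v by [].
      have -> : - w = s%:C *: v by apply: esym; apply/eqP; rewrite -addr_eq0 addrC wv.
      by rewrite scalerA -rmorphM /= mulVf // scale1r.
    apply: nv; exists ((- s)^-1 * b).
    have := KZ' (- s)^-1 _ _ _ Kw; rewrite invr_gt0 => /(_ s_lt0).
    suff -> : ((- s)^-1)%:C *: w = v by [].
    have -> : w = (- s)%:C *: v.
      by apply/eqP; rewrite rmorphN scaleNr -addr_eq0 wv.
    by rewrite scalerA -rmorphM /= mulVf ?oppr_eq0 // scale1r.
  apply: (maxK); last first.
    by move=> [w b] Kw; exists w, b, 0; split; rewrite //= scale0r addr0.
  split.
  - by exists 0, 0, 0; split => //=; rewrite scale0r addr0.
  - move=> [x c] [y c'] [w [b [s [Kw /= -> ->]]]] [w' [b' [s' [Kw' /= -> ->]]]].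
    exists (w + w'), (b + b'), (s + s'); split => //=; first exact: KD'.
    by rewrite rmorphD scalerDl addrACA.
  - move=> t [x c] t0 [w [b [s [Kw /= -> ->]]]].
    exists (t%:C *: w), (t * b), (t * s); split => //=; first exact: KZ'.
    by rewrite scalerDr scalerA -rmorphM.
  - move=> c [w [b [s [Kw /= wv ->]]]].
    have s0 : s = 0 by apply: nv' Kw _.
    by apply: Kpos; move: Kw; rewrite {1}(_ : w = 0) // wv s0 scale0r addr0.
  - move=> [x c] [w [b [s [Kw /= -> _]]]].
    have [b' Kw'] := Ksym _ Kw; exists b', (- w), b', (- s); split => //=.
    by rewrite opprD rmorphN scaleNr.
pose ub v := [set c | K (v, c)].
have ubi v : has_inf (ub v).
  split; first exact: Kdom.
  have [b Kb] := Kdom (- v); exists (- b) => c Kc.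
  by rewrite -subr_ge0 opprK; apply: Kpos; rewrite -(subrr v); apply: KD'.
pose l v := inf (ub v).
have l_le v c : K (v, c) -> l v <= c by move=> h; apply: ge_inf => //; case: (ubi v).
have le_l v c : (forall b, K (v, b) -> c <= b) -> c <= l v.
  by move=> h; apply: lb_le_inf; [case: (ubi v)|move=> b; apply: h].
have lD v w : l (v + w) <= l v + l w.
  rewrite -lerBlDr; apply: (le_l) => b Kb; rewrite lerBlDr -lerBlDl.
  by apply: (le_l) => b' Kb'; rewrite lerBlDl; apply: (l_le); apply: KD'.
have lN v : l (- v) = - l v.
  apply/eqP; rewrite eq_le; apply/andP; split; last first.
    rewrite -subr_ge0 opprK addrC (le_trans _ (lD _ _)) // subrr.
    by apply: (le_l) => b; apply: Kpos.
  rewrite -lerN2 opprK; apply/ler_addgt0Pr => e e0; rewrite -lerBlDr lerBlDl.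
  pose c := l v - e.
  have nK : ~ K (v, c) by move/l_le; rewrite /c; lra.
  suff : exists2 b, b <= - c & K (- v, b).
    by move=> [b bc /l_le h]; move: bc h; rewrite /c; lra.
  apply: contrapT => nb; apply: nK.
  pose K' := [set x : V * R | exists w b (s : R), [/\ K (w, b), 0 <= s, x.1 = w + s%:C *: v & x.2 = b + s * c]].
  suff: K' `<=` K.
    apply; exists 0, 0, 1; split => //=; first by rewrite add0r scale1r.
    by rewrite add0r mul1r.
  apply: (maxK); last first.
    by move=> [w b] Kw; exists w, b, 0; split; rewrite //= ?scale0r ?mul0r addr0 //.
  split.
  - by exists 0, 0, 0; split => //=; rewrite ?scale0r ?mul0r addr0.
  - move=> [x c1] [y c2] [w [b [s [Kw s0 /= -> ->]]]] [w' [b' [s' [Kw' s0' /= -> ->]]]].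
    exists (w + w'), (b + b'), (s + s'); split => //=.
    + exact: KD'.
    + exact: addr_ge0.
    + by rewrite rmorphD scalerDl addrACA.
    + by rewrite mulrDl addrACA.
  - move=> t [x c1] t0 [w [b [s [Kw s0 /= -> ->]]]].
    exists (t%:C *: w), (t * b), (t * s); split => //=.
    + exact: KZ'.
    + by rewrite mulr_ge0 // ltW.
    + by rewrite scalerDr scalerA -rmorphM.
    + by rewrite mulrDr mulrA.
  - move=> c1 [w [b [s [Kw s0 /= wv ->]]]].
    have [s00|s00] := eqVneq s 0.
      move: wv; rewrite s00 scale0r addr0 mul0r addr0 => w0.
      by apply: Kpos; rewrite w0.
    have sgt : 0 < s by rewrite lt_neqAle eq_sym s00.
    have Kn : K (- v, s^-1 * b).
      have -> : - v = (s^-1)%:C *: w.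
        have -> : w = s%:C *: - v.
          by apply/eqP; rewrite scalerN -addr_eq0 -wv.
        by rewrite scalerA -rmorphM /= mulVf // scale1r.
      by apply: KZ' => //; rewrite invr_gt0.
    have : - c < s^-1 * b by rewrite ltNge; apply/negP => h; apply: (nb); exists (s^-1 * b).
    by rewrite ltr_pdivlMl // mulrN; lra.
  - move=> [x c1] _ ; have [c2 h] := Kdom (- x); exists c2; exists (- x), c2, 0; split; rewrite //= ?scale0r ?mul0r addr0 //.
have lDE v w : l (v + w) = l v + l w.
  apply/eqP; rewrite eq_le lD /=.
  by have := lD (v + w) (- w); rewrite lN addrK lerBrDr.
have lZp t v : 0 < t -> l (t%:C *: v) = t * l v.
  move=> t0; apply/eqP; rewrite eq_le; apply/andP; split.
    rewrite -ler_pdivrMl //; apply: (le_l) => b Kb.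
    by rewrite ler_pdivrMl //; apply: (l_le); apply: KZ'.
  apply: (le_l) => b Kb; rewrite -ler_pdivlMl //; apply: l_le.
  have -> : v = (t^-1)%:C *: (t%:C *: v).
    by rewrite scalerA -rmorphM /= mulVf ?lt0r_neq0 // scale1r.
  by apply: KZ' => //; rewrite invr_gt0.
have l0 : l 0 = 0 by apply: (addrI (l 0)); rewrite -lDE !addr0.
have lZ t v : l (t%:C *: v) = t * l v.
  have [t0|t0|->] := ltrgt0P t; [exact: lZp| |by rewrite scale0r mul0r].
  by rewrite -[t]opprK rmorphN scaleNr lN lZp ?oppr_gt0 // !mulNr.
pose L v : C := (l v)%:C - 'i%C * (l ('i%C *: v))%:C.
have ReL v : complex.Re (L v) = l v.
  by rewrite /L ReD ReN /=; ring.
have Lscal : scalar L.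
  move=> a u v; rewrite /L.
  have lc (b : C) w : l (b *: w) = complex.Re b * l w + complex.Im b * l ('i%C *: w).
    by rewrite {1}(complexE b) scalerDl lDE lZ (mulrC 'i%C) -scalerA lZ.
  rewrite scalerDr !lDE (scalerA 'i%C) (mulrC 'i%C a) (lc a) (lc (a * _)) ReiNIm.
  have -> : complex.Im (a * 'i%C) = complex.Re a.
    by case: (a) => x y /=; rewrite mulr1 mulr0 addr0.
  move: (l u) (l v) (l _) (l _) => lu lv liu liv.
  rewrite [in RHS](complexE a) !rmorphD !rmorphM rmorphN /=.
  move: (complex.Re a)%:C (complex.Im a)%:C lu%:C lv%:C liu%:C liv%:C (@sqr_i R).
  move: ('i%C) => j x y p q r s j2.
  have -> : (x + j * y) * (s - j * r) = x * s - j * x * r + j * y * s - j ^+ 2 * (y * r).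
    by ring.
  by rewrite j2; ring.
pose LL := HB.pack_for {scalar V} L (GRing.isLinear.Build C V C^o *%R L Lscal).
by exists LL => v c /GK /l_le; rewrite -ReL.
Qed.

End HahnBanach.

(** * Weighted norms of polynomials *)

Section Model.
Variables (R : realType) (d : nat).
Local Notation C := R[i].
Local Notation mpol := (mpoly.mpoly d C).
Local Notation midx := (multinom d).
Implicit Types p q r : mpol.

(** Multiplies the homogeneous component of degree [n] by [c n]. *)
Definition deg_mul (c : nat -> C) p : mpol :=
  \sum_(m <- msupp p) (c (mdeg m) * mcoeff m p) *: mpolyX C m.

Lemma mcoeff_deg_mul c p m : mcoeff m (deg_mul c p) = c (mdeg m) * mcoeff m p.
Proof.
rewrite /deg_mul raddf_sum /=.
under eq_bigr do rewrite mcoeffZ mcoeffX.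
have [ms|ms] := boolP (m \in msupp p).
  rewrite (bigD1_seq m) //= ?msupp_uniq // eqxx mulr1 big1 ?addr0 // => k.
  by move/negbTE => ->; rewrite mulr0.
rewrite (memN_msupp_eq0 ms) mulr0 big_seq big1 // => k ks.
have [km|_] := eqVneq k m; first by rewrite -km ks in ms.
by rewrite mulr0.
Qed.

Lemma deg_mul_is_linear c : linear (deg_mul c).
Proof.
move=> a p q; apply/mpolyP => m.
by rewrite mcoeffD mcoeffZ !mcoeff_deg_mul mcoeffD mcoeffZ; ring.
Qed.

HB.instance Definition _ c :=
  GRing.isLinear.Build C mpol mpol *:%R (deg_mul c) (deg_mul_is_linear c).

Lemma deg_mul_comp c c' p :
  deg_mul c (deg_mul c' p) = deg_mul (fun n => c n * c' n) p.
Proof. by apply/mpolyP => m; rewrite !mcoeff_deg_mul mulrA. Qed.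

Lemma deg_mul1 c p : (forall n, c n = 1) -> deg_mul c p = p.
Proof. by move=> c1; apply/mpolyP => m; rewrite mcoeff_deg_mul c1 mul1r. Qed.

Lemma deg_mulX c m : deg_mul c (mpolyX C m) = c (mdeg m) *: mpolyX C m.
Proof.
apply/mpolyP => k; rewrite mcoeff_deg_mul mcoeffZ mcoeffX.
by have [->|] := eqVneq m k; rewrite ?mulr0.
Qed.

Lemma mpoly_lin_ind (P : mpol -> Prop) :
  (forall m, P (mpolyX C m)) -> (forall a p q, P p -> P q -> P (a *: p + q)) ->
  forall p, P p.
Proof.
move=> PX PD; have P0 : P 0.
  have := PD (-1) _ _ (PX (@mnm0 d)) (PX (@mnm0 d)).
  by rewrite scaleN1r addNr.
by elim/mpolyind => // a m p _ _ Pp; apply: PD.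
Qed.

Lemma deg_mul_monM c m q :
  deg_mul c (mpolyX C m * q) = mpolyX C m * deg_mul (fun n => c (mdeg m + n)%N) q.
Proof.
elim/mpoly_lin_ind: q => [k|a q1 q2 h1 h2].
  by rewrite -mpolyXD !deg_mulX mdegD -scalerAr mpolyXD.
by rewrite linearP /= !mulrDr -!scalerAr linearP /= h1 h2.
Qed.

(** Vanishing to order [N] at the origin. *)
Definition ord_ge (N : nat) p := forall m, (mdeg m < N)%N -> mcoeff m p = 0.

Lemma ord_geW N M p : (M <= N)%N -> ord_ge N p -> ord_ge M p.
Proof. by move=> MN h m mM; apply: h; apply: leq_trans MN. Qed.

Lemma ord_geD N p q : ord_ge N p -> ord_ge N q -> ord_ge N (p + q).
Proof. by move=> hp hq m mN; rewrite mcoeffD hp // hq // addr0. Qed.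

Lemma ord_geZ N a p : ord_ge N p -> ord_ge N (a *: p).
Proof. by move=> hp m mN; rewrite mcoeffZ hp // mulr0. Qed.

Lemma ord_ge_deg_mul N c p : ord_ge N p -> ord_ge N (deg_mul c p).
Proof. by move=> hp m mN; rewrite mcoeff_deg_mul hp // mulr0. Qed.

Lemma ord_geM N p q : ord_ge N p -> ord_ge N (p * q).
Proof.
move=> hp m mN; rewrite mpolyME raddf_sum big_seq big1 //= => -[m1 m2] /=.
case/allpairsP => -[a b] [/= am bm [-> ->]].
rewrite mcoeffZ mcoeffX; have [e|_] := eqVneq (mnm_add a b) m; last by rewrite mulr0.
rewrite hp ?mul0r ?scale0r //; apply: leq_ltn_trans mN.
by rewrite -e mdegD leq_addr.
Qed.

Definition high N p := deg_mul (fun n => (N <= n)%N%:R) p.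
Definition low N p := deg_mul (fun n => (n < N)%N%:R) p.

Lemma low_high N p : p = low N p + high N p.
Proof.
apply/mpolyP => m; rewrite mcoeffD !mcoeff_deg_mul -mulrDl -natrD.
by rewrite ltnNge; case: (N <= _)%N; rewrite /= mul1r.
Qed.

Lemma high_id N p : ord_ge N p -> high N p = p.
Proof.
move=> h; apply/mpolyP => m; rewrite mcoeff_deg_mul.
by case: leqP => [_|mN]; rewrite ?mul1r // h // mulr0.
Qed.

Lemma low_id0 N p : ord_ge N p -> low N p = 0.
Proof.
by move=> /high_id h; have := low_high N p; rewrite h => /(congr1 (+%R^~ (- p))); rewrite addrK subrr.
Qed.

Section Weights.
Variable w : midx -> R.
Hypothesis w_gt0 : forall m, 0 < w m.

Definition sqn p : R := \sum_(m <- msupp p) w m * nr (mcoeff m p) ^+ 2.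

Lemma sqnE (s : seq midx) p : uniq s -> {subset msupp p <= s} ->
  sqn p = \sum_(m <- s) w m * nr (mcoeff m p) ^+ 2.
Proof.
move=> us ps; rewrite /sqn [RHS](bigID (mem (msupp p))) /=.
rewrite [X in _ + X]big1 ?addr0; last first.
  by move=> m /memN_msupp_eq0 ->; rewrite nr0 expr0n mulr0.
rewrite -[RHS]big_filter; apply: perm_big; apply: uniq_perm.
- exact: msupp_uniq.
- exact: filter_uniq.
- move=> m; rewrite mem_filter /=.
  by apply/idP/andP => [h|[]//]; split => //; apply: ps.
Qed.

Lemma sqn_term_ge0 m p : 0 <= w m * nr (mcoeff m p) ^+ 2.
Proof. by rewrite mulr_ge0 ?sqr_ge0 // ltW. Qed.

Lemma sqn_ge0 p : 0 <= sqn p.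
Proof. by apply: sumr_ge0 => m _; apply: sqn_term_ge0. Qed.

Lemma sqn_deg_mul c p :
  sqn (deg_mul c p) = \sum_(m <- msupp p) w m * (nr (c (mdeg m)) ^+ 2 * nr (mcoeff m p) ^+ 2).
Proof.
rewrite (@sqnE (msupp p)) ?msupp_uniq //.
  by apply: eq_bigr => m _; rewrite mcoeff_deg_mul nrM exprMn.
move=> m; rewrite !mcoeff_msupp mcoeff_deg_mul; apply: contra => /eqP ->.
by rewrite mulr0.
Qed.

Lemma sqn_low_high N p : sqn p = sqn (low N p) + sqn (high N p).
Proof.
rewrite !sqn_deg_mul -big_split /=; apply: eq_bigr => m _.
by rewrite !nr_nat; case: leqP => _; rewrite expr1n expr0n /= mul0r mul1r mulr0 ?addr0 ?add0r.
Qed.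

End Weights.
End Model.

(** Polynomials as vectors of a normed space in which distinct monomials are
    orthogonal. *)
Section Graded.
Variables (R : realType) (d : nat).
Local Notation C := R[i].
Local Notation mpol := (mpoly.mpoly d C).
Variables (w : multinom d -> R) (w_gt0 : forall m, 0 < w m).
Variables (V : normedModType C) (iota : {linear mpol -> V}).
Hypothesis iota_norm : forall p, nr (iota p) ^+ 2 = sqn w p.
Implicit Types p q r : mpol.

Lemma iota_le_sqr p c : 0 <= c -> (nr (iota p) <= c) = (sqn w p <= c ^+ 2).
Proof. by move=> c0; rewrite -iota_norm ler_pXn2r ?nnegrE ?nr_ge0. Qed.

Lemma nr_deg_mul c b p : (forall n, nr (c n) <= b) ->
  nr (iota (deg_mul c p)) <= b * nr (iota p).
Proof.
move=> cb; have b0 : 0 <= b := le_trans (nr_ge0 _) (cb 0%N).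
rewrite iota_le_sqr ?mulr_ge0 ?nr_ge0 // exprMn iota_norm sqn_deg_mul.
rewrite /sqn mulr_sumr; apply: ler_sum => m _.
rewrite [leRHS]mulrCA ler_wpM2l ?(ltW (w_gt0 _)) // ler_wpM2r ?sqr_ge0 //.
by rewrite ler_pXn2r ?nnegrE ?nr_ge0.
Qed.

Lemma nr_high N p : nr (iota (high N p)) <= nr (iota p).
Proof. by rewrite -[leRHS]mul1r; apply: nr_deg_mul => n; rewrite nr_nat; case: leqP. Qed.

Lemma nr_low N p : nr (iota (low N p)) <= nr (iota p).
Proof. by rewrite -[leRHS]mul1r; apply: nr_deg_mul => n; rewrite nr_nat; case: ltnP. Qed.

(** Upper bounds of multiplier norms, tested on polynomials. *)
Definition mbound p (c : R) := forall q, nr (iota (p * q)) <= c * nr (iota q).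

Lemma iota1_gt0 : 0 < nr (iota 1).
Proof.
rewrite lt_neqAle nr_ge0 andbT eq_sym; apply/eqP => h.
have := iota_norm 1; rewrite h expr0n /= /sqn msupp1 big_seq1 mcoeff1 eqxx nr1.
by rewrite expr1n mulr1 => /esym/eqP; rewrite gt_eqF.
Qed.

Lemma mbound_ge0 p c : mbound p c -> 0 <= c.
Proof.
by move=> /(_ 1) h; rewrite -(pmulr_lge0 _ iota1_gt0) (le_trans _ h) ?nr_ge0.
Qed.

Lemma mboundD p p' c c' : mbound p c -> mbound p' c' -> mbound (p + p') (c + c').
Proof.
move=> h h' q; rewrite mulrDl linearD /= mulrDl.
exact: le_trans (nrD _ _) (lerD (h q) (h' q)).
Qed.

Lemma mboundZ a p c : mbound p c -> mbound (a *: p) (nr a * c).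
Proof.
move=> h q; rewrite -scalerAl linearZ /= nrZ -mulrA.
by rewrite ler_wpM2l ?nr_ge0.
Qed.

Lemma mboundM p p' c c' : mbound p c -> mbound p' c' -> mbound (p * p') (c * c').
Proof.
move=> h h' q; rewrite -mulrA -mulrA (le_trans (h _)) // ler_wpM2l //.
exact: mbound_ge0 h.
Qed.

(** A quantitative form of weak star continuity: the order from which the
    functional is small does not depend on the polynomial. *)
Definition tail (nu : mpol -> C) (eta : R) :=
  exists N, forall p c, ord_ge N p -> mbound p c -> nr (nu p) <= eta * c.

Definition tail_small (nu : mpol -> C) := forall eta, 0 < eta -> tail nu eta.

Lemma tailD nu nu' eta eta' : tail nu eta -> tail nu' eta' ->
  tail (fun p => nu p + nu' p) (eta + eta').
Proof.
move=> [N h] [N' h']; exists (maxn N N') => p c op pc.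
rewrite mulrDl (le_trans (nrD _ _)) // lerD //.
- by apply: h pc; apply: ord_geW op; rewrite leq_maxl.
- by apply: h' pc; apply: ord_geW op; rewrite leq_maxr.
Qed.

Section Hump.
Variable bt : nat -> R.
Hypothesis bt_gt0 : forall n, 0 < bt n.
Hypothesis bt_ratio : forall k eps, 0 < eps ->
  exists N, forall n, (N <= n)%N -> `|1 - bt (k + n)%N / bt n| <= eps.
Hypothesis mon_bounded : forall m, exists c, mbound (mpolyX C m) c.

(** [conj_mul p] is multiplication by [p] conjugated by the diagonal operator
    with weights [bt]; it differs from multiplication by an operator that is
    small on polynomials of high order. *)
Definition conj_mul p q : mpol :=
  deg_mul (fun n => (bt n)%:C) (p * deg_mul (fun n => (bt n)^-1%:C) q).

Definition mul_defect p q : mpol := p * q - conj_mul p q.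

Definition kbound p (b : R) := forall q, nr (iota (mul_defect p q)) <= b * nr (iota q).

Lemma mul_defectP a p p' q :
  mul_defect (a *: p + p') q = a *: mul_defect p q + mul_defect p' q.
Proof.
rewrite /mul_defect /conj_mul !mulrDl linearD /= -!scalerAl linearZ /=.
by rewrite scalerBr opprD addrACA.
Qed.

(** The operator [mul_defect p] is compact: for a monomial it multiplies degrees by
    ratios of weights that differ from one by a null sequence. *)
Lemma mul_defect_high p eps : 0 < eps ->
  exists M, forall q, nr (iota (high M (mul_defect p q))) <= eps * nr (iota q).
Proof.
move: eps; elim/mpoly_lin_ind: p => [m|a p1 p2 h1 h2] eps eps0.
  have [c mc] := mon_bounded m; have c0 := mbound_ge0 mc.
  have c1 : 0 < c + 1 by lra.
  have [N hN] := bt_ratio (mdeg m) (divr_gt0 eps0 c1).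
  exists (mdeg m + N)%N => q.
  have -> : high (mdeg m + N) (mul_defect (mpolyX C m) q) =
      mpolyX C m * deg_mul (fun n => (N <= n)%N%:R * (1 - bt (mdeg m + n)%N / bt n)%:C) q.
    rewrite /high /mul_defect /conj_mul deg_mul_monM deg_mul_comp -mulrBr.
    rewrite deg_mul_monM; congr (_ * _); apply/mpolyP => k.
    rewrite !(mcoeff_deg_mul, mcoeffB) leq_add2l rmorphB rmorphM /=.
    by rewrite rmorph1; ring.
  rewrite (le_trans (mc _)) //.
  have : nr (iota (deg_mul (fun n => (N <= n)%N%:R * (1 - bt (mdeg m + n)%N / bt n)%:C) q))
      <= eps / (c + 1) * nr (iota q).
    apply: nr_deg_mul => n; rewrite nrM nr_nat nrC.
    by case: leqP => [/hN|_]; rewrite ?mul1r // mul0r ltW // divr_gt0.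
  move=> /(ler_wpM2l c0) /le_trans; apply; rewrite mulrA ler_wpM2r ?nr_ge0 //.
  by rewrite mulrCA ler_piMr ?(ltW eps0) // ler_pdivrMr // mul1r; lra.
have a1 : 0 < nr a + 1 by have := nr_ge0 a; lra.
have [M1 {}h1] := h1 (eps / (nr a + 1) / 2) ltac:(by rewrite !divr_gt0).
have [M2 {}h2] := h2 (eps / 2) ltac:(by rewrite !divr_gt0).
exists (maxn M1 M2) => q.
have hh M M' r : (M <= M')%N -> nr (iota (high M' r)) <= nr (iota (high M r)).
  move=> MM; suff -> : high M' r = high M' (high M r) by exact: nr_high.
  rewrite /high deg_mul_comp; apply/mpolyP => k; rewrite !mcoeff_deg_mul -natrM.
  by congr (_%:R * _); case: leqP => //= h; rewrite (leq_trans MM h).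
rewrite mul_defectP /high linearD linearZ /= -/(high _ _) -/(high _ _) linearD linearZ /=.
rewrite (le_trans (nrD _ _)) // nrZ.
rewrite [eps in leRHS]splitr mulrDl lerD //; last first.
  by rewrite (le_trans (hh _ _ _ (leq_maxr M1 M2))).
have {}h1 := le_trans (hh _ _ _ (leq_maxl M1 M2)) (h1 q).
rewrite (le_trans (ler_wpM2l (nr_ge0 a) h1)) // mulrA ler_wpM2r ?nr_ge0 //.
have -> : nr a * (eps / (nr a + 1) / 2) = (eps / 2) * (nr a / (nr a + 1)) by field; lra.
by rewrite ler_piMr ?divr_ge0 ?(ltW eps0) // ler_pdivrMr // mul1r; lra.
Qed.

(** Gliding hump. Were the functional not small on high order polynomials, one
    could add up unit bumps, each placed beyond the essential range of the
    previous defects; orthogonality makes the defect of the sum grow like a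
    square root, while the value of the functional grows linearly. *)
Lemma hump (kap : {scalar mpol}) (c0 : R) : 0 <= c0 ->
  (forall p b, 0 <= b -> kbound p b -> nr (kap p) <= c0 * b) ->
  (forall p c, mbound p c -> kbound p (2 * c)) ->
  tail_small kap.
Proof.
move=> c00 kapb mk eta eta0; apply: contrapT => nt.
have bump N : exists p, [/\ ord_ge N p, mbound p 1 & kap p = (nr (kap p))%:C /\ eta <= nr (kap p)].
  apply: contrapT => nb; apply: nt; exists N => p c op pc.
  rewrite leNgt; apply/negP => lt.
  have [c_gt0|cle] := ltP 0 c; last first.
    have c_eq0 : c = 0 by apply/eqP; rewrite eq_le cle (mbound_ge0 pc).
    have p0 : p = 0.
      have h := pc 1; rewrite mulr1 c_eq0 mul0r in h.
      have : sqn w p = 0 by rewrite -iota_norm (_ : nr _ = 0) ?expr0n //; apply/eqP; rewrite eq_le h nr_ge0.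
      move=> s0; apply/mpolyP => m; rewrite mcoeff0.
      have [ms|/memN_msupp_eq0//] := boolP (m \in msupp p).
      have : w m * nr (mcoeff m p) ^+ 2 <= 0.
        rewrite -s0 /sqn (bigD1_seq m) ?msupp_uniq //= lerDl.
        by apply: sumr_ge0 => k _; apply: sqn_term_ge0.
      rewrite pmulr_rle0 // => h2; apply: nr_eq0; apply/eqP.
      by rewrite -sqrf_eq0 eq_le h2 sqr_ge0.
    by move: lt; rewrite p0 linear0 nr0 c_eq0 mulr0 ltxx.
  have [u [u1 uk]] := nr_phase (kap p).
  apply: nb; exists ((u / c%:C) *: p); split.
  - exact: ord_geZ.
  - have := mboundZ (u / c%:C) pc; rewrite nrM u1 nrV nrC gtr0_norm // mul1r.
    by rewrite mulVf // gt_eqF.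
  - have -> : kap ((u / c%:C) *: p) = (nr (kap p) / c)%:C.
      by rewrite linearZ /= mulrAC uk rmorphM /= fmorphV.
    rewrite nrC ger0_norm ?divr_ge0 ?nr_ge0 ?(ltW c_gt0) //; split => //.
    by rewrite ler_pdivlMr // ltW.
(* Above the degree [M] at which the new bump starts, the old defect contributes
   at most 1 and the new one at most 2, whence the 9. *)
have sums n : exists p, [/\ kap p = (nr (kap p))%:C, n%:R * eta <= nr (kap p) &
    forall q, nr (iota (mul_defect p q)) ^+ 2 <= 9 * n%:R * nr (iota q) ^+ 2].
  elim: n => [|n [p [kp np dp]]].
    exists 0; rewrite linear0 nr0 mul0r; split => // q.
    by rewrite /mul_defect /conj_mul !mul0r linear0 subrr linear0 nr0 expr0n mulr0 mul0r.
  have [M hM] := mul_defect_high p ltr01.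
  have [p' [op' bp' [kp' np']]] := bump M.
  exists (p + p'); split.
  - by rewrite linearD /= kp kp' -rmorphD nrC ger0_norm // addr_ge0 ?nr_ge0.
  - rewrite linearD /= kp kp' -rmorphD nrC ger0_norm ?addr_ge0 ?nr_ge0 //.
    by rewrite -natr1 mulrDl mul1r lerD.
  - move=> q; rewrite iota_norm (sqn_low_high _ M).
    have -> : mul_defect (p + p') q = mul_defect p q + mul_defect p' q.
      by have := mul_defectP 1 p p' q; rewrite !scale1r.
    have od : ord_ge M (mul_defect p' q).
      rewrite /mul_defect /conj_mul; apply: ord_geD; first exact: ord_geM.
      by rewrite -scaleN1r; apply/ord_geZ/ord_ge_deg_mul/ord_geM.
    rewrite {1}/low linearD /= -/(low _ _) -/(low _ _) (low_id0 od) addr0.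
    rewrite {1}/high linearD /= -/(high _ _) -/(high _ _) (high_id od).
    rewrite -!iota_norm linearD /=.
    have hlow : nr (iota (low M (mul_defect p q))) ^+ 2 <= 9 * n%:R * nr (iota q) ^+ 2.
      by apply: le_trans (dp q); rewrite ler_pXn2r ?nnegrE ?nr_ge0 // nr_low.
    have hhigh : nr (iota (high M (mul_defect p q)) + iota (mul_defect p' q)) ^+ 2
        <= 9 * nr (iota q) ^+ 2.
      rewrite (_ : 9 * _ = (3 * nr (iota q)) ^+ 2); last by ring.
      rewrite ler_pXn2r ?nnegrE ?mulr_ge0 ?nr_ge0 //.
      rewrite (le_trans (nrD _ _)) // (_ : 3 * _ = 1 * nr (iota q) + 2 * 1 * nr (iota q)); last by ring.
      by rewrite lerD // mk.
    apply: le_trans (lerD hlow hhigh) _; rewrite -[n.+1]addn1 natrD.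
    by rewrite le_eqVlt; apply/orP; left; apply/eqP; ring.
have [n n_gt] := nat_gt ((3 * c0 / eta) ^+ 2).
have [p [_ np dp]] := sums n.
have n0 : 0 <= n%:R :> R by rewrite ler0n.
pose b := 3 * Num.sqrt (n%:R : R).
have b0 : 0 <= b by rewrite mulr_ge0 ?sqrtr_ge0.
have kb : kbound p b.
  move=> q; rewrite -(@ler_pXn2r _ 2) ?nnegrE ?mulr_ge0 ?nr_ge0 //.
  by rewrite (le_trans (dp q)) // !exprMn sqr_sqrtr //; lra.
have := le_trans np (kapb _ _ b0 kb); apply/negP; rewrite -ltNge.
rewrite -(@ltr_pXn2r _ 2) ?nnegrE ?mulr_ge0 ?(ltW eta0) //.
rewrite /b !exprMn sqr_sqrtr //.
have -> : c0 ^+ 2 * (3 ^+ 2 * n%:R) = n%:R * eta ^+ 2 * (3 * c0 / eta) ^+ 2.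
  by field; lra.
rewrite [ltRHS](_ : _ = n%:R * eta ^+ 2 * n%:R); last by ring.
rewrite ltr_pM2l // mulr_gt0 ?exprn_gt0 //.
exact: le_lt_trans (sqr_ge0 _) n_gt.
Qed.

End Hump.
End Graded.

(** * Trace class representation *)

Section Dot.
Variables (R : realType) (d : nat).
Local Notation C := R[i].
Local Notation mpol := (mpoly.mpoly d C).
Variables (w : multinom d -> R) (w_gt0 : forall m, 0 < w m).
Implicit Types p q r x y : mpol.

Definition mdot p q : C := \sum_(m <- msupp p) (w m)%:C * mcoeff m p * (mcoeff m q)^*%C.

Lemma mdotE (s : seq (multinom d)) p q : uniq s -> {subset msupp p <= s} ->
  mdot p q = \sum_(m <- s) (w m)%:C * mcoeff m p * (mcoeff m q)^*%C.
Proof.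
move=> us ps; rewrite /mdot [RHS](bigID (mem (msupp p))) /=.
rewrite [X in _ + X]big1 ?addr0; last first.
  by move=> m /memN_msupp_eq0 ->; rewrite mulr0 mul0r.
rewrite -[RHS]big_filter; apply: perm_big; apply: uniq_perm.
- exact: msupp_uniq.
- exact: filter_uniq.
- move=> m; rewrite mem_filter /=.
  by apply/idP/andP => [h|[]//]; split => //; apply: ps.
Qed.

Lemma mdotPl a p p' q : mdot (a *: p + p') q = a * mdot p q + mdot p' q.
Proof.
pose s := undup (msupp p ++ msupp p' ++ msupp (a *: p + p')).
have us : uniq s by exact: undup_uniq.
rewrite !(@mdotE s) ?us //; last first.
- by move=> m ms; rewrite mem_undup !mem_cat ms !orbT.
- by move=> m ms; rewrite mem_undup !mem_cat ms.
- by move=> m ms; rewrite mem_undup !mem_cat ms !orbT.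
rewrite mulr_sumr -big_split /=; apply: eq_bigr => m _.
by rewrite mcoeffD mcoeffZ; ring.
Qed.

Lemma mdotPr a p q q' : mdot p (a *: q + q') = (a^*)%C * mdot p q + mdot p q'.
Proof.
rewrite /mdot mulr_sumr -big_split /=; apply: eq_bigr => m _.
by rewrite mcoeffD mcoeffZ rmorphD rmorphM /=; ring.
Qed.

Lemma mdot0l q : mdot 0 q = 0.
Proof. by rewrite /mdot msupp0 big_nil. Qed.

Lemma mdot0r p : mdot p 0 = 0.
Proof. by rewrite /mdot big1 // => m _; rewrite mcoeff0 conjc0 mulr0. Qed.

Lemma mdotZl a p q : mdot (a *: p) q = a * mdot p q.
Proof. by rewrite -[a *: p]addr0 mdotPl mdot0l addr0. Qed.

Lemma mdotZr a p q : mdot p (a *: q) = (a^*)%C * mdot p q.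
Proof. by rewrite -[a *: q]addr0 mdotPr mdot0r addr0. Qed.

Lemma mdotDl p p' q : mdot (p + p') q = mdot p q + mdot p' q.
Proof. by rewrite -[p]scale1r mdotPl mul1r scale1r. Qed.

Lemma mdotDr p q q' : mdot p (q + q') = mdot p q + mdot p q'.
Proof. by rewrite -{1}[q]scale1r mdotPr conjc1 mul1r. Qed.

Lemma mdot_suml I (s : seq I) (F : I -> mpol) q :
  mdot (\sum_(i <- s) F i) q = \sum_(i <- s) mdot (F i) q.
Proof. by elim/big_rec2: _ => [|i y1 y2 _ <-]; rewrite ?mdot0l ?mdotDl. Qed.

Lemma mdot_sumr I (s : seq I) (F : I -> mpol) q :
  mdot q (\sum_(i <- s) F i) = \sum_(i <- s) mdot q (F i).
Proof. by elim/big_rec2: _ => [|i y1 y2 _ <-]; rewrite ?mdot0r ?mdotDr. Qed.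

Lemma mdotX m m' : mdot (mpolyX C m) (mpolyX C m') = (w m)%:C * (m == m')%:R.
Proof.
rewrite /mdot msuppX big_seq1 !mcoeffX eqxx mulr1 eq_sym.
by rewrite conjc_nat.
Qed.

Lemma mdotpp p : mdot p p = (sqn w p)%:C.
Proof.
rewrite /mdot /sqn rmorph_sum; apply: eq_bigr => m _.
by rewrite -mulrA mulcJ -rmorphM.
Qed.

Lemma mcoeff_mdot p m : mcoeff m p = (w m)^-1%:C * mdot p (mpolyX C m).
Proof.
elim/mpoly_lin_ind: p => [k|a p q hp hq].
  rewrite mdotX mcoeffX mulrA -rmorphM /=; have [->|_] := eqVneq k m; last by rewrite !mulr0.
  by rewrite mulVf ?gt_eqF // rmorph1 mul1r.
by rewrite mcoeffD mcoeffZ mdotPl hp hq; ring.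
Qed.

End Dot.

(** Cesaro multipliers. Averaging over all windows of [N] consecutive degrees
    weights the component of degree [k] of a multiplier by [1 - k / N], so that
    these cutoffs are contractions of multiplier norms. *)
Section Fejer.
Variables (R : realType) (d : nat).
Local Notation C := R[i].
Local Notation mpol := (mpoly.mpoly d C).
Variables (w : multinom d -> R) (w_gt0 : forall m, 0 < w m).
Implicit Types p q r x y : mpol.

Definition fejer N (n : nat) : C := (N - n)%N%:R / N%:R.

Definition window N s p := deg_mul (fun n => ((n <= s) && (s < n + N))%N%:R) p.

Lemma count_window L a b : (\sum_(s < L) ((a <= s) && (s < b)) = minn L b - a)%N.
Proof.
elim: L => [|L IH]; first by rewrite big_ord0 min0n.
by rewrite big_ord_recr /= IH; case: leqP; case: ltnP => /=; lia.
Qed.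

Lemma fejer_window N x y : (0 < N)%N ->
  exists L, forall p, mdot w (deg_mul (fejer N) p * x) y =
    N%:R^-1 * \sum_(s < L) mdot w (p * window N s x) (window N s y).
Proof.
move=> N0; exists (msize y + N)%N => p; set L := (_ + _)%N.
have NC : (N%:R : C) != 0 by rewrite pnatr_eq0 -lt0n.
have base m : (mdeg m < msize y)%N ->
   mdot w (deg_mul (fejer N) p * x) (mpolyX C m) =
    N%:R^-1 * \sum_(s < L) mdot w (p * window N s x) (window N s (mpolyX C m)).
  move=> my; elim/mpoly_lin_ind: p => [g|a p1 p2 h1 h2]; last first.
    rewrite linearP /= mulrDl -scalerAl mdotPl h1 h2 mulrCA -mulrDr; congr (_ * _).
    by rewrite mulr_sumr -big_split /=; apply: eq_bigr => s _; rewrite mulrDl -scalerAl mdotPl.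
  elim/mpoly_lin_ind: x => [b|a x1 x2 h1 h2]; last first.
    rewrite mulrDr -scalerAr mdotPl h1 h2 mulrCA -mulrDr; congr (_ * _).
    rewrite mulr_sumr -big_split /=; apply: eq_bigr => s _.
    by rewrite /window linearP /= mulrDr -scalerAr mdotPl.
  rewrite deg_mulX -scalerAl mdotZl -mpolyXD mdotX.
  under eq_bigr => s _ do rewrite /window !deg_mulX -scalerAr -mpolyXD mdotZl mdotZr mdotX.
  have [e|_] := eqVneq (mnm_add g b) m; last first.
    by rewrite !mulr0 big1 ?mulr0 // => s _; rewrite !mulr0.
  rewrite -e mulr1 /fejer.
  transitivity (N%:R^-1 * ((\sum_(s < L) ((mdeg (mnm_add g b) <= s) && (s < mdeg b + N)))%N%:R * (w (mnm_add g b))%:C) : C).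
    rewrite count_window (_ : minn L _ = mdeg b + N)%N; last first.
      apply/minn_idPr; rewrite /L; move: my; rewrite -e mdegD; lia.
    rewrite mdegD (_ : mdeg b + N - (mdeg g + mdeg b) = N - mdeg g)%N; last by lia.
    by ring.
  congr (_ * _); rewrite natr_sum mulr_suml; apply: eq_bigr => s _.
  rewrite conjc_nat mulrA -natrM mdegD; congr (_%:R * _).
  have -> : ((mdeg b <= s) && (s < mdeg b + N) * ((mdeg g + mdeg b <= s) && (s < mdeg g + mdeg b + N)) = (mdeg g + mdeg b <= s) && (s < mdeg b + N) :> nat)%N.
    by case: (leqP (mdeg g + mdeg b) s); case: (ltnP s (mdeg b + N)); case: (leqP (mdeg b) s); case: (ltnP s (mdeg g + mdeg b + N)) => //=; lia.
  by [].
rewrite [y in LHS]mpolyE mdot_sumr.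
have -> : \sum_(s < L) mdot w (p * window N s x) (window N s y) =
   \sum_(m <- msupp y) ((mcoeff m y)^*%C * \sum_(s < L) mdot w (p * window N s x) (window N s (mpolyX C m))).
  under [RHS]eq_bigr => m _ do rewrite mulr_sumr.
  rewrite exchange_big /=; apply: eq_bigr => s _.
  rewrite {1}[y]mpolyE /window linear_sum mdot_sumr; apply: eq_bigr => m _.
  by rewrite linearZ /= mdotZr.
rewrite mulr_sumr big_seq [RHS]big_seq; apply: eq_bigr => m my.
by rewrite mdotZr base ?msize_mdeg_lt // mulrCA.
Qed.

Lemma sqn_window N L x : \sum_(s < L) sqn w (window N s x) <= N%:R * sqn w x.
Proof.
under eq_bigr => s _ do rewrite sqn_deg_mul //.
rewrite exchange_big /= /sqn mulr_sumr; apply: ler_sum => m _.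
have -> : \sum_(i < L) w m * (nr (((mdeg m <= i) && (i < mdeg m + N))%N%:R : C) ^+ 2 * nr (mcoeff m x) ^+ 2)
   = (\sum_(i < L) ((mdeg m <= i) && (i < mdeg m + N)))%N%:R * (w m * nr (mcoeff m x) ^+ 2).
  rewrite natr_sum mulr_suml; apply: eq_bigr => s _; rewrite nr_nat -natrX.
  by case: (_ && _); rewrite ?expr1n ?expr0n /=; ring.
by rewrite ler_wpM2r ?sqn_term_ge0 // count_window ler_nat; lia.
Qed.

(** The cutoff [2 F_(2N) - F_N] of de la Vallee Poussin. *)
Definition vallee N (n : nat) : C := 2 * fejer (N + N) n - fejer N n.

Lemma vallee1 N n : (0 < N)%N -> (n <= N)%N -> vallee N n = 1.
Proof.
move=> N0 nN; have NC : (N%:R : C) != 0 by rewrite pnatr_eq0 -lt0n.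
rewrite /vallee /fejer !natrB ?natrD //; last by lia.
have N2 : N%:R + N%:R != 0 :> C by rewrite -natrD pnatr_eq0; lia.
by field; rewrite ?N2 ?NC.
Qed.

Lemma vallee0 N n : (N + N <= n)%N -> vallee N n = 0.
Proof.
move=> nN; rewrite /vallee /fejer (_ : N + N - n = 0)%N; last by lia.
by rewrite (_ : N - n = 0)%N ?mul0r ?mulr0 ?subrr //; lia.
Qed.

Lemma deg_mul_vallee N p :
  deg_mul (vallee N) p = 2 *: deg_mul (fejer (N + N)) p - deg_mul (fejer N) p.
Proof.
by apply/mpolyP => m; rewrite mcoeffB mcoeffZ !mcoeff_deg_mul /vallee; ring.
Qed.

Lemma ord_ge_vallee N p : (0 < N)%N -> ord_ge N (p - deg_mul (vallee N) p).
Proof.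
move=> N0 m mN; rewrite mcoeffB mcoeff_deg_mul vallee1 ?mul1r ?subrr //.
exact: ltnW.
Qed.

Variables (V : normedModType C) (iota : {linear mpol -> V}).
Hypothesis iota_norm : forall p, nr (iota p) ^+ 2 = sqn w p.
Hypothesis CS : forall p q, nr (mdot w p q) <= nr (iota p) * nr (iota q).
Hypothesis mon_bounded : forall m, exists c, mbound iota (mpolyX C m) c.

Lemma mpoly_bounded p : exists c, mbound iota p c.
Proof.
elim/mpoly_lin_ind: p => // a p q [c hc] [c' hc'].
by exists (nr a * c + c'); apply: mboundD => //; apply: mboundZ.
Qed.

(** Testing the form at a multiple of [p * x] that has the norm of [x]. *)
Lemma mbound_of_form p (A : R) : 0 <= A ->
  (forall x y, nr (mdot w (p * x) y) <= A * (sqn w x + sqn w y)) ->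
  mbound iota p (2 * A).
Proof.
move=> A0 h x.
have [->|px0] := eqVneq (nr (iota (p * x))) 0.
  by rewrite !mulr_ge0 ?nr_ge0.
have px : 0 < nr (iota (p * x)) by rewrite lt_neqAle eq_sym px0 nr_ge0.
pose s := nr (iota x) / nr (iota (p * x)).
have := h x (s%:C *: (p * x)).
rewrite mdotZr mdotpp conjc_real -rmorphM nrC -!iota_norm linearZ /= nrZ nrC.
rewrite ger0_norm; last by rewrite mulr_ge0 ?divr_ge0 ?nr_ge0 ?sqr_ge0.
rewrite ger0_norm ?divr_ge0 ?nr_ge0 //.
have -> : s * nr (iota (p * x)) = nr (iota x) by rewrite mulfVK.
rewrite (_ : s * _ = nr (iota x) * nr (iota (p * x))); last by rewrite /s; field.
move=> {}h; have [x0|x0] := eqVneq (nr (iota x)) 0.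
  have := nr_ge0 (iota x); have : mdot w (p * x) (p * x) = 0.
    have xz : sqn w x = 0 by rewrite -iota_norm x0 expr0n.
    have -> : x = 0.
      apply/mpolyP => m; rewrite (mcoeff_mdot w_gt0) mcoeff0.
      by rewrite (_ : mdot _ _ _ = 0) ?mulr0 //; apply: nr_eq0; apply/eqP; rewrite eq_le nr_ge0 andbT (le_trans (CS _ _)) // x0 mul0r.
    by rewrite mulr0 mdot0l.
  rewrite mdotpp => /eqP; rewrite -iota_norm -(rmorph0 (real_complex R)).
  by move=> /eqP/complexI/eqP; rewrite sqrf_eq0 (negbTE px0).
have xp : 0 < nr (iota x) by rewrite lt_neqAle eq_sym x0 nr_ge0.
rewrite -(ler_pM2l xp) (le_trans h) // le_eqVlt; apply/orP; left; apply/eqP; ring.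
Qed.

Lemma mbound_form p c x y : mbound iota p c ->
  nr (mdot w (p * x) y) <= c / 2 * (sqn w x + sqn w y).
Proof.
move=> pc; have c0 := mbound_ge0 w_gt0 iota_norm pc.
rewrite (le_trans (CS _ _)) // (le_trans (ler_wpM2r (nr_ge0 _) (pc x))) //.
rewrite -!iota_norm -!mulrA ler_wpM2l //.
have := sqr_ge0 (nr (iota x) - nr (iota y)); rewrite sqrrB; lra.
Qed.

Lemma form_fejer p N A : (0 < N)%N -> 0 <= A ->
  (forall x y, nr (mdot w (p * x) y) <= A * (sqn w x + sqn w y)) ->
  forall x y, nr (mdot w (deg_mul (fejer N) p * x) y) <= A * (sqn w x + sqn w y).
Proof.
move=> N0 A0 h x y; have [L ->] := fejer_window x y N0.
rewrite nrM nrV nr_nat ler_pdivrMl ?ltr0n //.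
rewrite (le_trans (nr_sum _ _ _)) // (le_trans (ler_sum _ (fun s _ => h _ _))) //.
rewrite -mulr_sumr mulrCA ler_wpM2l // big_split mulrDr.
by rewrite lerD // sqn_window.
Qed.

Lemma form_vallee p N A : (0 < N)%N -> 0 <= A ->
  (forall x y, nr (mdot w (p * x) y) <= A * (sqn w x + sqn w y)) ->
  forall x y, nr (mdot w (deg_mul (vallee N) p * x) y) <= 3 * A * (sqn w x + sqn w y).
Proof.
move=> N0 A0 h x y; rewrite deg_mul_vallee mulrDl -scalerAl mdotPl.
rewrite -scaleN1r -scalerAl mdotZl mulN1r (le_trans (nrB _ _)) // nrM nr_nat.
have h1 := form_fejer (ltn_addr N N0) A0 h x y.
have h2 := form_fejer N0 A0 h x y.
rewrite -mulrA; move: (A * _) (nr _) (nr _) h1 h2 => t a b h1 h2.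
lra.
Qed.

Lemma mbound_vallee p N c : (0 < N)%N -> mbound iota p c ->
  mbound iota (deg_mul (vallee N) p) (3 * c).
Proof.
move=> N0 pc; have c0 := mbound_ge0 w_gt0 iota_norm pc.
rewrite (_ : 3 * c = 2 * (3 * (c / 2))); last by field.
apply: mbound_of_form; first by rewrite mulr_ge0 // divr_ge0.
apply: form_vallee => //; first by rewrite divr_ge0.
by move=> x y; apply: mbound_form.
Qed.

End Fejer.

(** * Functionals of finite degree *)

Section FiniteDegree.
Variables (R : realType) (d : nat).
Local Notation C := R[i].
Local Notation mpol := (mpoly.mpoly d C).
Variables (w : multinom d -> R) (w_gt0 : forall m, 0 < w m).
Variables (V : normedModType C) (iota : {linear mpol -> V}).
Hypothesis iota_norm : forall p, nr (iota p) ^+ 2 = sqn w p.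
Hypothesis CS : forall p q, nr (mdot w p q) <= nr (iota p) * nr (iota q).
Hypothesis mon_bounded : forall m, exists c, mbound iota (mpolyX C m) c.
Implicit Types p q r x y b : mpol.

(** A list of pairs of vectors stands for the finite rank functional
    [p |-> sum <p x, y>]. *)
Definition rank_form (s : seq (mpol * mpol)) p : C :=
  \sum_(xy <- s) mdot w (p * xy.1) xy.2.

Definition mass (s : seq (mpol * mpol)) : R :=
  \sum_(xy <- s) (sqn w xy.1 + sqn w xy.2).

Definition coef_pair b p : C := \sum_(m <- msupp b) mcoeff m b * mcoeff m p.

Lemma coef_pairE (s : seq (multinom d)) b p : uniq s -> {subset msupp b <= s} ->
  coef_pair b p = \sum_(m <- s) mcoeff m b * mcoeff m p.
Proof.
move=> us ps; rewrite /coef_pair [RHS](bigID (mem (msupp b))) /=.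
rewrite [X in _ + X]big1 ?addr0; last first.
  by move=> m /memN_msupp_eq0 ->; rewrite mul0r.
rewrite -[RHS]big_filter; apply: perm_big; apply: uniq_perm.
- exact: msupp_uniq.
- exact: filter_uniq.
- move=> m; rewrite mem_filter /=.
  by apply/idP/andP => [h|[]//]; split => //; apply: ps.
Qed.

Lemma coef_pairP a b b' p : coef_pair (a *: b + b') p = a * coef_pair b p + coef_pair b' p.
Proof.
pose s := undup (msupp b ++ msupp b' ++ msupp (a *: b + b')).
have us : uniq s by exact: undup_uniq.
rewrite !(@coef_pairE s) ?us //; last first.
- by move=> m ms; rewrite mem_undup !mem_cat ms !orbT.
- by move=> m ms; rewrite mem_undup !mem_cat ms.
- by move=> m ms; rewrite mem_undup !mem_cat ms !orbT.
rewrite mulr_sumr -big_split /=; apply: eq_bigr => m _.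
by rewrite mcoeffD mcoeffZ; ring.
Qed.

Lemma coef_pair0 p : coef_pair 0 p = 0.
Proof. by rewrite /coef_pair msupp0 big_nil. Qed.

Lemma coef_pairZ a b p : coef_pair (a *: b) p = a * coef_pair b p.
Proof. by rewrite -[a *: b]addr0 coef_pairP coef_pair0 addr0. Qed.

Lemma coef_pairD b b' p : coef_pair (b + b') p = coef_pair b p + coef_pair b' p.
Proof. by rewrite -{1}[b]scale1r coef_pairP mul1r. Qed.

Lemma coef_pair_linear b a p q : coef_pair b (a *: p + q) = a * coef_pair b p + coef_pair b q.
Proof.
rewrite /coef_pair mulr_sumr -big_split /=; apply: eq_bigr => m _.
by rewrite mcoeffD mcoeffZ; ring.
Qed.

Lemma coef_pairX m p : coef_pair (mpolyX C m) p = mcoeff m p.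
Proof. by rewrite /coef_pair msuppX big_seq1 mcoeffX eqxx mul1r. Qed.

Lemma coef_pair_mon b m : coef_pair b (mpolyX C m) = mcoeff m b.
Proof.
rewrite /coef_pair; under eq_bigr do rewrite mcoeffX.
have [ms|ms] := boolP (m \in msupp b).
  rewrite (bigD1_seq m) //= ?msupp_uniq // eqxx mulr1 big1 ?addr0 // => j.
  by rewrite eq_sym => /negbTE ->; rewrite mulr0.
rewrite (memN_msupp_eq0 ms) big_seq big1 // => j js.
have [jm|_] := eqVneq m j; first by rewrite jm js in ms.
by rewrite mulr0.
Qed.

Definition trunc_series (k : nat) (E : multinom d -> C) : mpol :=
  \sum_(m : bmultinom d k) E m *: mpolyX C m.

Lemma mcoeff_trunc_series k E m :
  mcoeff m (trunc_series k E) = if (mdeg m < k)%N then E m else 0.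
Proof.
have [mk|km] := ltnP (mdeg m) k; first by rewrite /trunc_series mcoeff_mpoly.
rewrite /trunc_series raddf_sum big1 //= => -[j jk] _ /=.
rewrite mcoeffZ mcoeffX; have [jm|_] := eqVneq j m; last by rewrite mulr0.
by move: jk; rewrite jm ltnNge km.
Qed.

Lemma rank_form_cat s s' p : rank_form (s ++ s') p = rank_form s p + rank_form s' p.
Proof. by rewrite /rank_form big_cat. Qed.

Lemma mass_cat s s' : mass (s ++ s') = mass s + mass s'.
Proof. by rewrite /mass big_cat. Qed.

Lemma mass_ge0 s : 0 <= mass s.
Proof. by apply: sumr_ge0 => xy _; rewrite addr_ge0 ?sqn_ge0. Qed.

Lemma sqnZ a p : sqn w (a *: p) = nr a ^+ 2 * sqn w p.
Proof. by rewrite -!iota_norm linearZ /= nrZ exprMn. Qed.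

Lemma rank_form_scale (t : R) s : 0 < t ->
  exists s', (forall p, rank_form s' p = t%:C * rank_form s p) /\ mass s' = t * mass s.
Proof.
move=> t0; pose u := (Num.sqrt t)%:C : C.
have u2 : u * (u^*)%C = t%:C by rewrite mulcJ nrC ger0_norm ?sqrtr_ge0 // sqr_sqrtr // ltW.
have nu : nr u ^+ 2 = t by rewrite nrC ger0_norm ?sqrtr_ge0 // sqr_sqrtr // ltW.
exists [seq (u *: xy.1, u *: xy.2) | xy <- s]; split.
  move=> p; rewrite /rank_form big_map mulr_sumr; apply: eq_bigr => xy _ /=.
  by rewrite -scalerAr mdotZl mdotZr mulrA u2.
rewrite /mass big_map mulr_sumr; apply: eq_bigr => xy _ /=.
by rewrite !sqnZ nu mulrDr.
Qed.

Lemma rank_form_rotate (u : C) s : nr u = 1 ->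
  exists s', (forall p, rank_form s' p = u * rank_form s p) /\ mass s' = mass s.
Proof.
move=> u1; exists [seq (u *: xy.1, xy.2) | xy <- s]; split.
  move=> p; rewrite /rank_form big_map mulr_sumr; apply: eq_bigr => xy _ /=.
  by rewrite -scalerAr mdotZl.
rewrite /mass big_map; apply: eq_bigr => xy _ /=.
by rewrite sqnZ u1 expr1n mul1r.
Qed.

Lemma coef_pair_rank b : exists s, forall p, coef_pair b p = rank_form s p.
Proof.
elim/mpoly_lin_ind: b => [m|a b b' [s hs] [s' hs']].
  exists [:: ((w m)^-1%:C *: 1, mpolyX C m)] => p.
  rewrite coef_pairX /rank_form big_seq1 /= -scalerAr mulr1 mdotZl.
  exact: mcoeff_mdot.
exists ([seq (a *: xy.1, xy.2) | xy <- s] ++ s') => p.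
rewrite coef_pairP rank_form_cat -hs'; congr (_ + _).
rewrite hs /rank_form big_map mulr_sumr; apply: eq_bigr => xy _ /=.
by rewrite -scalerAr mdotZl.
Qed.

(** The functional [p |-> <p x, y>] only involves coefficients of degree at
    most that of [y]. *)
Lemma form_coef_pair x y : exists b, forall p, coef_pair b p = mdot w (p * x) y.
Proof.
suff [k hk] : exists k, forall m, (k <= mdeg m)%N -> mdot w (mpolyX C m * x) y = 0.
  pose b := trunc_series k (fun m => mdot w (mpolyX C m * x) y).
  exists b; elim/mpoly_lin_ind => [m|a p q hp hq]; last first.
    by rewrite coef_pair_linear hp hq mulrDl -scalerAl mdotPl.
  rewrite coef_pair_mon mcoeff_trunc_series.
  by case: ltnP => // /hk ->.
exists (msize y) => m my.
rewrite (mpolyE x) mulr_sumr mdot_suml big1_seq // => k _.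
rewrite -scalerAr -mpolyXD mdotZl (mpolyE y) mdot_sumr big1_seq ?mulr0 // => j /= jy.
rewrite mdotZr mdotX; have [e|_] := eqVneq (mnm_add m k) j; last by rewrite !mulr0.
have := msize_mdeg_lt jy; rewrite -e mdegD; lia.
Qed.

(** Were there no representation of mass comparable to [c], a functional on the
    finite rank forms, bounded by the mass, would separate [phi] from those of
    smaller mass. Such a functional is a formal power series; cut off as above, it
    is a polynomial of multiplier norm at most six, at which [phi] is too large. *)
Lemma finite_degree_rank (phi : {scalar mpol}) (c delta : R) M :
  0 <= c -> 0 < delta ->
  (forall p, ord_ge M p -> phi p = 0) ->
  (forall p (a : R), mbound iota p a -> nr (phi p) <= c * a) ->
  exists s, (forall p, phi p = rank_form s p) /\ mass s <= 6 * c + delta.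
Proof.
move=> c0 delta0 phiM phic; apply: contrapT => nos.
pose c' := 6 * c + delta; have c'0 : 0 < c' by rewrite /c'; lra.
pose b0 := trunc_series M (phi \o @mpolyX d C).
have b0E p : coef_pair b0 p = phi p.
  elim/mpoly_lin_ind: p => [m|a p q hp hq]; last by rewrite coef_pair_linear hp hq linearP.
  rewrite coef_pair_mon mcoeff_trunc_series /=; case: ltnP => // Mm.
  rewrite phiM // => k kM; rewrite mcoeffX; have [e|//] := eqVneq m k.
  by move: kM; rewrite -e ltnNge Mm.
(* The multiples of [b0] force the functional to be at least [c'] there. *)
pose G := [set x : mpol * R | exists (t : R) s, [/\ 0 <= t,
  forall p, coef_pair (x.1 + t%:C *: b0) p = rank_form s p & mass s <= x.2 + t * c']].
have [|L hL] := @hahn_banach R mpol G.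
  split.
  - exists 0, [::]; split => //= [p|]; last by rewrite /mass big_nil mul0r addr0.
    by rewrite scale0r addr0 coef_pair0 /rank_form big_nil.
  - move=> [v c1] [v' c2] [t [s [t0 hs ms]]] [t' [s' [t0' hs' ms']]] /=.
    exists (t + t'), (s ++ s'); split => /=; first exact: addr_ge0.
      move=> p; rewrite rank_form_cat -hs -hs' -coef_pairD /=; congr coef_pair.
      by rewrite rmorphD scalerDl addrACA.
    by rewrite mass_cat; move: ms ms' => /=; lra.
  - move=> r [v c1] r0 [t [s [t0 hs ms]]] /=.
    have [s' [hs' ms']] := rank_form_scale s r0.
    exists (r * t), s'; split => /=; first by rewrite mulr_ge0 // ltW.
      move=> p; rewrite hs' -hs -coef_pairZ /=; congr coef_pair.
      by rewrite rmorphM -scalerA scalerDr.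
    by rewrite ms' -mulrA -mulrDr ler_wpM2l // ltW.
  - move=> c1 [t [s [t0 /= hs ms]]].
    have [t00|tn0] := eqVneq t 0.
      by move: ms; rewrite t00 mul0r addr0; apply: le_trans (mass_ge0 s).
    have tp : 0 < t by rewrite lt_neqAle eq_sym tn0.
    rewrite leNgt; apply/negP => c10; apply: nos.
    have ti : 0 < t^-1 by rewrite invr_gt0.
    have [s' [hs' ms']] := rank_form_scale s ti.
    exists s'; split.
      move=> p; rewrite hs' -hs add0r coef_pairZ b0E mulrA -rmorphM /=.
      by rewrite mulVf // rmorph1 mul1r.
    rewrite ms' ler_pdivrMl // (le_trans ms) // -/c'; lra.
  - move=> [v c1] _ /=; have [s hs] := coef_pair_rank (- v).
    exists (mass s), 0, s; split => //=; last by rewrite mul0r addr0.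
    by move=> p; rewrite scale0r addr0.
have Lc s v : (forall p, coef_pair v p = rank_form s p) -> nr (L v) <= mass s.
  move=> hs; have [u [u1 uL]] := nr_phase (L v).
  have [s' [hs' <-]] := rank_form_rotate s u1.
  have <- : complex.Re (L (u *: v)) = nr (L v) by rewrite linearZ /= uL.
  apply: hL; exists 0, s'; split => //=; last by rewrite mul0r addr0.
  by move=> p; rewrite scale0r addr0 coef_pairZ hs hs'.
have Lb0 : c' <= nr (L b0).
  apply: le_trans (Re_le_nr _); rewrite -lerN2 -ReN -linearN; apply: hL.
  exists 1, [::]; split => //=; last by rewrite /mass big_nil mul1r addNr.
  by move=> p; rewrite scale1r addNr coef_pair0 /rank_form big_nil.
have [Mp hMp] : exists N, (0 < N)%N /\ (M <= N)%N by exists M.+1; lia.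
have [N0 MN] := hMp.
pose V_ := vallee R Mp.
pose ph := trunc_series (Mp + Mp) (fun m => V_ (mdeg m) * L (mpolyX C m)).
have phE m : mcoeff m ph = V_ (mdeg m) * L (mpolyX C m).
  by rewrite mcoeff_trunc_series; case: ltnP => // mM; rewrite /V_ vallee0 // mul0r.
have coefL b : coef_pair b ph = L (deg_mul V_ b).
  elim/mpoly_lin_ind: b => [m|a b b' h h']; last by rewrite coef_pairP h h' !linearP.
  by rewrite coef_pairX phE deg_mulX linearZ.
have phb0 : phi ph = L b0.
  rewrite -b0E coefL; congr (L _); apply/mpolyP => m; rewrite mcoeff_deg_mul.
  have [mM|Mm] := ltnP (mdeg m) M.
    by rewrite /V_ vallee1 ?mul1r //; lia.
  by rewrite mcoeff_trunc_series ltnNge Mm mulr0.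
have Lfejer N b x y : (0 < N)%N -> (forall p, coef_pair b p = mdot w (p * x) y) ->
    nr (L (deg_mul (fejer R N) b)) <= sqn w x + sqn w y.
  move=> Np hb.
  have adj p : coef_pair (deg_mul (fejer R N) b) p = coef_pair b (deg_mul (fejer R N) p).
    elim/mpoly_lin_ind: b {hb} => [m|a b b' h h'].
      by rewrite deg_mulX coef_pairZ !coef_pairX mcoeff_deg_mul.
    by rewrite linearP /= !coef_pairP h h'.
  have Ni : 0 < N%:R^-1 :> R by rewrite invr_gt0 ltr0n.
  have [K hK] := fejer_window w x y Np.
  pose s0 := [seq (window N (val i) x, window N (val i) y) | i <- enum 'I_K].
  have [s' [hs' ms']] := rank_form_scale s0 Ni.
  apply: (le_trans (Lc s' _ _)).
    move=> p; rewrite adj hb hK hs' fmorphV rmorph_nat; congr (_ * _).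
    by rewrite /rank_form big_map big_enum.
  rewrite ms' ler_pdivrMl ?ltr0n // /mass big_map big_enum /= big_split mulrDr.
  by rewrite lerD // sqn_window.
have ph6 : mbound iota ph (2 * 3).
  apply: mbound_of_form => // x y.
  have [b hb] := form_coef_pair x y.
  rewrite -hb coefL /V_ deg_mul_vallee linearB linearZ /=.
  rewrite (le_trans (nrB _ _)) // nrM nr_nat.
  have h1 := Lfejer _ _ _ _ (ltn_addr Mp N0) hb.
  have h2 := Lfejer _ _ _ _ N0 hb.
  move: (nr _) (nr _) h1 h2 => t1 t2; lra.
have := le_trans Lb0 (le_trans _ (phic _ _ ph6)); rewrite phb0 lexx => /(_ isT).
by rewrite /c'; lra.
Qed.

(** A functional that is small on high order polynomials is the norm convergent
    sum of its differences of successive cutoffs, hence of finite rank forms of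
    summable mass: it is given by a trace class operator. *)
Lemma trace_class_repr (phi : {scalar mpol}) (c0 : R) : 0 <= c0 ->
  (forall p a, mbound iota p a -> nr (phi p) <= c0 * a) -> tail_small iota phi ->
  exists s : nat -> seq (mpol * mpol),
    (exists A, forall k, mass (s k) <= A * 2^-1 ^+ k) /\
    forall p, exists B, forall n,
      nr (phi p - \sum_(k < n.+1) rank_form (s k) p) <= B * 2^-1 ^+ n.
Proof.
move=> c00 phic ts.
have e0 k : 0 < 2^-1 ^+ k :> R by rewrite exprn_gt0 // invr_gt0.
have /choice[N_ hN] : forall k, exists N, (0 < N)%N /\
    forall p a, ord_ge N p -> mbound iota p a -> nr (phi p) <= 2^-1 ^+ k * a.
  move=> k.
  have [N hN] := ts _ (e0 k); exists N.+1; split => // p a op.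
  by apply: hN; apply: ord_geW op.
pose cut k n := if k is k'.+1 then vallee R (N_ k) n - vallee R (N_ k') n else vallee R (N_ 0%N) n.
have cutS k p : deg_mul (cut k.+1) p = deg_mul (vallee R (N_ k.+1)) p - deg_mul (vallee R (N_ k)) p.
  by apply/mpolyP => m; rewrite mcoeffB !mcoeff_deg_mul mulrBl.
have rem k p a : mbound iota p a -> nr (phi p - phi (deg_mul (vallee R (N_ k)) p)) <= 4 * 2^-1 ^+ k * a.
  move=> pa; have [Nk hk] := hN k; rewrite -linearB.
  have := hk _ (a + 3 * a) (ord_ge_vallee p Nk).
  rewrite (_ : 2^-1 ^+ k * (a + 3 * a) = 4 * 2^-1 ^+ k * a); last by ring.
  apply; apply: mboundD => //; rewrite -[3 * a]mul1r -{1}(nr1 R) -nrN -scaleN1r.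
  by apply: mboundZ; apply: mbound_vallee.
(* The first cutoff costs [3 * c0]; a difference of successive ones is the
   difference of two remainders. *)
pose c1 := 3 * c0 + 12; have c10 : 0 <= c1 by rewrite /c1; lra.
have psib k p a : mbound iota p a -> nr (phi (deg_mul (cut k) p)) <= c1 * 2^-1 ^+ k * a.
  move=> pa; have a0 := mbound_ge0 w_gt0 iota_norm pa.
  case: k => [|k].
    rewrite expr0 mulr1 (le_trans (phic _ (3 * a) _)) //.
      by apply: mbound_vallee => //; case: (hN 0%N).
    by rewrite mulrA ler_wpM2r // /c1; lra.
  rewrite cutS linearB /=.
  have h1 := rem k p a pa; have h2 := rem k.+1 p a pa.
  rewrite (_ : _ - _ = (phi p - phi (deg_mul (vallee R (N_ k)) p)) - (phi p - phi (deg_mul (vallee R (N_ k.+1)) p))); last by ring.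
  rewrite (le_trans (nrB _ _)) // (le_trans (lerD h1 h2)) // exprS.
  have t0 : 0 <= 2^-1 ^+ k * a by rewrite mulr_ge0 // ltW.
  rewrite (_ : _ + _ = 6 * (2^-1 ^+ k * a)); last by field.
  rewrite (_ : c1 * _ * _ = (c1 / 2) * (2^-1 ^+ k * a)); last by ring.
  by rewrite ler_wpM2r // /c1; lra.
have psifin k : exists M, forall p, ord_ge M p -> phi (deg_mul (cut k) p) = 0.
  exists (N_ k + N_ k + (N_ k.-1 + N_ k.-1))%N => p op.
  suff -> : deg_mul (cut k) p = 0 by rewrite linear0.
  apply/mpolyP => m; rewrite mcoeff_deg_mul mcoeff0.
  have [mM|Mm] := ltnP (mdeg m) (N_ k + N_ k + (N_ k.-1 + N_ k.-1))%N.
    by rewrite op // mulr0.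
  rewrite /cut; case: k op Mm => [|k] op Mm; first by rewrite vallee0 ?mul0r //=; lia.
  rewrite /= in Mm; by rewrite !vallee0 ?subrr ?mul0r //=; lia.
have /choice[s hs] : forall k, exists s, (forall p, phi (deg_mul (cut k) p) = rank_form s p)
    /\ mass s <= 6 * (c1 * 2^-1 ^+ k) + 2^-1 ^+ k.
  move=> k.
  have [M hM] := psifin k.
  apply: (@finite_degree_rank (phi \o deg_mul (cut k)) (c1 * 2^-1 ^+ k) _ M) => //.
    by rewrite mulr_ge0 // ltW.
  by move=> p a /= pa; apply: psib.
exists s; split.
  exists (6 * c1 + 1) => k; have [_ h] := hs k.
  apply: le_trans h _; rewrite le_eqVlt; apply/orP; left; apply/eqP; ring.
move=> p; have [a pa] := mpoly_bounded mon_bounded p; exists (4 * a) => n.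
have -> : \sum_(k < n.+1) rank_form (s k) p = phi (deg_mul (vallee R (N_ n)) p).
  elim: n => [|n IH]; first by rewrite big_ord1 -(hs 0%N).1.
  rewrite big_ord_recr IH /= -(hs n.+1).1 cutS linearB /=; ring.
by rewrite mulrAC; apply: rem.
Qed.

End FiniteDegree.

(** * Polynomials in one variable *)

Section OneVariable.
Variable R : realType.
Local Notation C := R[i].
Implicit Types (Q : {poly C}) (a z : C).

Lemma prim_root_exists n : (0 < n)%N -> exists z : C, n.-primitive_root z.
Proof.
move=> n0; have [rs rsE] := closed_field_poly_normal ('X^n - 1 : {poly C}).
have mn : 'X^n - 1 \is @monic C by rewrite monicXnsubC.
rewrite (monicP mn) scale1r in rsE.
have nC : n%:R != 0 :> C by rewrite pnatr_eq0 -lt0n.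
have urs : uniq rs.
  by rewrite -separable_prod_XsubC -rsE separable_Xn_sub_1.
have srs : size rs = n.
  have := size_prod_XsubC rs id; rewrite -rsE size_XnsubC //.
  by move=> [].
have : has n.-primitive_root rs.
  apply: has_prim_root => //; last by rewrite srs.
  apply/allP => z zs; rewrite /root_of_unity.
  by rewrite rsE root_prod_XsubC.
by move=> /hasP[z _ hz]; exists z.
Qed.

Lemma nr_prim_root n z : n.-primitive_root z -> nr z = 1.
Proof.
move=> hz; have n0 := prim_order_gt0 hz; have := prim_expr_order hz.
move/(congr1 (@nr R C)); rewrite nrX nr1 => /eqP.
by rewrite pexpr_eq1 ?nr_ge0 // => /eqP.
Qed.

Lemma nr1_conj z : nr z = 1 -> z * (z^*)%C = 1.
Proof. by move=> h; rewrite mulcJ h expr1n. Qed.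

(** Orthogonality of the characters of the cyclic group. *)
Lemma prim_root_orth n z i j : n.-primitive_root z -> (i < n)%N -> (j < n)%N ->
  \sum_(t < n) z ^+ (i * t) * ((z ^+ (j * t))^*)%C = n%:R * (i == j)%:R.
Proof.
move=> hz ilt jlt; have nz := nr_prim_root hz; have zJ := nr1_conj nz.
pose u := z ^+ i * ((z ^+ j)^*)%C.
have -> : \sum_(t < n) z ^+ (i * t) * ((z ^+ (j * t))^*)%C = \sum_(t < n) u ^+ t.
  by apply: eq_bigr => t _; rewrite /u exprMn -!rmorphXn -!exprM.
have zjJ : z ^+ j * ((z ^+ j)^*)%C = 1 by rewrite rmorphXn -exprMn zJ expr1n.
have uE : (u == 1) = (i == j).
  have -> : (i == j) = (z ^+ i == z ^+ j).
    by rewrite (eq_prim_root_expr hz) !modn_small.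
  apply/eqP/eqP => [h|h]; last by rewrite /u h.
  have : u * z ^+ j = z ^+ j by rewrite h mul1r.
  by rewrite /u -mulrA (mulrC _ (z ^+ j)) zjJ mulr1.
have un : u ^+ n = 1.
  rewrite /u exprMn -rmorphXn -!exprM !(mulnC _ n) !exprM (prim_expr_order hz).
  by rewrite !expr1n rmorph1 mulr1.
case eij: (i == j) in uE *; [move/eqP: uE => u1|move/negbT: uE => u1].
  by rewrite u1 (eq_bigr (fun=> 1)) ?sumr_const ?card_ord ?mulr1 // => t _; rewrite expr1n.
apply/eqP; rewrite mulr0; have := subrX1 u n; rewrite un subrr => /esym/eqP.
by rewrite mulf_eq0 subr_eq0 (negbTE u1).
Qed.

(** Cauchy estimate; the coefficient is an average over roots of unity of order
    larger than all degrees involved. *)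
Lemma cauchy_coef Q (M r : R) k : 0 < r ->
  (forall z, nr z = r -> nr Q.[z] <= M) -> nr Q`_k <= M / r ^+ k.
Proof.
move=> r0 hM; pose n := (size Q + k).+1.
have [w hw] := @prim_root_exists n isT.
have wJ := nr1_conj (nr_prim_root hw).
have nC : n%:R != 0 :> C by rewrite pnatr_eq0.
have M0 : 0 <= M by apply: le_trans (nr_ge0 _) (hM r%:C _); rewrite nrC gtr0_norm.
have key : r%:C ^+ k * Q`_k = n%:R^-1 * \sum_(t < n) Q.[r%:C * w ^+ t] * ((w ^+ (k * t))^*)%C.
  have -> : \sum_(t < n) Q.[r%:C * w ^+ t] * ((w ^+ (k * t))^*)%C =
     \sum_(i < size Q) Q`_i * r%:C ^+ i * (n%:R * (nat_of_ord i == k)%:R).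
    under eq_bigr => t _ do rewrite horner_coef mulr_suml.
    rewrite exchange_big /=; apply: eq_bigr => i _.
    rewrite -(prim_root_orth hw (i := i) (j := k)); first last.
    - by rewrite /n ltnS leq_addl.
    - by rewrite (leq_trans (ltn_ord i)) // /n leqW // leq_addr.
    rewrite mulr_sumr; apply: eq_bigr => t _.
    by rewrite exprMn -exprM (mulnC t); ring.
  have [kQ|Qk] := ltnP k (size Q); last first.
    rewrite nth_default // mulr0 big1 ?mulr0 // => i _.
    by rewrite (ltn_eqF (leq_trans (ltn_ord i) Qk)) !mulr0.
  rewrite (bigD1 (Ordinal kQ)) //= eqxx big1 ?addr0; first by rewrite mulr1 mulrCA mulVf // mulr1 mulrC.
  by move=> i; rewrite -val_eqE /= => /negbTE ->; rewrite !mulr0.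
have := congr1 (@nr R C) key; rewrite nrM nrX nrC gtr0_norm // => e.
rewrite ler_pdivlMr ?exprn_gt0 // mulrC e nrM nrV nr_nat.
rewrite ler_pdivrMl ?ltr0n // (le_trans (nr_sum _ _ _)) //.
have -> : n%:R * M = \sum_(t < n) M by rewrite sumr_const card_ord mulr_natl.
apply: ler_sum => t _; rewrite nrM nr_conj nrX (nr_prim_root hw) expr1n mulr1.
by apply: hM; rewrite nrM nrX (nr_prim_root hw) expr1n mulr1 nrC gtr0_norm.
Qed.

(** Maximum principle. The coefficients of [Q ^+ m] are at most [M ^+ m], so that
    a value of modulus larger than [M] would grow exponentially relative to
    the number of coefficients. *)
Lemma max_principle Q (M : R) a : (forall z, nr z = 1 -> nr Q.[z] <= M) ->
  nr a <= 1 -> nr Q.[a] <= M.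
Proof.
move=> hM a1; rewrite leNgt; apply/negP => ltM.
pose q := nr Q.[a]; pose M' := (M + q) / 2.
have M0 : 0 <= M by apply: le_trans (nr_ge0 _) (hM 1 _); rewrite nr1.
have M'0 : 0 < M' by rewrite /M' /q; lra.
have hM' z : nr z = 1 -> nr Q.[z] <= M'.
  by move=> /hM h; rewrite (le_trans h) // /M' /q; lra.
have M'q : M' < q by rewrite /M' /q; lra.
have bd m : q ^+ m <= (m * size Q).+1%:R * M' ^+ m.
  rewrite -nrX -horner_exp horner_coef (le_trans (nr_sum _ _ _)) //.
  have : \sum_(i < size (Q ^+ m)) nr ((Q ^+ m)`_i * a ^+ i) <= \sum_(i < size (Q ^+ m)) M' ^+ m.
    apply: ler_sum => i _; rewrite nrM nrX.
    have := @cauchy_coef (Q ^+ m) (M' ^+ m) 1 i ltr01; rewrite expr1n divr1 => h.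
    have {}h : nr (Q ^+ m)`_i <= M' ^+ m.
      apply: h => z z1; rewrite horner_exp nrX lerXn2r ?nnegrE ?nr_ge0 ?(ltW M'0) //.
      exact: hM'.
    rewrite (le_trans (ler_wpM2r _ h)) ?exprn_ge0 ?nr_ge0 //.
    by rewrite ler_piMr ?exprn_ge0 ?(ltW M'0) // exprn_ile1 ?nr_ge0.
  move=> /le_trans; apply; rewrite sumr_const card_ord -[M' ^+ m *+ _]mulr_natl.
  rewrite ler_wpM2r ?exprn_ge0 ?(ltW M'0) // ler_nat.
  apply: leq_trans (size_poly_exp_leq Q m) _; rewrite ltnS mulnC leq_mul2l.
  by rewrite leq_pred orbT.
pose x := q / M' - 1.
have x0 : 0 < x by rewrite /x subr_gt0 ltr_pdivlMr // mul1r.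
have [m hm] := nat_gt ((2 * (size Q)%:R + 1) / x ^+ 2 + 1).
have bern k : 1 + k%:R * x <= (1 + x) ^+ k.
  elim: k => [|k IH]; first by rewrite mul0r addr0 expr0.
  rewrite exprS (le_trans _ (ler_wpM2l _ IH)) //; last by lra.
  have : 0 <= k%:R * x ^+ 2 by rewrite mulr_ge0 // sqr_ge0.
  by rewrite -natr1; nra.
have h1 : (1 + m%:R * x) ^+ 2 <= (m * 2 * size Q).+1%:R.
  have h2 : (1 + x) ^+ (m * 2) <= (m * 2 * size Q).+1%:R.
    rewrite /x addrC subrK expr_div_n ler_pdivrMr ?exprn_gt0 //; exact: bd.
  apply: le_trans h2; rewrite exprM lerXn2r ?nnegrE //.
    by rewrite addr_ge0 // mulr_ge0 // ltW.
  by rewrite exprn_ge0 //; lra.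
have x2 : 0 < x ^+ 2 by rewrite exprn_gt0.
have m1 : 1 < m%:R :> R.
  apply: le_lt_trans hm; rewrite lerDr divr_ge0 ?(ltW x2) //.
have h3 : (2 * (size Q)%:R + 1) < (m%:R - 1) * x ^+ 2.
  by rewrite -ltr_pdivrMr //; lra.
move: h1; rewrite -[(_ * size Q).+1]addn1 natrD !natrM; apply/negP; rewrite -ltNge.
have : m%:R * (2 * (size Q)%:R + 1) < m%:R * ((m%:R - 1) * x ^+ 2) by rewrite ltr_pM2l //; lra.
have := ler0n R (size Q); move: (m%:R : R) (size Q)%:R m1 x2 x0 => mm s m1 x2 x0 s0.
nra.
Qed.

End OneVariable.

(** * Analytic approximation of products on the sphere *)

Section Henkin.
Variables (R : realType) (d : nat).
Hypothesis d_gt0 : (0 < d)%N.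
Local Notation C := R[i].
Local Notation mpol := (mpoly.mpoly d C).
Local Notation pt := ('I_d -> C).
Implicit Types (p q : mpol) (v z : pt).

Definition nrm2 v : R := \sum_i nr (v i) ^+ 2.

Definition on_sphere v := nrm2 v = 1.

Definition sbound p (c : R) := forall z, on_sphere z -> nr (meval z p) <= c.

Lemma nrm2_ge0 v : 0 <= nrm2 v.
Proof. by apply: sumr_ge0 => i _; rewrite sqr_ge0. Qed.

Lemma sphere_point : exists e : pt, on_sphere e.
Proof.
pose i0 := Ordinal d_gt0.
exists (fun i => (i == i0)%:R); rewrite /on_sphere /nrm2 (bigD1 i0) //= ?eqxx nr1 expr1n.
by rewrite big1 ?addr0 // => i /negbTE ->; rewrite nr0 expr0n.
Qed.

Lemma sphere_polar v : exists e s, [/\ on_sphere e, 0 <= s, s ^+ 2 = nrm2 v &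
  forall i, v i = s%:C * e i].
Proof.
have [v0|v0] := eqVneq (nrm2 v) 0.
  have [e he] := sphere_point; exists e, 0; split => //; first by rewrite expr0n.
  move=> i; rewrite mul0r; apply: nr_eq0; apply/eqP; rewrite -sqrf_eq0.
  have := psumr_eq0P (fun j _ => sqr_ge0 (nr (v j))) v0 => /(_ i isT) ->.
  by rewrite eqxx.
have vp : 0 < nrm2 v by rewrite lt_neqAle eq_sym v0 nrm2_ge0.
pose s := Num.sqrt (nrm2 v); have s0 : 0 < s by rewrite sqrtr_gt0.
have s2 : s ^+ 2 = nrm2 v by rewrite sqr_sqrtr // ltW.
exists (fun i => s^-1%:C * v i), s; split => //; last 2 first.
- exact: ltW.
- by move=> i; rewrite mulrA -rmorphM divff ?gt_eqF // rmorph1 mul1r.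
rewrite /on_sphere /nrm2; under eq_bigr do rewrite nrM nrC exprMn.
rewrite -mulr_sumr -/(nrm2 v) -s2 gtr0_norm ?invr_gt0 // -exprMn mulVf ?gt_eqF //.
by rewrite expr1n.
Qed.

Definition line_poly N p (e : pt) : {poly C} :=
  \sum_(m <- msupp p) (mcoeff m p * \prod_i e i ^+ m i) *: 'X^(mdeg m - N).

Lemma meval_scale m (s : C) (e : pt) :
  \prod_i (s * e i) ^+ (m : multinom d) i = s ^+ mdeg m * \prod_i e i ^+ m i.
Proof.
under eq_bigr do rewrite exprMn.
by rewrite big_split /= mdegE expr_sum.
Qed.

Lemma horner_line_poly N p e s : ord_ge N p ->
  s ^+ N * (line_poly N p e).[s] = meval (fun i => s * e i) p.
Proof.
move=> op; rewrite /line_poly horner_sum mulr_sumr mevalE.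
rewrite big_seq [RHS]big_seq; apply: eq_bigr => m ms.
have Nm : (N <= mdeg m)%N.
  by rewrite leqNgt; apply/negP => /op h; move: ms; rewrite mcoeff_msupp h eqxx.
rewrite meval_scale hornerZ hornerXn -{2}(subnKC Nm) exprD; ring.
Qed.

Lemma on_sphere_rot (u : C) e : nr u = 1 -> on_sphere e -> on_sphere (fun i => u * e i).
Proof.
move=> u1; rewrite /on_sphere /nrm2 => <-; apply: eq_bigr => i _.
by rewrite nrM u1 mul1r.
Qed.

(** Schwarz lemma: vanishing to order [N] improves the maximum principle. *)
Lemma schwarz N p c v th : ord_ge N p -> sbound p c -> 0 <= th -> th <= 1 ->
  nrm2 v <= th ^+ 2 -> nr (meval v p) <= th ^+ N * c.
Proof.
move=> op pc th0 th1 vth; have [e [s [he s0 s2 vs]]] := sphere_polar v.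
have sth : s <= th by rewrite -(@ler_pXn2r _ 2) ?nnegrE // s2.
have -> : meval v p = s%:C ^+ N * (line_poly N p e).[s%:C].
  by rewrite horner_line_poly //; apply: meval_eq.
have c0 : 0 <= c by apply: le_trans (nr_ge0 _) (pc _ he).
rewrite nrM nrX nrC ger0_norm //; apply: ler_pM; rewrite ?exprn_ge0 ?nr_ge0 //.
  by rewrite lerXn2r ?nnegrE.
apply: max_principle; last by rewrite nrC ger0_norm // (le_trans sth).
move=> z z1; have := pc _ (on_sphere_rot z1 he).
by rewrite -(horner_line_poly e z op) nrM nrX z1 expr1n mul1r.
Qed.

Definition dir_deriv (t : pt) p : pt -> C :=
  fun z => \sum_j t j * meval z (mderiv j p).

Definition line_sub (z t : pt) : mpol -> {poly C} :=
  mmap polyC (fun j => (z j)%:P + t j *: 'X).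

Lemma horner_line_sub z t p s :
  (line_sub z t p).[s] = meval (fun j => z j + s * t j) p.
Proof.
elim/mpoly_lin_ind: p => [m|a p q hp hq].
  rewrite /line_sub mmapX /mmap1 horner_prod mevalX; apply: eq_bigr => j _.
  by rewrite horner_exp hornerD hornerC hornerZ hornerX mulrC.
by rewrite /line_sub mmapD mmapZ hornerD hornerM hornerC mevalD mevalZ -hp -hq.
Qed.

Lemma line_subM z t p q : line_sub z t (p * q) = line_sub z t p * line_sub z t q.
Proof. exact: rmorphM. Qed.

Lemma line_subP z t a p q :
  line_sub z t (a *: p + q) = a%:P * line_sub z t p + line_sub z t q.
Proof. by rewrite /line_sub mmapD mmapZ. Qed.

Lemma line_subD z t p q : line_sub z t (p + q) = line_sub z t p + line_sub z t q.
Proof. exact: rmorphD. Qed.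

Lemma deriv_line_subM z t p q :
  (line_sub z t p)^`() = \sum_j t j *: line_sub z t (mderiv j p) ->
  (line_sub z t q)^`() = \sum_j t j *: line_sub z t (mderiv j q) ->
  (line_sub z t (p * q))^`() = \sum_j t j *: line_sub z t (mderiv j (p * q)).
Proof.
move=> h1 h2; rewrite line_subM derivM h1 h2.
rewrite mulr_suml mulr_sumr -big_split /=; apply: eq_bigr => j _.
by rewrite mderivM line_subD !line_subM scalerDr -scalerAl -scalerAr.
Qed.

Lemma deriv_line_subX z t i :
  (line_sub z t (mpolyX C (mnm1 i)))^`() =
    \sum_j t j *: line_sub z t (mderiv j (mpolyX C (mnm1 i))).
Proof.
rewrite {1}/line_sub mmapX mmap1U derivD derivC add0r derivZ derivX.
rewrite (bigD1 i) //= big1 ?addr0 => [|j ji]; rewrite mderivX mnm1E /line_sub.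
  rewrite eqxx scale1r; have -> : mnm_sub (mnm1 i) (mnm1 i) = @mnm0 d.
    by apply/mnmP => k; rewrite mnmBE subnn mnm0E.
  by rewrite mpolyX0 rmorph1.
by rewrite eq_sym (negbTE ji) scale0r rmorph0 scaler0.
Qed.

Lemma deriv_line_sub z t p :
  (line_sub z t p)^`() = \sum_j t j *: line_sub z t (mderiv j p).
Proof.
elim/mpoly_lin_ind: p => [m|a p q hp hq].
  have P1 : (line_sub z t 1)^`() = \sum_j t j *: line_sub z t (mderiv j 1).
    rewrite /line_sub rmorph1 -polyC1 derivC big1 // => j _.
    by rewrite -mpolyC1 mderivC rmorph0 scaler0.
  rewrite mpolyXE_id.
  apply: (big_ind (fun p => (line_sub z t p)^`() = \sum_j t j *: line_sub z t (mderiv j p))).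
  - exact: P1.
  - by move=> q1 q2; apply: deriv_line_subM.
  - move=> i _; elim: (m i) => [|n IH]; first by rewrite expr0; exact: P1.
    rewrite exprS; exact: (deriv_line_subM (deriv_line_subX z t i) IH).
rewrite line_subP derivD derivM derivC mul0r add0r hp hq.
rewrite mulr_sumr -big_split /=; apply: eq_bigr => j _.
by rewrite linearP /= line_subP scalerDr scalerAr.
Qed.

Lemma coef1_line_sub z t p : (line_sub z t p)`_1 = dir_deriv t p z.
Proof.
have -> : (line_sub z t p)`_1 = (line_sub z t p)^`().[0].
  by rewrite horner_coef0 coef_deriv mulr1n.
rewrite deriv_line_sub horner_sum; apply: eq_bigr => j _.
rewrite hornerZ horner_line_sub; congr (_ * _); apply: meval_eq => k.
by rewrite mul0r addr0.
Qed.

Lemma euler z p : dir_deriv z p z = meval z (deg_mul (fun n => n%:R) p).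
Proof.
elim/mpoly_lin_ind: p => [m|a p q hp hq].
  rewrite deg_mulX mevalZ mdegE natr_sum mulr_suml; apply: eq_bigr => j _.
  rewrite mderivX mevalZ mulrCA.
  have [->|mj] := eqVneq (m j) 0%N; first by rewrite !mul0r.
  congr (_ * _); rewrite -{2}(submK (m := mnm1 j) (m' := m)) ?lep1mP //.
  by rewrite mpolyXD mevalM mevalXU mulrC.
rewrite linearP mevalD mevalZ -hp -hq /dir_deriv mulr_sumr -big_split /=.
by apply: eq_bigr => j _; rewrite linearP mevalD mevalZ; ring.
Qed.

Lemma dir_deriv_scale t m (s : C) z :
  dir_deriv t (mpolyX C m) (fun i => s * z i) = s ^+ (mdeg m).-1 * dir_deriv t (mpolyX C m) z.
Proof.
rewrite /dir_deriv mulr_sumr; apply: eq_bigr => j _.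
rewrite mderivX !mevalZ !mevalX.
have [->|mj] := eqVneq (m j) 0%N; first by rewrite !mul0r !mulr0.
rewrite (meval_scale (mnm_sub m (mnm1 j))).
have -> : mdeg (mnm_sub m (mnm1 j)) = (mdeg m).-1.
  by rewrite -{2}(submK (m := mnm1 j) (m' := m)) ?lep1mP // mdegD mdeg1 addn1.
by ring.
Qed.

Lemma dir_deriv_linear t z a p q :
  dir_deriv t (a *: p + q) z = a * dir_deriv t p z + dir_deriv t q z.
Proof.
rewrite /dir_deriv mulr_sumr -big_split /=; apply: eq_bigr => j _.
by rewrite linearP mevalD mevalZ; ring.
Qed.

Lemma dir_deriv_sum t z p :
  dir_deriv t p z = \sum_(m <- msupp p) mcoeff m p * dir_deriv t (mpolyX C m) z.
Proof.
rewrite [p in LHS]mpolyE; elim: (msupp p) => [|m s IH].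
  by rewrite !big_nil /dir_deriv big1 // => j _; rewrite linear0 meval0 mulr0.
by rewrite !big_cons dir_deriv_linear IH.
Qed.

(** The analytic substitute for the product of [p] with the conjugate of the
    [i]-th coordinate. *)
Definition coordJ (i : 'I_d) p := mderiv i (deg_mul (fun n => n%:R^-1) p).

Lemma ord_ge_coordJ i n p : ord_ge n p -> ord_ge n.-1 (coordJ i p).
Proof.
move=> op m mn; rewrite mcoeff_deriv mcoeff_deg_mul op ?mulr0 ?mul0rn //.
by rewrite mdegD mdeg1; lia.
Qed.

Section Tangent.
Variables (z : pt) (i : 'I_d) (p : mpol) (c : R) (N : nat).
Hypotheses (z_sph : on_sphere z) (p_ord : ord_ge N.+1 p) (p_bd : sbound p c).

(** The complex tangential component of the [i]-th basis vector at [z]. *)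
Definition tangent : pt := fun j => (j == i)%:R - ((z i)^*)%C * z j.

Lemma coordJ_tangent : meval z (coordJ i p) - ((z i)^*)%C * meval z p =
  dir_deriv tangent (deg_mul (fun n => n%:R^-1) p) z.
Proof.
have -> : meval z p = dir_deriv z (deg_mul (fun n => n%:R^-1) p) z.
  rewrite euler deg_mul_comp; congr meval; apply/mpolyP => m; rewrite mcoeff_deg_mul.
  have [m0|m0] := posnP (mdeg m); first by rewrite p_ord ?mulr0 // m0.
  by rewrite divff ?mul1r // pnatr_eq0 -lt0n.
rewrite /dir_deriv /tangent mulr_sumr.
under [RHS]eq_bigr do rewrite mulrBl -mulrA.
rewrite sumrB; congr (_ - _); rewrite (bigD1 i) //= eqxx mul1r big1 ?addr0 //.
by move=> j /negbTE ->; rewrite mul0r.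
Qed.

(** The tangent vector is orthogonal to [z] and its norm is at most one. *)
Lemma tangent_orth (t r : R) (u : C) : 0 <= t -> nr u = r ->
  nrm2 (fun j => t%:C * z j + u * tangent j) <= t ^+ 2 + r ^+ 2.
Proof.
move=> t0 ur.
have E j : (nr (t%:C * z j + u * tangent j) ^+ 2)%:C =
   (t ^+ 2)%:C * (nr (z j) ^+ 2)%:C + (r ^+ 2)%:C * (nr (tangent j) ^+ 2)%:C +
   (t%:C * (u^*)%C * (z j * ((tangent j)^*)%C) + t%:C * u * (((z j)^*)%C * tangent j)).
  have cE : ((t%:C * z j + u * tangent j)^*)%C = t%:C * ((z j)^*)%C + (u^*)%C * ((tangent j)^*)%C.
    by rewrite rmorphD !rmorphM; congr (_ * _ + _); exact: conjc_real.
  by rewrite -!mulcJ -ur -(mulcJ u) cE expr2 rmorphM; ring.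
have orth : \sum_j ((z j)^*)%C * tangent j = 0.
  rewrite /tangent; under eq_bigr do rewrite mulrBr mulrCA.
  rewrite sumrB (bigD1 i) //= eqxx mulr1 big1 ?addr0; last first.
    by move=> j /negbTE ->; rewrite mulr0.
  rewrite -mulr_sumr; apply/eqP; rewrite subr_eq0; apply/eqP.
  rewrite (_ : \sum_j _ = 1) ?mulr1 //.
  under eq_bigr do rewrite mulrC mulcJ.
  by rewrite -rmorph_sum -/(nrm2 z) z_sph rmorph1.
have orthJ : \sum_j z j * ((tangent j)^*)%C = 0.
  rewrite -[RHS](rmorph0 (@conjc R)) -[in RHS]orth rmorph_sum; apply: eq_bigr => j _.
  by rewrite rmorphM /= conjcK.
have tau1 : nrm2 tangent <= 1.
  have e : (nrm2 tangent)%:C = (1 - nr (z i) ^+ 2)%:C.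
    have -> : (nrm2 tangent)%:C = \sum_j tangent j * ((tangent j)^*)%C.
      by rewrite /nrm2 rmorph_sum; apply: eq_bigr => j _; rewrite mulcJ.
    under eq_bigr do rewrite {2}/tangent rmorphB rmorphM /= conjcK mulrBr mulrCA.
    rewrite sumrB -mulr_sumr; under [X in _ - _ * X]eq_bigr do rewrite mulrC.
    rewrite orth mulr0 subr0 (bigD1 i) //= big1; last first.
      by move=> j /negbTE ->; rewrite conjc0 mulr0.
    by rewrite /tangent eqxx conjc1 mulr1 addr0 mulrC mulcJ rmorphB rmorph1.
  by rewrite (complexI e) gerBl sqr_ge0.
have -> : nrm2 (fun j => t%:C * z j + u * tangent j) = t ^+ 2 + r ^+ 2 * nrm2 tangent.
  apply: complexI; rewrite [in LHS]/nrm2 rmorph_sum (eq_bigr _ (fun j _ => E j)).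
  rewrite !big_split /= -!mulr_sumr orth orthJ !mulr0 !addr0 rmorphD !rmorphM -!rmorph_sum.
  by rewrite -/(nrm2 z) z_sph rmorph1 mulr1.
by rewrite lerD2l ler_piMr // sqr_ge0.
Qed.

(** Cauchy estimate on the complex tangential disc of radius [r] at [t z]. *)
Lemma tangent_deriv_bound (t r th : R) : 0 <= t -> 0 < r -> 0 <= th -> th <= 1 ->
  t ^+ 2 + r ^+ 2 <= th ^+ 2 ->
  nr (dir_deriv tangent p (fun j => t%:C * z j)) <= th ^+ N * c / r.
Proof.
move=> t0 r0 th0 th1 h; rewrite -coef1_line_sub -[X in _ / X]expr1.
apply: cauchy_coef => // u ur; rewrite horner_line_sub.
apply: schwarz => //; first exact: ord_geW p_ord.
by apply: le_trans h; apply: tangent_orth.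
Qed.

(** Along the radius of [z], the derivative in the tangential direction is small by
    Schwarz' lemma except close to [z], where the tangential disc inside the ball
    still has a radius of the order of the square root of the distance to the
    sphere. The substitution of [1 - s ^ 2] for the position on the radius makes the
    integrand bounded, and the mean value theorem replaces the integral. *)
Lemma tangent_bound (del th : R) : 0 < del -> del <= 1 -> 0 <= th -> th <= 1 ->
  1 - del ^+ 2 * (3 / 4) <= th ^+ 2 ->
  nr (((z i)^*)%C * meval z p - meval z (coordJ i p)) <= (2 * del + 4 * th ^+ N) * c.
Proof.
move=> del0 del1 th0 th1 hth.
have c0 : 0 <= c by apply: le_trans (nr_ge0 _) (p_bd z_sph).
rewrite nr_dist coordJ_tangent.
pose e m := mcoeff m p * dir_deriv tangent (mpolyX C m) z.
have F1 : dir_deriv tangent (deg_mul (fun n => n%:R^-1) p) z =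
    \sum_(m <- msupp p) (mdeg m)%:R^-1 * e m.
  pose Q := \sum_(m <- msupp p) (mdeg m)%:R^-1 *: (mcoeff m p *: mpolyX C m) : mpol.
  have -> : deg_mul (fun n => n%:R^-1) p = Q.
    by rewrite /deg_mul /Q; apply: eq_bigr => m _; rewrite scalerA.
  rewrite /Q; elim: (msupp p) => [|m s IH].
    by rewrite !big_nil /dir_deriv big1 // => j _; rewrite linear0 meval0 mulr0.
  rewrite !big_cons dir_deriv_linear IH -[_ *: mpolyX _ _]addr0 dir_deriv_linear.
  by rewrite [dir_deriv _ 0 _]big1 ?addr0 // => j _; rewrite linear0 meval0 mulr0.
have E t : dir_deriv tangent p (fun j => t%:C * z j) =
    \sum_(m <- msupp p) t%:C ^+ (mdeg m).-1 * e m.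
  rewrite dir_deriv_sum; apply: eq_bigr => m _.
  by rewrite dir_deriv_scale /e; ring.
have mpos m : m \in msupp p -> (0 < mdeg m)%N.
  move=> ms; rewrite ltnNge; apply/negP => m0.
  by move: ms; rewrite mcoeff_msupp p_ord ?eqxx //; lia.
have [u [u1 uF]] := nr_phase (dir_deriv tangent (deg_mul (fun n => n%:R^-1) p) z).
(* The real part along the radius at the position [1 - s ^ 2], after a rotation
   that makes the value at [z] positive. *)
pose P : {poly R} := \sum_(m <- msupp p) ((mdeg m)%:R^-1 * complex.Re (u * e m)) *: (1 - 'X^2) ^+ mdeg m.
have P0 : P.[0] = nr (dir_deriv tangent (deg_mul (fun n => n%:R^-1) p) z).
  rewrite /P horner_sum; have <- : complex.Re (nr (dir_deriv tangent (deg_mul (fun n => n%:R^-1) p) z))%:C = nr (dir_deriv tangent (deg_mul (fun n => n%:R^-1) p) z) by [].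
  rewrite -uF F1 mulr_sumr Re_sum; apply: eq_bigr => m _.
  have -> : (((mdeg m)%:R^-1 * complex.Re (u * e m)) *: (1 - 'X^2) ^+ mdeg m).[0] = (mdeg m)%:R^-1 * complex.Re (u * e m).
    by rewrite hornerZ horner_exp !hornerE expr0n subr0 expr1n mulr1.
  rewrite -ReZ (_ : ((mdeg m)%:R^-1)%:C = (mdeg m)%:R^-1 :> C); last by rewrite fmorphV rmorph_nat.
  by rewrite mulrCA.
have P1 : P.[1] = 0.
  rewrite /P horner_sum big_seq big1 // => m /mpos m0.
  by rewrite hornerZ horner_exp !hornerE expr1n subrr expr0n gtn_eqF // mulr0.
have dP s : P^`().[s] = - (2 * s) * complex.Re (u * dir_deriv tangent p (fun j => (1 - s ^+ 2)%:C * z j)).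
  have -> : P^`() = \sum_(m <- msupp p) ((mdeg m)%:R^-1 * complex.Re (u * e m)) *: ((1 - 'X^2) ^+ mdeg m)^`().
    by rewrite /P raddf_sum; apply: eq_bigr => m _; exact: derivZ.
  have dq n : ((1 - 'X^2 : {poly R}) ^+ n)^`().[s] = - (2 * s) * n%:R * (1 - s ^+ 2) ^+ n.-1.
    rewrite deriv_exp derivB derivC derivXn hornerMn hornerM horner_exp !hornerE.
    by rewrite -[LHS]mulr_natr /=; ring.
  rewrite E mulr_sumr Re_sum mulr_sumr horner_sum big_seq [RHS]big_seq.
  apply: eq_bigr => m /mpos m0.
  rewrite hornerZ dq (_ : u * (_ * e m) = ((1 - s ^+ 2) ^+ (mdeg m).-1)%:C * (u * e m)) ?ReZ; last first.
    by rewrite rmorphXn mulrCA.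
  have mR : (mdeg m)%:R != 0 :> R by rewrite pnatr_eq0 -lt0n.
  move: (complex.Re _) ((mdeg m)%:R : R) mR (_ ^+ _) => a n n0 b.
  by field.
have dPb s r th' : 0 < s -> s <= 1 -> 0 < r -> 0 <= th' -> th' <= 1 ->
    (1 - s ^+ 2) ^+ 2 + r ^+ 2 <= th' ^+ 2 -> `|P^`().[s]| <= 2 * (s / r) * (th' ^+ N * c).
  move=> s0 s1 r0 th'0 th'1 h.
  have s2 : s ^+ 2 <= 1 by rewrite expr_le1 // ltW.
  have := tangent_deriv_bound (t := 1 - s ^+ 2) _ r0 th'0 th'1 h.
  rewrite subr_ge0 => /(_ s2) b.
  rewrite dP normrM normrN normrM gtr0_norm // (gtr0_norm s0).
  rewrite (_ : 2 * (s / r) * _ = 2 * s * (th' ^+ N * c / r)); last by ring.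
  rewrite ler_wpM2l ?mulr_ge0 ?(ltW s0) // (le_trans _ b) //.
  set a := dir_deriv _ _ _; rewrite -[leRHS]mul1r -u1 -nrM.
  rewrite -(@ler_pXn2r _ 2) ?nnegrE ?nr_ge0 // real_normK ?num_real // nr_sqr.
  by rewrite lerDl sqr_ge0.
have h1 : P.[0] - P.[del] <= 2 * del * c.
  have [x /itvP xin] := poly_mvt P del0; rewrite subr0 => ePx.
  have x0 : 0 < x by rewrite xin.
  have x1 : x <= 1 by rewrite (le_trans _ del1) // xin.
  have := dPb x x 1 x0 x1 x0 ler01 (lexx _); rewrite divff ?gt_eqF // !expr1n mul1r mulr1.
  have x2 : x ^+ 2 <= 1 by rewrite expr_le1 // ltW.
  have hx : (1 - x ^+ 2) ^+ 2 + x ^+ 2 <= 1.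
    by have := sqr_ge0 x; nra.
  move=> /(_ hx); rewrite ler_norml => /andP[b _].
  by rewrite -opprB ePx; have := ler_wpM2r (ltW del0) b; lra.
have h2 : P.[del] - P.[1] <= 4 * th ^+ N * c.
  have [->|dn1] := eqVneq del 1; first by rewrite subrr !mulr_ge0 // exprn_ge0.
  have dl1 : del < 1 by rewrite lt_neqAle dn1.
  have [x /itvP xin ePx] := poly_mvt P dl1.
  have xd : del < x by rewrite xin.
  have x0 : 0 < x by rewrite (lt_trans del0).
  have x1 : x <= 1 by rewrite xin.
  have := dPb x (x / 2) th x0 x1 _ th0 th1.
  rewrite divr_gt0 // (_ : x / (x / 2) = 2); last by field; rewrite gt_eqF.
  have x2 : x ^+ 2 <= 1 by rewrite expr_le1 // ltW.
  have hx : (1 - x ^+ 2) ^+ 2 + (x / 2) ^+ 2 <= th ^+ 2.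
    have dx : del ^+ 2 <= x ^+ 2 by rewrite lerXn2r ?nnegrE ?ltW.
    apply: le_trans hth; rewrite expr_div_n.
    by have := sqr_ge0 x; nra.
  move=> /(_ isT hx); rewrite ler_norml => /andP[b _].
  rewrite -opprB ePx.
  have t0 : 0 <= th ^+ N * c by rewrite mulr_ge0 // exprn_ge0.
  have d1' : 0 <= 1 - del <= 1 by rewrite subr_ge0 del1 /= gerBl ltW.
  move: b t0 d1'; move: (P^`().[x]) (th ^+ N) => y tn b t0 /andP[d1' d2'].
  by nra.
rewrite -P0; lra.
Qed.

End Tangent.

(** The error is the tangential derivative of a primitive of [p] along radii; [del]
    bounds the part near the sphere, the order of [p] the rest. *)
Lemma coordJ_approx i (eps : R) : 0 < eps -> exists N, forall p c z,
  ord_ge N p -> sbound p c -> on_sphere z ->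
  nr (((z i)^*)%C * meval z p - meval z (coordJ i p)) <= eps * c.
Proof.
move=> eps0; pose del := Num.min 1 (eps / 4).
have del0 : 0 < del by rewrite lt_min ltr01 divr_gt0.
have del1 : del <= 1 by rewrite ge_min lexx.
have dele : del <= eps / 4 by rewrite ge_min lexx orbT.
pose th := 1 - del ^+ 2 * (3 / 8).
have d2 : 0 < del ^+ 2 by rewrite exprn_gt0.
have d21 : del ^+ 2 <= 1 by rewrite expr_le1 // ltW.
have th0 : 0 <= th by rewrite /th; lra.
have th1 : th < 1 by rewrite /th; lra.
have hth : 1 - del ^+ 2 * (3 / 4) <= th ^+ 2.
  by rewrite /th; have := sqr_ge0 (del ^+ 2 * (3 / 8)); nra.
have [N hN] : exists N, th ^+ N <= eps / 8.
  have := @cvg_geometric R 1 th; rewrite ger0_norm // => /(_ th1).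
  move=> /cvgrPdist_le /(_ (eps / 8)); rewrite divr_gt0 // => /(_ isT) [N _ h].
  exists N; have := h N (leqnn N); rewrite /geometric /= mul1r sub0r normrN.
  by apply: le_trans; rewrite ler_norm.
exists N.+1 => p c z op pc zs.
have c0 : 0 <= c by apply: le_trans (nr_ge0 _) (pc _ zs).
apply: (le_trans (tangent_bound i zs op pc del0 del1 th0 (ltW th1) hth)).
by rewrite ler_wpM2r //; lra.
Qed.

End Henkin.

(** * Functionals on bounded functions *)

Lemma quad_bound (R : realType) (n c E : R) : 0 <= n -> 0 <= c -> 0 <= E ->
  (forall s, 0 <= s -> 2 * (s * n) <= c + s ^+ 2 * E) -> n ^+ 2 <= c * E.
Proof.
move=> n0 c0 E0 h; have [E00|En0] := eqVneq E 0.
  have [->|nn0] := eqVneq n 0; first by rewrite expr0n /= mulr_ge0.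
  have np : 0 < n by rewrite lt_neqAle eq_sym nn0.
  have := h ((c + 1) / n); rewrite E00 mulr0 addr0 divfK // divr_ge0 ?addr_ge0 //.
  by move=> /(_ isT); lra.
have Ep : 0 < E by rewrite lt_neqAle eq_sym En0.
have := h (n / E); rewrite divr_ge0 // => /(_ isT).
rewrite (_ : 2 * _ = 2 * (n ^+ 2 / E)); last by field.
rewrite (_ : (n / E) ^+ 2 * E = n ^+ 2 / E); last by field.
move=> {}h; have : n ^+ 2 / E <= c by lra.
by rewrite ler_pdivrMr.
Qed.

Section BoundedFunctions.
Variables (R : realType) (T : Type) (z0 : T).
Local Notation C := R[i].
Local Notation fct := (T -> C^o).
Implicit Types (f g h : fct).

Definition bfun h (H : R) := forall z, nr (h z) <= H.
Definition bdd h := exists H, bfun h H.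

Definition fmul f g : fct := fun z => f z * g z.
Definition fconj f : fct := fun z => (f z)^*%C.

Lemma bfunW h H H' : H <= H' -> bfun h H -> bfun h H'.
Proof. by move=> HH hb z; apply: le_trans (hb z) HH. Qed.

Lemma bfun_bdd h H : bfun h H -> bdd h. Proof. by exists H. Qed.

Lemma bdd_ge0 h : bdd h -> exists H, 0 <= H /\ bfun h H.
Proof.
move=> [H hH]; exists `|H|; split => // z.
exact: le_trans (hH z) (ler_norm _).
Qed.

Lemma bfunD f g F G : bfun f F -> bfun g G -> bfun (f + g) (F + G).
Proof. by move=> hf hg z; apply: le_trans (nrD _ _) (lerD (hf z) (hg z)). Qed.

Lemma bfunZ a f F : bfun f F -> bfun (a *: f) (nr a * F).
Proof. by move=> hf z; rewrite [nr _](nrM a) ler_wpM2l ?nr_ge0. Qed.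

Lemma bfunM f g F G : bfun f F -> bfun g G -> bfun (fmul f g) (F * G).
Proof. by move=> hf hg z; rewrite nrM ler_pM ?nr_ge0. Qed.

Lemma bfunJ f F : bfun f F -> bfun (fconj f) F.
Proof. by move=> hf z; rewrite nr_conj. Qed.

Lemma bddD f g : bdd f -> bdd g -> bdd (f + g).
Proof. by move=> [F hF] [G hG]; exists (F + G); exact: bfunD. Qed.

Lemma bddZ a f : bdd f -> bdd (a *: f).
Proof. by move=> [F hF]; exists (nr a * F); exact: bfunZ. Qed.

Lemma bddM f g : bdd f -> bdd g -> bdd (fmul f g).
Proof. by move=> [F hF] [G hG]; exists (F * G); exact: bfunM. Qed.

Lemma bddJ f : bdd f -> bdd (fconj f).
Proof. by move=> [F hF]; exists F; exact: bfunJ. Qed.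

Lemma fscalarZ (lam : {scalar fct}) a f : lam (a *: f) = a * lam f.
Proof. by rewrite linearZ. Qed.

Lemma fscalarD (lam : {scalar fct}) f g : lam (f + g) = lam f + lam g.
Proof. by rewrite linearD. Qed.

Lemma fscalarB (lam : {scalar fct}) f g : lam (f - g) = lam f - lam g.
Proof. by rewrite linearB. Qed.

Definition fbound (lam : fct -> C) (c : R) :=
  0 <= c /\ forall h H, bfun h H -> nr (lam h) <= c * H.

(** Positive functionals; positivity and the bound [c] are expressed at once. *)
Definition positive_bound (rho : fct -> C) (c : R) :=
  0 <= c /\ forall h a, bdd h -> (forall z, complex.Re (h z) <= a) ->
    complex.Re (rho h) <= c * a.

Definition energy (rho : fct -> C) f : R := complex.Re (rho (fmul f (fconj f))).

(** A positive functional whose [L^2] norm dominates the functional [mu]: the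
    inequalities [rho (|g| ^ 2) >= 2 Re (mu g) - c] are consistent with the
    sup-norm bound on [rho] because [|g| ^ 2] is convex in [g]. *)
Lemma dominating_positive (mu : {scalar fct}) (c : R) : fbound mu c ->
  exists rho : {scalar fct}, positive_bound rho c /\
    forall g, bdd g -> nr (mu g) ^+ 2 <= c * energy rho g.
Proof.
move=> [c0 muc].
pose G := [set x : fct * R | x = (0, 0) \/ bdd x.1 /\ exists (g : fct) (t a : R), [/\ 0 < t, bdd g,
  forall z, complex.Re (x.1 z) + nr (g z) ^+ 2 / t <= a &
  x.2 = c * a + c * t - 2 * complex.Re (mu g)]].
have bdd0 : bdd 0 by exists 0 => z; rewrite nr0.
have [|L hL] := @hahn_banach R fct G.
  split.
  - by left.
  - move=> [v c1] [v' c2] [[-> ->]|[/= bv [g [t [a [t0 bg h ->]]]]]].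
      by rewrite /= !add0r.
    case=> [[-> ->]|[/= bv' [g' [t' [a' [t0' bg' h' ->]]]]]].
      by rewrite /= !addr0; right; split => //; exists g, t, a.
    right.
    split => /=; first exact: bddD.
    exists (g + g'), (t + t'), (a + a'); split => /=.
    + exact: addr_gt0.
    + exact: bddD.
    + move=> z; rewrite ReD.
      have : nr (g z + g' z) ^+ 2 / (t + t') <= nr (g z) ^+ 2 / t + nr (g' z) ^+ 2 / t'.
        rewrite ler_pdivrMr ?addr_gt0 //.
        have n1 := nrD (g z) (g' z).
        have h2 : nr (g z + g' z) ^+ 2 <= (nr (g z) + nr (g' z)) ^+ 2.
          by rewrite lerXn2r ?nnegrE ?addr_ge0 ?nr_ge0.
        apply: le_trans h2 _; rewrite -subr_ge0.
        move: (nr (g z)) (nr (g' z)) => x y.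
        have -> : (x ^+ 2 / t + y ^+ 2 / t') * (t + t') - (x + y) ^+ 2 =
            (x * t' - y * t) ^+ 2 / (t * t') by field; rewrite !gt_eqF.
        by rewrite divr_ge0 ?sqr_ge0 // mulr_ge0 // ltW.
      by have := h z; have := h' z; lra.
    + by rewrite linearD ReD; ring.
  - move=> r [v c1] r0 [[-> ->]|[/= bv [g [t [a [t0 bg h ->]]]]]]; first by rewrite /= scaler0 mulr0; left.
    right; split; first exact: bddZ.
    exists (r%:C *: g), (r * t), (r * a); split => /=.
    + exact: mulr_gt0.
    + exact: bddZ.
    + move=> z; rewrite [X in complex.Re X](_ : _ = r%:C * v z) // ReZ.
      rewrite [nr _](nrM r%:C) nrC gtr0_norm // exprMn.
      rewrite (_ : r ^+ 2 * _ / (r * t) = r * (nr (g z) ^+ 2 / t)); last by field; rewrite !gt_eqF.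
      by rewrite -mulrDr ler_wpM2l // ltW.
    + by rewrite fscalarZ ReZ; ring.
  - move=> b [[->]//|[_ [g [t [a [t0 bg /= h ->]]]]]].
    have a0 : 0 <= a by apply: le_trans (h z0); rewrite add0r divr_ge0 ?sqr_ge0 // ltW.
    pose s := Num.sqrt (t * a).
    have s2 : s ^+ 2 = t * a by rewrite sqr_sqrtr // mulr_ge0 // ltW.
    have s0 : 0 <= s by rewrite sqrtr_ge0.
    have gs : bfun g s.
      move=> z; rewrite -(@ler_pXn2r _ 2) ?nnegrE ?nr_ge0 // s2.
      by have := h z; rewrite add0r ler_pdivrMr // mulrC.
    have := le_trans (Re_le_nr _) (muc _ _ gs) => hm.
    have : 2 * s <= t + a.
      rewrite -(@ler_pXn2r _ 2) ?nnegrE ?mulr_ge0 ?addr_ge0 ?(ltW t0) // exprMn s2.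
      by rewrite -subr_ge0 (_ : _ - _ = (t - a) ^+ 2) ?sqr_ge0 //; ring.
    move=> /(ler_wpM2l c0); lra.
  - move=> [v c1] hv.
    have [V hV] : bdd v by case: hv => [[-> _]|[]].
    exists (c * V + c * 1 - 2 * complex.Re (mu 0)); right; split.
      by exists V => z /=; rewrite nrN.
    exists 0, 1, V; split => //= z.
    rewrite nr0 expr0n mul0r addr0 ReN.
    by rewrite -ReN (le_trans (Re_le_nr _)) // nrN.
exists L.
have Lp h a : bdd h -> (forall z, complex.Re (h z) <= a) -> complex.Re (L h) <= c * a.
  move=> bh ha; apply/ler_addgt0Pr => e e0.
  have ce : 0 < e / (c + 1) by rewrite divr_gt0 //; lra.
  have : c * a + c * (e / (c + 1)) - 2 * complex.Re (mu 0) <= c * a + e.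
    rewrite linear0 mulr0 subr0 lerD2l mulrCA ler_piMr ?(ltW e0) //.
    by rewrite ler_pdivrMr ?mul1r; lra.
  apply: le_trans; apply: hL; right; split => //.
  exists 0, (e / (c + 1)), a; split => //= z.
  by rewrite nr0 expr0n mul0r addr0.
split; first by split.
move=> g bg.
have E0 : 0 <= energy L g.
  rewrite /energy -lerN2 oppr0 -ReN -linearN -(mulr0 c); apply: Lp => [|z].
    by rewrite -scaleN1r; apply/bddZ/bddM => //; exact: bddJ.
  by rewrite ReN oppr_le0 /fmul /fconj mulcJ sqr_ge0.
have main (k : fct) : bdd k -> 2 * complex.Re (mu k) <= c + energy L k.
  move=> bk.
  have : complex.Re (L (- fmul k (fconj k))) <= c * 0 + c * 1 - 2 * complex.Re (mu k).
    apply: hL; right; split.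
      by rewrite -scaleN1r; apply/bddZ/bddM => //; exact: bddJ.
    exists k, 1, 0; split => //= z.
    by rewrite ReN /fmul /fconj mulcJ divr1 addNr.
  by rewrite linearN ReN /energy; lra.
have [u [u1 um]] := nr_phase (mu g).
have ms (s : R) : 0 <= s -> 2 * (s * nr (mu g)) <= c + s ^+ 2 * energy L g.
  move=> s0; have := main ((s%:C * u) *: g) (bddZ _ bg).
  have -> : mu ((s%:C * u) *: g) = (s * nr (mu g))%:C.
    by rewrite fscalarZ -mulrA um rmorphM.
  have -> // : energy L ((s%:C * u) *: g) = s ^+ 2 * energy L g.
  rewrite /energy (_ : fmul _ _ = (s ^+ 2)%:C *: fmul g (fconj g)); last first.
    apply/funext => z; rewrite /fmul /fconj /=.
    rewrite [((_ *: g) z)](_ : _ = s%:C * u * g z) // [in RHS](_ : ((_ *: _) z) = (s ^+ 2)%:C * (g z * (g z)^*%C)) //.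
    by rewrite !mulcJ !nrM u1 nrC ger0_norm // mulr1 exprMn rmorphM.
  by rewrite fscalarZ ReZ.
by apply: quad_bound; rewrite ?nr_ge0.
Qed.

Section PositiveFunctional.
Variables (rho : {scalar fct}) (c1 : R).
Hypothesis rho_pos : positive_bound rho c1.

Lemma energy_ge0 f : bdd f -> 0 <= energy rho f.
Proof.
move=> bf; have [_ h] := rho_pos; rewrite /energy -lerN2 oppr0 -ReN -linearN -(mulr0 c1).
apply: h => [|z]; first by rewrite -scaleN1r; apply/bddZ/bddM => //; exact: bddJ.
by rewrite ReN oppr_le0 /fmul /fconj mulcJ sqr_ge0.
Qed.

Lemma pos_fbound : fbound rho c1.
Proof.
have [c0 h] := rho_pos; split => // f F hf.
have [u [u1 uf]] := nr_phase (rho f).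
have -> : nr (rho f) = complex.Re (rho (u *: f)) by rewrite fscalarZ uf.
apply: h => [|z]; first by exists (nr u * F); exact: bfunZ.
by rewrite (le_trans (Re_le_nr _)) // [nr _](nrM u) u1 mul1r.
Qed.

Lemma energy_bound f F : bfun f F -> energy rho f <= c1 * F ^+ 2.
Proof.
move=> hf; have [c0 h] := rho_pos; apply: h => [|z].
  by apply: bddM; [exists F|apply: bddJ; exists F].
have F0 : 0 <= F := le_trans (nr_ge0 _) (hf z).
by rewrite /fmul /fconj mulcJ /= lerXn2r ?nnegrE ?nr_ge0.
Qed.

Lemma rho_imag f : bdd f -> (forall z, complex.Re (f z) = 0) -> complex.Re (rho f) = 0.
Proof.
move=> bf f0; have [c0 h] := rho_pos; apply/eqP; rewrite eq_le; apply/andP; split.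
  by rewrite -(mulr0 c1); apply: h => // z; rewrite f0.
rewrite -lerN2 oppr0 -ReN -linearN -(mulr0 c1); apply: h => [|z].
  by rewrite -scaleN1r; exact: bddZ.
by rewrite ReN f0 oppr0.
Qed.

Lemma rho_conj f : bdd f -> rho (fconj f) = ((rho f)^*)%C.
Proof.
have ReJ g : bdd g -> complex.Re (rho (fconj g)) = complex.Re (rho g).
  move=> bg; apply/eqP; rewrite -subr_eq0 -ReN -ReD -linearB; apply/eqP.
  apply: rho_imag => [|z]; first by apply: bddD; [exact: bddJ|rewrite -scaleN1r; exact: bddZ].
  by rewrite ReD ReN Re_conjc subrr.
move=> bf; apply/eqP; rewrite eq_complex Re_conjc ReJ // eqxx /=.
have ImE x : complex.Im x = - complex.Re ('i%C * x) :> R.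
  by rewrite mulrC ReiNIm opprK.
have -> : complex.Im ((rho f)^*)%C = - complex.Im (rho f) by case: (rho f).
rewrite !ImE -!fscalarZ opprK -ReJ; last by apply/bddZ/bddJ.
rewrite -ReN -linearN; apply/eqP; congr (complex.Re (rho _)); apply/funext => z.
have iJ : ('i%C^*)%C = - 'i%C :> C by apply/eqP; rewrite eq_complex /= oppr0 !eqxx.
change (- (('i%C * ((f z)^*)%C)^*)%C = 'i%C * f z :> C).
by rewrite (rmorphM (@conjc R) 'i%C (f z)^*%C : _ = 'i^*%C * (f z)^*^*%C) iJ conjcK mulNr opprK.
Qed.

Lemma energyD f g : bdd f -> bdd g ->
  energy rho (f + g) = energy rho f + energy rho g + 2 * complex.Re (rho (fmul g (fconj f))).
Proof.
move=> bf bg; rewrite /energy.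
have -> : fmul (f + g) (fconj (f + g)) =
    fmul f (fconj f) + fmul g (fconj g) + (fmul g (fconj f) + fconj (fmul g (fconj f))).
  apply/funext => z; rewrite /fmul /fconj /= [(f + g) z](_ : _ = f z + g z) //.
  rewrite [RHS](_ : _ = f z * (f z)^*%C + g z * (g z)^*%C + (g z * (f z)^*%C + (g z * (f z)^*%C)^*%C)) //.
  by rewrite rmorphD rmorphM /= conjcK; ring.
rewrite !fscalarD !ReD rho_conj ?Re_conjc; last by apply: bddM => //; exact: bddJ.
by ring.
Qed.

Lemma energyZ a f : energy rho (a *: f) = nr a ^+ 2 * energy rho f.
Proof.
rewrite /energy (_ : fmul _ _ = (nr a ^+ 2)%:C *: fmul f (fconj f)); last first.
  apply/funext => z; rewrite /fmul /fconj /=.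
  rewrite [((_ *: f) z)](_ : _ = a * f z) // [in RHS](_ : ((_ *: _) z) = (nr a ^+ 2)%:C * (f z * (f z)^*%C)) //.
  by rewrite !mulcJ !nrM exprMn rmorphM.
by rewrite fscalarZ ReZ.
Qed.

(** Otherwise a step in the direction [k] would lower the energy by more than [dl]. *)
Lemma near_min_orth e k (dl : R) : 0 <= dl -> bdd e -> bdd k ->
  (forall t : C, energy rho e <= energy rho (e + t *: k) + dl) ->
  nr (rho (fmul k (fconj e))) ^+ 2 <= dl * energy rho k.
Proof.
move=> dl0 be bk h; have [u [u1 ue]] := nr_phase (rho (fmul k (fconj e))).
apply: quad_bound; rewrite ?nr_ge0 ?energy_ge0 // => s s0.
have := h (- (s%:C * u)).
rewrite energyD //; last exact: bddZ.
rewrite energyZ nrN nrM u1 nrC ger0_norm // mulr1.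
have -> : fmul (- (s%:C * u) *: k) (fconj e) = (- (s%:C * u)) *: fmul k (fconj e).
  by apply/funext => z; rewrite /fmul /= [X in X * _](_ : _ = - (s%:C * u) * k z) // -mulrA.
rewrite fscalarZ mulNr -(mulrA s%:C) ue -rmorphM ReN /=; lra.
Qed.

Lemma rho_CS f g : bdd f -> bdd g ->
  nr (rho (fmul f (fconj g))) ^+ 2 <= energy rho g * energy rho f.
Proof.
move=> bf bg; apply: near_min_orth => //; first exact: energy_ge0.
by move=> t; rewrite lerDr energy_ge0 //; apply: bddD => //; exact: bddZ.
Qed.

Lemma near_min (I : Type) (F : I -> R) (i0 : I) (B eps : R) : 0 < eps ->
  (forall i, B <= F i) -> exists i, forall j, F i <= F j + eps.
Proof.
move=> e0 hB; have hi : has_inf (range F).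
  by split; [exists (F i0), i0|exists B => _ [i _ <-]].
have [_ [i _ <-] lt] := inf_adherent e0 hi.
exists i => j; apply: le_trans (ltW lt) _; rewrite lerD2r.
by apply: ge_inf; [case: hi|exists j].
Qed.

(** Approximate Radon-Nikodym theorem: minimize
    [rho (|b| ^ 2) - 2 Re (nu (conj b))]. *)
Lemma density (Q : fct -> Prop) (nu : {scalar fct}) (c2 dl : R) : 0 < dl -> 0 <= c2 ->
  Q 0 -> (forall f, Q f -> bdd f) -> (forall a f g, Q f -> Q g -> Q (f + a *: g)) ->
  (forall f, Q f -> Q (fconj f)) ->
  (forall g, bdd g -> nr (nu g) ^+ 2 <= c2 * energy rho g) ->
  exists b, Q b /\ forall g, Q g -> nr (rho (fmul g b) - nu g) ^+ 2 <= dl * energy rho g.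
Proof.
move=> dl0 c20 Q0 Qb QD QJ nuc.
pose F (b : {b | Q b}) := energy rho (sval b) - 2 * complex.Re (nu (fconj (sval b))).
have Elow b : Q b -> - c2 <= energy rho b - 2 * complex.Re (nu (fconj b)).
  move=> /Qb bb; have E0 := energy_ge0 bb.
  have EJ : energy rho (fconj b) = energy rho b.
    rewrite /energy; congr (complex.Re (rho _)); apply/funext => z.
    by rewrite /fmul /fconj conjcK mulrC.
  have := nuc _ (bddJ bb); rewrite EJ => h.
  have := Re_le_nr (nu (fconj b)); have := nr_ge0 (nu (fconj b)).
  move: (nr _) (complex.Re _) h => n r h n0 rn.
  have : (2 * n) ^+ 2 <= (c2 + energy rho b) ^+ 2.
    rewrite exprMn; have := sqr_ge0 (c2 - energy rho b); nra.
  rewrite ler_pXn2r ?nnegrE ?mulr_ge0 ?addr_ge0 //; lra.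
have [[b Qbb] hb] := @near_min _ F (exist _ 0 Q0) (- c2) dl dl0 (fun b => Elow _ (svalP b)).
exists b; split => // g Qg.
have bb := Qb _ Qbb; have bg := Qb _ Qg.
have [u [u1 ue]] := nr_phase (rho (fmul g b) - nu g).
apply: quad_bound; rewrite ?nr_ge0 ?energy_ge0 ?(ltW dl0) // => s s0.
pose t : C := - (s%:C * (u^*)%C).
have := hb (exist _ (b + t *: fconj g) (QD t _ _ Qbb (QJ _ Qg))); rewrite /F /=.
rewrite energyD //; last by apply/bddZ/bddJ.
rewrite energyZ /t nrN nrM nr_conj u1 nrC ger0_norm // mulr1.
have -> : energy rho (fconj g) = energy rho g.
  rewrite /energy; congr (complex.Re (rho _)); apply/funext => z.
  by rewrite /fmul /fconj conjcK mulrC.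
have -> : fconj (b + - (s%:C * (u^*)%C) *: fconj g) = fconj b + (- (s%:C * u)) *: g.
  apply/funext => z; rewrite /fconj /= [(b + _) z](_ : _ = b z + - (s%:C * (u^*)%C) * (g z)^*%C) //.
  rewrite [RHS](_ : _ = (b z)^*%C + - (s%:C * u) * g z) // rmorphD rmorphM rmorphN rmorphM /= !conjcK.
  by congr (_ + - (_ * _) * _); exact: conjc_real.
have -> : fmul (- (s%:C * (u^*)%C) *: fconj g) (fconj b) = (- (s%:C * (u^*)%C)) *: fconj (fmul g b).
  apply/funext => z; rewrite /fmul /fconj /= [X in X * _](_ : _ = - (s%:C * (u^*)%C) * (g z)^*%C) //.
  by rewrite -mulrA -rmorphM.
rewrite fscalarD fscalarZ fscalarZ rho_conj; last exact: bddM.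
have e1 : complex.Re (- (s%:C * (u^*)%C) * (rho (fmul g b))^*%C) = - (s * complex.Re (u * rho (fmul g b))).
  by rewrite mulNr ReN -(mulrA s%:C) ReZ -rmorphM Re_conjc.
rewrite e1 ReD mulNr -(mulrA s%:C) ReN ReZ.
have : complex.Re (u * (rho (fmul g b) - nu g)) = nr (rho (fmul g b) - nu g) by rewrite ue.
rewrite mulrBr ReD ReN => <-; lra.
Qed.

End PositiveFunctional.
End BoundedFunctions.

(** * Functionals on the sphere *)

Section Sphere.
Variables (R : realType) (d : nat).
Hypothesis d_gt0 : (0 < d)%N.
Local Notation C := R[i].
Local Notation mpol := (mpoly.mpoly d C).
Definition sphere := {z : 'I_d -> C | on_sphere z}.
Local Notation fct := (sphere -> C^o).
Implicit Types (p q : mpol) (f g h b : fct).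

Definition pev p : fct := fun z => meval (sval z) p.

Lemma pevP a p q : pev (a *: p + q) = a *: pev p + pev q.
Proof. by apply/funext => z; rewrite /pev mevalD mevalZ. Qed.

Lemma pevD p q : pev (p + q) = pev p + pev q.
Proof. by apply/funext => z; rewrite /pev mevalD. Qed.

Lemma pevM p q : pev (p * q) = fmul (pev p) (pev q).
Proof. by apply/funext => z; rewrite /pev mevalM. Qed.

Lemma sbound_bfun p c : sbound p c <-> bfun (pev p) c.
Proof. by split=> [h [z zs]|h z zs]; [exact: h|exact: (h (exist _ z zs))]. Qed.

Lemma sphere_coord (z : sphere) i : nr (sval z i) <= 1.
Proof.
case: z => z zs /=; rewrite -(@ler_pXn2r _ 2) ?nnegrE ?nr_ge0 // expr1n -zs /nrm2.
by rewrite (bigD1 i) //= lerDl; apply: sumr_ge0 => j _; rewrite sqr_ge0.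
Qed.

Lemma bdd_pev p : bdd (pev p).
Proof.
elim/mpoly_lin_ind: p => [m|a p q hp hq]; last by rewrite pevP; apply: bddD => //; apply: bddZ.
exists 1 => z; rewrite /pev mevalX.
elim/big_ind: _ => [|x y hx hy|i _]; first by rewrite nr1.
  by rewrite nrM -[1]mulr1 ler_pM ?nr_ge0.
by rewrite nrX exprn_ile1 ?nr_ge0 // sphere_coord.
Qed.

(** Multiplication by [h] maps high order polynomials to functions that are
    uniformly close to high order polynomials. *)
Definition approx_mult h := bdd h /\ forall eps : R, 0 < eps ->
  exists k N, forall n p c, (N <= n)%N -> ord_ge n p -> sbound p c ->
    exists p', ord_ge (n - k) p' /\ bfun (fmul h (pev p) - pev p') (eps * c).

Lemma sbound_ge0 p c : sbound p c -> 0 <= c.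
Proof. by move=> h; have [e he] := @sphere_point R d d_gt0; apply: le_trans (nr_ge0 _) (h _ he). Qed.

Lemma approx_mult_pev q : approx_mult (pev q).
Proof.
split; first exact: bdd_pev.
move=> eps e0; exists 0%N, 0%N => n p c _ op pc; exists (q * p); split.
  by rewrite subn0 mulrC; exact: ord_geM.
rewrite pevM subrr => z; rewrite nr0 mulr_ge0 ?(ltW e0) //; exact: sbound_ge0 pc.
Qed.

Lemma approx_multP a h1 h2 : approx_mult h1 -> approx_mult h2 -> approx_mult (h1 + a *: h2).
Proof.
move=> [b1 A1] [b2 A2]; split; first by apply: bddD => //; exact: bddZ.
move=> eps e0; have a1 : 0 < nr a + 1 by have := nr_ge0 a; lra.
have [k1 [N1 {}A1]] := A1 (eps / 2) ltac:(by rewrite divr_gt0).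
have [k2 [N2 {}A2]] := A2 (eps / 2 / (nr a + 1)) ltac:(by rewrite !divr_gt0).
exists (k1 + k2)%N, (N1 + N2)%N => n p c nN op pc; have c0 := sbound_ge0 pc.
have [p1 [ho1 e1]] := A1 n p c ltac:(lia) op pc.
have [p2 [ho2 e2]] := A2 n p c ltac:(lia) op pc.
exists (p1 + a *: p2); split.
  by apply: ord_geD; [apply: ord_geW ho1|apply: ord_geZ; apply: ord_geW ho2]; lia.
have -> : fmul (h1 + a *: h2) (pev p) - pev (p1 + a *: p2) =
   (fmul h1 (pev p) - pev p1) + a *: (fmul h2 (pev p) - pev p2).
  apply/funext => z; change ((h1 z + a * h2 z) * pev p z - pev (p1 + a *: p2) z =
    (h1 z * pev p z - pev p1 z) + a * (h2 z * pev p z - pev p2 z) :> C).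
  by rewrite /pev mevalD mevalZ; ring.
apply: bfunW (bfunD e1 (bfunZ a e2)).
have -> : eps / 2 * c + nr a * (eps / 2 / (nr a + 1) * c) = eps * c * (1 / 2 + nr a / (nr a + 1) / 2).
  by field; rewrite gt_eqF.
rewrite ler_piMr ?mulr_ge0 ?(ltW e0) //.
have : nr a / (nr a + 1) <= 1 by rewrite ler_pdivrMr // mul1r; lra.
lra.
Qed.

Lemma approx_multM h1 h2 : approx_mult h1 -> approx_mult h2 -> approx_mult (fmul h1 h2).
Proof.
move=> [b1 A1] [b2 A2]; split; first exact: bddM.
have [H1 [H10 hH1]] := bdd_ge0 b1; have [H2 [H20 hH2]] := bdd_ge0 b2.
move=> eps e0.
pose e1 := eps / 2 / (H2 + 1); pose e2 := Num.min 1 (eps / 2 / (H1 + 1)).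
have e1p : 0 < e1 by rewrite !divr_gt0 //; lra.
have e2p : 0 < e2 by rewrite lt_min ltr01 !divr_gt0 //; lra.
have e21 : e2 <= 1 by rewrite ge_min lexx.
have e2e : e2 <= eps / 2 / (H1 + 1) by rewrite ge_min lexx orbT.
have [k2 [N2 {}A2]] := A2 _ e2p.
have [k1 [N1 {}A1]] := A1 _ e1p.
exists (k1 + k2)%N, (N1 + N2 + k2)%N => n p c nN op pc; have c0 := sbound_ge0 pc.
have [p2 [ho2 E2]] := A2 n p c ltac:(lia) op pc.
have pc2 : sbound p2 ((H2 + 1) * c).
  apply/sbound_bfun; have -> : pev p2 = fmul h2 (pev p) - (fmul h2 (pev p) - pev p2) by rewrite opprB addrC subrK.
  move=> z; apply: le_trans (nrB (fmul h2 (pev p) z) ((fmul h2 (pev p) - pev p2) z)) _.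
  rewrite mulrDl lerD //; first exact: (bfunM hH2 ((sbound_bfun p c).1 pc) z).
  by apply: le_trans (E2 z) _; rewrite ler_wpM2r.
have [p1 [ho1 E1]] := A1 (n - k2)%N p2 _ ltac:(lia) ho2 pc2.
exists p1; split; first by apply: ord_geW ho1; lia.
have -> : fmul (fmul h1 h2) (pev p) - pev p1 =
   fmul h1 (fmul h2 (pev p) - pev p2) + (fmul h1 (pev p2) - pev p1).
  apply/funext => z; change (h1 z * h2 z * pev p z - pev p1 z =
    h1 z * (h2 z * pev p z - pev p2 z) + (h1 z * pev p2 z - pev p1 z) :> C).
  by ring.
apply: bfunW (bfunD (bfunM hH1 E2) E1).
have -> : e1 * ((H2 + 1) * c) = eps / 2 * c by rewrite /e1; field; lra.
have : H1 * (e2 * c) <= (H1 + 1) * (eps / 2 / (H1 + 1)) * c.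
  by rewrite mulrA ler_wpM2r // ler_pM // ?(ltW e2p) //; lra.
have -> : (H1 + 1) * (eps / 2 / (H1 + 1)) * c = eps / 2 * c by field; lra.
lra.
Qed.

Lemma approx_mult_lim h : bdd h ->
  (forall eps, 0 < eps -> exists h', approx_mult h' /\ bfun (h - h') eps) -> approx_mult h.
Proof.
move=> bh A; split => // eps e0.
have e2 : 0 < eps / 2 by rewrite divr_gt0.
have [h' [[_ A'] hh]] := A _ e2; have [k [N {}A']] := A' _ e2.
exists k, N => n p c nN op pc; have [p' [ho' E]] := A' n p c nN op pc.
exists p'; split => //.
have -> : fmul h (pev p) - pev p' = fmul (h - h') (pev p) + (fmul h' (pev p) - pev p').
  apply/funext => z; change (h z * pev p z - pev p' z =
    (h z - h' z) * pev p z + (h' z * pev p z - pev p' z) :> C).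
  by ring.
apply: bfunW (bfunD (bfunM hh ((sbound_bfun p c).1 pc)) E).
by rewrite -mulrDl -splitr.
Qed.

Lemma approx_mult_coordJ i : approx_mult (fconj (pev (mpolyX C (mnm1 i)))).
Proof.
split; first exact/bddJ/bdd_pev.
move=> eps e0; have [N hN] := coordJ_approx d_gt0 i e0.
exists 1%N, N => n p c nN op pc; exists (coordJ i p); split.
  by rewrite subn1; exact: ord_ge_coordJ.
move=> [z zs]; have := hN p c z (ord_geW nN op) pc zs.
by rewrite -[X in (X^*)%C](@mevalXU d C z i).
Qed.

(** The self-adjoint algebra of functions used in place of all continuous
    functions on the sphere. *)
Definition star_mult h := approx_mult h /\ approx_mult (fconj h).

Lemma fconjK f : fconj (fconj f) = f.
Proof. by apply/funext => z; rewrite /fconj conjcK. Qed.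

Lemma fconjP a f g : fconj (f + a *: g) = fconj f + (a^*)%C *: fconj g.
Proof.
apply/funext => z; change ((f z + a * g z)^*%C = (f z)^*%C + (a^*)%C * (g z)^*%C :> C).
by rewrite rmorphD rmorphM.
Qed.

Lemma fconjM f g : fconj (fmul f g) = fmul (fconj f) (fconj g).
Proof. by apply/funext => z; rewrite /fconj /fmul rmorphM. Qed.

Lemma star_multJ h : star_mult h -> star_mult (fconj h).
Proof. by move=> [h1 h2]; split => //; rewrite fconjK. Qed.

Lemma star_multP a h1 h2 : star_mult h1 -> star_mult h2 -> star_mult (h1 + a *: h2).
Proof.
by move=> [? ?] [? ?]; split; [|rewrite fconjP]; apply: approx_multP.
Qed.

Lemma star_multM h1 h2 : star_mult h1 -> star_mult h2 -> star_mult (fmul h1 h2).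
Proof.
by move=> [? ?] [? ?]; split; [|rewrite fconjM]; apply: approx_multM.
Qed.

Lemma pev0 : pev 0 = 0.
Proof. by apply/funext => z; rewrite /pev meval0. Qed.

Lemma star_mult0 : star_mult 0.
Proof.
rewrite -pev0; split; first exact: approx_mult_pev.
have -> : fconj (pev 0) = pev 0 by apply/funext => z; rewrite pev0 /fconj conjc0.
exact: approx_mult_pev.
Qed.

Lemma star_multZ a h : star_mult h -> star_mult (a *: h).
Proof. by move=> hh; rewrite -[_ *: _]add0r; apply: star_multP => //; exact: star_mult0. Qed.

Lemma star_multD h1 h2 : star_mult h1 -> star_mult h2 -> star_mult (h1 + h2).
Proof. by move=> h1s h2s; rewrite -[h2]scale1r; apply: star_multP. Qed.

Lemma star_mult_bdd h : star_mult h -> bdd h. Proof. by case=> [[]]. Qed.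

Lemma star_mult_pev q : star_mult (pev q).
Proof.
split; first exact: approx_mult_pev.
elim/mpoly_lin_ind: q => [m|a p q hp hq]; last first.
  by rewrite pevP addrC fconjP; apply: approx_multP.
have h1 : approx_mult (fconj (pev 1)).
  have -> : fconj (pev 1) = pev 1 by apply/funext => z; rewrite /fconj /pev meval1 conjc1.
  exact: approx_mult_pev.
rewrite mpolyXE_id.
apply: (big_ind (fun p => approx_mult (fconj (pev p)))) => [//|p q hp hq|i _].
  by rewrite pevM fconjM; exact: approx_multM.
elim: (m i) => [|n IH]; first by rewrite expr0; exact: h1.
by rewrite exprS pevM fconjM; apply: approx_multM; [exact: approx_mult_coordJ|exact: IH].
Qed.

Lemma star_mult_lim h : bdd h ->
  (forall eps, 0 < eps -> exists h', star_mult h' /\ bfun (h - h') eps) -> star_mult h.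
Proof.
move=> bh A; split.
  apply: (approx_mult_lim bh) => eps e0.
  by have [h' [[s _] hh]] := A _ e0; exists h'.
apply: (approx_mult_lim (bddJ bh)) => eps e0.
have [h' [[_ s] hh]] := A _ e0; exists (fconj h'); split => // z.
have -> : (fconj h - fconj h') z = ((h - h') z)^*%C by rewrite [RHS](rmorphB (@conjc R)).
by rewrite nr_conj.
Qed.

(** * The band property *)

Section Band.
Variables (w : multinom d -> R) (w_gt0 : forall m, 0 < w m).
Variables (V : normedModType C) (iota : {linear mpol -> V}).
Hypothesis iota_norm : forall p, nr (iota p) ^+ 2 = sqn w p.
Hypothesis mon_bounded : forall m, exists c, mbound iota (mpolyX C m) c.
Hypothesis mbound_sbound : forall p c, mbound iota p c -> sbound p c.

(** The product of [h] with a polynomial of high order is, up to a small error, a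
    polynomial, and polynomials are nearly annihilated by [lam]. *)
Lemma annihilator_tail (lam : {scalar fct}) (l dl H eta : R) h :
  fbound lam l -> 0 <= dl ->
  (forall p c, sbound p c -> nr (lam (pev p)) <= dl * c) ->
  approx_mult h -> bfun h H -> 0 < eta ->
  tail iota (fun p => lam (fmul h (pev p))) (dl * (H + 1) + eta).
Proof.
move=> [l0 lb] dl0 ld [_ A] hH eta0.
pose eps := Num.min 1 (eta / (l + 1)).
have l1 : 0 < l + 1 by lra.
have e0 : 0 < eps by rewrite lt_min ltr01 divr_gt0.
have e1 : eps <= 1 by rewrite ge_min lexx.
have ee : eps <= eta / (l + 1) by rewrite ge_min lexx orbT.
have [k [N {}A]] := A _ e0; exists N => p c op /mbound_sbound pc.
have c0 := sbound_ge0 pc.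
have [p' [_ E]] := A N p c (leqnn N) op pc.
have -> : fmul h (pev p) = pev p' + (fmul h (pev p) - pev p') by rewrite addrC subrK.
rewrite fscalarD (le_trans (nrD _ _)) // mulrDl lerD //.
  rewrite -mulrA ld //; apply/sbound_bfun => z.
  have -> : pev p' z = fmul h (pev p) z - (fmul h (pev p) - pev p') z.
    by rewrite [in RHS](_ : (fmul h (pev p) - pev p') z = fmul h (pev p) z - pev p' z) // opprB addrC subrK.
  apply: le_trans (nrB _ _) _; rewrite mulrDl lerD //.
    exact: (bfunM hH ((sbound_bfun p c).1 pc) z).
  by apply: le_trans (E z) _; rewrite ler_wpM2r.
apply: le_trans (lb _ _ E) _; rewrite mulrA ler_wpM2r //.
apply: le_trans (ler_wpM2l l0 ee) _.
by rewrite mulrCA ler_piMr ?(ltW eta0) // ler_pdivrMr // mul1r; lra.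
Qed.

(** The powers of [1 - x] decrease, and [x] times their sum telescopes. *)
Lemma cutoff_bound (x : R) n : 0 <= x -> x <= 1 -> x * (1 - x) ^+ n <= n.+1%:R^-1.
Proof.
move=> x0 x1; have y0 : 0 <= 1 - x by rewrite subr_ge0.
rewrite -[leRHS]mul1r ler_pdivlMr ?ltr0n //.
have : x * \sum_(i < n.+1) (1 - x) ^+ i <= 1.
  have -> : x * \sum_(i < n.+1) (1 - x) ^+ i = 1 - (1 - x) ^+ n.+1.
    by rewrite -[RHS]opprB subrX1; ring.
  by rewrite gerBl exprn_ge0.
apply: le_trans; rewrite -mulrA ler_wpM2l //.
have -> : (1 - x) ^+ n * n.+1%:R = \sum_(i < n.+1) (1 - x) ^+ n.
  by rewrite sumr_const card_ord mulr_natr.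
apply: ler_sum => i _; rewrite -[X in _ ^+ X <= _](subnK (leq_ord i)) exprD.
by rewrite ler_piMl ?exprn_ge0 // exprn_ile1 // gerBl.
Qed.

Definition fmulS (lam : fct -> C) f : fct -> C := fun k => lam (fmul f k).

Lemma fmulS_scalar (lam : {scalar fct}) f : scalar (fmulS lam f).
Proof.
move=> a k k'; rewrite /fmulS -fscalarZ -fscalarD; congr (lam _); apply/funext => z.
change (f z * (a * k z + k' z) = a * (f z * k z) + f z * k' z :> C); ring.
Qed.

HB.instance Definition _ (lam : {scalar fct}) f :=
  GRing.isLinear.Build C fct C^o *%R (fmulS lam f) (fmulS_scalar lam f).

Lemma fmulS_bound (lam : {scalar fct}) f l F : fbound lam l -> bfun f F -> 0 <= F ->
  fbound (fmulS lam f) (l * F).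
Proof.
move=> [l0 lb] hf F0; split; first exact: mulr_ge0.
by move=> h H hH; rewrite -mulrA; apply: lb; exact: bfunM.
Qed.

Lemma energy_le (rho : {scalar fct}) c1 f g : positive_bound rho c1 -> bdd g ->
  (forall z, nr (f z) <= nr (g z)) -> energy rho f <= energy rho g.
Proof.
move=> [c0 hp] bg fg; have bf : bdd f.
  by have [G hG] := bg; exists G => z; apply: le_trans (fg z) (hG z).
rewrite -subr_le0 /energy -ReN -ReD -fscalarB -(mulr0 c1); apply: hp.
  apply: bddD; first by apply/bddM => //; exact: bddJ.
  by rewrite -scaleN1r; apply/bddZ/bddM => //; exact: bddJ.
move=> z; change (complex.Re (f z * (f z)^*%C - g z * (g z)^*%C) <= 0).
by rewrite !mulcJ -rmorphB /= subr_le0 lerXn2r ?nnegrE ?nr_ge0.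
Qed.

Fixpoint fpow (v : fct) n : fct := if n is n'.+1 then fmul v (fpow v n') else pev 1.

Lemma fpowE v n z : fpow v n z = v z ^+ n.
Proof. by elim: n => [|n IH]; rewrite /= ?/pev ?meval1 ?expr0 // /fmul IH exprS. Qed.

Lemma star_mult_pow v n : star_mult v -> star_mult (fpow v n).
Proof. by move=> hv; elim: n => [|n IH] /=; [exact: star_mult_pev|exact: star_multM]. Qed.

Lemma star_mult_sum n (F : nat -> fct) : (forall i, star_mult (F i)) ->
  star_mult (\sum_(i < n) F i).
Proof.
move=> h; elim: n => [|n IH]; first by rewrite big_ord0; exact: star_mult0.
by rewrite big_ord_recr; apply: star_multD.
Qed.

(** The quotient of [e] by its conjugate has modulus one but need not be continuous
    where [e] vanishes; there [b * e] is small, so that a regularised quotient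
    suffices. This transfers orthogonality relations, which involve the conjugate of
    an error term, to the error term itself. *)
Lemma conj_swap b e (B eps : R) : star_mult b -> star_mult e -> bfun b B -> 0 <= B ->
  0 < eps -> exists g, [/\ star_mult g, bfun g B &
    bfun (fmul b e - fmul g (fconj e)) eps].
Proof.
move=> sb se hB B0 eps0; have [E [E0 hE]] := bdd_ge0 (star_mult_bdd se).
pose s := E ^+ 2 + 1; have s0 : 0 < s by rewrite ltr_wpDl ?sqr_ge0.
have [n hn] := nat_gt (B ^+ 2 * s / eps ^+ 2).
pose x z : R := nr (e z) ^+ 2 / s.
have x0 z : 0 <= x z by rewrite divr_ge0 ?sqr_ge0 // ltW.
have x1 z : x z <= 1.
  rewrite ler_pdivrMr // mul1r /s (le_trans (_ : _ <= E ^+ 2)) ?lerDl //.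
  by rewrite lerXn2r ?nnegrE ?nr_ge0.
have y0 z : 0 <= 1 - x z by rewrite subr_ge0.
pose v : fct := pev 1 + (- s^-1%:C) *: fmul e (fconj e).
have vE z : v z = (1 - x z)%:C.
  change (meval (sval z) 1 + (- s^-1%:C) * (e z * (e z)^*%C) = (1 - x z)%:C :> C).
  by rewrite meval1 mulcJ mulNr -rmorphM mulrC rmorphB rmorph1.
have sv : star_mult v by apply: star_multP; [exact: star_mult_pev|apply: star_multM => //; exact: star_multJ].
pose S : fct := \sum_(i < n) fpow v i.
have SE z : S z = (\sum_(i < n) (1 - x z) ^+ i)%:C.
  rewrite /S rmorph_sum fct_sumE; apply: eq_bigr => i _.
  by rewrite fpowE vE rmorphXn.
have xS z : x z * (\sum_(i < n) (1 - x z) ^+ i) = 1 - (1 - x z) ^+ n.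
  by rewrite -[RHS]opprB subrX1; ring.
pose g : fct := s^-1%:C *: fmul b (fmul (fmul e e) S).
have gE z : g z = s^-1%:C * (b z * (e z * e z * (\sum_(i < n) (1 - x z) ^+ i)%:C)) by rewrite -SE.
exists g; split.
- apply/star_multZ/star_multM => //; apply: star_multM; first exact: star_multM.
  by apply: star_mult_sum => i; exact: star_mult_pow.
- move=> z; rewrite gE !nrM !nrC ger0_norm ?invr_ge0 ?(ltW s0) // ger0_norm; last first.
    by apply: sumr_ge0 => i _; rewrite exprn_ge0.
  rewrite (_ : _ * _ = nr (b z) * (x z * (\sum_(i < n) (1 - x z) ^+ i))); last first.
    by rewrite /x expr2; ring.
  rewrite xS; apply: le_trans (hB z); rewrite ler_piMr ?nr_ge0 //.
  by rewrite gerBl exprn_ge0.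
- move=> z.
  have -> : (fmul b e - fmul g (fconj e)) z = b z * e z * ((1 - x z) ^+ n)%:C.
    change (b z * e z - g z * (e z)^*%C = b z * e z * ((1 - x z) ^+ n)%:C :> C).
    rewrite gE (_ : _ * (e z)^*%C = b z * e z * (s^-1%:C * (e z * (e z)^*%C) * (\sum_(i < n) (1 - x z) ^+ i)%:C)); last by ring.
    rewrite mulcJ -!rmorphM (_ : s^-1 * nr (e z) ^+ 2 = x z); last by rewrite mulrC.
    rewrite xS rmorphB rmorph1; ring.
  have lhs0 : 0 <= nr (b z) * nr (e z) * (1 - x z) ^+ n by rewrite !mulr_ge0 ?nr_ge0 ?exprn_ge0.
  rewrite !nrM nrC ger0_norm ?exprn_ge0 // -(@ler_pXn2r _ 2) ?nnegrE ?(ltW eps0) //.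
  rewrite !exprMn; have hx : nr (e z) ^+ 2 = s * x z by rewrite /x mulrCA divff ?mulr1 // gt_eqF.
  have c := cutoff_bound n (x0 z) (x1 z).
  have p1 : (1 - x z) ^+ n ^+ 2 <= (1 - x z) ^+ n.
    by rewrite expr2 ler_piMr ?exprn_ge0 // exprn_ile1 // gerBl.
  have p2 : x z * (1 - x z) ^+ n ^+ 2 <= n.+1%:R^-1 by apply: le_trans c; rewrite ler_wpM2l.
  have b2 : nr (b z) ^+ 2 <= B ^+ 2 by rewrite lerXn2r ?nnegrE ?nr_ge0.
  rewrite hx (_ : _ * _ = nr (b z) ^+ 2 * s * (x z * (1 - x z) ^+ n ^+ 2)); last by ring.
  apply: le_trans (_ : B ^+ 2 * s * n.+1%:R^-1 <= _).
    apply: ler_pM => //.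
    - by apply: mulr_ge0; [exact: sqr_ge0|exact: ltW].
    - by apply: mulr_ge0; rewrite ?exprn_ge0.
    - by rewrite ler_wpM2r // ltW.
  rewrite ler_pdivrMr ?ltr0n // (mulrC (eps ^+ 2)) -ler_pdivrMr ?exprn_gt0 //.
  by rewrite (le_trans (ltW hn)) // ler_nat.
Qed.

(** The functionals that are small on high order polynomials form a module over
    the self-adjoint algebra. Approximate [h] by polynomials in the energy
    norm: the error [e] is nearly orthogonal to polynomials, so that [conj e * rho]
    is nearly an annihilating functional, and [e * nu] is absolutely continuous
    with respect to it. *)
Lemma band (rho nu : {scalar fct}) (c1 c2 : R) h : positive_bound rho c1 -> 0 <= c2 ->
  (forall g, bdd g -> nr (nu g) ^+ 2 <= c2 * energy rho g) ->
  tail_small iota (fun p => nu (pev p)) -> star_mult h ->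
  tail_small iota (fun p => nu (fmul h (pev p))).
Proof.
move=> rp c20 nuc nts sh eta eta0.
have [c10 _] := rp; have e8 : 0 < eta / 8 by rewrite divr_gt0.
have e82 : 0 < (eta / 8) ^+ 2 by rewrite exprn_gt0.
have bh := star_mult_bdd sh.
pose M0 := energy rho h + 1.
have M00 : 0 < M0 by rewrite ltr_wpDl // (energy_ge0 rp).
have z1 : sphere by have /cid[e he] := @sphere_point R d d_gt0; exists e.
have [b [sb hb]] := @density R sphere rho c1 rp (@star_mult) nu c2 ((eta / 8) ^+ 2 / M0)
  (divr_gt0 e82 M00) c20 star_mult0 star_mult_bdd (fun a f g hf hg => star_multP a hf hg) star_multJ nuc.
have [B [B0 hB]] := bdd_ge0 (star_mult_bdd sb).
pose dl := Num.min 1 ((eta / 8) ^+ 2 / (4 * c1 * B ^+ 2 + 1)).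
have den0 : 0 < 4 * c1 * B ^+ 2 + 1 by rewrite ltr_wpDl // !mulr_ge0 // sqr_ge0.
have dl0 : 0 < dl by rewrite lt_min ltr01 divr_gt0.
have dl1 : dl <= 1 by rewrite ge_min lexx.
have dle : dl <= (eta / 8) ^+ 2 / (4 * c1 * B ^+ 2 + 1) by rewrite ge_min lexx orbT.
have be p : bdd (h - pev p) by rewrite -scaleN1r; apply: bddD => //; apply/bddZ/bdd_pev.
have [q hq] := @near_min R mpol (fun p => energy rho (h - pev p)) 0 0 dl dl0
   (fun p => energy_ge0 rp (be p)).
set e := h - pev q in hq.
have se : star_mult e by rewrite /e -scaleN1r; apply: star_multP => //; exact: star_mult_pev.
have eps0 : 0 < eta / 8 / (c1 + 1) by rewrite divr_gt0 //; lra.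
have [g [sg gB gE]] := conj_swap sb se hB B0 eps0.
pose del := eta / 8 / (B + 1); have del0 : 0 < del by rewrite divr_gt0 //; lra.
pose dl' := Num.min dl (del ^+ 2 / (c1 + 1)).
have c11 : 0 < c1 + 1 by lra.
have dl'0 : 0 < dl' by rewrite lt_min dl0 divr_gt0 // exprn_gt0.
have [q' hq'] := @near_min R mpol (fun p => energy rho (h - pev p)) 0 0 dl' dl'0
   (fun p => energy_ge0 rp (be p)).
set e' := h - pev q' in hq'.
have orth p : nr (rho (fmul (pev p) (fconj e'))) ^+ 2 <= dl' * energy rho (pev p).
  apply: (near_min_orth rp) => //; [exact: ltW|exact: be|exact: bdd_pev|] => t.
  have -> : e' + t *: pev p = h - pev (q' - t *: p).
    apply/funext => z; change (h z - pev q' z + t * pev p z = h z - pev (q' - t *: p) z :> C).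
    by rewrite /pev mevalB mevalZ; ring.
  exact: hq'.
have ee' : energy rho (e + (-1) *: e') <= 4 * dl.
  have bee : bdd e := be q. have bee' : bdd e' := be q'.
  have par : energy rho (e + e') + energy rho (e + (-1) *: e') = 2 * energy rho e + 2 * energy rho e'.
    rewrite (energyD rp bee bee') (energyD rp bee (bddZ (-1) bee')) energyZ nrN nr1 expr1n mul1r.
    have -> : fmul ((-1) *: e') (fconj e) = (-1) *: fmul e' (fconj e).
      by apply/funext => z; exact: esym (mulrA (-1 : C) (e' z) _).
    by rewrite fscalarZ mulN1r ReN; ring.
  have mid : e + e' = 2 *: (h - pev (2^-1 *: (q + q'))).
    apply/funext => z; change (h z - pev q z + (h z - pev q' z) = 2 * (h z - pev (2^-1 *: (q + q')) z) :> C).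
    by rewrite /pev mevalZ mevalD; field.
  have := hq (2^-1 *: (q + q')); have := hq' (2^-1 *: (q + q')).
  have dd : dl' <= dl by rewrite ge_min lexx.
  move: par; rewrite mid energyZ nr_nat => par; move: par dd.
  move: (energy rho e) (energy rho e') (energy rho (h - _)) (energy rho (e + _)) => x1 x2 x3 x4; lra.
have [E' [E'0 hE']] := bdd_ge0 (be q').
have lamb := fmulS_bound (pos_fbound rp) (bfunJ hE') E'0.
have ann p c : sbound p c -> nr (fmulS rho (fconj e') (pev p)) <= del * c.
  move=> pc; have c0 := sbound_ge0 pc.
  rewrite -(@ler_pXn2r _ 2) ?nnegrE ?nr_ge0 ?(mulr_ge0 (ltW del0) c0) //.
  have -> : fmulS rho (fconj e') (pev p) = rho (fmul (pev p) (fconj e')).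
    by rewrite /fmulS; congr (rho _); apply/funext => z; rewrite /fmul mulrC.
  apply: le_trans (orth p) _; apply: le_trans (_ : dl' * (c1 * c ^+ 2) <= _).
    by rewrite ler_wpM2l ?(ltW dl'0) // (energy_bound rp) //; apply/sbound_bfun.
  rewrite exprMn mulrA ler_wpM2r ?sqr_ge0 //.
  apply: le_trans (_ : del ^+ 2 / (c1 + 1) * c1 <= _).
    by rewrite ler_wpM2r // ge_min lexx orbT.
  by rewrite mulrAC -mulrA ler_piMr ?sqr_ge0 // ler_pdivrMr // mul1r; lra.
have [N1 T5] := annihilator_tail lamb (ltW del0) ann sg.1 gB e8.
have [cq hcq] := mpoly_bounded mon_bounded q.
have cq0 := mbound_ge0 w_gt0 iota_norm hcq.
have eq0 : 0 < eta / 8 / (cq + 1) by rewrite divr_gt0 //; lra.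
have [N2 T1] := nts _ eq0.
exists (N1 + N2)%N => p c op pc; have ps := mbound_sbound pc; have c0 := sbound_ge0 ps.
have pB := (sbound_bfun p c).1 ps.
have {}T1 : nr (nu (pev (q * p))) <= eta / 8 * c.
  apply: le_trans (T1 _ (cq * c) _ (mboundM w_gt0 iota_norm hcq pc)) _.
    by rewrite mulrC; apply: ord_geM; apply: ord_geW op; rewrite leq_addl.
  rewrite mulrA ler_wpM2r // mulrAC -mulrA ler_piMr ?(ltW e8) //.
  by rewrite ler_pdivrMr ?mul1r; lra.
have {}T5 := T5 p c (ord_geW (leq_addr _ _) op) pc.
have Ee : energy rho e <= M0.
  apply: le_trans (hq 0) _; rewrite /M0 pev0 subr0 lerD2l; exact: dl1.
have bdp := bdd_pev p.
have T2 : nr (rho (fmul (fmul e (pev p)) b) - nu (fmul e (pev p))) <= eta / 8 * c.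
  rewrite -(@ler_pXn2r _ 2) ?nnegrE ?nr_ge0 ?(mulr_ge0 (ltW e8) c0) //.
  apply: le_trans (hb _ (star_multM se (star_mult_pev p))) _.
  have : energy rho (fmul e (pev p)) <= c ^+ 2 * M0.
    apply: le_trans (_ : energy rho (c%:C *: e) <= _).
      apply: (energy_le rp) => [|z]; first exact/bddZ/be.
      rewrite [leRHS](nrM c%:C (e z)) nrC ger0_norm // [leLHS](nrM (e z)) mulrC.
      by rewrite ler_wpM2r ?nr_ge0.
    by rewrite energyZ nrC ger0_norm // ler_wpM2l ?sqr_ge0.
  move=> /(ler_wpM2l (ltW (divr_gt0 e82 M00))) /le_trans; apply.
  by rewrite exprMn le_eqVlt; apply/orP; left; apply/eqP; field; rewrite gt_eqF.
have T3 : nr (rho (fmul (fmul b e - fmul g (fconj e)) (pev p))) <= eta / 8 * c.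
  apply: le_trans ((pos_fbound rp).2 _ _ (bfunM gE pB)) _.
  rewrite mulrA ler_wpM2r // mulrCA ler_piMr ?(ltW e8) // ler_pdivrMr // mul1r; lra.
have bgp : bfun (fmul g (pev p)) (B * c) by exact: bfunM.
have T4 : nr (rho (fmul (fmul g (pev p)) (fconj (e + (-1) *: e')))) <= eta / 8 * c.
  rewrite -(@ler_pXn2r _ 2) ?nnegrE ?nr_ge0 ?(mulr_ge0 (ltW e8) c0) //.
  have bd : bdd (e + (-1) *: e') by apply: bddD (be q) (bddZ _ (be q')).
  apply: le_trans (rho_CS rp (bfun_bdd bgp) bd) _.
  apply: le_trans (_ : 4 * dl * (c1 * (B * c) ^+ 2) <= _).
    by apply: ler_pM; rewrite ?(energy_ge0 rp) ?(energy_bound rp) //; exact: bfun_bdd bgp.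
  rewrite exprMn (_ : 4 * dl * _ = dl * (4 * c1 * B ^+ 2) * c ^+ 2); last by ring.
  rewrite exprMn ler_wpM2r ?sqr_ge0 //.
  apply: le_trans (_ : (eta / 8) ^+ 2 / (4 * c1 * B ^+ 2 + 1) * (4 * c1 * B ^+ 2) <= _).
    by rewrite ler_wpM2r // !mulr_ge0 // sqr_ge0.
  by rewrite mulrAC -mulrA ler_piMr ?(ltW e82) // ler_pdivrMr // mul1r; lra.
have -> : nu (fmul h (pev p)) = nu (pev (q * p)) -
    (rho (fmul (fmul e (pev p)) b) - nu (fmul e (pev p))) +
    (rho (fmul (fmul b e - fmul g (fconj e)) (pev p)) +
     rho (fmul (fmul g (pev p)) (fconj (e + (-1) *: e'))) +
     fmulS rho (fconj e') (fmul g (pev p))).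
  have -> : nu (fmul h (pev p)) = nu (pev (q * p)) + nu (fmul e (pev p)).
    rewrite -fscalarD; congr (nu _); apply/funext => z.
    change (h z * pev p z = meval (sval z) (q * p) + (h z - pev q z) * pev p z :> C).
    by rewrite /pev mevalM; ring.
  have -> : rho (fmul (fmul e (pev p)) b) =
     rho (fmul (fmul b e - fmul g (fconj e)) (pev p)) +
     rho (fmul (fmul g (pev p)) (fconj (e + (-1) *: e'))) +
     fmulS rho (fconj e') (fmul g (pev p)).
    rewrite /fmulS -!fscalarD; congr (rho _); apply/funext => z.
    change (e z * pev p z * b z = (b z * e z - g z * (e z)^*%C) * pev p z +
      g z * pev p z * (e z + -1 * e' z)^*%C + (e' z)^*%C * (g z * pev p z) :> C).
    have -> : ((e z + -1 * e' z)^*)%C = (e z)^*%C - (e' z)^*%C by rewrite mulN1r rmorphB.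
    by ring.
  by ring.
apply: le_trans (nrD _ _) _; apply: le_trans (lerD (nrB _ _) (nrD _ _)) _.
apply: le_trans (lerD (lexx _) (lerD (nrD _ _) (lexx _))) _.
have dB : del * (B + 1) = eta / 8 by rewrite /del; field; lra.
move: T5; rewrite dB; move: (nr _) (nr _) (nr _) (nr _) (nr _) T1 T2 T3 T4 => x1 x2 x3 x4 x5 T1 T2 T3 T4 T5.
have : 0 <= eta * c by rewrite mulr_ge0 // ltW.
lra.
Qed.

End Band.

End Sphere.

(** * The Hardy space norm *)

Section Lattice.

Lemma bin_convolution n a b :
  (\sum_(j < n.+1) 'C(j, a) * 'C(n - j, b) = 'C(n.+1, (a + b).+1))%N.
Proof.
elim: n b => [|n IH] b.
  rewrite big_ord_recr big_ord0 /= subnn !bin0n.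
  by case: a => [|a]; case: b => [|b]; rewrite //= ?addn0 ?binS ?bin0n.
rewrite big_ord_recr /= subnn bin0n; case: b => [|b].
  rewrite muln1 binS addn0; congr (_ + _)%N.
  by rewrite -{2}(addn0 a) -(IH 0%N); apply: eq_bigr => j _; rewrite !bin0.
rewrite muln0 addn0 binS -(IH b.+1) (_ : (a + b.+1) = (a + b).+1)%N ?addnS // -(IH b).
rewrite -big_split /=; apply: eq_bigr => j _.
by rewrite subSn ?leq_ord // binS mulnDr.
Qed.

Lemma bin_rising_convolution n a b :
  (\sum_(j < n.+1) 'C(j + a, a) * 'C(n - j + b, b) = 'C(n + a + b + 1, a + b + 1))%N.
Proof.
elim: b n => [|b IHb] n.
  elim: n => [|n IH]; first by rewrite big_ord_recr big_ord0 /= !addn0 add0n !binn.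
  rewrite big_ord_recr /= subnn addn0 bin0 muln1.
  rewrite (_ : n.+1 + a + 0 + 1 = (n + a + 1).+1)%N; last by lia.
  rewrite (_ : a + 0 + 1 = a.+1)%N; last by lia.
  rewrite binS; congr (_ + _)%N; last by congr 'C(_, _); lia.
  rewrite (_ : 'C(n + a + 1, a.+1) = 'C(n + a + 0 + 1, a + 0 + 1))%N; last by congr 'C(_, _); lia.
  by rewrite -IH; apply: eq_bigr => j _; rewrite !bin0.
elim: n => [|n IH]; first by rewrite big_ord_recr big_ord0 /= subnn !add0n !binn.
rewrite (_ : n.+1 + a + b.+1 + 1 = (n + a + b.+1 + 1).+1)%N; last by lia.
rewrite (_ : a + b.+1 + 1 = (a + b + 1).+1)%N; last by lia.
rewrite binS -[in X in (_ = X + _)%N](_ : a + b.+1 + 1 = (a + b + 1).+1)%N; last by lia.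
rewrite -IH (_ : n + a + b.+1 + 1 = n.+1 + a + b + 1)%N; last by lia.
rewrite -(IHb n.+1) [LHS]big_ord_recr [X in (_ = _ + X)%N]big_ord_recr /= !subnn !add0n !binn addnA.
congr (_ + _)%N; rewrite -big_split /=; apply: eq_bigr => j _.
rewrite subSn ?leq_ord // -mulnDr; congr (_ * _)%N.
by rewrite addSnnS addnS binS; congr (_ + _)%N; congr 'C(_, _); lia.
Qed.

(** The lattice points of the dilated simplex: the lists of [D] natural numbers
    with sum [m]. *)
Fixpoint lattice D m : seq (seq nat) :=
  if D is D'.+1 then flatten [seq [seq j :: l | l <- lattice D' (m - j)%N] | j <- iota 0 m.+1]
  else if m is 0 then [:: [::]] else [::].

Lemma latticeS D m :
  lattice D.+1 m = flatten [seq [seq j :: l | l <- lattice D (m - j)%N] | j <- iota 0 m.+1].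
Proof. by []. Qed.

Lemma lattice_size D m k : k \in lattice D m -> size k = D /\ sumn k = m.
Proof.
elim: D m k => [|D IH] m k; first by case: m => //=; rewrite inE => /eqP ->.
rewrite latticeS => /flattenP[s /mapP[j jm ->] /mapP[l lj ->]] /=.
have [-> ->] := IH _ _ lj; split => //.
by move: jm; rewrite mem_iota => /andP[_ h]; lia.
Qed.

Lemma lattice_sum (A : Type) (idx : A) (op : Monoid.law idx) D m (F : seq nat -> A) :
  \big[op/idx]_(k <- lattice D.+1 m) F k =
  \big[op/idx]_(j < m.+1) \big[op/idx]_(l <- lattice D (m - j)%N) F (val j :: l).
Proof.
rewrite latticeS big_flatten big_map -{1}[m.+1]subn0 -/(index_iota 0 m.+1) big_mkord.
by apply: eq_bigr => j _; rewrite big_map.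
Qed.

Lemma lattice1_sum (A : Type) (idx : A) (op : Monoid.law idx) m (F : seq nat -> A) :
  \big[op/idx]_(k <- lattice 1 m) F k = F [:: m].
Proof.
rewrite lattice_sum big_ord_recr /= subnn big_seq1 big1 ?Monoid.mul1m // => j _.
by rewrite (_ : m - j = (m - j).-1.+1)%N ?big_nil //; have := ltn_ord j; lia.
Qed.

Definition lterm (f : nat -> nat -> nat) (al : nat -> nat) D (k : seq nat) : nat :=
  (\prod_(i < D) f (nth 0 k i) (al i))%N.

Lemma lterm_cons f al D j l :
  lterm f al D.+1 (j :: l) = (f j (al 0) * lterm f (fun i => al i.+1) D l)%N.
Proof. by rewrite /lterm big_ord_recl. Qed.

Lemma lattice_bin D m al :
  (\sum_(k <- lattice D.+1 m) lterm (fun j a => 'C(j, a)) al D.+1 k =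
   'C(m + D, \sum_(i < D.+1) al i + D))%N.
Proof.
elim: D m al => [|D IH] m al.
  rewrite lattice1_sum lterm_cons /lterm big_ord0 muln1 big_ord_recr big_ord0 /=.
  by rewrite !addn0 add0n.
rewrite lattice_sum.
under eq_bigr => j _ do (under eq_bigr do rewrite lterm_cons; rewrite -big_distrr /= IH).
rewrite [in RHS]big_ord_recl /= (_ : \sum_(i < D.+1) al (bump 0 i) = \sum_(i < D.+1) al i.+1)%N //.
set B := (\sum_(i < D.+1) al i.+1)%N.
have -> : (\sum_(j < m.+1) 'C(j, al 0) * 'C(m - j + D, B + D) =
  \sum_(j < (m + D).+1) 'C(j, al 0) * 'C(m + D - j, B + D))%N.
  rewrite -addSn big_split_ord /= [X in (_ = _ + X)%N]big1 ?addn0.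
    by apply: eq_bigr => j _; congr (_ * 'C(_, _))%N; have := ltn_ord j; lia.
  by move=> j _; have jD := ltn_ord j; rewrite (bin_small (n := m + D - _)) ?muln0 //; lia.
by rewrite bin_convolution; congr 'C(_, _); lia.
Qed.

Lemma lattice_rising D m al :
  (\sum_(k <- lattice D.+1 m) lterm (fun j a => 'C(j + a, a)) al D.+1 k =
   'C(m + \sum_(i < D.+1) al i + D, \sum_(i < D.+1) al i + D))%N.
Proof.
elim: D m al => [|D IH] m al.
  rewrite lattice1_sum lterm_cons /lterm big_ord0 muln1 big_ord_recr big_ord0 /=.
  by rewrite !addn0 add0n.
rewrite lattice_sum.
under eq_bigr => j _ do (under eq_bigr do rewrite lterm_cons; rewrite -big_distrr /= IH).
rewrite [in RHS]big_ord_recl /= (_ : \sum_(i < D.+1) al (bump 0 i) = \sum_(i < D.+1) al i.+1)%N //.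
set B := (\sum_(i < D.+1) al i.+1)%N.
under eq_bigr do rewrite -addnA.
by rewrite bin_rising_convolution; congr 'C(_, _); lia.
Qed.

Lemma ffact_split n p q : (n ^_ (p + q) = n ^_ p * (n - p) ^_ q)%N.
Proof.
elim: p n => [|p IH] n; first by rewrite add0n subn0 ffactn0 mul1n.
case: n => [|n]; first by rewrite addSn !ffact0n.
by rewrite addSn !ffactSS IH subSS mulnA.
Qed.

Lemma ffact_le_exp n a : (n ^_ a <= n ^ a)%N.
Proof.
elim: a n => [|a IH] n; first by rewrite ffactn0 expn0.
case: n => [|n]; first by rewrite ffact0n.
rewrite ffactSS expnS leq_mul2l (leq_trans (IH n)) ?orbT //.
by case: a {IH} => [|a]; rewrite ?expn0 // leq_exp2r.
Qed.

Lemma exp_le_ffact n a b : (a <= b)%N -> ((n - b) ^ a <= n ^_ a)%N.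
Proof.
elim: a n b => [|a IH] n b ab; first by rewrite ffactn0 expn0.
case: n => [|n]; first by rewrite sub0n exp0n.
rewrite ffactSS expnS leq_mul //; first by lia.
by case: b ab => // b ab; rewrite subSS IH.
Qed.

Lemma exp_le_rising j a : (j ^ a <= a`! * 'C(j + a, a))%N.
Proof.
rewrite mulnC bin_ffact; apply: leq_trans (exp_le_ffact (j + a) (leqnn a)).
by rewrite addnK.
Qed.

Lemma bin_le_exp j a : (a`! * 'C(j, a) <= j ^ a)%N.
Proof. by rewrite mulnC bin_ffact ffact_le_exp. Qed.

(** Moments of the lattice: the number of points times the moment of the
    uniform distribution on the simplex, up to factors tending to one. *)
Definition lmom D m al := (\sum_(k <- lattice D.+1 m) lterm expn al D.+1 k)%N.

Lemma lmom_lower D m (al : nat -> nat) A : A = (\sum_(i < D.+1) al i)%N ->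
  ((m + D) ^_ D * (m - A) ^ A * \prod_(i < D.+1) (al i)`! <= (A + D)`! * lmom D m al)%N.
Proof.
move=> defA; apply: leq_trans (_ : (A + D)`! * (\prod_(i < D.+1) (al i)`! * 'C(m + D, A + D)) <= _)%N.
  rewrite mulnCA mulnC leq_mul2l; apply/orP; right.
  rewrite [X in (_ <= X)%N]mulnC bin_ffact (addnC A D) ffact_split.
  by rewrite addnK leq_mul2l exp_le_ffact ?orbT.
rewrite leq_mul2l; apply/orP; right.
rewrite /lmom defA -lattice_bin big_distrr; apply: leq_sum => k _.
rewrite /= /lterm -big_split /=; apply: leq_prod => i _; exact: bin_le_exp.
Qed.

Lemma lmom_upper D m (al : nat -> nat) A : A = (\sum_(i < D.+1) al i)%N ->
  ((A + D)`! * lmom D m al <= (m + D) ^_ D * (m + A + D) ^ A * \prod_(i < D.+1) (al i)`!)%N.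
Proof.
move=> defA; apply: leq_trans (_ : _ <= (A + D)`! * (\prod_(i < D.+1) (al i)`! * 'C(m + A + D, A + D)))%N _.
  rewrite leq_mul2l; apply/orP; right.
  rewrite /lmom defA -lattice_rising big_distrr; apply: leq_sum => k _.
  rewrite /= /lterm -big_split /=; apply: leq_prod => i _; exact: exp_le_rising.
rewrite mulnCA mulnC leq_mul2r; apply/orP; right.
rewrite mulnC bin_ffact ffact_split (_ : m + A + D - A = m + D)%N; last by lia.
by rewrite mulnC leq_mul2l ffact_le_exp orbT.
Qed.

End Lattice.

Section Hardy.
Variables (R : realType) (D : nat).
Local Notation C := R[i].
Local Notation mpol := (mpoly.mpoly D.+1 C).
Local Notation midx := (multinom D.+1).
Implicit Types (p q r : mpol) (m : midx).

(** Squared norms of monomials in the Hardy space of the sphere. *)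
Definition hardy_weight m : R :=
  (\prod_i (m i)`!)%:R * (D`!)%:R / ((mdeg m + D)`!)%:R.

Lemma hardy_weight_gt0 m : 0 < hardy_weight m.
Proof.
rewrite /hardy_weight divr_gt0 ?mulr_gt0 ?ltr0n ?fact_gt0 //.
by apply: prodn_gt0 => i; exact: fact_gt0.
Qed.

Lemma nr_sqr_conj (a : C) : (nr a ^+ 2)%:C = a * (a^*)%C.
Proof. by rewrite mulcJ. Qed.

Lemma torus_orth (u : C) K m m' : K.-primitive_root u ->
  (forall i, (m i < K)%N) -> (forall i, (m' i < K)%N) ->
  \sum_(t : {ffun 'I_D.+1 -> 'I_K}) \prod_i (u ^+ (m i * t i) * ((u ^+ (m' i * t i))^*)%C) =
  (K ^ D.+1)%:R * (m == m')%:R.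
Proof.
move=> hu mK mK'.
rewrite -(bigA_distr_bigA (fun i (j : 'I_K) => u ^+ (m i * j) * ((u ^+ (m' i * j))^*)%C)) /=.
under eq_bigr => i _ do rewrite (prim_root_orth hu (mK i) (mK' i)).
rewrite big_split /= prodr_const card_ord natrX; congr (_ * _).
have [->|mm'] := eqVneq m m'; first by rewrite big1 // => i _; rewrite eqxx.
have [i mi] : exists i, m i != m' i.
  apply/existsP; apply: contraR mm'; rewrite negb_exists => /forallP h.
  by apply/eqP/mnmP => i; apply/eqP; have := h i; rewrite negbK.
by rewrite (bigD1 i) //= (negbTE mi) !mul0r.
Qed.

(** Parseval identity on a torus, with roots of unity in place of an integral. *)
Lemma torus_parseval (u : C) K (rho : 'I_D.+1 -> R) r : K.-primitive_root u ->
  (msize r <= K)%N -> (forall i, 0 <= rho i) ->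
  \sum_(t : {ffun 'I_D.+1 -> 'I_K}) nr (meval (fun i => u ^+ t i * (rho i)%:C) r) ^+ 2 =
  (K ^ D.+1)%:R * \sum_(m <- msupp r) nr (mcoeff m r) ^+ 2 * \prod_i (rho i ^+ 2) ^+ m i.
Proof.
move=> hu rK rho0.
pose mon m (t : {ffun 'I_D.+1 -> 'I_K}) : C := \prod_i (u ^+ t i * (rho i)%:C) ^+ m i.
have monE m t : mon m t = \prod_i u ^+ (m i * t i) * (\prod_i rho i ^+ m i)%:C.
  rewrite /mon rmorph_prod -big_split /=; apply: eq_bigr => i _.
  by rewrite exprMn -exprM mulnC rmorphXn.
have Kb m : m \in msupp r -> forall i, (m i < K)%N.
  move=> ms i; apply: leq_trans rK; apply: leq_ltn_trans (msize_mdeg_lt ms).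
  by rewrite mdegE (bigD1 i) //= leq_addr.
have orth m m' : m \in msupp r -> m' \in msupp r ->
    \sum_t mon m t * ((mon m' t)^*)%C = (K ^ D.+1)%:R * (m == m')%:R * (\prod_i (rho i ^+ 2) ^+ m i)%:C.
  move=> ms ms'.
  have -> : \sum_t mon m t * ((mon m' t)^*)%C =
     (\sum_(t : {ffun 'I_D.+1 -> 'I_K}) \prod_i (u ^+ (m i * t i) * ((u ^+ (m' i * t i))^*)%C)) *
      ((\prod_i rho i ^+ m i)%:C * (\prod_i rho i ^+ m' i)%:C).
    rewrite mulr_suml; apply: eq_bigr => t _; rewrite !monE big_split /= -rmorph_prod.
    have -> (x : C) (y : R) : ((x * y%:C)^*)%C = (x^*)%C * y%:C.
      by rewrite rmorphM; congr (_ * _); exact: conjc_real.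
    by rewrite mulrACA.
  rewrite (torus_orth hu (Kb _ ms) (Kb _ ms')) -!mulrA; congr (_ * _).
  have [->|_] := eqVneq m m'; last by rewrite !mul0r.
  rewrite !mul1r -rmorphM -big_split /=; congr (_%:C).
  by apply: eq_bigr => i _; rewrite exprAC expr2.
apply: complexI; rewrite rmorph_sum rmorphM rmorph_nat rmorph_sum.
have evE t : meval (fun i => u ^+ (t : {ffun 'I_D.+1 -> 'I_K}) i * (rho i)%:C) r = \sum_(m <- msupp r) mcoeff m r * mon m t.
  by rewrite mevalE.
transitivity (\sum_(t : {ffun 'I_D.+1 -> 'I_K}) \sum_(m <- msupp r) \sum_(m' <- msupp r)
    mcoeff m r * ((mcoeff m' r)^*)%C * (mon m t * ((mon m' t)^*)%C)).
  apply: eq_bigr => t _; rewrite /= nr_sqr_conj evE rmorph_sum mulr_suml.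
  apply: eq_bigr => m _; rewrite mulr_sumr; apply: eq_bigr => m' _.
  by rewrite rmorphM /= mulrACA.
rewrite exchange_big mulr_sumr /= big_seq [RHS]big_seq; apply: eq_bigr => m ms.
rewrite exchange_big /= (bigD1_seq m) ?msupp_uniq //= [X in _ + X]big1_seq ?addr0; last first.
  move=> m' /andP[/negbTE mm' ms']; rewrite -mulr_sumr orth //.
  by rewrite eq_sym mm' mulr0 mul0r mulr0.
rewrite -mulr_sumr orth // eqxx mulr1 -nr_sqr_conj rmorphM /=; ring.
Qed.

Definition simplex_pt M (k : seq nat) (i : 'I_D.+1) : R :=
  Num.sqrt ((nth 0%N k i)%:R / M%:R).

Lemma simplex_pt_sqr M k i : simplex_pt M k i ^+ 2 = (nth 0%N k i)%:R / M%:R.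
Proof. by rewrite sqr_sqrtr // divr_ge0. Qed.

Lemma simplex_torus_sphere (u : C) M k (t : 'I_D.+1 -> nat) : (0 < M)%N -> nr u = 1 ->
  k \in lattice D.+1 M -> on_sphere (fun i => u ^+ t i * (simplex_pt M k i)%:C).
Proof.
move=> M0 u1 /lattice_size[sk kM]; rewrite /on_sphere /nrm2.
under eq_bigr => i _ do rewrite nrM nrX u1 expr1n mul1r nrC ger0_norm ?sqrtr_ge0 // simplex_pt_sqr.
rewrite -mulr_suml -natr_sum; have -> : (\sum_(i < D.+1) nth 0%N k i = M)%N.
  by rewrite -kM sumnE [RHS](big_nth 0%N) big_mkord sk.
by rewrite divff // pnatr_eq0 -lt0n.
Qed.

Definition lattice_form M r : R :=
  \sum_(k <- lattice D.+1 M) \sum_(m <- msupp r) nr (mcoeff m r) ^+ 2 * \prod_(i < D.+1) ((nth 0%N k i)%:R / M%:R) ^+ m i.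

Lemma lattice_form_le M p q c : (0 < M)%N -> sbound p c ->
  lattice_form M (p * q) <= c ^+ 2 * lattice_form M q.
Proof.
move=> M0 pc; rewrite /lattice_form mulr_sumr.
rewrite big_seq [leRHS]big_seq; apply: ler_sum => k kM.
pose K := (msize q + msize (p * q)).+1.
have [u hu] := @prim_root_exists R K isT.
have P r : (msize r <= K)%N -> \sum_(m <- msupp r) nr (mcoeff m r) ^+ 2 * \prod_(i < D.+1) ((nth 0%N k i)%:R / M%:R) ^+ m i =
   (K ^ D.+1)%:R^-1 * \sum_(t : {ffun 'I_D.+1 -> 'I_K}) nr (meval (fun i => u ^+ t i * (simplex_pt M k i)%:C) r) ^+ 2.
  move=> rK; rewrite (torus_parseval hu rK) => [|i]; last exact: sqrtr_ge0.
  rewrite mulKf ?pnatr_eq0 ?expn_eq0 //; apply: eq_bigr => m _; congr (_ * _).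
  by apply: eq_bigr => i _; rewrite simplex_pt_sqr.
rewrite !P; [|rewrite /K; lia|rewrite /K; lia].
rewrite mulrCA ler_wpM2l ?invr_ge0 // mulr_sumr; apply: ler_sum => t _.
rewrite mevalM nrM exprMn ler_wpM2r ?sqr_ge0 //.
have h := pc _ (simplex_torus_sphere (fun i => t i : nat) M0 (nr_prim_root hu) kM).
by rewrite lerXn2r ?nnegrE ?nr_ge0 // (le_trans _ h) ?nr_ge0.
Qed.

Definition lsize M : R := ((M + D) ^_ D)%:R / (D`!)%:R.

Lemma lattice_formE M r : (0 < M)%N ->
  lattice_form M r = \sum_(m <- msupp r) nr (mcoeff m r) ^+ 2 *
    ((lmom D M (fun i => m (inord i)))%:R / M%:R ^+ mdeg m).
Proof.
move=> M0; rewrite /lattice_form exchange_big /=; apply: eq_bigr => m _.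
rewrite -mulr_sumr; congr (_ * _); rewrite /lmom natr_sum mulr_suml; apply: eq_bigr => k _.
rewrite /lterm natr_prod mdegE -prodrXr -prodf_div; apply: eq_bigr => i _.
by rewrite inord_val expr_div_n natrX.
Qed.

(** Powers lie between falling and rising factorials, whose sums over the lattice
    are binomial coefficients; for large [M] the two bounds nearly agree. *)
Lemma lmom_bounds M m (eps : R) : 0 < eps -> eps < 1 -> (0 < M)%N ->
  (mdeg m * (mdeg m + D))%N%:R <= eps * M%:R ->
  lsize M * hardy_weight m * (1 - eps) <= (lmom D M (fun i => m (inord i)))%:R / M%:R ^+ mdeg m /\
  (lmom D M (fun i => m (inord i)))%:R / M%:R ^+ mdeg m * (1 - eps) <= lsize M * hardy_weight m.
Proof.
move=> e0 e1 M0 hM; set A := mdeg m in hM *; set L := lmom _ _ _.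
have defA : A = (\sum_(i < D.+1) m (inord i))%N.
  by rewrite /A mdegE; apply: eq_bigr => i _; rewrite inord_val.
have fE : (\prod_(i < D.+1) (m (inord i))`! = \prod_i (m i)`!)%N.
  by apply: eq_bigr => i _; rewrite inord_val.
have lo := lmom_lower (al := fun i => m (inord i)) M defA.
have up := lmom_upper (al := fun i => m (inord i)) M defA.
rewrite fE in lo up; rewrite -/L in lo up.
have MR : 0 < M%:R :> R by rewrite ltr0n.
have F0 : 0 < ((A + D)`!)%:R :> R by rewrite ltr0n fact_gt0.
have G0 : 0 < (D`!)%:R :> R by rewrite ltr0n fact_gt0.
have W : lsize M * hardy_weight m = ((M + D) ^_ D)%:R * (\prod_i (m i)`!)%:R / ((A + D)`!)%:R.
  by rewrite /lsize /hardy_weight -/A; field; rewrite !gt_eqF.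
have bern (x : R) n : 0 <= x <= 1 -> 1 - n%:R * x <= (1 - x) ^+ n.
  move=> /andP[x0 x1]; elim: n => [|n IH]; first by rewrite mul0r subr0 expr0.
  have y0 : 0 <= 1 - x by lra.
  rewrite exprS; apply: le_trans (ler_wpM2l y0 IH).
  have : 0 <= n%:R * x ^+ 2 by rewrite mulr_ge0 // sqr_ge0.
  by rewrite -natr1; nra.
have AM : (A * (A + D))%N%:R < M%:R :> R.
  by apply: le_lt_trans hM _; rewrite gtr_pMl.
have AM' : (A <= M)%N.
  move: AM; rewrite ltr_nat => h; case: (posnP A) => [->//|A0].
  by apply: leq_trans (ltnW h); rewrite leq_pmulr // ltn_addr.
have low : 1 - eps <= ((M - A)%:R / M%:R) ^+ A.
  have -> : (M - A)%:R / M%:R = 1 - A%:R / M%:R :> R.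
    by rewrite natrB // mulrBl divff // gt_eqF.
  apply: le_trans (bern _ _ _); last first.
    by rewrite divr_ge0 //= ler_pdivrMr // mul1r ler_nat.
  rewrite lerD2l lerN2 mulrA ler_pdivrMr //; apply: le_trans hM.
  by rewrite -natrM ler_nat leq_mul2l leq_addr orbT.
have high : ((M + A + D)%:R / M%:R) ^+ A * (1 - eps) <= 1.
  case: (posnP A) => [A0|Apos]; first by rewrite A0 expr0 mul1r gerBl ltW.
  pose y : R := (A + D)%:R / M%:R.
  have y0 : 0 <= y by rewrite divr_ge0.
  have y1 : y <= 1.
    rewrite ler_pdivrMr // mul1r ler_nat; move: AM; rewrite ltr_nat => /ltnW.
    by apply: leq_trans; rewrite leq_pmull.
  have -> : (M + A + D)%:R / M%:R = 1 + y.
    by rewrite -addnA natrD mulrDl divff ?gt_eqF.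
  have h : 1 - eps <= (1 - y) ^+ A.
    apply: le_trans (bern _ _ _); last by rewrite y0.
    rewrite lerD2l lerN2 mulrA -natrM ler_pdivrMr //.
  apply: le_trans (ler_wpM2l _ h) _; first by rewrite exprn_ge0 // addr_ge0.
  rewrite -exprMn exprn_ile1 //.
    by apply: mulr_ge0; [exact: addr_ge0|rewrite subr_ge0].
  by rewrite (_ : _ * _ = 1 - y ^+ 2) ?gerBl ?sqr_ge0 //; ring.
move: lo up; rewrite -!(ler_nat R) !natrM !natrX => lo up.
rewrite W; set P := (\prod_i _)%:R in lo up *; set N := ((M + D) ^_ D)%:R in lo up *.
have P0 : 0 <= P by rewrite ler0n.
have N0 : 0 <= N by rewrite ler0n.
have MA : 0 < M%:R ^+ A :> R by rewrite exprn_gt0.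
split.
  apply: le_trans (ler_wpM2l _ low) _; first by rewrite divr_ge0 ?mulr_ge0 // ltW.
  rewrite expr_div_n mulrA ler_wpM2r ?invr_ge0 ?(ltW MA) //.
  rewrite mulrAC ler_pdivrMr //; move: lo; move: (_ ^+ A) => x lo.
  by rewrite [leRHS]mulrC; apply: le_trans lo; rewrite mulrAC.
have up' : L%:R / M%:R ^+ A <= N * P / ((A + D)`!)%:R * ((M + A + D)%:R / M%:R) ^+ A.
  rewrite expr_div_n mulrA ler_wpM2r ?invr_ge0 ?(ltW MA) //.
  rewrite mulrAC ler_pdivlMr // mulrC; apply: le_trans up _.
  by rewrite mulrAC.
have e1' : 0 <= 1 - eps by lra.
apply: le_trans (ler_wpM2r e1' up') _; rewrite -mulrA ler_piMr //.
by rewrite divr_ge0 ?mulr_ge0 // ltW.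
Qed.

Lemma lsize_gt0 M : 0 < lsize M.
Proof. by rewrite divr_gt0 ?ltr0n ?fact_gt0 // ffact_gt0 leq_addl. Qed.

(** The Hardy norm is a limit of averages over the tori [|z_i| ^ 2 = k_i / M] of
    the sphere, with [k] in the lattice, and on each of them [p] is at most [c]. *)
Lemma hardy_bound p q c : sbound p c ->
  sqn hardy_weight (p * q) <= c ^+ 2 * sqn hardy_weight q.
Proof.
move=> pc; apply/ler_addgt0Pr => del del0.
set X := sqn _ _; set Y := sqn _ _.
have X0 : 0 <= X by apply: sqn_ge0; exact: hardy_weight_gt0.
(* Two factors [1 - eps] are lost, at a cost of at most [2 * eps * X]. *)
pose eps := Num.min (1 / 2) (del / (2 * X + 1)).
have e0 : 0 < eps by rewrite lt_min !divr_gt0 //; lra.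
have e12 : eps <= 1 / 2 by rewrite ge_min lexx.
have e1 : eps < 1 by lra.
have eX : eps <= del / (2 * X + 1) by rewrite ge_min lexx orbT.
pose B := (msize q + msize (p * q))%N.
have [M hM] := nat_gt ((B * (B + D))%N%:R / eps).
have M0 : (0 < M)%N.
  by rewrite -(ltr_nat R) (le_lt_trans _ hM) // divr_ge0 // ltW.
have deg r m : m \in msupp r -> (msize r <= B)%N -> (mdeg m * (mdeg m + D))%N%:R <= eps * M%:R.
  move=> /msize_mdeg_lt ms rB; have mB : (mdeg m <= B)%N by lia.
  apply: le_trans (_ : (B * (B + D))%N%:R <= _).
    by rewrite ler_nat leq_mul // leq_add2r.
  by rewrite mulrC -ler_pdivrMr // ltW.
have h1 : lsize M * X * (1 - eps) <= lattice_form M (p * q).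
  rewrite lattice_formE // /X /sqn mulr_sumr mulr_suml.
  rewrite big_seq [leRHS]big_seq; apply: ler_sum => m ms.
  have [h _] := lmom_bounds e0 e1 M0 (deg _ _ ms (leq_addl _ _)).
  by have := ler_wpM2l (sqr_ge0 (nr (mcoeff m (p * q)))) h; apply: le_trans; rewrite le_eqVlt; apply/orP; left; apply/eqP; ring.
have h2 : lattice_form M q * (1 - eps) <= lsize M * Y.
  rewrite lattice_formE // /Y /sqn mulr_sumr mulr_suml.
  rewrite big_seq [leRHS]big_seq; apply: ler_sum => m ms.
  have [_ h] := lmom_bounds e0 e1 M0 (deg _ _ ms (leq_addr _ _)).
  rewrite [leRHS](_ : _ = nr (mcoeff m q) ^+ 2 * (lsize M * hardy_weight m)); last by ring.
  by rewrite -mulrA ler_wpM2l // sqr_ge0.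
have h3 := lattice_form_le q M0 pc.
have e1' : 0 <= 1 - eps by lra.
have L0 := lsize_gt0 M.
have : lsize M * (X * (1 - eps) * (1 - eps)) <= lsize M * (c ^+ 2 * Y).
  have := ler_wpM2r e1' (le_trans h1 h3).
  rewrite -[X in _ <= X -> _]mulrA => /le_trans /(_ (ler_wpM2l (sqr_ge0 c) h2)).
  by move=> hh; rewrite [leRHS]mulrCA; apply: le_trans hh; rewrite !mulrA.
rewrite ler_pM2l // => h; apply: le_trans (_ : c ^+ 2 * Y + 2 * eps * X <= _).
  by have := mulr_ge0 X0 (sqr_ge0 eps); nra.
rewrite lerD2l; apply: le_trans (_ : del / (2 * X + 1) * (2 * X) <= _).
  by rewrite (_ : 2 * eps * X = eps * (2 * X)) ?ler_wpM2r //; [lra|ring].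
by rewrite mulrAC -mulrA ler_piMr ?(ltW del0) // ler_pdivrMr ?mul1r; lra.
Qed.

End Hardy.

Section Transfer.
Variables (R : realType) (D : nat).
Local Notation C := R[i].
Local Notation mpol := (mpoly.mpoly D.+1 C).
Variables (w : multinom D.+1 -> R) (w_gt0 : forall m, 0 < w m).
Variables (V : normedModType C) (iota : {linear mpol -> V}).
Hypothesis iota_norm : forall p, nr (iota p) ^+ 2 = sqn w p.
Variable bt : nat -> R.
Hypothesis bt_gt0 : forall n, 0 < bt n.
Hypothesis hardy_bt : forall m, hardy_weight R m = w m * bt (mdeg m) ^+ 2.
Implicit Types p q : mpol.

Lemma conj_mul_bound p q c : 0 <= c -> sbound p c ->
  nr (iota (conj_mul bt p q)) <= c * nr (iota q).
Proof.
move=> c0 pc; rewrite (iota_le_sqr iota_norm) ?mulr_ge0 ?nr_ge0 // exprMn iota_norm.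
have E r : sqn w (deg_mul (fun n => (bt n)%:C) r) = sqn (hardy_weight R (D := D)) r.
  rewrite sqn_deg_mul /sqn; apply: eq_bigr => m _.
  by rewrite nrC real_normK ?num_real // hardy_bt; ring.
rewrite /conj_mul E; apply: le_trans (hardy_bound _ pc) _.
rewrite -E deg_mul_comp; set r := deg_mul _ _; have -> // : r = q.
apply: deg_mul1 => n; rewrite -rmorphM /= mulfV ?gt_eqF //.
Qed.

Lemma mbound_kbound p c : sbound p c -> mbound iota p c -> kbound iota bt p (2 * c).
Proof.
move=> ps pc q; rewrite /mul_defect linearB; apply: le_trans (nrB _ _) _.
by rewrite mulrDl mul1r mulrDl lerD //; apply: conj_mul_bound (mbound_ge0 w_gt0 iota_norm pc) ps.
Qed.

End Transfer.

Section Ratio.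
Variable R : realType.

Lemma ratio_shift (b : nat -> R) : (forall n, 0 < b n) ->
  (fun n => b n.+1 / b n) @ \oo --> (1 : R) ->
  forall k, (fun n => b (k + n)%N / b n) @ \oo --> (1 : R).
Proof.
move=> b0 h; elim=> [|k IH].
  rewrite (_ : (fun n => _) = (fun=> 1)); first exact: cvg_cst.
  by apply/funext => n; rewrite add0n divff // gt_eqF.
rewrite (_ : (fun n => _) = (fun n => (b (n + k).+1 / b (n + k)%N) * (b (k + n)%N / b n))); last first.
  apply/funext => n; rewrite addSn (addnC n k) mulrA mulfVK ?gt_eqF //.
rewrite -[X in _ --> X]mulr1; apply: cvgM IH.
by move: h; rewrite -(cvg_shiftn k).
Qed.

Lemma sqrt_ratio (b : nat -> R) : (forall n, 0 < b n) ->
  (fun n => b n.+1 / b n) @ \oo --> (1 : R) ->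
  forall k eps, 0 < eps -> exists N, forall n, (N <= n)%N ->
    `|1 - Num.sqrt (b (k + n)%N) / Num.sqrt (b n)| <= eps.
Proof.
move=> b0 h k eps e0; have /cvgrPdist_le /(_ _ e0)[N _ hN] := ratio_shift b0 h k.
exists N => n Nn; apply: le_trans (hN n Nn).
rewrite /= -sqrtrV ?(ltW (b0 _)) // -sqrtrM ?(ltW (b0 _)) //; set x := b _ / b _.
have x0 : 0 <= x by rewrite divr_ge0 ?ltW.
have s0 := sqrtr_ge0 x; rewrite -{2}(sqr_sqrtr x0); move: (Num.sqrt x) s0 => s s0.
rewrite (_ : 1 - s ^+ 2 = (1 - s) * (1 + s)); last by ring.
rewrite normrM (@ger0_norm _ (1 + s)) ?addr_ge0 //.
by rewrite ler_peMr // lerDl.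
Qed.

(** The squares of the weights comparing a regular space with the Hardy space. *)
Lemma hardy_ratio (a : nat -> R) D : (forall n, 0 < a n) ->
  (fun n => a n / a n.+1) @ \oo --> (1 : R) ->
  let b := fun n => a n * (n`!)%:R * (D`!)%:R / ((n + D)`!)%:R in
  (fun n => b n.+1 / b n) @ \oo --> (1 : R).
Proof.
move=> a0 h b.
have f0 n : (n`!)%:R != 0 :> R by rewrite pnatr_eq0 -lt0n fact_gt0.
rewrite (_ : (fun n => _) = (fun n => (a n / a n.+1)^-1 * (1 + D%:R * n.+1%:R^-1)^-1)); last first.
  apply/funext => n; rewrite /b addSn !factS !natrM (_ : (n + D).+1%:R = n.+1%:R + D%:R :> R); last first.
    by rewrite -natrD addSn.
  have an := a0 n; have an1 := a0 n.+1.
  have fn := f0 n; have fd := f0 D; have fnd := f0 (n + D)%N.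
  have n1 : n.+1%:R != 0 :> R by rewrite pnatr_eq0.
  have nd : n.+1%:R + D%:R != 0 :> R by rewrite -natrD pnatr_eq0.
  by field; rewrite !gt_eqF // n1 nd fn fd fnd.
have lim : (fun n => 1 + D%:R * n.+1%:R^-1 : R) @ \oo --> 1 + D%:R * (0 : R).
  by apply: cvgD; [exact: cvg_cst|apply: cvgMr; exact: cvg_harmonic].
rewrite mulr0 addr0 in lim.
have u0 : (1 : R) != 0 by exact: oner_neq0.
have := cvgM (cvgV u0 h) (cvgV u0 lim).
by rewrite invr1 mulr1; apply.
Qed.

End Ratio.

(** * Hilbert spaces of functions *)

Section Limits.
Variable R : realType.
Local Notation C := R[i].

Section Def.
Variable V : normedZmodType C.
Implicit Types (x y : nat -> V) (u v : V).

(** Convergence of sequences, with real tolerances. *)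
Definition nlim x u := forall eps : R, 0 < eps ->
  exists N, forall n, (N <= n)%N -> nr (x n - u) <= eps.

Lemma nr_small v : (forall eps : R, 0 < eps -> nr v <= eps) -> v = 0.
Proof.
move=> h; apply: nr_eq0; apply/eqP; rewrite eq_le nr_ge0 andbT.
by apply/ler_addgt0Pr => e e0; rewrite add0r h.
Qed.

Lemma nlim_cst u : nlim (fun=> u) u.
Proof. by move=> e e0; exists 0%N => n _; rewrite subrr nr0 ltW. Qed.

Lemma nlim_unique x u v : nlim x u -> nlim x v -> u = v.
Proof.
move=> hu hv; apply/eqP; rewrite -subr_eq0; apply/eqP; apply: nr_small => e e0.
have e2 : 0 < e / 2 by rewrite divr_gt0.
have [N1 h1] := hu _ e2; have [N2 h2] := hv _ e2; pose n := (N1 + N2)%N.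
rewrite -(subrKA (x n) u) addrC; apply: le_trans (nrD _ _) _.
rewrite [nr (u - _)]nr_dist [leRHS](splitr e) lerD ?h1 ?h2 ?leq_addl ?leq_addr //.
Qed.

Lemma nlimD x y u v : nlim x u -> nlim y v -> nlim (fun n => x n + y n) (u + v).
Proof.
move=> hu hv e e0; have e2 : 0 < e / 2 by rewrite divr_gt0.
have [N1 h1] := hu _ e2; have [N2 h2] := hv _ e2; exists (N1 + N2)%N => n nN.
rewrite opprD addrACA (le_trans (nrD _ _)) // [leRHS](splitr e) lerD // ?h1 ?h2 //.
  by rewrite (leq_trans _ nN) ?leq_addr.
by rewrite (leq_trans _ nN) ?leq_addl.
Qed.

Lemma nlim_bound x u c : nlim x u -> (exists N, forall n, (N <= n)%N -> nr (x n) <= c) -> nr u <= c.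
Proof.
move=> hu [N h]; apply/ler_addgt0Pr => e e0; have [M hM] := hu _ e0.
have := nr_ler_dist u (x (N + M)%N); rewrite [nr (u - _)]nr_dist => /le_trans; apply.
by rewrite lerD ?h ?hM ?leq_addl ?leq_addr.
Qed.

Lemma nlim_shift x u k : nlim x u -> nlim (fun n => x (n + k)%N) u.
Proof. by move=> h e /h[N hN]; exists N => n Nn; rewrite hN // (leq_trans Nn) ?leq_addr. Qed.

End Def.

Lemma nlim_lipschitz (V W : normedZmodType C) (f : V -> W) x u c : 0 <= c ->
  (forall v v', nr (f v - f v') <= c * nr (v - v')) -> nlim x u -> nlim (f \o x) (f u).
Proof.
move=> c0 fc h e e0; have e1 : 0 < e / (c + 1) by rewrite divr_gt0 // ltr_wpDl.
have [N hN] := h _ e1; exists N => n /hN {}hN.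
apply: le_trans (fc _ _) _; apply: le_trans (ler_wpM2l c0 hN) _.
by rewrite mulrA ler_pdivrMr ?ltr_wpDl // mulrC ler_wpM2l ?(ltW e0) // lerDl.
Qed.

Lemma nlim_le (V W : normedZmodType C) (x : nat -> V) (y : nat -> W) u v c : 0 <= c ->
  nlim x u -> nlim y v -> (forall n, nr (x n) <= c * nr (y n)) -> nr u <= c * nr v.
Proof.
move=> c0 hx hy h; apply/ler_addgt0Pr => e e0.
have e1 : 0 < e / 2 by rewrite divr_gt0.
have e2 : 0 < e / 2 / (c + 1) by rewrite divr_gt0 // ltr_wpDl.
have [N1 h1] := hx _ e1; have [N2 h2] := hy _ e2; pose n := (N1 + N2)%N.
have {}h1 : nr (x n - u) <= e / 2 by rewrite h1 ?leq_addr.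
have {}h2 : nr (y n - v) <= e / 2 / (c + 1) by rewrite h2 ?leq_addl.
have := nr_ler_dist u (x n); rewrite [nr (u - _)]nr_dist => /le_trans; apply.
apply: le_trans (lerD (h n) h1) _.
apply: le_trans (lerD (ler_wpM2l c0 (le_trans (nr_ler_dist (y n) v) (lerD (lexx _) h2))) (lexx _)) _.
rewrite mulrDr -addrA lerD2l [leRHS](splitr e) lerD2r.
by rewrite mulrA ler_pdivrMr ?ltr_wpDl // mulrC ler_wpM2l ?(ltW e1) // lerDl.
Qed.

Lemma nlimZ (V : normedModType C) (a : C) (x : nat -> V) u : nlim x u -> nlim (fun n => a *: x n) (a *: u).
Proof.
apply: (nlim_lipschitz (f := fun v => a *: v) (nr_ge0 a)) => v v'.
by rewrite -scalerBr nrZ.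
Qed.

Lemma nlimM (a : C) (x : nat -> C) u : nlim x u -> nlim (fun n => a * x n) (a * u).
Proof.
apply: (nlim_lipschitz (f := fun v : C => a * v) (nr_ge0 a)) => v v'.
by rewrite -mulrBr nrM.
Qed.

Lemma nlim_sum (V : normedZmodType C) (I : Type) (s : seq I) (x : I -> nat -> V) (u : I -> V) :
  (forall i, nlim (x i) (u i)) -> nlim (fun n => \sum_(i <- s) x i n) (\sum_(i <- s) u i).
Proof.
move=> h; elim: s => [|i s IH].
  by rewrite big_nil; under eq_fun do rewrite big_nil; exact: nlim_cst.
by rewrite big_cons; under eq_fun do rewrite big_cons; exact: nlimD.
Qed.

Lemma nlim_cvg (V : normedModType C) (x : nat -> V) u : (x @ \oo --> u) <-> nlim x u.
Proof.
split=> [/cvgrPdist_le h e e0|h].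
  have /h[N _ hN] : 0 < e%:C :> C by rewrite -(ltcR 0) in e0.
  by exists N => n /hN; rewrite /= -nr_le nr_dist.
apply/cvgrPdist_le => e e0.
have eE : e = (complex.Re e)%:C by rewrite RRe_real // gtr0_real.
have /h[N hN] : 0 < complex.Re e by rewrite -(ltcR 0) -eE.
by exists N => // n /hN; rewrite /= eE -nr_le nr_dist.
Qed.

Lemma ncauchy (V : completeNormedModType C) (x : nat -> V) :
  (forall eps : R, 0 < eps -> exists N, forall n m, (N <= n)%N -> (N <= m)%N -> nr (x n - x m) <= eps) ->
  exists u, nlim x u.
Proof.
move=> h; suff cx : cvgn x by exists (limn x); apply/nlim_cvg.
apply: cauchy_cvg; apply/cauchy_ballP => e e0.
have eE : e = (complex.Re e)%:C by rewrite RRe_real // gtr0_real.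
have e2 : 0 < complex.Re e / 2 by rewrite divr_gt0 // -(ltcR 0) -eE.
have [N hN] := h _ e2.
exists (x @` [set n | (N <= n)%N], x @` [set n | (N <= n)%N]).
  by split; exists N => // n Nn; exists n.
move=> [_ _] [/= [m Nm <-] [n Nn <-]]; rewrite -ball_normE /= eE -nr_lt.
apply: le_lt_trans (hN _ _ Nm Nn) _.
by rewrite ltr_pdivrMr // ltr_pMr ?ltr1n // -(ltcR 0) -eE.
Qed.

Lemma nr_ReIm (a : C) : nr a <= `|complex.Re a| + `|complex.Im a|.
Proof.
rewrite -(@ler_pXn2r _ 2) ?nnegrE ?nr_ge0 ?addr_ge0 // nr_sqr sqrrD !real_normK ?num_real //.
by rewrite -addrA lerD2l lerDr mulrn_wge0 // mulr_ge0.
Qed.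

Lemma ncauchyC (x : nat -> C) :
  (forall eps : R, 0 < eps -> exists N, forall n m, (N <= n)%N -> (N <= m)%N -> nr (x n - x m) <= eps) ->
  exists u, nlim x u.
Proof.
move=> h.
have cauchyR (y : nat -> R) : (forall n m, `|y n - y m| <= nr (x n - x m)) ->
    exists l, forall e, 0 < e -> exists N, forall n, (N <= n)%N -> `|y n - l| <= e.
  move=> yx; suff cy : cvgn y.
    exists (limn y) => e e0; have /cvgrPdist_le/(_ _ e0)[N _ hN] := cy.
    by exists N => n /hN; rewrite /= distrC.
  apply: cauchy_cvg; apply/cauchy_ballP => e e0.
  have [N hN] := h _ (divr_gt0 e0 (ltr0n R 2)).
  exists (y @` [set n | (N <= n)%N], y @` [set n | (N <= n)%N]).
    by split; exists N => // n Nn; exists n.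
  move=> [_ _] [/= [m Nm <-] [n Nn <-]]; rewrite -ball_normE /=.
  apply: le_lt_trans (le_trans (yx _ _) (hN _ _ Nm Nn)) _.
  by rewrite ltr_pdivrMr // ltr_pMr ?ltr1n.
have [A hA] : exists l, forall e, 0 < e -> exists N, forall n, (N <= n)%N -> `|complex.Re (x n) - l| <= e.
  apply: cauchyR => n m; rewrite -ReN -ReD ler_norml Re_le_nr andbT.
  by rewrite lerNl -ReN -nrN Re_le_nr.
have [B hB] : exists l, forall e, 0 < e -> exists N, forall n, (N <= n)%N -> `|complex.Im (x n) - l| <= e.
  apply: cauchyR => n m; rewrite -(@ler_pXn2r _ 2) ?nnegrE ?nr_ge0 // nr_sqr real_normK ?num_real //.
  by rewrite (_ : complex.Im (x n) - complex.Im (x m) = complex.Im (x n - x m)) ?lerDr ?sqr_ge0 //; case: (x n); case: (x m).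
exists (Complex A B) => e e0.
have [N1 h1] := hA _ (divr_gt0 e0 (ltr0n R 2)); have [N2 h2] := hB _ (divr_gt0 e0 (ltr0n R 2)).
exists (N1 + N2)%N => n nN; apply: le_trans (nr_ReIm _) _; rewrite [leRHS](splitr e) lerD //.
  have := h1 n (leq_trans (leq_addr _ _) nN); by case: (x n).
have := h2 n (leq_trans (leq_addl _ _) nN); by case: (x n).
Qed.

End Limits.

Section Hilbert.
Variables (R : realType) (X : Type) (H : hilbertFunctionSpace R X).
Local Notation C := R[i].
Implicit Types u v : H.

Lemma hdotC u v : hdot H u v = ((hdot H v u)^*)%C.
Proof. by rewrite hermC expr0 mul1r. Qed.

Lemma hdot_nr u : hdot H u u = (nr u ^+ 2)%:C.
Proof. by rewrite -hdot_norm nrE rmorphXn. Qed.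

Lemma hdotZr (a : C) u v : hdot H u (a *: v) = (a^*)%C * hdot H u v.
Proof. by rewrite hdotC linearZl_LR rmorphM /= -hdotC. Qed.

Lemma hdotZl (a : C) u v : hdot H (a *: u) v = a * hdot H u v.
Proof. by rewrite linearZl_LR. Qed.

Lemma hdotDl u u' v : hdot H (u + u') v = hdot H u v + hdot H u' v.
Proof. exact: linearDl. Qed.

Lemma hdotDr u v v' : hdot H u (v + v') = hdot H u v + hdot H u v'.
Proof. exact: linearDr. Qed.

Lemma hdotBl u u' v : hdot H (u - u') v = hdot H u v - hdot H u' v.
Proof. exact: linearBl. Qed.

Lemma hdotBr u v v' : hdot H u (v - v') = hdot H u v - hdot H u v'.
Proof. exact: linearBr. Qed.

Lemma hdot_CS u v : nr (hdot H u v) <= nr u * nr v.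
Proof.
have [->|v0] := eqVneq v 0; first by rewrite linear0r !nr0 mulr0.
have n0 : nr v != 0 by apply: contra_neq v0 => /nr_eq0.
set a := hdot H u v / (nr v ^+ 2)%:C.
have : 0 <= complex.Re (hdot H (u - a *: v) (u - a *: v)) by rewrite hdot_nr /= sqr_ge0.
have vv : (nr v ^+ 2)%:C != 0 :> C by rewrite -[0]/(0%:C) (inj_eq (@complexI R)) expf_neq0.
have -> : hdot H (u - a *: v) (u - a *: v) = (nr u ^+ 2 - nr (hdot H u v) ^+ 2 / nr v ^+ 2)%:C.
  rewrite linearBl !linearBr /= !hdotZl !hdotZr !hdot_nr.
  have vR : ((nr v ^+ 2)%:C^*)%C = (nr v ^+ 2)%:C :> C by exact: conjc_real.
  have aJ : (a^*)%C = hdot H v u / (nr v ^+ 2)%:C.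
    by rewrite /a rmorphM fmorphV (hdotC v u); congr (_ * _^-1).
  have -> : (nr u ^+ 2 - nr (hdot H u v) ^+ 2 / nr v ^+ 2)%:C =
      (nr u ^+ 2)%:C - hdot H u v * hdot H v u / (nr v ^+ 2)%:C :> C.
    by rewrite (hdotC v u) mulcJ -fmorphV -rmorphM -rmorphB.
  move: vv; rewrite aJ /a; move: ((nr u ^+ 2)%:C) ((nr v ^+ 2)%:C) => U n2 vv.
  by field.
rewrite /= subr_ge0 ler_pdivrMr ?exprn_gt0 ?lt_neqAle ?nr_ge0 ?andbT 1?eq_sym // -exprMn.
by rewrite ler_pXn2r ?nnegrE ?mulr_ge0 ?nr_ge0.
Qed.

Lemma hdot_suml (I : Type) (s : seq I) (F : I -> H) v :
  hdot H (\sum_(i <- s) F i) v = \sum_(i <- s) hdot H (F i) v.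
Proof. by rewrite linear_sumlz. Qed.

Lemma hdot_sumr (I : Type) (s : seq I) (F : I -> H) v :
  hdot H v (\sum_(i <- s) F i) = \sum_(i <- s) hdot H v (F i).
Proof. by rewrite linear_sumr. Qed.

Lemma hdot_liml x u v : nlim x u -> nlim (fun n => hdot H (x n) v) (hdot H u v).
Proof.
apply: (nlim_lipschitz (f := fun u => hdot H u v) (nr_ge0 v)) => w w'.
by rewrite -linearBl mulrC hdot_CS.
Qed.

(** Expanding the squared norms of differences shows that the sequence is Cauchy. *)
Lemma gram_limit (x : nat -> H) (c : C) :
  (forall eps : R, 0 < eps -> exists N, forall n m, (N <= n)%N -> (N <= m)%N ->
     nr (hdot H (x n) (x m) - c) <= eps) ->
  exists u, nlim x u.
Proof.
move=> h; apply: ncauchy => e e0.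
have e4 : 0 < e ^+ 2 / 4 by rewrite divr_gt0 ?exprn_gt0.
have [N hN] := h _ e4; exists N => n m Nn Nm.
rewrite -(@ler_pXn2r _ 2) ?nnegrE ?nr_ge0 ?(ltW e0) //.
have E : (nr (x n - x m) ^+ 2)%:C =
    (hdot H (x n) (x n) - c) - (hdot H (x n) (x m) - c) - ((hdot H (x m) (x n) - c) - (hdot H (x m) (x m) - c)).
  by rewrite -hdot_nr linearBl !linearBr /=; ring.
have -> : nr (x n - x m) ^+ 2 = nr ((nr (x n - x m) ^+ 2)%:C : C).
  by rewrite nrC ger0_norm // sqr_ge0.
rewrite E; apply: le_trans (nrB _ _) _.
have h1 := nrB (hdot H (x n) (x n) - c) (hdot H (x n) (x m) - c).
have h2 := nrB (hdot H (x m) (x n) - c) (hdot H (x m) (x m) - c).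
have := hN _ _ Nn Nn; have := hN _ _ Nn Nm; have := hN _ _ Nm Nn; have := hN _ _ Nm Nm.
lra.
Qed.

Section Basis.
Variable e : nat -> H.
Hypothesis he : orthonormal_basis e.

Definition partial u n := \sum_(k < n) hdot H u (e k) *: e k.

Lemma hdot_partial u n v : hdot H (partial u n) v = \sum_(k < n) hdot H u (e k) * ((hdot H v (e k))^*)%C.
Proof.
by rewrite hdot_suml; apply: eq_bigr => k _; rewrite hdotZl (hdotC (e k)).
Qed.

Lemma hdot_partial_basis u n j : hdot H (partial u n) (e j) = if (j < n)%N then hdot H u (e j) else 0.
Proof.
rewrite hdot_suml; under eq_bigr do rewrite hdotZl he.1.
case: ltnP => jn.
  rewrite (bigD1 (Ordinal jn)) //= eqxx mulr1 big1 ?addr0 // => k kj.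
  by rewrite (_ : (k == j :> nat) = false) ?mulr0 //; apply/negbTE.
rewrite big1 // => k _; rewrite (_ : (k == j :> nat) = false) ?mulr0 //.
by apply/negbTE; rewrite neq_ltn (leq_trans (ltn_ord k)).
Qed.

Lemma nr_partial u n : nr (partial u n) ^+ 2 = \sum_(k < n) nr (hdot H u (e k)) ^+ 2.
Proof.
apply: complexI; rewrite -hdot_nr hdot_partial rmorph_sum; apply: eq_bigr => k _ /=.
by rewrite hdot_partial_basis ltn_ord mulcJ.
Qed.

Lemma bessel u n : \sum_(k < n) nr (hdot H u (e k)) ^+ 2 <= nr u ^+ 2.
Proof.
rewrite -nr_partial; have h : hdot H (partial u n) u = (nr (partial u n) ^+ 2)%:C.
  rewrite hdot_partial nr_partial rmorph_sum; apply: eq_bigr => k _ /=.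
  by rewrite mulcJ.
have := hdot_CS (partial u n) u; rewrite h nrC ger0_norm ?sqr_ge0 //.
have := nr_ge0 (partial u n); have := nr_ge0 u; nra.
Qed.

Lemma parseval u : nlim (partial u) u.
Proof.
pose S n := \sum_(k < n) nr (hdot H u (e k)) ^+ 2.
have Sm n m : (n <= m)%N -> S n <= S m.
  by move=> /subnK <-; rewrite addnC /S big_split_ord /= lerDl sumr_ge0 // => k _; rewrite sqr_ge0.
have hsup : has_sup (range S).
  by split; [exists (S 0%N); exists 0%N|exists (nr u ^+ 2) => _ [n _ <-]; exact: bessel].
have dist n m : (n <= m)%N -> nr (partial u m - partial u n) ^+ 2 = S m - S n.
  move=> nm; apply: complexI; rewrite -hdot_nr linearBl !linearBr /= !hdot_partial.
  have E k l : \sum_(i < k) hdot H u (e i) * ((hdot H (partial u l) (e i))^*)%C = (S (minn k l))%:C.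
    rewrite /S !rmorph_sum -(big_mkord xpredT (fun i => hdot H u (e i) * ((hdot H (partial u l) (e i))^*)%C)).
    rewrite -(big_mkord xpredT (fun i => (nr (hdot H u (e i)) ^+ 2)%:C)).
    rewrite (@big_cat_nat _ _ _ (minn k l)) ?geq_minl //= [X in _ + X]big_nat_cond [X in _ + X]big1 ?addr0.
      rewrite big_nat_cond [RHS]big_nat_cond; apply: eq_bigr => i /andP[/andP[_ ik] _].
      by rewrite hdot_partial_basis (leq_trans ik) ?geq_minr // mulcJ.
    move=> i /andP[/andP[ki ik] _]; rewrite hdot_partial_basis ifF ?rmorph0 ?mulr0 //; lia.
  rewrite !E !minnn (minn_idPr nm) (minn_idPl nm) !rmorphB /=; ring.
have [v hv] : exists v, nlim (partial u) v.
  apply: ncauchy => eps e0; have [_ [N _ <-] hN] := @sup_adherent _ _ (eps ^+ 2) (exprn_gt0 _ e0) hsup.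
  have key n m : (N <= n)%N -> (n <= m)%N -> nr (partial u m - partial u n) <= eps.
    move=> Nn nm; rewrite -(@ler_pXn2r _ 2) ?nnegrE ?nr_ge0 ?(ltW e0) // dist //.
    have := Sm _ _ Nn; have : S m <= sup (range S) by apply: ub_le_sup; [exact: hsup.2|exists m].
    by move: hN; lra.
  exists N => n m Nn Nm; case: (leqP n m) => nm; last exact: key (ltnW nm).
  by rewrite nr_dist key.
suff E : v = u by move: hv; rewrite E.
apply/eqP; rewrite -subr_eq0; apply/eqP; apply: he.2 => n.
rewrite linearBl; apply/eqP; rewrite subr_eq0; apply/eqP.
apply: nlim_unique (hdot_liml (e n) hv) _.
move=> eps e0; exists n.+1 => m nm; rewrite hdot_partial_basis nm subrr nr0 ltW //.
Qed.

Lemma parseval_dot u v : nlim (fun n => \sum_(k < n) hdot H u (e k) * ((hdot H v (e k))^*)%C) (hdot H u v).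
Proof. by have := hdot_liml v (parseval u); under eq_fun do rewrite hdot_partial. Qed.

Lemma parseval_dot_bound u v n :
  nr (\sum_(k < n) hdot H u (e k) * ((hdot H v (e k))^*)%C) <= nr u * nr v.
Proof.
rewrite -hdot_partial; apply: le_trans (hdot_CS _ _) _; rewrite ler_wpM2r ?nr_ge0 //.
by rewrite -(@ler_pXn2r _ 2) ?nnegrE ?nr_ge0 // nr_partial bessel.
Qed.

End Basis.
End Hilbert.

(** * The monomial basis of a unitarily invariant space *)

Section Multinomial.
Variables (F : fieldType) (d : nat).
Hypothesis char0 : forall n, n.+1%:R != 0 :> F.
Local Notation mpol := (mpoly.mpoly d F).
Implicit Types m : multinom d.

Definition mfact m := (\prod_i (m i)`!)%N.

Lemma mfact_gt0 m : (0 < mfact m)%N.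
Proof. by apply: prodn_gt0 => i; exact: fact_gt0. Qed.

Lemma mfact_add1 m i : mfact (mnm_add m (mnm1 i)) = ((m i).+1 * mfact m)%N.
Proof.
rewrite /mfact (bigD1 i) //= [in RHS](bigD1 i) //= mulnA; congr (_ * _)%N.
  by rewrite mnmDE mnm1E eqxx addn1 factS.
by apply: eq_bigr => j ji; rewrite mnmDE mnm1E eq_sym (negbTE ji) addn0.
Qed.

Lemma mnm_pred m : m != mnm0 -> exists i m', m = mnm_add m' (mnm1 i).
Proof.
move=> m0; have [i mi] : exists i, m i != 0%N.
  apply/existsP; apply: contraR m0; rewrite negb_exists => /forallP h.
  by apply/eqP/mnmP => i; rewrite mnm0E; apply/eqP; have := h i; rewrite negbK.
exists i, (mnm_sub m (mnm1 i)); apply/mnmP => j; rewrite mnmDE mnmBE mnm1E.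
by case: eqP => [<-|_]; [rewrite subnK // lt0n|rewrite subn0 addn0].
Qed.

Lemma mderiv_sumX i n : mderiv i ((\sum_j mpolyX F (mnm1 j)) ^+ n.+1 : mpol) =
  n.+1%:R *: (\sum_j mpolyX F (mnm1 j)) ^+ n.
Proof.
set s := \sum_j _; have ds : mderiv i s = 1.
  rewrite /s linear_sum /= (bigD1 i) //= mderivX mnm1E eqxx scale1r.
  rewrite (_ : mnm_sub _ _ = mnm0); last by apply/mnmP => j; rewrite mnmBE subnn mnm0E.
  rewrite mpolyX0 big1 ?addr0 // => j ji; rewrite mderivX mnm1E (negbTE ji) scale0r //.
elim: n => [|n IH]; first by rewrite expr1 ds scale1r expr0.
have -> : mderiv i (s ^+ n.+2) = s ^+ n.+1 + n.+1%:R *: s ^+ n.+1.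
  by rewrite [s ^+ n.+2]exprS mderivM ds IH mul1r -scalerAr -exprS.
by rewrite -[n.+2]addn1 natrD scalerDl scale1r addrC.
Qed.

(** The multinomial theorem, by differentiation. *)
Lemma mcoeff_sumX n m : mcoeff m ((\sum_j mpolyX F (mnm1 j)) ^+ n : mpol) =
  if mdeg m == n then (n`!)%:R / (mfact m)%:R else 0.
Proof.
elim: n m => [|n IH] m.
  rewrite expr0 mcoeff1 mdeg_eq0; case: eqP => // ->.
  by rewrite /mfact big1 ?divr1 // => i _; rewrite mnm0E.
have [->|] := eqVneq m mnm0.
  rewrite mdeg0 /= exprS (mcoeff0_is_multiplicative _ _).1 (_ : mcoeff _ _ = 0) ?mul0r //.
  rewrite linear_sum /= big1 // => j _; rewrite mcoeffX; case: eqP => // /mnmP/(_ j).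
  by rewrite mnm1E eqxx mnm0E.
move=> /mnm_pred[i [m' ->]]; have := mcoeff_mderiv i ((\sum_j mpolyX F (mnm1 j)) ^+ n.+1) m'.
rewrite mderiv_sumX mcoeffZ IH mdegD mdeg1 addn1 eqSS mfact_add1 => h.
apply: (mulIf (char0 (m' i))); rewrite mulr_natr -h; case: eqP => [_|_]; last by rewrite mulr0 mul0r.
have c0 : (mfact m')%:R != 0 :> F by rewrite -(prednK (mfact_gt0 m')).
rewrite factS !natrM invfM -!mulrA; congr (_ * (_ * _)).
by rewrite [X in _ = _ * X]mulrC mulKf.
Qed.

Lemma multinomial (x : 'I_d -> F) n : (\sum_i x i) ^+ n =
  \sum_(m : bmultinom d n.+1 | mdeg m == n) (n`!)%:R / (mfact m)%:R * \prod_i x i ^+ m i.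
Proof.
have -> : (\sum_i x i) ^+ n = meval x ((\sum_j mpolyX F (mnm1 j)) ^+ n).
  rewrite rmorphXn rmorph_sum /=; congr (_ ^+ _); apply: eq_bigr => i _.
  rewrite mevalX (bigD1 i) //= mnm1E eqxx expr1 big1 ?mulr1 // => j ji.
  by rewrite mnm1E eq_sym (negbTE ji) expr0.
set Q : mpol := _ ^+ n; have sz : (msize Q <= n.+1)%N.
  rewrite msizeE; apply/bigmax_leqP_seq => m; rewrite mcoeff_msupp mcoeff_sumX => mQ _.
  by case: ifP mQ => [/eqP ->//|_]; rewrite eqxx.
rewrite (mpolywE sz) raddf_sum /= [RHS]big_mkcond; apply: eq_bigr => m _ /=.
rewrite mevalZ mevalX mcoeff_sumX; case: eqP => _ //; by rewrite mul0r.
Qed.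

End Multinomial.

Lemma cdot_nrm2 (R : realType) (d : nat) (v : 'rV[R[i]^o]_d) :
  cdot v v = (nrm2 (fun i => v 0 i))%:C.
Proof. by rewrite /cdot /nrm2 rmorph_sum; apply: eq_bigr => i _ /=; rewrite mulcJ. Qed.

Section Kernel.
Variables (R : realType) (D : nat).
Local Notation C := R[i].
Local Notation T := (unit_ball R D.+1).
Local Notation mpol := (mpoly.mpoly D.+1 C).
Variable H : hilbertFunctionSpace R T.
Variables (a : nat -> R) (K : T -> T -> C).
Hypothesis a_gt0 : forall n, 0 < a n.
Hypothesis K_series : forall z w : T, series (fun n => (a n)%:C * cdot (val z) (val w) ^+ n : C^o) @ \oo --> (K z w : C^o).
Hypothesis K_kernel : reproducing_kernel H K.
Implicit Types (z w : T) (p q : mpol) (m : multinom D.+1).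

Definition coords z : 'I_D.+1 -> C := fun i => val z 0 i.

Lemma coords_lt1 z : nrm2 (coords z) < 1.
Proof. by have := set_valP z; rewrite /unit_ball /= cdot_nrm2 -(ltcR _ 1). Qed.

Lemma ball_point (v : 'I_D.+1 -> C) : nrm2 v < 1 -> exists z, coords z = v.
Proof.
move=> v1; have vB : (\row_i v i : 'rV[C^o]_D.+1) \in T.
  apply/mem_set; rewrite /unit_ball /= cdot_nrm2 -(ltcR _ 1) in v1 *.
  by congr (_ < _): v1; congr (_%:C); apply: eq_bigr => i _; rewrite mxE.
by exists (SigSub vB); apply/funext => i; rewrite /coords /= mxE.
Qed.

Lemma coords_inj z w : coords z = coords w -> z = w.
Proof. by move=> h; apply/val_inj/rowP => i; have := congr1 (fun f => f i) h. Qed.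

Lemma cdot_coords z w : cdot (val z) (val w) = \sum_i coords z i * ((coords w i)^*)%C.
Proof. by []. Qed.

Lemma cdot_lt1 z w : exists2 r, nr (cdot (val z) (val w)) <= r & 0 <= r < 1.
Proof.
exists ((nrm2 (coords z) + nrm2 (coords w)) / 2); last first.
  have := coords_lt1 z; have := coords_lt1 w.
  by have := nrm2_ge0 (coords z); have := nrm2_ge0 (coords w); lra.
rewrite cdot_coords; apply: le_trans (nr_sum _ _ _) _.
rewrite /nrm2 -big_split /= mulr_suml; apply: ler_sum => i _.
by rewrite nrM nr_conj; have := sqr_ge0 (nr (coords z i) - nr (coords w i)); lra.
Qed.

Lemma cdot_scale z w w' (c : C) : coords w' = (fun i => c * coords w i) ->
  cdot (val z) (val w') = (c^*)%C * cdot (val z) (val w).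
Proof.
move=> h; rewrite !cdot_coords mulr_sumr h; apply: eq_bigr => i _.
by rewrite rmorphM /= mulrCA.
Qed.

Lemma rotate w (c : C) : nr c = 1 -> exists w', coords w' = (fun i => c * coords w i).
Proof.
move=> c1; apply: ball_point; apply: le_lt_trans (coords_lt1 w).
by apply: ler_sum => i _; rewrite nrM c1 mul1r.
Qed.

Definition small_tail (r : R) N eps := forall M, \sum_(N <= l < M) a l * r ^+ l <= eps.

Lemma tail_exists r eps : 0 <= r -> r < 1 -> 0 < eps ->
  exists N, forall n, (N <= n)%N -> small_tail r n eps.
Proof.
move=> r0 r1 e0; pose v (i : 'I_D.+1) : C := if i == ord0 then (Num.sqrt r)%:C else 0.
have vE : nrm2 v = r.
  rewrite /nrm2 (bigD1 ord0) //= big1 /v ?eqxx ?addr0 => [|i /negbTE ->]; last by rewrite nr0 expr0n.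
  by rewrite nrC real_normK ?num_real // sqr_sqrtr.
have [z zE] : exists z, coords z = v by apply: ball_point; rewrite vE.
have := @K_series z z; rewrite cdot_nrm2 -/(coords z) zE vE => /nlim_cvg /(_ (eps / 2)).
rewrite divr_gt0 // => /(_ isT)[N hN]; exists N => n Nn M.
have [nM|Mn] := leqP n M; last by rewrite big_geq ?(ltW e0) // ltnW.
have : nr (\sum_(n <= l < M) (a l)%:C * r%:C ^+ l) <= eps.
  have -> : \sum_(n <= l < M) (a l)%:C * r%:C ^+ l =
     (series (fun n => (a n)%:C * r%:C ^+ n) M - K z z) - (series (fun n => (a n)%:C * r%:C ^+ n) n - K z z) :> C.
    by rewrite opprB subrKA /series /= (@big_cat_nat _ _ _ n 0 M) //= addrAC subrr add0r.
  by apply: le_trans (nrB _ _) _; rewrite [leRHS](splitr eps) lerD // hN // (leq_trans Nn).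
have -> : \sum_(n <= l < M) (a l)%:C * r%:C ^+ l = (\sum_(n <= l < M) a l * r ^+ l)%:C :> C.
  by rewrite rmorph_sum; apply: eq_bigr => l _; rewrite rmorphM rmorphXn.
by rewrite nrC; apply: le_trans; exact: ler_norm.
Qed.

(** Averaging the kernel over rotations by roots of unity isolates the degrees
    congruent to [n]. *)
Lemma averaged_kernel w n N (u : C) : N.-primitive_root u -> (n < N)%N ->
  exists x : H,
    (forall v s, (forall j : 'I_N, coords (s j) = (fun i => u ^+ j * coords w i)) ->
       hdot H v x = N%:R^-1 * \sum_(j < N) ((u ^+ (n * j))^*)%C * hev H v (s j)) /\
    (forall z r eps, nr (cdot (val z) (val w)) <= r -> small_tail r N eps ->
       nr (hev H x z - (a n)%:C * cdot (val z) (val w) ^+ n) <= eps).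
Proof.
move=> hu nN; have N0 : (0 < N)%N by case: N hu nN.
have u1 := nr_prim_root hu.
have /choice[s hs] : forall j : 'I_N, exists w', coords w' = (fun i => u ^+ j * coords w i).
  by move=> j; apply: rotate; rewrite nrX u1 expr1n.
have /choice[k hk] := K_kernel.
have sE z j : cdot (val z) (val (s j)) = ((u ^+ j)^*)%C * cdot (val z) (val w) by apply: cdot_scale; rewrite hs.
exists (N%:R^-1 *: \sum_(j < N) u ^+ (n * j) *: k (s j)); split=> [v s' hs'|z r eps zr tl].
  rewrite hdotZr hdot_sumr fmorphV rmorph_nat; congr (_ * _); apply: eq_bigr => j _.
  by rewrite hdotZr -(hk _).2 (_ : s j = s' j) //; apply: coords_inj; rewrite hs hs'.
set b := cdot _ _ in zr *.
have lim : nlim (fun L => \sum_(l < L) (a l)%:C * b ^+ l * (l %% N == n)%N%:R)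
   (hev H (N%:R^-1 *: \sum_(j < N) u ^+ (n * j) *: k (s j)) z).
  have -> : hev H (N%:R^-1 *: \sum_(j < N) u ^+ (n * j) *: k (s j)) z =
     N%:R^-1 * \sum_(j < N) u ^+ (n * j) * K z (s j).
    rewrite linearZ linear_sum /= (_ : forall (c : C) (g : T -> C^o), (c *: g) z = c * g z) //.
    congr (_ * _); rewrite (_ : forall F : 'I_N -> (T -> C^o), (\sum_j F j) z = \sum_j F j z); last first.
      by move=> F; elim/big_ind2: _ => // f1 f2 y1 y2 <- <-.
    by apply: eq_bigr => j _; rewrite linearZ -(hk _).1.
  have := nlimM N%:R^-1 (nlim_sum (index_enum 'I_N) (fun j => nlimM (u ^+ (n * j)) ((nlim_cvg _ _).1 (@K_series z (s j))))).
  congr nlim; apply/funext => L; rewrite /series /=.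
  under eq_bigr => j _ do rewrite big_mkord mulr_sumr.
  rewrite exchange_big mulr_sumr; apply: eq_bigr => l _ /=.
  have E (j : 'I_N) : u ^+ (n * j) * ((a l)%:C * cdot (val z) (val (s j)) ^+ l) =
     (a l)%:C * b ^+ l * (u ^+ (n * j) * ((u ^+ (l %% N * j))^*)%C).
    have -> : u ^+ (l %% N * j) = u ^+ j ^+ l.
      by rewrite mulnC exprM expr_mod // exprAC (prim_expr_order hu) expr1n.
    by rewrite sE exprMn [in RHS]rmorphXn -/b; ring.
  under eq_bigr => j _ do rewrite E.
  rewrite -mulr_sumr (prim_root_orth hu nN (ltn_pmod l N0)) eq_sym; field.
  by rewrite pnatr_eq0 -lt0n.
set y := hev H _ z in lim *; have := nlimD lim (nlim_cst (- ((a n)%:C * b ^+ n))).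
move/nlim_bound; apply; exists N => L NL.
rewrite -(big_mkord xpredT (fun l => (a l)%:C * b ^+ l * (l %% N == n)%N%:R)) (@big_cat_nat _ _ _ N) //=.
have -> : \sum_(0 <= l < N) (a l)%:C * b ^+ l * (l %% N == n)%N%:R = (a n)%:C * b ^+ n.
  rewrite big_mkord (bigD1 (Ordinal nN)) //= modn_small // eqxx mulr1 big1 ?addr0 // => l ln.
  by rewrite modn_small // (_ : (l == n :> nat) = false) ?mulr0 //; apply/negbTE.
rewrite addrAC subrr add0r; apply: le_trans (nr_sum _ _ _) (le_trans _ (tl L)).
apply: ler_sum => l _; rewrite !nrM nrC nrX ger0_norm ?(ltW (a_gt0 _)) // -mulrA ler_wpM2l ?(ltW (a_gt0 _)) //.
rewrite nr_nat; apply: le_trans (_ : nr b ^+ l <= _); first by rewrite ler_piMr ?exprn_ge0 ?nr_ge0 //; case: eqP.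
by rewrite lerXn2r ?nnegrE ?nr_ge0 // (le_trans (nr_ge0 b)).
Qed.

Definition homog (v : H) (n : nat) := forall z z' (c : C), nr c = 1 ->
  coords z' = (fun i => c * coords z i) -> hev H v z' = c ^+ n * hev H v z.

(** The homogeneous parts of the kernel functions are limits of such averages. *)
Lemma kernel_part w n : exists x : H,
  (forall z, hev H x z = (a n)%:C * cdot (val z) (val w) ^+ n) /\
  (forall v (m : nat), homog v m -> hdot H v x = (m == n)%:R * hev H v w).
Proof.
have /choice[u hu] : forall N, exists u : C, (N + n).+1.-primitive_root u.
  by move=> N; exact: prim_root_exists.
have /choice[x hx] := fun N => averaged_kernel w (hu N) (ltac:(lia) : (n < (N + n).+1)%N).
have homx N v (m : nat) : (m < (N + n).+1)%N -> homog v m -> hdot H v (x N) = (m == n)%:R * hev H v w.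
  move=> mN hv; have u1 := nr_prim_root (hu N).
  have /choice[s hs] : forall j : 'I_(N + n).+1, exists w', coords w' = (fun i => u N ^+ j * coords w i).
    by move=> j; apply: rotate; rewrite nrX u1 expr1n.
  rewrite ((hx N).1 v s hs).
  under eq_bigr => j _ do rewrite (hv w (s j) (u N ^+ j)) ?nrX ?u1 ?expr1n // -exprM mulrA (mulnC j m) [X in X * _]mulrC.
  have nN : (n < (N + n).+1)%N by lia.
  by rewrite -mulr_suml (prim_root_orth (hu N) mN nN) mulrA mulKf // pnatr_eq0.
have lim_hev z : nlim (fun N => hev H (x N) z) ((a n)%:C * cdot (val z) (val w) ^+ n).
  move=> e e0; have [r zr /andP[r0 r1]] := cdot_lt1 z w.
  have [N hN] := tail_exists r0 r1 e0; exists N => M NM.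
  by apply: (hx M).2 zr (hN _ _); lia.
have [y hy] : exists y, nlim x y.
  apply: (@gram_limit _ _ _ x ((a n)%:C * (nrm2 (coords w))%:C ^+ n)) => e e0.
  have [N hN] := tail_exists (nrm2_ge0 (coords w)) (coords_lt1 w) e0; exists N => n1 n2 Nn1 Nn2.
  have u1 := nr_prim_root (hu n2).
  have /choice[s hs] : forall j : 'I_(n2 + n).+1, exists w', coords w' = (fun i => u n2 ^+ j * coords w i).
    by move=> j; apply: rotate; rewrite nrX u1 expr1n.
  rewrite ((hx n2).1 _ s hs); set M := (n2 + n).+1.
  have M0 : M%:R != 0 :> C by rewrite pnatr_eq0.
  set c := (a n)%:C * _.
  have sw j : cdot (val (s j)) (val w) = u n2 ^+ j * (nrm2 (coords w))%:C.
    rewrite -cdot_nrm2 !cdot_coords mulr_sumr; apply: eq_bigr => i _; rewrite hs mulrA //.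
  have -> : M%:R^-1 * \sum_(j < M) ((u n2 ^+ (n * j))^*)%C * hev H (x n1) (s j) - c =
    M%:R^-1 * \sum_(j < M) ((u n2 ^+ (n * j))^*)%C * (hev H (x n1) (s j) - (a n)%:C * cdot (val (s j)) (val w) ^+ n).
    under [in RHS]eq_bigr => j _ do rewrite mulrBr.
    rewrite sumrB mulrBr; congr (_ - _).
    have E (j : 'I_M) : ((u n2 ^+ (n * j))^*)%C * ((a n)%:C * cdot (val (s j)) (val w) ^+ n) = c.
      rewrite sw exprMn -exprM (mulnC j) /c mulrCA; congr (_ * _); rewrite mulrA [_^*%C * _]mulrC nr1_conj ?mul1r //.
      by rewrite nrX u1 expr1n.
    under eq_bigr => j _ do rewrite E.
    by rewrite sumr_const card_ord -[c *+ _]mulr_natl mulKf.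
  rewrite nrM nrV nr_nat mulrC ler_pdivrMr ?ltr0n //; apply: le_trans (nr_sum _ _ _) _.
  rewrite mulr_natr -[X in _ *+ X](card_ord M) -sumr_const; apply: ler_sum => j _.
  rewrite nrM nr_conj nrX u1 expr1n mul1r; apply: (hx n1).2 (nrm2 (coords w)) _ _ _.
    by rewrite sw nrM nrX u1 expr1n mul1r nrC ger0_norm // nrm2_ge0.
  by apply: hN; lia.
exists y; split=> [z|v m hv].
  have [k [_ hk]] := K_kernel z; rewrite hk; apply: nlim_unique (hdot_liml k hy) _.
  by have := lim_hev z; under eq_fun do rewrite hk.
rewrite hdotC; apply: (nlim_unique (x := fun N => ((hdot H (x (N + m)%N) v)^*)%C)).
  have := nlim_shift m (hdot_liml v hy); apply: (nlim_lipschitz (f := fun c : C => (c^*)%C) ler01).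
  by move=> c c'; rewrite -rmorphB nr_conj mul1r.
under eq_fun do rewrite -hdotC.
by move=> e e0; exists 0%N => N _; rewrite (homx _ _ m) ?subrr ?nr0 ?ltW //; lia.
Qed.

Lemma hevD u v z : hev H (u + v) z = hev H u z + hev H v z.
Proof. by rewrite linearD. Qed.

Lemma hevZ (c : C) v z : hev H (c *: v) z = c * hev H v z.
Proof. by rewrite linearZ. Qed.

Lemma hev_sum (I : Type) (s : seq I) (P : pred I) (F : I -> H) z :
  hev H (\sum_(i <- s | P i) F i) z = \sum_(i <- s | P i) hev H (F i) z.
Proof.
elim/big_rec2: _ => [|i y x _ <-]; first by rewrite linear0.
by rewrite hevD.
Qed.

(** Squared norms of the monomials. *)
Definition space_weight (m : multinom D.+1) : R := (mfact m)%:R / ((mdeg m)`!%:R * a (mdeg m)).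

Lemma space_weight_gt0 m : 0 < space_weight m.
Proof. by rewrite divr_gt0 ?mulr_gt0 ?ltr0n ?mfact_gt0 ?fact_gt0. Qed.

Lemma homog_monomial (v : H) (m : multinom D.+1) : (forall z, hev H v z = \prod_i coords z i ^+ m i) -> homog v (mdeg m).
Proof.
move=> h z z' c c1 zz'; rewrite !h zz'; under eq_bigr => i _ do rewrite exprMn.
by rewrite big_split /= prodrXr mdegE.
Qed.

Lemma charC0 n : n.+1%:R != 0 :> C.
Proof. by rewrite pnatr_eq0. Qed.

(** Averaging homogeneous parts of kernel functions over a small torus, against a
    character of the torus, isolates a multiple of the monomial. *)
Lemma monomial_exists (m : multinom D.+1) : exists e : H,
  (forall z, hev H e z = \prod_i coords z i ^+ m i) /\
  (forall v (m' : multinom D.+1), (forall z, hev H v z = \prod_i coords z i ^+ m' i) ->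
     hdot H v e = (space_weight m)%:C * (m' == m)%:R).
Proof.
set n := mdeg m; have [u hu] := @prim_root_exists R n.+1 isT; have u1 := nr_prim_root hu.
(* The radii need only place the torus inside the ball. *)
pose rho : R := D.+2%:R^-1.
have rho0 : 0 < rho by rewrite invr_gt0 ltr0n.
have mn m' i : (mdeg m' <= n)%N -> (m' i < n.+1)%N.
  by rewrite ltnS; apply: leq_trans; rewrite mdegE (bigD1 i) //= leq_addr.
have /choice[w hw] : forall t : {ffun 'I_D.+1 -> 'I_n.+1}, exists w, coords w = (fun i => u ^+ t i * rho%:C).
  move=> t; apply: ball_point; rewrite /nrm2.
  under eq_bigr => i _ do rewrite nrM nrX u1 expr1n mul1r nrC ger0_norm ?(ltW rho0) //.
  rewrite sumr_const card_ord -[_ *+ _]mulr_natr.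
  have D2 : D.+2%:R = D.+1%:R + 1 :> R by rewrite natr1.
  have D0 : 0 < D.+1%:R :> R by rewrite ltr0n.
  rewrite /rho exprVn mulrC ltr_pdivrMr ?exprn_gt0 ?ltr0n // mul1r D2.
  by have := sqr_ge0 (D.+1%:R : R); lra.
have /choice[k hk] := fun t => kernel_part (w t) n.
pose gam : C := (n`!)%:R / (mfact m)%:R.
have g0 : gam != 0 by rewrite mulf_neq0 ?invr_eq0 // pnatr_eq0 -lt0n ?fact_gt0 ?mfact_gt0.
have aC0 : (a n)%:C != 0 :> C by rewrite -[0]/(0%:C) (inj_eq (@complexI R)) gt_eqF.
have N0 : (n.+1 ^ D.+1)%:R != 0 :> C by rewrite pnatr_eq0 expn_eq0.
have r0 : rho%:C != 0 :> C by rewrite -[0]/(0%:C) (inj_eq (@complexI R)) gt_eqF.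
pose c : C := (n.+1 ^ D.+1)%:R * ((a n)%:C * gam * rho%:C ^+ n).
have cJ : (c^*)%C = c.
  have -> : c = ((n.+1 ^ D.+1)%:R * (a n * ((n`!)%:R / (mfact m)%:R) * rho ^+ n))%:C.
    rewrite /c /gam [RHS]rmorphM rmorph_nat; congr (_ * _).
    rewrite [RHS]rmorphM; congr (_ * _); last by rewrite rmorphXn.
    by rewrite [RHS]rmorphM; congr (_ * _); rewrite fmorph_div !rmorph_nat.
  exact: conjc_real.
have c0 : c != 0.
  by apply: mulf_neq0 => //; apply: mulf_neq0; [exact: mulf_neq0|exact: expf_neq0].
have rnE (m' : multinom D.+1) : mdeg m' = n -> rho%:C ^+ n = \prod_i rho%:C ^+ m' i.
  by move=> <-; rewrite mdegE -prodrXr.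
pose th (t : {ffun 'I_D.+1 -> 'I_n.+1}) : C := \prod_i u ^+ (m i * t i).
exists (c^-1 *: \sum_t th t *: k t); split=> [z|v m' hv].
  rewrite hevZ hev_sum; apply: (canLR (mulKf _)); first exact: c0.
  have E0 t : hev H (th t *: k t) z = \sum_(m' : bmultinom D.+1 n.+1 | mdeg m' == n)
      th t * ((a n)%:C * ((n`!)%:R / (mfact m')%:R * \prod_i (coords z i * ((coords (w t) i)^*)%C) ^+ m' i)).
    by rewrite hevZ (hk t).1 cdot_coords (multinomial charC0) !mulr_sumr.
  rewrite (eq_bigr _ (fun t _ => E0 t)).
  have E (m' : multinom D.+1) t : mdeg m' = n ->
      th t * ((a n)%:C * ((n`!)%:R / (mfact m')%:R * \prod_i (coords z i * ((coords (w t) i)^*)%C) ^+ m' i)) =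
      (\prod_i (u ^+ (m i * t i) * ((u ^+ (m' i * t i))^*)%C)) *
      ((a n)%:C * ((n`!)%:R / (mfact m')%:R) * rho%:C ^+ n * \prod_i coords z i ^+ m' i).
    move=> dm'; have P : th t * \prod_i (coords z i * ((coords (w t) i)^*)%C) ^+ m' i =
      (\prod_i (u ^+ (m i * t i) * ((u ^+ (m' i * t i))^*)%C)) * (rho%:C ^+ n * \prod_i coords z i ^+ m' i).
      rewrite (rnE _ dm') -!big_split /=; apply: eq_bigr => i _.
      have -> : ((coords (w t) i)^*)%C = ((u ^+ t i)^*)%C * rho%:C.
        by rewrite hw rmorphM; congr (_ * _); exact: conjc_real.
      by rewrite !exprMn -rmorphXn -exprM [(t i * m' i)%N]mulnC; ring.
    move: P; set X := \prod_i (_ * _) ^+ _; set Y := \prod_i (_ * _); set Z := \prod_i coords _ _ ^+ _ => P.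
    set g := _ / _; rewrite (_ : th t * ((a n)%:C * (g * X)) = (a n)%:C * g * (th t * X)); last by ring.
    by rewrite P; ring.
  rewrite exchange_big /= (bigD1 (BMultinom (ltnSn n : (mdeg m < n.+1)%N))) //= [X in _ + X]big1 ?addr0.
    rewrite (eq_bigr _ (fun t _ => E m t erefl)).
    by rewrite -mulr_suml (torus_orth hu) ?eqxx ?mulr1 => [|i|i]; rewrite ?mn // /c mulrA.
  move=> m' /andP[/eqP dm' mm']; rewrite (eq_bigr _ (fun t _ => E _ t dm')).
  rewrite -mulr_suml (torus_orth hu) => [|i|i]; rewrite ?mn ?dm' //.
  rewrite (_ : (m == m') = false) ?mulr0 ?mul0r //.
  by apply: contraNF mm' => /eqP h; apply/eqP/val_inj; rewrite /= -h.
have cVJ : ((c^-1)^*)%C = c^-1 by rewrite fmorphV; congr (_^-1).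
rewrite hdotZr cVJ hdot_sumr.
have E0 t : hdot H v (th t *: k t) = ((th t)^*)%C * ((mdeg m' == n)%:R * hev H v (w t)).
  by rewrite hdotZr ((hk t).2 _ _ (homog_monomial hv)).
rewrite (eq_bigr _ (fun t _ => E0 t)).
have [dm|dm] := eqVneq (mdeg m') n; last first.
  under eq_bigr do rewrite mul0r mulr0.
  rewrite big1 // mulr0 (_ : (m' == m) = false) ?mulr0 //.
  by apply: contraNF dm => /eqP ->.
have E (t : {ffun 'I_D.+1 -> 'I_n.+1}) : ((th t)^*)%C * (1%:R * hev H v (w t)) =
   (\prod_i (u ^+ (m' i * t i) * ((u ^+ (m i * t i))^*)%C)) * rho%:C ^+ n.
  rewrite hv mul1r /th rmorph_prod (rnE _ dm) -!big_split /=; apply: eq_bigr => i _.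
  by rewrite hw exprMn -exprM [(t i * m' i)%N]mulnC; ring.
under eq_bigr => t _ do rewrite E.
rewrite -mulr_suml (torus_orth hu) => [|i|i]; rewrite ?mn ?dm //.
have [_|_] := eqVneq m' m; last by rewrite !mulr0 mul0r mulr0.
have f0 : (n`!)%:R != 0 :> C by rewrite pnatr_eq0 -lt0n fact_gt0.
have m0 : (mfact m)%:R != 0 :> C by rewrite pnatr_eq0 -lt0n mfact_gt0.
have rn : rho%:C ^+ n != 0 by rewrite expf_neq0.
have -> : (space_weight m)%:C = (mfact m)%:R / ((n`!)%:R * (a n)%:C) :> C.
  by rewrite /space_weight fmorph_div rmorphM !rmorph_nat.
rewrite /c /gam.
have alg (x1 x2 x3 x4 x5 : C) : x1 != 0 -> x2 != 0 -> x3 != 0 -> x4 != 0 -> x5 != 0 ->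
    (x2 * (x3 * (x4 / x5) * x1))^-1 * (x2 * x1) = x5 / (x4 * x3).
  by move=> h1 h2 h3 h4 h5; field; rewrite h1 h2 h3 h4 h5.
by rewrite !mulr1; exact: alg.
Qed.

Section Embedding.
Variable e : multinom D.+1 -> H.
Hypothesis e_hev : forall m z, hev H (e m) z = \prod_i coords z i ^+ m i.

Definition embed p : H := \sum_(m <- msupp p) mcoeff m p *: e m.

Lemma hev_embed p z : hev H (embed p) z = meval (coords z) p.
Proof.
by rewrite hev_sum mevalE; apply: eq_bigr => m _; rewrite hevZ e_hev.
Qed.

Lemma embed_linear : linear embed.
Proof.
move=> c p q; apply: (hev_inj (h := H)); apply/funext => z.
by rewrite hevD hevZ !hev_embed mevalD mevalZ.
Qed.

HB.instance Definition _ := GRing.isLinear.Build C mpol H _ embed embed_linear.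

Lemma embedX m : embed (mpolyX C m) = e m.
Proof. by rewrite /embed msuppX big_seq1 mcoeffX eqxx scale1r. Qed.

End Embedding.

(** A regular unitarily invariant space is a weighted space of power series, in
    which the monomials are complete and orthogonal. *)
Lemma monomial_model : exists iota : {linear mpol -> H},
  [/\ forall p z, hev H (iota p) z = meval (coords z) p,
      forall m m', hdot H (iota (mpolyX C m)) (iota (mpolyX C m')) = (space_weight m)%:C * (m == m')%:R &
      forall u, (forall m, hdot H u (iota (mpolyX C m)) = 0) -> u = 0].
Proof.
have /choice[e he] := monomial_exists.
have e_hev m z : hev H (e m) z = \prod_i coords z i ^+ m i by exact: (he m).1.
exists (embed e); split=> [p z|m m'|u hu]; first exact: hev_embed.
  rewrite /= !embedX ((he m').2 (e m) m (e_hev m)).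
  by have [->|_] := eqVneq m m'; rewrite ?mulr0.
apply: (hev_inj (h := H)); apply/funext => w; rewrite [RHS](_ : _ = 0); last by rewrite linear0.
have [k [hk hkw]] := K_kernel w; rewrite hkw.
have /choice[kap hkap] := fun n => kernel_part w n.
have kapE n : hdot H u (kap n) = 0.
  pose P : mpol := \sum_(m : bmultinom D.+1 n.+1 | mdeg m == n)
    ((a n)%:C * ((n`!)%:R / (mfact m)%:R) * \prod_i ((coords w i)^*)%C ^+ m i) *: mpolyX C m.
  have -> : kap n = embed e P.
    apply: (hev_inj (h := H)); apply/funext => z; rewrite hev_embed // (hkap n).1 cdot_coords (multinomial charC0).
    rewrite /P raddf_sum /= mulr_sumr; apply: eq_bigr => m _.
    rewrite mevalZ mevalX -!mulrA; congr (_ * (_ * (_ * _))).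
    by rewrite -big_split /=; apply: eq_bigr => i _; rewrite exprMn mulrC.
  have -> : embed e P = \sum_(m : bmultinom D.+1 n.+1 | mdeg m == n)
    ((a n)%:C * ((n`!)%:R / (mfact m)%:R) * \prod_i ((coords w i)^*)%C ^+ m i) *: embed e (mpolyX C m).
    by rewrite /P linear_sum; apply: eq_bigr => m _; rewrite linearZ.
  rewrite linear_sumr big1 // => m _.
  by apply: (etrans (hdotZr _ _ _)); rewrite hu mulr0.
have homk n : homog (kap n) n.
  move=> z z' c c1 zz'; rewrite !(hkap n).1 mulrCA -exprMn; congr (_ * _ ^+ _).
  by rewrite !cdot_coords zz' mulr_sumr; apply: eq_bigr => i _; rewrite mulrA.
pose S N := \sum_(n < N) kap n.
pose s N : C := \sum_(n < N) (a n)%:C * cdot (val w) (val w) ^+ n.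
have sJ N : ((s N)^*)%C = s N.
  have -> : s N = (\sum_(n < N) a n * nrm2 (coords w) ^+ n)%:C.
    by rewrite /s cdot_nrm2 [RHS]rmorph_sum; apply: eq_bigr => n _; rewrite rmorphM rmorphXn.
  exact: conjc_real.
have Sk N : hdot H (S N) k = s N.
  by rewrite hdot_suml; apply: eq_bigr => n _; rewrite -hkw (hkap n).1.
have SS N : hdot H (S N) (S N) = s N.
  rewrite hdot_suml; apply: eq_bigr => n _; rewrite hdot_sumr (bigD1 n) //= big1 ?addr0.
    by rewrite ((hkap n).2 _ _ (homk n)) eqxx mul1r (hkap n).1.
  by move=> n' nn'; rewrite ((hkap n').2 _ _ (homk n)) (_ : (n == n' :> nat) = false) ?mul0r // eq_sym; apply/negbTE.
have kS N : hdot H (k - S N) (k - S N) = hev H k w - s N.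
  have hdotBB (x y : H) : hdot H (x - y) (x - y) = hdot H x x - hdot H x y - (hdot H y x - hdot H y y).
    by rewrite linearBl !linearBr.
  by rewrite hdotBB SS (hdotC k (S N)) Sk sJ -hkw; ring.
apply: nr_small => eps e0; pose de := eps / (nr u + 1).
have u0 : 0 < nr u + 1 by rewrite ltr_wpDl ?nr_ge0.
have d0 : 0 < de by rewrite divr_gt0.
have /nlim_cvg /(_ (de ^+ 2)) := @K_series w w; rewrite exprn_gt0 // => /(_ isT)[N /(_ N (leqnn N)) hN].
have -> : hdot H u k = hdot H u (k - S N).
  have uS : hdot H u (S N) = 0 by rewrite hdot_sumr big1.
  by rewrite hdotBr uS subr0.
apply: le_trans (hdot_CS _ _) _.
have : nr (k - S N) <= de.
  rewrite -(@ler_pXn2r _ 2) ?nnegrE ?nr_ge0 ?(ltW d0) //.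
  rewrite -[X in X <= _](ger0_norm (sqr_ge0 _)) -nrC -hdot_nr kS hk nr_dist.
  by move: hN; rewrite /series /= big_mkord.
move/(ler_wpM2l (nr_ge0 u))/le_trans; apply.
by rewrite /de mulrA ler_pdivrMr // mulrC ler_wpM2l ?(ltW e0) // lerDl.
Unshelve. all: exact: e_hev.
Qed.

End Kernel.

(** * Trace class operators and the weak star closure *)

Section Blocks.
Variable R : realType.
Local Notation C := R[i].

Lemma geo_tail (V : normedZmodType C) (x : nat -> V) (A : R) k l : 0 <= A ->
  (forall j, nr (x j) <= A * 2^-1 ^+ j) -> (k <= l)%N ->
  nr (\sum_(j < l) x j - \sum_(j < k) x j) <= 2 * A * 2^-1 ^+ k.
Proof.
move=> A0 hx /subnK <-; move: (l - k)%N => n; rewrite addnC big_split_ord /= addrAC subrr add0r.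
apply: le_trans (nr_sum _ _ _) _.
apply: le_trans (_ : \sum_(i < n) A * 2^-1 ^+ (k + i) <= _); first by apply: ler_sum => i _; exact: hx.
suff : \sum_(i < n) A * 2^-1 ^+ (k + i) = 2 * A * 2^-1 ^+ k - 2 * A * 2^-1 ^+ (k + n).
  by move=> ->; rewrite gerBl !mulr_ge0 // exprn_ge0.
elim: n => [|n IH]; first by rewrite big_ord0 addn0 subrr.
by rewrite big_ord_recr /= IH addnS exprS; field.
Qed.

Lemma geo_small (B : R) eps : 0 <= B -> 0 < eps -> exists N, forall k, (N <= k)%N -> B * 2^-1 ^+ k <= eps.
Proof.
move=> B0 e0; have B1 : 0 < B + 1 by lra.
have [N hN] := nat_gt (B / eps); exists N => k Nk.
rewrite exprVn ler_pdivrMr ?exprn_gt0 // mulrC -ler_pdivrMr //.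
apply: le_trans (ltW hN) _; rewrite -natrX ler_nat.
by apply: leq_trans Nk _; apply: ltnW; exact: ltn_expl.
Qed.

Lemma nlim_ge0 (r : nat -> R) (u : C) : (forall n, 0 <= r n) -> nlim (fun n => (r n)%:C : C) u -> 0 <= u.
Proof.
move=> r0 h; rewrite lecE /=; apply/andP; split.
  apply/eqP/normr0_eq0/eqP; rewrite eq_le normr_ge0 andbT; apply/ler_addgt0Pr => e e0.
  have [N /(_ N (leqnn N)) hN] := h _ e0; rewrite add0r; apply: le_trans hN.
  rewrite -(@ler_pXn2r _ 2) ?nnegrE ?nr_ge0 // nr_sqr real_normK ?num_real //.
  by case: u h => x y h /=; rewrite sub0r sqrrN lerDr sqr_ge0.
apply/ler_addgt0Pr => e e0; have [N /(_ N (leqnn N)) hN] := h _ e0.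
have := Re_le_nr ((r N)%:C - u); rewrite ReD ReN /= => h1.
by have := r0 N; lra.
Qed.

End Blocks.

Section Trace.
Variables (R : realType) (X : Type) (H : hilbertFunctionSpace R X).
Local Notation C := R[i].
Hypothesis basis : orthonormal_basis (onb H).
Local Notation e := (onb H).
Implicit Types u v : H.

Definition bounded_op (M : H -> H) (c : R) :=
  (forall (a : C) u v, M (a *: u + v) = a *: M u + M v) /\ forall u, nr (M u) <= c * nr u.

Section BoundedOp.
Variables (M : H -> H) (c : R).
Hypothesis Mc : bounded_op M c.

Lemma bounded_opB u v : M (u - v) = M u - M v.
Proof. by rewrite addrC -scaleN1r Mc.1 scaleN1r addrC. Qed.

Lemma bounded_op0 : M 0 = 0.
Proof. by rewrite -[X in M X](subrr 0) bounded_opB subrr. Qed.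

Lemma bounded_opZ (a : C) u : M (a *: u) = a *: M u.
Proof. by rewrite -[X in M X]addr0 Mc.1 bounded_op0 addr0. Qed.

Lemma bounded_opD u v : M (u + v) = M u + M v.
Proof. by rewrite -[u in LHS]scale1r Mc.1 scale1r. Qed.

Lemma bounded_op_sum (I : Type) (s : seq I) (F : I -> H) :
  M (\sum_(i <- s) F i) = \sum_(i <- s) M (F i).
Proof.
elim: s => [|i s IH]; first by rewrite !big_nil bounded_op0.
by rewrite !big_cons bounded_opD IH.
Qed.

Lemma bounded_op_lim (x : nat -> H) u : 0 <= c -> nlim x u -> nlim (M \o x) (M u).
Proof.
move=> c0; apply: nlim_lipschitz c0 _ => v v'.
by rewrite -bounded_opB; exact: Mc.2.
Qed.

End BoundedOp.

Section Positive.
Variables (z : nat -> seq H) (A : R).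
Hypothesis A_ge0 : 0 <= A.
Hypothesis z_mass : forall j, \sum_(v <- z j) nr v ^+ 2 <= A * 2^-1 ^+ j.

Definition block_op j u := \sum_(v <- z j) hdot H u v *: v.

Lemma block_op_bound j u : nr (block_op j u) <= (A * nr u) * 2^-1 ^+ j.
Proof.
apply: le_trans (nr_sum _ _ _) _; rewrite mulrAC.
apply: le_trans (ler_wpM2r (nr_ge0 u) (z_mass j)); rewrite mulr_suml; apply: ler_sum => v _.
by rewrite nrZ expr2 mulrAC ler_wpM2r ?nr_ge0 // mulrC hdot_CS.
Qed.

Lemma positive_op_exists : exists T : {linear H -> H},
  (forall u, nlim (fun k => \sum_(j < k) block_op j u) (T u)) /\ forall u, nr (T u) <= 2 * A * nr u.
Proof.
have /choice[T hT] : forall u, exists t, nlim (fun k => \sum_(j < k) block_op j u) t.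
  move=> u; apply: ncauchy => eps e0; have A2 : 0 <= A * nr u by rewrite mulr_ge0 ?nr_ge0.
  have [N hN] := geo_small (mulr_ge0 (ler0n R 2) A2) e0; exists N => k l Nk Nl.
  have key k' l' : (N <= k')%N -> (k' <= l')%N -> nr (\sum_(j < l') block_op j u - \sum_(j < k') block_op j u) <= eps.
    by move=> {}Nk kl; apply: le_trans (geo_tail A2 (block_op_bound^~ u) kl) _; exact: hN.
  case: (leqP l k) => kl; first exact: key.
  by rewrite nr_dist; apply: key => //; exact: ltnW.
have Tlin : linear T.
  move=> a u v; apply: nlim_unique (hT _) _.
  have := nlimD (nlimZ a (hT u)) (hT v); congr nlim; apply/funext => k.
  rewrite scaler_sumr -big_split /=; apply: eq_bigr => j _.
  rewrite /block_op scaler_sumr -big_split /=; apply: eq_bigr => w _.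
  by rewrite hdotDl hdotZl scalerDl scalerA.
pose TL : {linear H -> H} := HB.pack T (GRing.isLinear.Build C H H *:%R T Tlin).
exists TL; split=> // u.
apply: nlim_bound (hT u) _; exists 0%N => k _.
have A2 : 0 <= A * nr u by rewrite mulr_ge0 ?nr_ge0.
have := geo_tail A2 (block_op_bound^~ u) (leq0n k); rewrite big_ord0 subr0 expr0 mulr1 mulrA.
exact.
Qed.

(** The trace of a bounded operator times a positive operator. *)
Lemma trace_series (T : {linear H -> H}) (M : H -> H) c : 0 <= c -> bounded_op M c ->
  (forall u, nlim (fun k => \sum_(j < k) block_op j u) (T u)) ->
  exists S : C, nlim (fun n => \sum_(i < n) hdot H (M (T (e i))) (e i)) S /\
    nlim (fun k => \sum_(j < k) \sum_(v <- z j) hdot H (M v) v) S.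
Proof.
move=> c0 Mc hT.
pose G j n := \sum_(v <- z j) \sum_(i < n) hdot H (M v) (e i) * ((hdot H v (e i))^*)%C.
pose s j := \sum_(v <- z j) hdot H (M v) v.
have massC j (F : H -> C) : (forall v, nr (F v) <= c * nr v ^+ 2) -> nr (\sum_(v <- z j) F v) <= (c * A) * 2^-1 ^+ j.
  move=> hF; apply: le_trans (nr_sum _ _ _) _; rewrite -mulrA.
  by apply: le_trans (ler_wpM2l c0 (z_mass j)); rewrite mulr_sumr; apply: ler_sum => v _; exact: hF.
have Mv v : nr (M v) * nr v <= c * nr v ^+ 2.
  by rewrite expr2 mulrA ler_wpM2r ?nr_ge0 //; exact: Mc.2.
have Gb n j : nr (G j n) <= (c * A) * 2^-1 ^+ j.
  by apply: massC => v; apply: le_trans (Mv v); exact: parseval_dot_bound.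
have sb j : nr (s j) <= (c * A) * 2^-1 ^+ j.
  by apply: massC => v; apply: le_trans (Mv v); exact: hdot_CS.
have cA : 0 <= c * A by rewrite mulr_ge0.
have cA2 : 0 <= 2 * (c * A) by rewrite mulr_ge0.
have [S hS] : exists S, nlim (fun k => \sum_(j < k) s j) S.
  apply: ncauchyC => eps e0.
  have [N hN] := geo_small cA2 e0; exists N => k l Nk Nl.
  have key k' l' : (N <= k')%N -> (k' <= l')%N -> nr (\sum_(j < l') s j - \sum_(j < k') s j) <= eps.
    by move=> {}Nk kl; apply: le_trans (geo_tail cA sb kl) _; exact: hN.
  case: (leqP l k) => kl; first exact: key.
  by rewrite nr_dist; apply: key => //; exact: ltnW.
have hF n : nlim (fun k => \sum_(j < k) G j n) (\sum_(i < n) hdot H (M (T (e i))) (e i)).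
  have := nlim_sum (index_enum 'I_n) (fun i : 'I_n => hdot_liml (e i) (bounded_op_lim Mc c0 (hT (e i)))).
  congr nlim; apply/funext => k /=.
  under eq_bigr => i _ do rewrite (bounded_op_sum Mc) hdot_suml.
  rewrite exchange_big; apply: eq_bigr => j _; rewrite /G exchange_big; apply: eq_bigr => i _.
  rewrite (bounded_op_sum Mc) hdot_suml; apply: eq_bigr => v _.
  by rewrite (bounded_opZ Mc) hdotZl -hdotC mulrC.
exists S; split=> // eps e0; have e3 : 0 < eps / 3 by rewrite divr_gt0.
have [N hN] := geo_small cA2 e3; have {}hN := hN N (leqnn N).
have gs : nlim (fun n => \sum_(j < N) G j n) (\sum_(j < N) s j).
  apply: (nlim_sum (index_enum 'I_N)) => j; apply: nlim_sum => v; exact: parseval_dot.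
have [N2 hN2] := gs _ e3; exists N2 => n nN2.
have far (x : nat -> C) L : (forall j, nr (x j) <= c * A * 2^-1 ^+ j) -> nlim (fun k => \sum_(j < k) x j) L ->
    nr (L - \sum_(j < N) x j) <= eps / 3.
  move=> hx hL; have := nlimD hL (nlim_cst (- \sum_(j < N) x j)); move/nlim_bound; apply.
  by exists N => k Nk; apply: le_trans (geo_tail cA hx Nk) hN.
have h1 := far _ _ (Gb n) (hF n); have h2 := far _ _ sb hS.
have h3 := hN2 n nN2; rewrite nr_dist in h2.
set F := \sum_(i < n) _ in h1 *; set g := \sum_(j < N) G j n in h1 h3; set t := \sum_(j < N) s j in h2 h3.
rewrite (_ : F - S = (F - g) + ((g - t) + (t - S))); last by ring.
apply: le_trans (nrD _ _) _; apply: le_trans (lerD h1 (nrD _ _)) _.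
apply: le_trans (lerD (lexx _) (lerD h3 h2)) _; lra.
Qed.

(** A positive operator is its own absolute value. *)
Lemma positive_trace_class (T : {linear H -> H}) :
  (forall u, nlim (fun k => \sum_(j < k) block_op j u) (T u)) -> (forall u, nr (T u) <= 2 * A * nr u) ->
  trace_class T.
Proof.
move=> hT Tb; have Tcont : continuous T.
  move=> u; apply/cvgrPdist_le => eps e0.
  have eE : eps = (complex.Re eps)%:C by rewrite RRe_real // gtr0_real.
  have eR : 0 < complex.Re eps by rewrite -(ltcR 0) -eE.
  have A1 : 0 < 2 * A + 1 by rewrite ltr_wpDl // mulr_ge0.
  have d0 : 0 < complex.Re eps / (2 * A + 1) by rewrite divr_gt0.
  have d0C : 0 < (complex.Re eps / (2 * A + 1))%:C :> C by rewrite -(ltcR 0) in d0.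
  have : \forall v \near u, `|u - v| <= (complex.Re eps / (2 * A + 1))%:C.
    by apply/nbhs_normP; exists (complex.Re eps / (2 * A + 1))%:C => //= v; exact: ltW.
  apply: filterS => v; rewrite -nr_le eE -nr_le -linearB => hv.
  apply: le_trans (Tb _) _; apply: le_trans (ler_wpM2l (mulr_ge0 (ler0n R 2) A_ge0) hv) _.
  by rewrite mulrA ler_pdivrMr // mulrC ler_wpM2l ?(ltW eR) // lerDl.
split=> //; exists T.
  split=> // u; have := hdot_liml u (hT u).
  rewrite (_ : (fun n => _) = (fun n => (\sum_(j < n) \sum_(v <- z j) nr (hdot H u v) ^+ 2)%:C)).
    by apply: nlim_ge0 => n; apply: sumr_ge0 => j _; apply: sumr_ge0 => v _; rewrite sqr_ge0.
  apply/funext => n; rewrite hdot_suml rmorph_sum; apply: eq_bigr => j _ /=.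
  rewrite hdot_suml rmorph_sum; apply: eq_bigr => v _ /=.
  by rewrite hdotZl (hdotC v u) mulcJ.
have idop : bounded_op id 1 by split=> // u; rewrite mul1r.
have [S [hS _]] := trace_series ler01 idop hT.
apply/cvg_ex; exists S; apply/(nlim_cvg (V := C^o)).
by move: hS; congr nlim; apply/funext => n; rewrite /series /= big_mkord.
Qed.

End Positive.
Variable J : set (X -> C).

(** Functionals given by summable families of rank one operators are continuous
    for the weak star topology: polarisation turns the operator into a
    combination of four positive ones, which are their own absolute values. *)
Lemma weak_star_vanish (s : nat -> seq (H * H)) (A : R) (f : X -> C) :
  (forall g, J g \/ g = f -> exists c, 0 <= c /\ bounded_op (mult_op (H := H) g) c) ->
  (forall j, \sum_(xy <- s j) (nr xy.1 ^+ 2 + nr xy.2 ^+ 2) <= A * 2^-1 ^+ j) ->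
  weak_star_closure H J f ->
  (forall g, J g -> nlim (fun k => \sum_(j < k) \sum_(xy <- s j) hdot H (mult_op g xy.1) xy.2) 0) ->
  nlim (fun k => \sum_(j < k) \sum_(xy <- s j) hdot H (mult_op f xy.1) xy.2) 0.
Proof.
move=> bd mass [_ cl] hJ.
have A0 : 0 <= A.
  have := mass 0%N; rewrite expr0 mulr1; apply: le_trans.
  by apply: sumr_ge0 => xy _; rewrite addr_ge0 ?sqr_ge0.
pose om (q : 'I_4) : C := 'i ^+ q.
have om1 q : nr (om q) = 1 by rewrite nrX (_ : nr 'i = 1) ?expr1n //; apply: complexI; rewrite -nrE normCi.
pose z q j := [seq xy.1 + om q *: xy.2 | xy <- s j].
have z_mass q j : \sum_(v <- z q j) nr v ^+ 2 <= 2 * A * 2^-1 ^+ j.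
  rewrite big_map -mulrA; apply: le_trans (ler_wpM2l (ler0n R 2) (mass j)).
  rewrite mulr_sumr; apply: ler_sum => xy _; have := nrD xy.1 (om q *: xy.2).
  rewrite nrZ om1 mul1r => h; apply: le_trans (_ : (nr xy.1 + nr xy.2) ^+ 2 <= _).
    by rewrite lerXn2r ?nnegrE ?nr_ge0 ?addr_ge0 ?nr_ge0.
  by have := sqr_ge0 (nr xy.1 - nr xy.2); nra.
have A2 : 0 <= 2 * A by rewrite mulr_ge0.
have /choice[T hT] := fun q => positive_op_exists A2 (z_mass q).
pose tT q := exist _ (T q) (positive_trace_class A2 (z_mass q) (hT q).1 (hT q).2) : {T : {linear H -> H} | trace_class T}.
have pairing g q : J g \/ g = f -> nlim (fun k => \sum_(j < k) \sum_(v <- z q j) hdot H (mult_op g v) v) (trace_pairing (H := H) g (tT q)).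
  move=> /bd[c [c0 gc]]; have [S [hS1 hS2]] := trace_series A2 (z_mass q) c0 gc (hT q).1.
  rewrite (_ : trace_pairing _ _ = S) //; apply: cvg_lim; first exact: norm_hausdorff.
  apply/(nlim_cvg (V := C^o)); move: hS1; congr nlim.
  by apply/funext => n; rewrite /series /= big_mkord.
pose psi (g : X -> C) : C := \sum_(q < 4) (om q / 4) * trace_pairing (H := H) g (tT q).
have polar g : J g \/ g = f -> nlim (fun k => \sum_(j < k) \sum_(xy <- s j) hdot H (mult_op g xy.1) xy.2) (psi g).
  move=> gJ; have [c [c0 gc]] := bd g gJ.
  have := nlim_sum (index_enum 'I_4) (fun q => nlimM (om q / 4) (pairing g q gJ)).
  congr nlim; apply/funext => k; under eq_bigr => q _ do rewrite mulr_sumr.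
  rewrite exchange_big; apply: eq_bigr => j _ /=.
  under eq_bigr => q _ do rewrite big_map mulr_sumr.
  rewrite exchange_big; apply: eq_bigr => [[x y]] _ /=.
  have E q : hdot H (mult_op g (x + om q *: y)) (x + om q *: y) =
     hdot H (mult_op g x) x + ((om q)^*)%C * hdot H (mult_op g x) y + om q * hdot H (mult_op g y) x + hdot H (mult_op g y) y.
    rewrite (bounded_opD gc) (bounded_opZ gc) !(hdotDl, hdotDr) !(hdotZl, hdotZr).
    have unim : om q * ((om q)^*)%C = 1 by rewrite mulcJ om1 expr1n.
    by rewrite -[in RHS](mul1r (hdot H (mult_op g y) y)) -unim; ring.
  have omJ q : ((om q)^*)%C = (- 'i) ^+ q by rewrite /om rmorphXn; congr (_ ^+ _); exact: conjCi.
  under eq_bigr => q _ do rewrite E omJ.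
  rewrite !big_ord_recr big_ord0 /= /om add0r !expr0 !expr1 !exprS expr0 !mulr1.
  have i2 : 'i * 'i = -1 :> C by rewrite -expr2 sqrCi.
  have alg (I a b c' d' : C) : I * I = -1 -> 1 / 4 * (a + 1 * b + 1 * c' + d') +
      I / 4 * (a + - I * b + I * c' + d') + I * I / 4 * (a + - I * - I * b + I * I * c' + d') +
      I * (I * I) / 4 * (a + - I * (- I * - I) * b + I * (I * I) * c' + d') = b.
    move=> II; transitivity (b + (I * I + 1) * (((a + d') * (1 + I) + c' * (1 + I ^+ 4) +
      b * (- I ^+ 4 + 2 * I ^+ 2 - 3)) / 4)); first by field.
    by rewrite II addNr mul0r addr0.
  exact: alg i2.
have f0 : psi f = 0.
  apply: nr_small => eps e0.
  pose W := initial_topology (trace_pairing (H := H)).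
  have cont q : continuous (fun h : W => trace_pairing (H := H) h (tT q) : C^o).
    move=> h; apply: (@continuous_comp W _ _ (trace_pairing (H := H)) (fun F => F (tT q))).
      exact: initial_continuous.
    exact: (@proj_continuous {classic {T : {linear H -> H} | trace_class T}} (fun=> C^o : topologicalType) (tT q)).
  have e0C : 0 < eps%:C :> C by rewrite -(ltcR 0) in e0.
  have near_f : \forall h \near (f : W), forall q,
      `|trace_pairing (H := H) f (tT q) - trace_pairing (H := H) h (tT q)| <= eps%:C :> C.
    have near1 q : \forall h \near (f : W), `|trace_pairing (H := H) f (tT q) - trace_pairing (H := H) h (tT q)| <= eps%:C :> C.
      by have /cvgrPdist_le/(_ _ e0C) := @cont q f.
    exact: (@filter_forall W _ _ (nbhs (f : W)) (nbhs_filter (f : W)) near1).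
  have [g [Jg hg]] := cl _ near_f.
  have g0 : psi g = 0 by apply: nlim_unique (polar g (or_introl Jg)) (hJ g Jg).
  rewrite -[psi f]subr0 -g0 /psi -sumrB; apply: le_trans (nr_sum _ _ _) _.
  apply: le_trans (_ : \sum_(q < 4) eps / 4 <= _); last first.
    by rewrite !big_ord_recr big_ord0 /=; lra.
  apply: ler_sum => q _; rewrite -mulrBr nrM nrM om1 nrV nr_nat mul1r mulrC.
  by rewrite ler_pM2r ?invr_gt0 // nr_le; exact: hg.
by have := polar f (or_intror erefl); rewrite f0.
Qed.

End Trace.

(** * Exhausting the part of a measure that lives off a zero set *)

Section Exhaustion.
Variables (R : realType) (T : Type) (z0 : T).
Local Notation C := R[i].
Local Notation fct := (T -> C^o).
Implicit Types (f g h t s : fct).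
Variables (rho mu : {scalar fct}) (c1 c2 : R).
Hypothesis rho_pos : positive_bound rho c1.
Hypothesis c2_ge0 : 0 <= c2.
Hypothesis mu_rho : forall g, bdd g -> nr (mu g) ^+ 2 <= c2 * energy rho g.
Local Notation E h := (complex.Re (rho h)).

Lemma rho_mono f g : bdd f -> bdd g -> (forall z, complex.Re (f z) <= complex.Re (g z)) -> E f <= E g.
Proof.
move=> bf bg fg; rewrite -subr_le0 -ReN -ReD -fscalarB -(mulr0 c1).
apply: rho_pos.2 => [|z]; first by rewrite -scaleN1r; apply: bddD => //; exact: bddZ.
by rewrite [X in complex.Re X](_ : _ = f z - g z) // ReD ReN subr_le0.
Qed.

Definition unit_valued t := forall z, exists2 r : R, 0 <= r <= 1 & t z = r%:C.

Lemma unit_valued_bfun t : unit_valued t -> bfun t 1.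
Proof. by move=> ht z; have [r /andP[r0 r1] ->] := ht z; rewrite nrC ger0_norm. Qed.

Lemma unit_valued_bdd t : unit_valued t -> bdd t.
Proof. by move=> /unit_valued_bfun h; exists 1. Qed.

Variable Tc : fct -> Prop.
Hypothesis Tc1 : Tc (fun=> 1).
Hypothesis TcM : forall t s, Tc t -> Tc s -> Tc (fmul t s).
Hypothesis Tc_unit : forall t, Tc t -> unit_valued t.

(** Take cut-offs that nearly minimise the integral against [rho]. Multiplying two
    of them lowers the integral only slightly, so they are close in the mean
    square with respect to [rho], which controls [mu]. *)
Lemma exhaustion : exists t : nat -> fct, [/\ forall n, Tc (t n),
  forall s, Tc s -> forall eps, 0 < eps -> exists N, forall n, (N <= n)%N -> E (t n - fmul (t n) s) <= eps &
  forall eps, 0 < eps -> exists N, forall n m, (N <= n)%N -> (N <= m)%N -> forall h B, bfun h B ->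
    nr (mu (fmul (t n) h) - mu (fmul (t m) h)) <= eps * B].
Proof.
have i0 n : 0 < n.+1%:R^-1 :> R by rewrite invr_gt0 ltr0n.
pose I := {t | Tc t}; pose F (i : I) := E (sval i).
have F0 i : 0 <= F i.
  have bt := unit_valued_bdd (Tc_unit (svalP i)); rewrite /F -[0](_ : E 0 = 0); last by rewrite linear0.
  apply: rho_mono => // [|z]; first by exists 0 => z; rewrite nr0.
  by have [r /andP[r0 _] ->] := Tc_unit (svalP i) z.
have /choice[u hu] := fun n => @near_min R I F (exist _ _ Tc1) 0 _ (i0 n) F0.
pose t n := sval (u n); have tT n : Tc (t n) := svalP (u n).
have t1 n := unit_valued_bfun (Tc_unit (tT n)).
have small s n : Tc s -> E (t n - fmul (t n) s) <= n.+1%:R^-1.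
  move=> hs; have := hu n (exist _ _ (TcM (tT n) hs)); rewrite /F /= -/(t n).
  by rewrite fscalarB ReD ReN lerBlDl.
have lim0 (eps : R) : 0 < eps -> exists N, forall n, (N <= n)%N -> n.+1%:R^-1 <= eps.
  move=> e0; have [N hN] := nat_gt eps^-1; exists N => n Nn.
  rewrite -[leRHS]invrK lef_pV2 ?posrE ?invr_gt0 ?ltr0n //.
  by rewrite (le_trans (ltW hN)) // ler_nat (leq_trans Nn).
exists t; split=> // [s hs eps /lim0[N hN]|eps e0].
  by exists N => n /hN; apply: le_trans; exact: small.
have e1 : 0 < eps ^+ 2 / (2 * (c2 + 1)) by rewrite divr_gt0 ?exprn_gt0 // mulr_gt0 // ltr_wpDl.
have [N hN] := lim0 _ e1; exists N => n m Nn Nm h B hB.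
have B0 : 0 <= B := le_trans (nr_ge0 _) (hB z0).
have b1 : bdd (t n - fmul (t n) (t m)).
  by rewrite -scaleN1r; apply: bddD; [exists 1|apply/bddZ/bddM; exists 1].
have b2 : bdd (t m - fmul (t m) (t n)).
  by rewrite -scaleN1r; apply: bddD; [exists 1|apply/bddZ/bddM; exists 1].
have bh : bdd h by exists B.
have bd : bdd (fmul (t n - t m) h).
  by apply: bddM => //; rewrite -scaleN1r; apply: bddD; [exists 1|apply: bddZ; exists 1].
rewrite -fscalarB (_ : _ - _ = fmul (t n - t m) h); last first.
  by apply/funext => z; change (t n z * h z - t m z * h z = (t n z - t m z) * h z :> C); ring.
rewrite -(@ler_pXn2r _ 2) ?nnegrE ?nr_ge0 ?mulr_ge0 ?(ltW e0) //.
apply: le_trans (mu_rho bd) _.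
have en : energy rho (fmul (t n - t m) h) <=
    E ((B ^+ 2)%:C *: ((t n - fmul (t n) (t m)) + (t m - fmul (t m) (t n)))).
  apply: rho_mono => [||z]; [by apply: bddM => //; exact: bddJ|by apply/bddZ/bddD|].
  rewrite /fmul /fconj mulcJ /= .
  have [x /andP[x0 x1] tx] := Tc_unit (tT n) z; have [y /andP[y0 y1] ty] := Tc_unit (tT m) z.
  rewrite [X in _ <= complex.Re X](_ : _ = (B ^+ 2)%:C * ((t n z - t n z * t m z) + (t m z - t m z * t n z))) //.
  rewrite [((t n - t m) z)](_ : _ = t n z - t m z) // tx ty -!rmorphM -!rmorphB -rmorphD -rmorphM /=.
  rewrite nrM nrC exprMn real_normK ?num_real // mulrC ler_pM ?sqr_ge0 //.
    by rewrite lerXn2r ?nnegrE ?nr_ge0.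
  by nra.
apply: le_trans (ler_wpM2l c2_ge0 en) _.
rewrite fscalarZ ReZ fscalarD ReD exprMn.
have h1 := le_trans (small _ n (tT m)) (hN n Nn); have h2 := le_trans (small _ m (tT n)) (hN m Nm).
apply: le_trans (_ : c2 * (B ^+ 2 * (eps ^+ 2 / (c2 + 1))) <= _).
  apply: ler_wpM2l => //; apply: ler_wpM2l; first exact: sqr_ge0.
  apply: le_trans (lerD h1 h2) _; rewrite le_eqVlt; apply/orP; left; apply/eqP; field.
  by rewrite gt_eqF // ltr_wpDl.
rewrite mulrCA [leRHS]mulrC ler_wpM2l ?sqr_ge0 // mulrA ler_pdivrMr ?ltr_wpDl //.
by rewrite mulrC ler_wpM2l ?sqr_ge0 // lerDl.
Qed.

End Exhaustion.

(** * Multipliers of a regular space *)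

Section Compactness.
Variables (R : realType) (d : nat).
Local Notation C := R[i].

Lemma complex_box (r : R) : exists K : set C^o, compact K /\ forall x, nr x <= r -> K x.
Proof.
pose sq : set (R * R) := `[- r, r]%classic `*` `[- r, r]%classic.
have sqc : compact sq by apply: compact_setX; exact: segment_compact.
pose F (x : R * R) : C^o := x.1%:C + 'i * x.2%:C.
have Fcont : continuous F.
  move=> x; apply/cvgrPdist_le => e e0.
  have eE : e = (complex.Re e)%:C by rewrite RRe_real // gtr0_real.
  have eR : 0 < complex.Re e / 2 by rewrite divr_gt0 // -(ltcR 0) -eE.
  have c1 : \forall y \near x, `|x.1 - y.1| <= complex.Re e / 2.
    by have /cvgrPdist_le/(_ _ eR) : fst @ x --> x.1 by exact: cvg_fst.
  have c2 : \forall y \near x, `|x.2 - y.2| <= complex.Re e / 2.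
    by have /cvgrPdist_le/(_ _ eR) : snd @ x --> x.2 by exact: cvg_snd.
  apply: filterS2 c1 c2 => y h1 h2; rewrite eE -nr_le /F.
  rewrite (_ : _ - _ = (x.1 - y.1)%:C + 'i * (x.2 - y.2)%:C); last first.
    by rewrite !rmorphB mulrBr opprD addrACA.
  apply: le_trans (nrD _ _) _; rewrite nrM !nrC (_ : nr 'i = 1) ?mul1r.
    by rewrite [leRHS]splitr lerD.
  by apply: complexI; rewrite -nrE normCi.
exists (F @` sq); split.
  by apply: continuous_compact sqc; apply: continuous_subspaceT.
move=> x /= xr; exists (complex.Re x, complex.Im x); last first.
  exact: esym (complexE x).
have h1 : complex.Re x ^+ 2 <= r ^+ 2.
  apply: le_trans (_ : nr x ^+ 2 <= _); first by rewrite nr_sqr lerDl sqr_ge0.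
  by rewrite lerXn2r ?nnegrE ?nr_ge0 // (le_trans (nr_ge0 x)).
have h2 : complex.Im x ^+ 2 <= r ^+ 2.
  apply: le_trans (_ : nr x ^+ 2 <= _); first by rewrite nr_sqr lerDr sqr_ge0.
  by rewrite lerXn2r ?nnegrE ?nr_ge0 // (le_trans (nr_ge0 x)).
have r0 : 0 <= r := le_trans (nr_ge0 x) xr.
have ab (y : R) : y ^+ 2 <= r ^+ 2 -> - r <= y <= r.
  move=> h; rewrite -ler_norml -(@ler_pXn2r _ 2) ?nnegrE // real_normK ?num_real //.
by split=> /=; rewrite in_itv /=; exact: ab.
Qed.

Lemma sphere_compact : compact (unit_sphere R d).
Proof.
have [K [cK hK]] := complex_box 1.
have box := @rV_compact C^o d (fun=> K) (fun=> cK).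
apply: subclosed_compact box _; last first.
  move=> v; rewrite /unit_sphere /= cdot_nrm2 => /complexI hv i; apply: hK.
  exact: (@sphere_coord R d (exist _ (fun i => v ord0 i) hv) i).
have cj : continuous (fun x : C^o => (x^*)%C : C^o).
  move=> x U /(@nbhs_ballP _ C^o) [e e0 xU]; apply/(@nbhs_ballP _ C^o); exists e => // y.
  rewrite -ball_normE /= => xy; apply: xU; rewrite -ball_normE /=.
  by move: xy; rewrite !nrE -rmorphB nr_conj.
have conj_cont i : continuous (fun v : 'rV[C^o]_d => ((v ord0 i)^*)%C : C^o).
  move=> v; apply: (@continuous_comp _ _ _ (fun v : 'rV[C^o]_d => v ord0 i : C^o) (fun x : C^o => (x^*)%C : C^o)).
    exact: coord_continuous.
  exact: cj.
have sum_cont (s : seq 'I_d) : continuous (fun v : 'rV[C^o]_d => \sum_(i <- s) v ord0 i * ((v ord0 i)^*)%C : C^o).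
  move=> v; elim: s => [|i s IH].
    have -> : (fun v : 'rV[C^o]_d => \sum_(i <- [::]) v ord0 i * ((v ord0 i)^*)%C : C^o) = fun=> 0.
      by apply/funext => u; rewrite big_nil.
    exact: (@cst_continuous 'rV[C^o]_d C^o 0 v).
  have -> : (fun v : 'rV[C^o]_d => \sum_(j <- i :: s) v ord0 j * ((v ord0 j)^*)%C : C^o) =
      fun v => (v ord0 i : C^o) * (((v ord0 i)^*)%C : C^o) + \sum_(j <- s) v ord0 j * ((v ord0 j)^*)%C.
    by apply/funext => u; rewrite big_cons.
  have c1 : (fun v : 'rV[C^o]_d => v ord0 i : C^o) @ v --> v ord0 i by exact: coord_continuous.
  exact: (cvgD (cvgM c1 (conj_cont i v)) IH).
have c1 : closed [set (1 : C^o)].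
  by apply: compact_closed; [exact: norm_hausdorff|exact: compact_set1].
exact: ((continuous_closedP _).1 (sum_cont (index_enum 'I_d)) _ c1).
Qed.


End Compactness.

Section MonomialModel.
Variables (R : realType) (D : nat).
Local Notation C := R[i].
Local Notation T := (unit_ball R D.+1).
Local Notation mpol := (mpoly.mpoly D.+1 C).
Variable H : hilbertFunctionSpace R T.
Variable a : nat -> R.
Hypothesis a_gt0 : forall n, 0 < a n.
Hypothesis a_ratio : (fun n => a n / a n.+1) @ \oo --> (1 : R).
Hypothesis eval_bounded : forall z : T, exists k : H, forall u, hev H u z = hdot H u k.
Variable iota : {linear mpol -> H}.
Hypothesis iota_hev : forall p (z : T), hev H (iota p) z = meval (coords z) p.
Local Notation w := (@space_weight R D a).
Hypothesis iota_monomial : forall m m',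
  hdot H (iota (mpolyX C m)) (iota (mpolyX C m')) = (w m)%:C * (m == m')%:R.
Hypothesis iota_complete : forall u, (forall m, hdot H u (iota (mpolyX C m)) = 0) -> u = 0.
Implicit Types (p q : mpol) (z : T) (u v : H) (g h : T -> C).

Let w_gt0 m : 0 < w m.
Proof. exact: space_weight_gt0. Qed.

Lemma iota_dot p q : hdot H (iota p) (iota q) = mdot w p q.
Proof.
elim/mpoly_lin_ind: q => [m'|c q1 q2 h1 h2]; last first.
  by rewrite linearP hdotDr hdotZr h1 h2 mdotPr.
elim/mpoly_lin_ind: p => [m|c p1 p2 h1 h2]; last first.
  by rewrite linearP hdotDl hdotZl h1 h2 mdotPl.
by rewrite iota_monomial mdotX.
Qed.

Lemma iota_norm p : nr (iota p) ^+ 2 = sqn w p.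
Proof. by apply: complexI; rewrite -hdot_nr iota_dot mdotpp. Qed.

Lemma iota_CS p q : nr (mdot w p q) <= nr (iota p) * nr (iota q).
Proof. by rewrite -iota_dot hdot_CS. Qed.

(** Ratios of successive coefficients converge, hence are bounded. *)
Lemma weight_shift : exists2 B, 0 < B & forall m i, w (mnm_add m (mnm1 i)) <= B * w m.
Proof.
have [B hB] : exists B, forall n, a n / a n.+1 <= B.
  have /cvgrPdist_le /(_ _ ltr01)[N _ hN] := a_ratio.
  have r0 n : 0 <= a n / a n.+1 by rewrite divr_ge0 ?(ltW (a_gt0 _)).
  exists (2 + \sum_(n < N) a n / a n.+1) => n; have [Nn|nN] := leqP N n.
    rewrite -[leLHS]addr0 lerD ?sumr_ge0 //.
    by have := hN n Nn; rewrite /= ler_norml; lra.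
  rewrite (bigD1 (Ordinal nN)) //= addrCA lerDl addr_ge0 // sumr_ge0 //.
have B0 : 0 < B by apply: lt_le_trans (hB 0%N); rewrite divr_gt0.
exists B => // m i; rewrite /space_weight mfact_add1 mdegD mdeg1 addn1 factS !natrM.
have m0 : 0 < (mfact m)%:R :> R by rewrite ltr0n mfact_gt0.
have f0 : 0 < (mdeg m)`!%:R :> R by rewrite ltr0n fact_gt0.
have an := a_gt0 (mdeg m); have an1 := a_gt0 (mdeg m).+1.
have n0 : 0 < (mdeg m).+1%:R :> R by rewrite ltr0n.
have -> : (m i).+1%:R * (mfact m)%:R / ((mdeg m).+1%:R * (mdeg m)`!%:R * a (mdeg m).+1) =
  ((m i).+1%:R / (mdeg m).+1%:R) * (a (mdeg m) / a (mdeg m).+1) * ((mfact m)%:R / ((mdeg m)`!%:R * a (mdeg m))) :> R.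
  by field; rewrite !gt_eqF.
rewrite ler_wpM2r ?divr_ge0 ?mulr_ge0 ?(ltW m0) ?(ltW f0) ?(ltW an) //.
rewrite -[leRHS]mul1r ler_pM ?divr_ge0 ?(ltW an) ?(ltW an1) //.
by rewrite ler_pdivrMr // mul1r ler_nat ltnS mdegE (bigD1 i) //= leq_addr.
Qed.

Lemma mon_bounded m : exists c, mbound iota (mpolyX C m) c.
Proof.
have [B B0 hB] := weight_shift.
have [n] := ubnP (mdeg m); elim: n m => // n IH m mn.
have [->|/mnm_pred[i [m' mE]]] := eqVneq m mnm0.
  by exists 1 => q; rewrite mpolyX0 !mul1r.
have [|c hc] := IH m'; first by move: mn; rewrite mE mdegD mdeg1 addn1 ltnS.
exists (c * Num.sqrt B); rewrite mE mpolyXD; apply: (mboundM w_gt0 iota_norm) => // q.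
rewrite (iota_le_sqr iota_norm) ?mulr_ge0 ?sqrtr_ge0 ?nr_ge0 // exprMn sqr_sqrtr ?(ltW B0) //.
rewrite iota_norm mulrC.
have add_inj : injective (mnm_add (mnm1 i)).
  by move=> k k' /mnmP h; apply/mnmP => j; have := h j; rewrite !mnmDE; exact: addnI.
rewrite (@sqnE _ _ w [seq mnm_add (mnm1 i) k | k <- msupp q]).
- rewrite big_map /sqn mulr_sumr; apply: ler_sum => k _.
  rewrite mcoeffMX [leRHS]mulrA ler_wpM2r ?sqr_ge0 //.
  by have := hB k i; rewrite (_ : mnm_add k (mnm1 i) = mnm_add (mnm1 i) k) //; apply/mnmP => j; rewrite !mnmDE addnC.
- by rewrite (map_inj_uniq add_inj) msupp_uniq.
- by move=> k; rewrite (perm_mem (msuppMX q (mnm1 i))).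
Qed.

(** The normalised monomials, in some enumeration. *)
Lemma basis_exists : exists e : nat -> H, orthonormal_basis e /\ forall n, exists p, e n = iota p.
Proof.
pose pw n : multinom D.+1 := mnm_muln (mnm1 ord0) n.
have pw_inj : injective pw by move=> n n' /mnmP/(_ ord0); rewrite !mulmnE mnm1E eqxx !mul1n.
have inf : infinite_set [set: multinom D.+1].
  move=> fin; apply: infinite_nat; have := finite_preimage (f := pw) (in2W pw_inj) fin.
  by rewrite preimage_setT.
have /card_set_bijP[f [_ f_inj f_surj]] := eq_card_nat (countableP [set: multinom D.+1]) inf.
have /choice[m hm] : forall n, exists m, f m = n by move=> n; have [m _ <-] := f_surj n I; exists m.
have m_inj : injective m by move=> n n' h; rewrite -(hm n) -(hm n') h.
have m_surj k : m (f k) = k by apply: f_inj; rewrite ?inE // hm.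
exists (fun n => (Num.sqrt (w (m n)))^-1%:C *: iota (mpolyX C (m n))); split; last first.
  by move=> n; exists ((Num.sqrt (w (m n)))^-1%:C *: mpolyX C (m n)); rewrite linearZ.
split=> [n n'|u hu].
  rewrite hdotZl hdotZr iota_monomial (inj_eq m_inj).
  have [->|_] := eqVneq n n'; last by rewrite !mulr0.
  rewrite (_ : ((Num.sqrt (w (m n')))^-1%:C^*)%C = (Num.sqrt (w (m n')))^-1%:C); last exact: conjc_real.
  rewrite mulr1 -!rmorphM mulrA -expr2 exprVn sqr_sqrtr ?(ltW (w_gt0 _)) //.
  by rewrite mulVf ?gt_eqF.
apply: iota_complete => k; have := hu (f k); rewrite m_surj hdotZr => /eqP.
rewrite mulf_eq0 conjc_eq0 => /orP[|/eqP //].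
by rewrite -[0]/(0%:C) (inj_eq (@complexI R)) invr_eq0 sqrtr_eq0 leNgt w_gt0.
Qed.

Lemma onb_basis : orthonormal_basis (onb H).
Proof. by have [e [he _]] := basis_exists; rewrite /onb; case: xgetP => [y _ //|/(_ e)]. Qed.

Lemma polynomials_dense u : exists p : nat -> mpol, nlim (fun n => iota (p n)) u.
Proof.
have [e [he hp]] := basis_exists.
have /choice[p hpE] := hp.
exists (fun n => \sum_(k < n) hdot H u (e k) *: p k) => eps e0.
have [N hN] := parseval he u e0; exists N => n /hN.
have -> // : partial e u n = iota (\sum_(k < n) hdot H u (e k) *: p k).
by rewrite linear_sum; apply: eq_bigr => k _; rewrite linearZ hpE.
Qed.

(** [gbound g c]: multiplication by [g] is an operator of norm at most [c]. *)
Definition gbound g (c : R) := forall u, exists v, hev H v = g * hev H u /\ nr v <= c * nr u.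

Definition pfun p : T -> C := fun z => meval (coords z) p.

Lemma pfunB p q : pfun (p - q) = pfun p - pfun q.
Proof. by apply/funext => z; rewrite /pfun mevalB. Qed.

Lemma pfunM p q : pfun (p * q) = pfun p * pfun q.
Proof. by apply/funext => z; rewrite /pfun mevalM. Qed.

Lemma hev_iota p : hev H (iota p) = pfun p.
Proof. by apply/funext => z; rewrite iota_hev. Qed.

Lemma eval_lim (x : nat -> H) u z : nlim x u -> nlim (fun n => hev H (x n) z) (hev H u z).
Proof.
by move=> h; have [k hk] := eval_bounded z; rewrite hk; under eq_fun do rewrite hk; exact: hdot_liml.
Qed.

(** Polynomials are dense, and evaluations are continuous. *)
Lemma mbound_gbound p c : mbound iota p c -> gbound (pfun p) c.
Proof.
move=> pc u; have c0 := mbound_ge0 w_gt0 iota_norm pc.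
have [q hq] := polynomials_dense u.
have [v hv] : exists v, nlim (fun n => iota (p * q n)) v.
  apply: ncauchy => e e0; have e1 : 0 < e / (2 * (c + 1)) by rewrite divr_gt0 // mulr_gt0 // ltr_wpDl.
  have [N hN] := hq _ e1; exists N => n m Nn Nm.
  rewrite -linearB -mulrBr; apply: le_trans (pc _) _; rewrite linearB.
  have d : nr (iota (q n) - iota (q m)) <= e / (c + 1).
    rewrite -(subrKA u); apply: le_trans (nrD _ _) _; rewrite [nr (u - _)]nr_dist.
    apply: le_trans (lerD (hN _ Nn) (hN _ Nm)) _; rewrite le_eqVlt; apply/orP; left; apply/eqP; field.
    by rewrite gt_eqF // ltr_wpDl.
  apply: le_trans (ler_wpM2l c0 d) _.
  by rewrite mulrA ler_pdivrMr ?ltr_wpDl // mulrC ler_wpM2l ?(ltW e0) // lerDl.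
exists v; split.
  apply/funext => z; apply: nlim_unique (eval_lim z hv) _.
  have := nlimM (pfun p z) (eval_lim z hq); congr nlim.
  by apply/funext => n; rewrite !iota_hev mevalM.
by apply: (nlim_le c0 hv hq) => n; exact: pc.
Qed.

Lemma gbound_mbound p c : gbound (pfun p) c -> mbound iota p c.
Proof.
move=> pc q; have [v [hv hn]] := pc (iota q).
rewrite (_ : iota (p * q) = v) //; apply: (hev_inj (h := H)).
by rewrite hv !hev_iota pfunM.
Qed.

Lemma gboundW g c c' : c <= c' -> gbound g c -> gbound g c'.
Proof.
move=> cc h u; have [v [hv hn]] := h u; exists v; split=> //.
by apply: le_trans hn _; rewrite ler_wpM2r ?nr_ge0.
Qed.

Lemma gboundD g g' c c' : gbound g c -> gbound g' c' -> gbound (g + g') (c + c').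
Proof.
move=> h h' u; have [v [hv hn]] := h u; have [v' [hv' hn']] := h' u; exists (v + v').
by split; [rewrite linearD /= hv hv' mulrDl|rewrite mulrDl (le_trans (nrD _ _)) // lerD].
Qed.

Lemma gboundN g c : gbound g c -> gbound (- g) c.
Proof.
by move=> h u; have [v [hv hn]] := h u; exists (- v); rewrite linearN /= hv mulNr nrN.
Qed.

Lemma gboundB g g' c c' : gbound g c -> gbound g' c' -> gbound (g - g') (c + c').
Proof. by move=> h h'; apply: gboundD => //; exact: gboundN. Qed.

Lemma gbound_ge0 g c : gbound g c -> 0 <= c.
Proof.
move=> h; have [v [_ hn]] := h (iota 1); have := le_trans (nr_ge0 _) hn.
by rewrite pmulr_lge0 // (iota1_gt0 w_gt0 iota_norm).
Qed.

Lemma gboundM g g' c c' : gbound g c -> gbound g' c' -> gbound (g * g') (c * c').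
Proof.
move=> h h' u; have [v [hv hn]] := h' u; have [v' [hv' hn']] := h v; exists v'.
split; first by rewrite hv' hv mulrA.
by apply: le_trans hn' _; rewrite -mulrA ler_wpM2l // (gbound_ge0 h).
Qed.

Lemma gbound0 : gbound 0 0.
Proof. by move=> u; exists 0; rewrite linear0 mul0r nr0 mul0r. Qed.

Lemma gbound_poly p : exists c, gbound (pfun p) c.
Proof.
by have [c pc] := mpoly_bounded mon_bounded p; exists c; exact: mbound_gbound.
Qed.

(** Multipliers are bounded functions: the kernel functions are eigenvectors of
    the adjoint operators. *)
Lemma gbound_sup g c z : gbound g c -> nr (g z) <= c.
Proof.
move=> h; have [k hk] := eval_bounded z; have [v [hv hn]] := h k.
have k0 : 0 < nr k.
  rewrite lt_neqAle nr_ge0 andbT eq_sym; apply/eqP => k0.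
  have := hk (iota 1); rewrite iota_hev meval1 (nr_eq0 k0) linear0r => /eqP.
  by rewrite oner_eq0.
have E : g z * (nr k ^+ 2)%:C = hdot H v k by rewrite -hk hv -hdot_nr -hk.
have := hdot_CS v k; rewrite -E nrM nrC ger0_norm ?sqr_ge0 //.
rewrite expr2 mulrA ler_pM2r // => h1; have := le_trans h1 hn.
by rewrite ler_pM2r.
Qed.

Lemma gbound_multiplier g c : gbound g c -> multiplier H g.
Proof. by move=> h u; have [v [hv _]] := h u; exists v. Qed.

Lemma mult_opE g u : multiplier H g -> hev H (mult_op g u) = g * hev H u.
Proof. by move=> /(_ u)[v hv]; rewrite /mult_op; case: xgetP => [y _ //|/(_ v)]. Qed.

Lemma mult_norm_gbound g c : multiplier H g -> (mult_norm H g < c%:E)%E -> gbound g c.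
Proof.
move=> hg lt u; exists (mult_op g u); split; first exact: mult_opE.
have [->|u0] := eqVneq u 0.
  rewrite (_ : mult_op g 0 = 0) ?nr0 ?mulr0 //; apply: (hev_inj (h := H)).
  by rewrite mult_opE // linear0 mulr0.
have n0 : 0 < nr u by rewrite lt_neqAle nr_ge0 andbT eq_sym; apply: contra_neq u0 => /nr_eq0.
have n1 : nr ((nr u)^-1%:C *: u) = 1 by rewrite nrZ nrC ger0_norm ?invr_ge0 ?nr_ge0 // mulVf ?gt_eqF.
have : (((nr (mult_op (H := H) g ((nr u)^-1%:C *: u)))%:E) < c%:E)%E.
  apply: le_lt_trans lt; apply: ereal_sup_ubound.
  by exists ((nr u)^-1%:C *: u) => //=; rewrite -[1]/(1%:C) -nr_le n1.
rewrite lte_fin (_ : mult_op _ _ = (nr u)^-1%:C *: mult_op g u); last first.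
  apply: (hev_inj (h := H)); apply/funext => z; rewrite hevZ !mult_opE //.
  rewrite -[LHS]/(g z * hev H ((nr u)^-1%:C *: u) z) -[X in _ = _ * X]/(g z * hev H u z).
  by rewrite hevZ mulrCA.
rewrite nrZ nrC ger0_norm ?invr_ge0 ?nr_ge0 // mulrC ltr_pdivrMr //; exact: ltW.
Qed.

Lemma gbound_mult_norm g c : gbound g c -> (mult_norm H g <= c%:E)%E.
Proof.
move=> h; apply: ge_ereal_sup => _ [u /= u1 <-]; rewrite lee_fin -/(nr _).
have [v [hv hn]] := h u; rewrite (_ : mult_op g u = v); last first.
  by apply: (hev_inj (h := H)); rewrite hv mult_opE //; exact: gbound_multiplier h.
apply: le_trans hn _; rewrite ler_piMr ?(gbound_ge0 h) //.
by rewrite nr_le.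
Qed.

Lemma multiplierB g g' : multiplier H g -> multiplier H g' -> multiplier H (g - g').
Proof.
move=> h h' u; have [v hv] := h u; have [v' hv'] := h' u; exists (v - v').
by rewrite linearB /= hv hv' mulrBl.
Qed.

Lemma mult_norm_closureP (S : set (T -> C)) : (forall g, S g -> multiplier H g) ->
  forall g, mult_norm_closure H S g <->
    multiplier H g /\ forall eps, 0 < eps -> exists2 g', S g' & gbound (g - g') eps.
Proof.
move=> Sm g; split=> -[mg h]; split=> // e e0.
  have [g' Sg' lt] := h e e0; exists g' => //.
  by apply: mult_norm_gbound => //; apply: multiplierB => //; exact: Sm.
have [g' Sg' b] := h (e / 2) (divr_gt0 e0 (ltr0n R 2)); exists g' => //.
apply: le_lt_trans (gbound_mult_norm b) _.
by rewrite lte_fin ltr_pdivrMr // ltr_pMr // ltr1n.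
Qed.

Lemma A_algP g : A_alg H g <-> forall eps, 0 < eps -> exists p, gbound (g - pfun p) eps.
Proof.
have polym f : polynomial_functions f -> multiplier H f.
  by move=> [p ->]; have [c pc] := gbound_poly p; exact: gbound_multiplier pc.
split=> [/(mult_norm_closureP polym)[_ h] e e0|h].
  by have [_ [p ->] b] := h e e0; exists p.
apply/(mult_norm_closureP polym); split.
  have [p b] := h 1 ltr01; have [c pc] := gbound_poly p.
  by apply: (gbound_multiplier (c := 1 + c)); rewrite -(subrK (pfun p) g); exact: gboundD.
by move=> e e0; have [p b] := h e e0; exists (pfun p) => //; exists p.
Qed.

Lemma A_alg_bounded g : A_alg H g -> exists c, gbound g c.
Proof.
move=> /A_algP/(_ 1 ltr01)[p b]; have [c pc] := gbound_poly p.
by exists (1 + c); rewrite -(subrK (pfun p) g); exact: gboundD.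
Qed.

Lemma A_alg_poly p : A_alg H (pfun p).
Proof. by apply/A_algP => e e0; exists p; rewrite subrr; exact: gboundW (ltW e0) gbound0. Qed.

(** ** Boundary values *)

Local Notation Cd := ('rV[C^o]_D.+1).

Lemma poly_continuous p : continuous (fun v : Cd => meval (fun i => v ord0 i) p : C^o).
Proof.
elim/mpoly_lin_ind: p => [m|c p q hp hq] v; last first.
  have -> : (fun v : Cd => meval (fun i => v ord0 i) (c *: p + q) : C^o) =
      (fun v : Cd => (c : C^o) * (meval (fun i => v ord0 i) p : C^o) + (meval (fun i => v ord0 i) q : C^o)).
    by apply/funext => u; rewrite mevalD mevalZ.
  exact: (cvgD (cvgM (cvg_cst (c : C^o)) (hp v)) (hq v)).
have [n] := ubnP (mdeg m); elim: n m => // n IH m mn.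
have [->|/mnm_pred[i [m' mE]]] := eqVneq m mnm0.
  have -> : (fun v : Cd => meval (fun i => v ord0 i) (mpolyX C mnm0) : C^o) = (fun=> 1 : C^o).
    by apply/funext => u; rewrite mpolyX0 meval1.
  exact: (@cst_continuous Cd C^o 1 v).
have -> : (fun v : Cd => meval (fun i => v ord0 i) (mpolyX C m) : C^o) =
    (fun v : Cd => (meval (fun i => v ord0 i) (mpolyX C m') : C^o) * (v ord0 i : C^o)).
  by apply/funext => u; rewrite mE mpolyXD mevalM mevalXU.
have m'n : (mdeg m' < n)%N by move: mn; rewrite mE mdegD mdeg1 addn1 ltnS.
have c2 : (fun v : Cd => v ord0 i : C^o) @ v --> v ord0 i by exact: coord_continuous.
exact: (cvgM (IH m' m'n) c2).
Qed.

Definition radius n : R := 1 - n.+2%:R^-1.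

Lemma radius_lt1 n : 0 < radius n < 1.
Proof.
rewrite /radius; have : 0 < n.+2%:R^-1 :> R by rewrite invr_gt0 ltr0n.
have : n.+2%:R^-1 < 1 :> R by rewrite invf_lt1 ?ltr0n // ltr1n.
by set x := _^-1 => x1 x0; apply/andP; split; lra.
Qed.

Lemma radius_cvg : radius @ \oo --> (1 : R).
Proof.
rewrite -[X in _ --> X]subr0; apply: cvgB; first exact: cvg_cst.
by have := @cvg_harmonic R; rewrite -(cvg_shiftn 1) /harmonic /=; under eq_fun do rewrite addn1.
Qed.

Lemma radius_pow k : nlim (fun n => (radius n)%:C ^+ k : C) 1.
Proof.
move=> e e0; have h : (fun n => radius n ^+ k) @ \oo --> (1 ^+ k : R).
  elim: k => [|k IH]; first by under eq_fun do rewrite expr0; exact: cvg_cst.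
  by under eq_fun do rewrite exprS; rewrite exprS; exact: cvgM radius_cvg IH.
move: h; rewrite expr1n => /cvgrPdist_le/(_ _ e0)[N _ hN]; exists N => n /hN /=.
rewrite distrC -nrC rmorphB rmorphXn //.
Qed.

Lemma radial_limit (v : 'I_D.+1 -> C) p :
  nlim (fun n => meval (fun i => (radius n)%:C * v i) p) (meval v p).
Proof.
rewrite [meval v p]mevalE; under eq_fun do rewrite mevalE.
apply: nlim_sum => m.
rewrite (_ : (fun n => _) = (fun n => (mcoeff m p * \prod_i v i ^+ m i) * (radius n)%:C ^+ mdeg m)).
  by rewrite -[X in nlim _ X]mulr1; apply: nlimM; exact: radius_pow.
apply/funext => n; rewrite -mulrA; congr (_ * _); rewrite mdegE -prodrXr -big_split /=.
by apply: eq_bigr => i _; rewrite exprMn mulrC.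
Qed.

Lemma radial_point (v : Cd) n : closed_unit_ball R D.+1 v ->
  exists z : T, val z = (radius n)%:C *: v /\ coords z = (fun i => (radius n)%:C * v ord0 i).
Proof.
rewrite /closed_unit_ball /= cdot_nrm2 => v1.
have [/andP[r0 r1]] := (radius_lt1 n); have [|z hz] := @ball_point R D (fun i => (radius n)%:C * v ord0 i).
  apply: le_lt_trans (_ : radius n ^+ 2 < 1); last by rewrite expr_lt1 // ltW.
  have {}v1 : nrm2 (fun i => v ord0 i) <= 1 by rewrite -(lecR _ 1).
  rewrite -[leRHS]mulr1; apply: le_trans (ler_wpM2l (sqr_ge0 _) v1).
  rewrite /nrm2 mulr_sumr; apply: ler_sum => i _.
  by rewrite nrM nrC exprMn real_normK ?num_real.
exists z; split=> //; apply/rowP => i; rewrite mxE.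
by have := congr1 (fun f => f i) hz.
Qed.

Lemma poly_closed_ball p c (v : Cd) : gbound (pfun p) c -> closed_unit_ball R D.+1 v ->
  nr (meval (fun i => v ord0 i) p) <= c.
Proof.
move=> pc v1; apply: nlim_bound (radial_limit (fun i => v ord0 i) p) _; exists 0%N => n _.
by have [z [_ hz]] := radial_point n v1; have := gbound_sup z pc; rewrite /pfun hz.
Qed.

Definition row_of (z : 'I_D.+1 -> C) : Cd := \row_i z i.

Lemma row_ofE (z : 'I_D.+1 -> C) : (fun i => row_of z ord0 i) = z.
Proof. by apply/funext => i; rewrite mxE. Qed.

Lemma row_of_sphere (z : 'I_D.+1 -> C) : on_sphere z -> unit_sphere R D.+1 (row_of z).
Proof. by move=> hz; rewrite /unit_sphere /= cdot_nrm2 row_ofE hz. Qed.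

Lemma row_of_closed (z : 'I_D.+1 -> C) : on_sphere z -> closed_unit_ball R D.+1 (row_of z).
Proof. by move=> hz; rewrite /closed_unit_ball /= cdot_nrm2 row_ofE hz. Qed.

Lemma mbound_sbound p c : mbound iota p c -> sbound p c.
Proof.
move=> /mbound_gbound pc z hz; rewrite -(row_ofE z).
exact: poly_closed_ball (row_of_closed hz).
Qed.

(** Approximating polynomials converge uniformly on the closed ball, since radial
    limits extend the bound by the multiplier norm to the sphere. *)
Lemma ball_extP g : A_alg H g ->
  {within closed_unit_ball R D.+1, continuous (ball_ext g)} /\ forall z : T, ball_ext g (val z) = g z.
Proof.
move=> /A_algP gA; suff [G hG] : exists G : Cd -> C^o,
    {within closed_unit_ball R D.+1, continuous G} /\ forall z : T, G (val z) = g z.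
  by rewrite /ball_ext; case: xgetP => [y _ //|/(_ G)].
have i0 k : 0 < k.+1%:R^-1 :> R by rewrite invr_gt0 ltr0n.
have /choice[p hp] := fun k => gA _ (i0 k).
pose ev (v : Cd) q := meval (fun i => v ord0 i) q.
have dist k l (v : Cd) : closed_unit_ball R D.+1 v ->
    nr (ev v (p k) - ev v (p l)) <= k.+1%:R^-1 + l.+1%:R^-1.
  move=> v1; rewrite /ev -mevalB; apply: poly_closed_ball v1.
  have -> : pfun (p k - p l) = (g - pfun (p l)) - (g - pfun (p k)) by rewrite pfunB opprB [RHS]addrC subrKA.
  by rewrite [X in gbound _ X]addrC; apply: gboundB.
have small (e : R) : 0 < e -> exists N, forall k, (N <= k)%N -> k.+1%:R^-1 <= e.
  move=> e0; have [N hN] := nat_gt e^-1; exists N => k Nk.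
  rewrite -[leRHS]invrK lef_pV2 ?posrE ?invr_gt0 ?ltr0n //.
  by rewrite (le_trans (ltW hN)) // ler_nat (leq_trans Nk).
have /choice[G hG] : forall v : Cd, exists y : C^o, closed_unit_ball R D.+1 v -> nlim (fun k => ev v (p k) : C^o) y.
  move=> v; have [v1|v1] := pselect (closed_unit_ball R D.+1 v); last by exists 0.
  have [|y hy] := @ncauchyC R (fun k => ev v (p k)); last by exists y.
  move=> e e0; have [N hN] := small _ (divr_gt0 e0 (ltr0n R 2)); exists N => k l Nk Nl.
  by apply: le_trans (dist k l v v1) _; rewrite [leRHS](splitr e) lerD ?hN.
have unif k (v : Cd) : closed_unit_ball R D.+1 v -> nr (ev v (p k) - G v) <= k.+1%:R^-1.
  move=> v1; apply/ler_addgt0Pr => e e0.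
  have [N hN] := small _ (divr_gt0 e0 (ltr0n R 2)); have [M hM] := hG v v1 _ (divr_gt0 e0 (ltr0n R 2)).
  rewrite -(subrKA (ev v (p (N + M)%N))); apply: le_trans (nrD _ _) _.
  rewrite [e]splitr addrA lerD ?hM ?leq_addl //; apply: le_trans (dist _ _ v v1) _.
  by rewrite lerD2l hN ?leq_addr.
exists G; split=> [|z].
  apply/subspace_continuousP => v v1; apply/cvgrPdist_le => e e0.
  have eE : e = (complex.Re e)%:C by rewrite RRe_real // gtr0_real.
  have e3 : 0 < complex.Re e / 3 by rewrite divr_gt0 // -(ltcR 0) -eE.
  have [N hN] := small _ e3; have {}hN := hN N (leqnn N).
  have e3C : 0 < (complex.Re e / 3)%:C :> C by rewrite -(ltcR 0) in e3.
  have /cvgrPdist_le/(_ _ e3C) near1 := @poly_continuous (p N) v.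
  rewrite near_withinE; apply: filterS near1 => u hu u1.
  rewrite eE -nr_le -(subrKA (ev v (p N))); apply: le_trans (nrD _ _) _.
  have h1 := unif N v v1; have h2 := unif N u u1.
  have h3 : nr (ev v (p N) - ev u (p N)) <= complex.Re e / 3 by rewrite nr_le.
  rewrite nr_dist in h1.
  have := nrD (ev v (p N) - ev u (p N)) (ev u (p N) - G u); rewrite subrKA => h4.
  apply: le_trans (lerD (lexx _) h4) _.
  apply: le_trans (lerD (le_trans h1 hN) (lerD h3 (le_trans h2 hN))) _.
  by rewrite le_eqVlt; apply/orP; left; apply/eqP; field.
have z1 : closed_unit_ball R D.+1 (val z).
  by have := set_valP z; rewrite /unit_ball /closed_unit_ball /=; exact: ltW.
apply: nlim_unique (hG _ z1) _ => e e0; have [N hN] := small _ e0; exists N => k Nk.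
by rewrite nr_dist; apply: le_trans (gbound_sup z (hp k)) (hN _ Nk).
Qed.

Lemma ball_ext_approx g p c (v : Cd) : A_alg H g -> gbound (g - pfun p) c -> closed_unit_ball R D.+1 v ->
  nr (ball_ext g v - meval (fun i => v ord0 i) p) <= c.
Proof.
move=> gA b v1; have [cont ext] := ball_extP gA.
have /choice[z hz] := fun n => radial_point n v1.
have l2 : nlim (fun n => g (z n) : C^o) (ball_ext g v).
  have -> : (fun n => g (z n) : C^o) = (fun n => ball_ext g (val (z n))) by apply/funext => n; rewrite ext.
  have /subspace_continuousP/(_ v v1) := cont; move=> h; apply/nlim_cvg.
  have zc : (fun n => val (z n)) @ \oo --> within (closed_unit_ball R D.+1) (nbhs v).
    move=> U; rewrite /within /= => hU.
    have : (fun n => (radius n)%:C *: v : Cd) @ \oo --> v.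
      rewrite -[X in _ --> X]scale1r; apply: cvgZr_tmp.
      by apply/(nlim_cvg (V := C^o)); have := radius_pow 1; under eq_fun do rewrite expr1.
    move/(_ _ hU); rewrite !near_simpl /= => h2.
    apply: filterS h2 => n; rewrite -(hz n).1; apply.
    by have := set_valP (z n); rewrite /unit_ball /closed_unit_ball /=; exact: ltW.
  exact: cvg_comp zc h.
have l3 := radial_limit (fun i => v ord0 i) p.
have := nlimD l2 (nlimM (-1) l3); rewrite mulN1r => /nlim_bound; apply.
exists 0%N => n _; have := gbound_sup (z n) b.
by rewrite /pfun -[X in nr X]/(g (z n) - meval (coords (z n)) p) (hz n).2 mulN1r.
Qed.

(** ** Boundary functions on the sphere *)

Local Notation sph := (sphere R D.+1).
Local Notation fct := (sph -> C^o).

Definition bval g : fct := fun x : sph => ball_ext g (row_of (sval x)).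

Lemma bval_approx g p c : A_alg H g -> gbound (g - pfun p) c -> bfun (bval g - pev p) c.
Proof.
move=> gA b z; have := ball_ext_approx gA b (row_of_closed (svalP z)).
by rewrite row_ofE.
Qed.

Lemma bval_star g : A_alg H g -> star_mult (bval g).
Proof.
move=> gA; have bA := (A_algP g).1 gA.
have bb : bdd (bval g).
  have [p b] := bA 1 ltr01; have [B hB] := bdd_pev p; exists (1 + B).
  by rewrite -(subrK (pev p) (bval g)); apply: bfunD hB; exact: bval_approx.
apply: star_mult_lim bb _ => // e e0; have [p b] := bA e e0.
by exists (pev p); split; [exact: star_mult_pev|exact: bval_approx].
Qed.

Lemma pev_open (q : mpol) (b : bool) :
  open [set v : Cd | if b then 1 < nr (meval (fun i => v ord0 i) q) else nr (meval (fun i => v ord0 i) q) < 1].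
Proof.
have Oo : open [set x : C^o | if b then 1 < nr x else nr x < 1].
  rewrite openE => x /= hx; pose e := `|nr x - 1|.
  have e0 : 0 < e by rewrite normr_gt0 subr_eq0; case: b hx => /lt_eqF h; rewrite ?h // eq_sym h.
  have e0C : 0 < e%:C :> C by rewrite -(ltcR 0) in e0.
  apply/(@nbhs_ballP _ C^o); exists e%:C => // y; rewrite -ball_normE /= -nr_lt => xy.
  have h1 := nr_ler_dist x y; have h2 := nr_ler_dist y x; rewrite [nr (y - x)]nr_dist in h2.
  case: b hx => hx; move: xy; rewrite /e.
    by rewrite gtr0_norm ?subr_gt0 //; lra.
  by rewrite ltr0_norm ?subr_lt0 //; lra.
exact: ((continuousP _).1 (@poly_continuous q) _ Oo).
Qed.

(** Compactness of the sphere: off the zero set of [J], where [f] may be large,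
    finitely many members of [J] are bounded below together. *)
Lemma boundary_domination (J : set (T -> C)) f eps : J `<=` A_alg H -> A_alg H f ->
  (forall x : sph, (forall g, J g -> bval g x = 0) -> bval f x = 0) -> 0 < eps ->
  exists (l : seq (T -> C)) (M : R), [/\ 0 <= M, List.Forall J l &
    forall x : sph, nr (bval f x) ^+ 2 <= eps ^+ 2 + M * \sum_(g <- l) nr (bval g x) ^+ 2].
Proof.
move=> JA fA fJ e0; have e4 : 0 < eps / 4 by rewrite divr_gt0.
have [p pb] := (A_algP f).1 fA _ e4.
pose Q : set (mpol * bool)%type := [set i | if i.2
  then exists g del, [/\ J g, 0 < del & forall x : sph, 1 < nr (pev i.1 x) -> del <= nr (bval g x)]
  else i.1 = (2 / eps)%:C *: p].
pose F (i : mpol * bool) := [set v : Cd | if i.2 then 1 < nr (meval (fun k => v ord0 k) i.1)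
  else nr (meval (fun k => v ord0 k) i.1) < 1].
have cov : unit_sphere R D.+1 `<=` \bigcup_(i in Q) F i.
  move=> v; rewrite /unit_sphere /= cdot_nrm2 => /complexI hv.
  pose x : sph := exist _ (fun i => v ord0 i) hv.
  have [[g [Jg gx]]|none] := pselect (exists g, J g /\ bval g x <> 0).
    have n0 : 0 < nr (bval g x).
      by rewrite lt_neqAle nr_ge0 andbT eq_sym; apply/eqP => /nr_eq0.
    pose eta := nr (bval g x) / 4; have eta0 : 0 < eta by rewrite divr_gt0.
    have [q qb] := (A_algP g).1 (JA _ Jg) _ eta0; have qx := bval_approx (JA _ Jg) qb.
    have i2 : 0 < (2 * eta)^-1 by rewrite invr_gt0 mulr_gt0.
    have qE y : nr (pev ((2 * eta)^-1%:C *: q) y) = nr (pev q y) / (2 * eta).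
      by rewrite /pev mevalZ nrM nrC gtr0_norm // mulrC.
    have d2 : 0 < 2 * eta by rewrite mulr_gt0.
    exists ((2 * eta)^-1%:C *: q, true) => /=.
      exists g, eta; split=> // y; rewrite qE ltr_pdivlMr // mul1r => h.
      have := nr_ler_dist (pev q y) (bval g y); have := qx y; rewrite -[nr (pev q y - _)]nr_dist; lra.
    change (1 < nr (pev ((2 * eta)^-1%:C *: q) x)); rewrite qE ltr_pdivlMr // mul1r.
    have := nr_ler_dist (bval g x) (pev q x); have := qx x.
    have : nr (bval g x) = 4 * eta by rewrite /eta mulrC divfK.
    lra.
  exists ((2 / eps)%:C *: p, false) => //; change (nr (pev ((2 / eps)%:C *: p) x) < 1).
  have f0 : bval f x = 0.
    by apply: fJ => g Jg; apply: contrapT => h; apply: none; exists g.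
  rewrite /pev mevalZ nrM nrC gtr0_norm ?divr_gt0 //; have := bval_approx fA pb x.
  rewrite -[meval _ p]/(pev p x) -[X in X <= _ -> _]/(nr (bval f x - pev p x)) f0 sub0r nrN => h.
  apply: le_lt_trans (ler_wpM2l _ h) _; first by rewrite divr_ge0 // ltW.
  rewrite mulrAC ltr_pdivrMr // mul1r; lra.
have := @sphere_compact R D.+1; rewrite compact_cover => /(_ _ Q F)[||D' D'Q cov'].
- by case=> q b _; exact: pev_open.
- exact: cov.
have [B [B0 hB]] := bdd_ge0 (star_mult_bdd (bval_star fA)).
have fam (s : seq (mpol * bool)) : (forall i, i \in s -> Q i) ->
    exists (l : seq (T -> C)) (M : R), [/\ 0 <= M, List.Forall J l &
      forall x : sph, (exists2 i, i \in s & F i (row_of (sval x))) ->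
        nr (bval f x) ^+ 2 <= eps ^+ 2 + M * \sum_(g <- l) nr (bval g x) ^+ 2].
  elim: s => [|i s IH] hs; first by exists [::], 0; split=> // x [].
  have [|l [M [M0 lJ hl]]] := IH; first by move=> j js; apply: hs; rewrite inE js orbT.
  have := hs i (mem_head _ _); case: i hs => q [] hs /=; last first.
    move=> hq; have qE : q = (2 / eps)%:C *: p by exact: hq.
    exists l, M; split=> // x [j]; rewrite inE => /predU1P[->|js] Fj; last by apply: hl; exists j.
    apply: le_trans (_ : eps ^+ 2 <= _); last first.
      by rewrite lerDl mulr_ge0 // sumr_ge0 // => g _; rewrite sqr_ge0.
    rewrite lerXn2r ?nnegrE ?nr_ge0 ?(ltW e0) //; move: Fj.
    rewrite /F /= row_ofE qE mevalZ nrM nrC gtr0_norm ?divr_gt0 //.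
    rewrite mulrAC ltr_pdivrMr // mul1r -[meval _ p]/(pev p x) => h.
    have := nr_ler_dist (bval f x) (pev p x); have := bval_approx fA pb x.
    rewrite -[nr ((_ - _) x)]/(nr (bval f x - pev p x)); lra.
  move=> [g [del [Jg del0 hg]]]; exists (g :: l), (M + B ^+ 2 / del ^+ 2); split.
  - by rewrite addr_ge0 // divr_ge0 // sqr_ge0.
  - exact: List.Forall_cons.
  have S0 x : 0 <= \sum_(g <- l) nr (bval g x) ^+ 2 by apply: sumr_ge0 => g' _; rewrite sqr_ge0.
  have BD : 0 <= B ^+ 2 / del ^+ 2 by rewrite divr_ge0 ?sqr_ge0.
  move=> x [j]; rewrite inE => /predU1P[->|js] Fj.
    have h := hg x; move: Fj; rewrite /F /= row_ofE -[meval _ q]/(pev q x) => /h gx.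
    have fB : nr (bval f x) ^+ 2 <= B ^+ 2 by rewrite lerXn2r ?nnegrE ?nr_ge0.
    have : B ^+ 2 <= B ^+ 2 / del ^+ 2 * nr (bval g x) ^+ 2.
      rewrite mulrAC -mulrA ler_peMr ?sqr_ge0 // ler_pdivlMr ?exprn_gt0 // mul1r.
      by rewrite lerXn2r ?nnegrE ?nr_ge0 // ltW.
    rewrite big_cons mulrDr mulrDl; have := mulr_ge0 M0 (sqr_ge0 (nr (bval g x))).
    by have := mulr_ge0 (addr_ge0 M0 BD) (S0 x); have := sqr_ge0 eps; lra.
  have := hl x (ex_intro2 _ _ j js Fj); rewrite big_cons mulrDl mulrDr.
  have := mulr_ge0 M0 (sqr_ge0 (nr (bval g x))).
  have := mulr_ge0 BD (addr_ge0 (sqr_ge0 (nr (bval g x))) (S0 x)); lra.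
have [|l [M [M0 lJ hl]]] := fam (finmap.enum_fset D'); first by move=> i /D'Q; rewrite inE.
exists l, M; split=> // x; apply: hl; have [i iD Fi] := cov' _ (row_of_sphere (svalP x)).
by exists i.
Qed.

(** ** Functionals separating a closed ideal *)

Section Ideal.
Variable J : set (T -> C).
Hypothesis hJ : closed_ideal H J.

Let JA : J `<=` A_alg H. Proof. by case: hJ. Qed.
Let J0 : J 0. Proof. by case: hJ. Qed.
Let JD g h : J g -> J h -> J (g + h). Proof. by case: hJ => _ _ + _ _; apply. Qed.
Let JM p g : J g -> J (pfun p * g).
Proof. by case: hJ => _ _ _ + _; apply; exact: A_alg_poly. Qed.

Lemma pfun_scale (c : C) g : pfun (mpolyC D.+1 c) * g = c *: (g : T -> C^o).
Proof. by apply/funext => z; rewrite -[LHS]/(pfun (mpolyC D.+1 c) z * g z) /pfun mevalC. Qed.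

Lemma gboundZ (c : C) g b : gbound g b -> gbound (c *: (g : T -> C^o)) (nr c * b).
Proof.
move=> h u; have [v [hv hn]] := h u; exists (c *: v); split; last first.
  by rewrite nrZ -mulrA ler_wpM2l ?nr_ge0.
apply/funext => z; rewrite hevZ hv -[LHS]/(c * (g z * hev H u z)) mulrA //.
Qed.

Lemma J_scale (c : C) g : J g -> J (c *: (g : T -> C^o)).
Proof. by rewrite -pfun_scale; exact: JM. Qed.

Lemma pfunZ (c : C) p : pfun (c *: p) = c *: (pfun p : T -> C^o).
Proof. by apply/funext => z; rewrite /pfun mevalZ. Qed.

Lemma pfun0 : pfun 0 = 0.
Proof. by apply/funext => z; rewrite /pfun meval0. Qed.

Lemma pfunD p q : pfun (p + q) = pfun p + pfun q.
Proof. by apply/funext => z; rewrite /pfun mevalD. Qed.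

Lemma ideal_gap f : A_alg H f -> ~ J f ->
  exists2 del, 0 < del & forall g, J g -> ~ gbound (f - g) del.
Proof.
move=> fA fJ; apply: contrapT => h; apply: fJ.
have [_ _ _ _ cl] := hJ; apply: cl; split=> //; apply/mult_norm_closureP.
  by move=> g /JA[].
split=> [|eps e0]; first by case: fA.
apply: contrapT => hn; apply: h; exists eps => // g Jg b; apply: hn; by exists g.
Qed.

(** The multiplier norm of [p - g], minimised over the ideal, is the constraint on
    [phi]; consistency of the bound imposed at [p0] is the distance of [f] from the
    ideal. *)
Lemma separating_functional f p0 del : 0 < del -> (forall g, J g -> ~ gbound (f - g) del) ->
  gbound (f - pfun p0) (del / 4) ->
  exists phi : {scalar mpol}, (forall p g c, J g -> gbound (pfun p - g) c -> nr (phi p) <= c) /\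
    del / 2 <= nr (phi p0).
Proof.
move=> d0 gap b0; pose dl := del / 2; have dl0 : 0 < dl by rewrite divr_gt0.
(* The multiples of [p0] force the functional to be at least [del / 2] there. *)
pose G : set (mpol * R) := [set x | exists (t : R) g c, [/\ 0 <= t, J g,
  gbound (pfun (x.1 + t%:C *: p0) - g) c & x.2 = c - t * dl]].
have cG : bound_cone G.
  split.
  - exists 0, 0, 0; split=> //=; last by rewrite mul0r subr0.
    by rewrite scale0r addr0 pfun0 subr0; exact: gbound0.
  - move=> x y [t [g [c [t0 Jg b ->]]]] [t' [g' [c' [t'0 Jg' b' ->]]]].
    exists (t + t'), (g + g'), (c + c'); split=> /=; [exact: addr_ge0|exact: JD| |ring].
    have -> : pfun (x.1 + y.1 + (t + t')%:C *: p0) - (g + g') =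
       (pfun (x.1 + t%:C *: p0) - g) + (pfun (y.1 + t'%:C *: p0) - g').
      by rewrite rmorphD scalerDl addrACA pfunD opprD addrACA.
    exact: gboundD.
  - move=> r x r0 [t [g [c [t0 Jg b ->]]]]; exists (r * t), (r%:C *: (g : T -> C^o)), (r * c).
    split=> /=; [by rewrite mulr_ge0 // ltW|exact: J_scale| |ring].
    have -> : pfun (r%:C *: x.1 + (r * t)%:C *: p0) - r%:C *: (g : T -> C^o) =
      r%:C *: ((pfun (x.1 + t%:C *: p0) - g) : T -> C^o).
      by rewrite rmorphM -scalerA -scalerDr pfunZ scalerBr.
    by have := gboundZ r%:C b; rewrite nrC ger0_norm // ltW.
  - move=> x [t [g [c [t0 Jg /= b /= xE]]]]; have c0 := gbound_ge0 b.
    rewrite add0r in b; rewrite xE subr_ge0.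
    have [t_eq|t_ne] := eqVneq t 0; first by rewrite t_eq mul0r.
    have t_gt : 0 < t by rewrite lt_neqAle eq_sym t_ne.
    rewrite leNgt; apply/negP => lt; apply: (gap (t^-1%:C *: (g : T -> C^o))); first exact: J_scale.
    have -> : f - t^-1%:C *: (g : T -> C^o) = (f - pfun p0) + t^-1%:C *: ((pfun (t%:C *: p0) - g) : T -> C^o).
      rewrite scalerBr pfunZ scalerA -rmorphM mulVf // scale1r addrA subrK //.
    apply: gboundW (gboundD b0 (gboundZ _ b)).
    rewrite nrC gtr0_norm ?invr_gt0 //; have : t^-1 * c < dl by rewrite mulrC ltr_pdivrMr // mulrC.
    rewrite /dl; lra.
  - move=> x _; have [c b] := gbound_poly (- x.1); exists c.
    by exists 0, 0, c; split=> //=; [rewrite scale0r addr0 subr0|rewrite mul0r subr0].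
have [phi hphi] := hahn_banach cG; exists phi; split.
  move=> p g c Jg b; have [u [u1 uf]] := nr_phase (phi p).
  have -> : nr (phi p) = complex.Re (phi (u *: p)) by rewrite linearZ /= uf.
  apply: hphi; exists 0, (u *: (g : T -> C^o)), c; split=> //=; [exact: J_scale| |by rewrite mul0r subr0].
  rewrite scale0r addr0 pfunZ -scalerBr.
  by have := gboundZ u b; rewrite u1 mul1r.
have h : complex.Re (phi (- p0)) <= - dl.
  apply: hphi; exists 1, 0, 0; split=> //=; last by rewrite mul1r sub0r.
  by rewrite scale1r addNr pfun0 subr0; exact: gbound0.
have := Re_le_nr (phi p0); move: h; rewrite linearN ReN; rewrite /dl; lra.
Qed.

Let d_gt0 : (0 < D.+1)%N. Proof. by []. Qed.

Local Notation tsmall := (tail_small iota).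

Lemma tsmallD (nu nu' nu2 : mpol -> C) : tsmall nu -> tsmall nu' ->
  (forall p, nu2 p = nu p + nu' p) -> tsmall nu2.
Proof.
move=> h h' E eta eta0; rewrite (splitr eta).
rewrite (_ : nu2 = fun p => nu p + nu' p); last by apply/funext.
by apply: tailD; [apply: h|apply: h']; rewrite divr_gt0.
Qed.

(** A bounded functional on polynomials is a functional on the boundary up to a
    remainder that is small on high order polynomials: the remainder is controlled
    by the defect of Hardy space multiplication, which vanishes on polynomials
    bounded on the sphere up to a compact operator. *)
Lemma boundary_part (phi : {scalar mpol}) :
  (forall p c, mbound iota p c -> nr (phi p) <= c) ->
  exists mu : {scalar fct}, fbound mu 1 /\
    exists kap : {scalar mpol}, (forall p, kap p = phi p - mu (pev p)) /\ tsmall kap.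
Proof.
move=> hphi; pose b n := a n * (n`!)%:R * (D`!)%:R / ((n + D)`!)%:R.
have fp n : 0 < (n`!)%:R :> R by rewrite ltr0n fact_gt0.
have b0 n : 0 < b n by rewrite divr_gt0 ?mulr_gt0.
pose bt n := Num.sqrt (b n).
have bt0 n : 0 < bt n by rewrite sqrtr_gt0.
have hardy_bt m : hardy_weight R m = w m * bt (mdeg m) ^+ 2.
  rewrite sqr_sqrtr ?(ltW (b0 _)) // /hardy_weight /space_weight /b /mfact.
  have h1 := fp (mdeg m); have h2 := fp (mdeg m + D)%N; have h3 := a_gt0 (mdeg m).
  by field; rewrite !gt_eqF.
have cmb p q c (c0 : 0 <= c) (pc : sbound p c) := conj_mul_bound iota_norm bt0 hardy_bt q c0 pc.
have kbP (c : C) p p' x x' : kbound iota bt p x -> kbound iota bt p' x' ->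
    kbound iota bt (c *: p + p') (nr c * x + x').
  move=> h h' q; rewrite mul_defectP linearP; apply: le_trans (nrD _ _) _.
  by rewrite nrZ mulrDl -mulrA lerD // ler_wpM2l ?nr_ge0.
have kb0 : kbound iota bt 0 0.
  move=> q; rewrite /mul_defect /conj_mul !mul0r.
  by rewrite (_ : deg_mul _ 0 = 0) ?subr0 ?linear0 ?nr0 //; apply/mpolyP => m; rewrite mcoeff_deg_mul !mcoeff0 mulr0.
have kbZ (c : C) p x : kbound iota bt p x -> kbound iota bt (c *: p) (nr c * x).
  by move=> h; have := kbP c _ _ _ _ h kb0; rewrite !addr0.
have kbD p p' x x' : kbound iota bt p x -> kbound iota bt p' x' -> kbound iota bt (p + p') (x + x').
  by move=> h h'; have := kbP 1 _ _ _ _ h h'; rewrite scale1r nr1 mul1r.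
have key p x y : sbound p x -> 0 <= y -> kbound iota bt p y -> nr (phi p) <= x + y.
  move=> px y0 py; have x0 := sbound_ge0 d_gt0 px; apply: hphi => q.
  have -> : p * q = conj_mul bt p q + mul_defect bt p q by rewrite /mul_defect addrC subrK.
  by rewrite linearD mulrDl; apply: le_trans (nrD _ _) (lerD (cmb _ _ _ x0 px) (py q)).
(* With these constraints [mu] has norm at most one, take [p = 0], and [phi - mu]
   is bounded by the norm of the defect, take [y = 0]. *)
pose G : set (fct * R) := [set x | exists p (y z : R), [/\ bfun (x.1 - pev p) y, kbound iota bt p z, 0 <= z &
  x.2 = complex.Re (phi p) + (y + z)]].
have pevN p : pev (- p) = - (pev p : fct) by rewrite -[- p]scaleN1r -[- pev p]scaleN1r -[_ *: p]addr0 pevP pev0 addr0.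
have pevZ (c : C) p : pev (c *: p) = c *: (pev p : fct) by rewrite -[_ *: p]addr0 pevP pev0 addr0.
have cG : bound_cone G.
  split.
  - exists 0, 0, 0; split=> //=; last by rewrite linear0 !addr0.
    by rewrite pev0 subr0 => z; rewrite nr0.
  - move=> x x' [p [y [z [h1 h2 z0 ->]]]] [p' [y' [z' [h1' h2' z'0 ->]]]].
    exists (p + p'), (y + y'), (z + z'); split=> /=; [|exact: kbD|exact: addr_ge0|by rewrite linearD ReD; ring].
    by rewrite pevD opprD addrACA; exact: bfunD.
  - move=> t x t0 [p [y [z [h1 h2 z0 ->]]]]; have tn : nr (t%:C : C) = t by rewrite nrC gtr0_norm.
    exists (t%:C *: p), (t * y), (t * z); split=> /=.
    + by rewrite pevZ -scalerBr; have := bfunZ t%:C h1; rewrite tn.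
    + by have := kbZ t%:C _ _ h2; rewrite tn.
    + by rewrite mulr_ge0 // ltW.
    + by rewrite linearZ /= ReZ; ring.
  - move=> x [p [y [z [/= h1 h2 z0 ->]]]].
    have ps : sbound p y.
      apply/sbound_bfun => s; have := h1 s; rewrite sub0r.
      by rewrite [X in nr X](_ : _ = - pev p s) // nrN.
    have := key _ _ _ ps z0 h2; have := Re_le_nr (- phi p); rewrite nrN ReN; lra.
  - move=> x [p [y [z [h1 h2 z0 _]]]]; exists (complex.Re (phi (- p)) + (y + z)).
    exists (- p), y, z; split=> //=.
      rewrite pevN -opprD => s; have := h1 s.
      by rewrite [X in _ -> nr X <= _](_ : _ = - (x.1 - pev p) s) // nrN.
    by have := kbZ (-1) _ _ h2; rewrite scaleN1r nrN nr1 mul1r.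
have [mu hmu] := hahn_banach cG.
have mub : fbound mu 1.
  split=> // h B hB; rewrite mul1r; have [u [u1 uf]] := nr_phase (mu h).
  have -> : nr (mu h) = complex.Re (mu (u *: h)) by rewrite fscalarZ uf.
  apply: hmu; exists 0, B, 0; split=> //=; last by rewrite linear0 addr0 add0r.
  by rewrite pev0 subr0; have := bfunZ u hB; rewrite u1 mul1r.
pose kf p : C := phi p - mu (pev p).
have kfS : scalar kf.
  move=> c p q; rewrite /kf pevP fscalarD fscalarZ linearP /=; ring.
pose kap := HB.pack_for {scalar mpol} kf (GRing.isLinear.Build C mpol C^o *%R kf kfS).
exists mu; split=> //; exists kap; split=> //.
have H1 p y : 0 <= y -> kbound iota bt p y -> nr (kap p) <= 1 * y.
  move=> y0 py; rewrite mul1r; have [u [u1 uf]] := nr_phase (kap p).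
  have -> : nr (kap p) = complex.Re (kap (u *: p)) by rewrite linearZ /= uf.
  have h : complex.Re (mu (- (pev (u *: p) : fct))) <= complex.Re (phi (- (u *: p))) + (0 + y).
    apply: hmu; exists (- (u *: p)), 0, y; split=> //=.
      by rewrite pevN subrr => s; rewrite nr0.
    by have := kbZ (- u) _ _ py; rewrite nrN u1 mul1r scaleNr.
  have e1 : mu (- (pev (u *: p) : fct)) = - mu (pev (u *: p)) by rewrite linearN.
  have e2 : phi (- (u *: p)) = - phi (u *: p) by rewrite linearN.
  have e3 : kap (u *: p) = phi (u *: p) - mu (pev (u *: p)) by [].
  move: h; rewrite e1 e2 e3 ReD !ReN.
  lra.
have H2 p c : mbound iota p c -> kbound iota bt p (2 * c).
  by move=> pc; apply: (mbound_kbound w_gt0 iota_norm bt0 hardy_bt) => //; exact: mbound_sbound.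
exact: (hump w_gt0 iota_norm (sqrt_ratio b0 (hardy_ratio D a_gt0 a_ratio)) mon_bounded ler01 H1 H2).
Qed.

(** ** The part of the boundary functional carried by the zero set *)

Section Singular.
Variables (phi kap : {scalar mpol}) (mu rho : {scalar fct}).
Hypothesis phi_ideal : forall p g c, J g -> gbound (pfun p - g) c -> nr (phi p) <= c.
Hypothesis mu_bound : fbound mu 1.
Hypothesis kapE : forall p, kap p = phi p - mu (pev p).
Hypothesis kap_small : tsmall kap.
Hypothesis rho_pos : positive_bound rho 1.
Hypothesis mu_rho : forall g : fct, bdd g -> nr (mu g) ^+ 2 <= 1 * energy rho g.
Local Notation E h := (complex.Re (rho h)).

(** Since [phi] annihilates the ideal, [mu] multiplied by a member of the ideal
    differs from a multiple of [phi] that vanishes only by a small remainder. *)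
Lemma ideal_tail g : J g -> tsmall (fun p => mu (fmul (bval g) (pev p))).
Proof.
move=> Jg eta eta0; have e0 : 0 < eta / 3 by rewrite divr_gt0.
have [q qb] := (A_algP g).1 (JA Jg) _ e0.
have [cq hcq] := mpoly_bounded mon_bounded q; have cq0 := mbound_ge0 w_gt0 iota_norm hcq.
have cq1 : 0 < cq + 1 by rewrite ltr_wpDl.
have [N hN] := kap_small (divr_gt0 e0 cq1); exists N => p c op pc.
have ps := mbound_sbound pc; have c0 := sbound_ge0 d_gt0 ps.
have -> : mu (fmul (bval g) (pev p)) =
    phi (q * p) - kap (q * p) + mu (fmul (bval g - pev q) (pev p)).
  have -> : mu (fmul (bval g) (pev p)) = mu (pev (q * p)) + mu (fmul (bval g - pev q) (pev p)).
    rewrite -fscalarD; congr (mu _); apply/funext => z.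
    change (bval g z * pev p z = meval (sval z) (q * p) + (bval g z - pev q z) * pev p z :> C).
    by rewrite mevalM -/(pev q z) -/(pev p z); ring.
  rewrite kapE; ring.
have h1 : nr (phi (q * p)) <= c * (eta / 3).
  apply: (phi_ideal (g := pfun p * g)); first exact: JM.
  rewrite mulrC pfunM -mulrBr -opprB mulrN; apply: gboundN.
  by apply: gboundM qb; exact: mbound_gbound.
have h2 : nr (kap (q * p)) <= c * (eta / 3).
  apply: le_trans (hN _ (cq * c) _ (mboundM w_gt0 iota_norm hcq pc)) _.
    by rewrite mulrC; exact: ord_geM.
  rewrite mulrA [leRHS]mulrC ler_wpM2r // mulrAC ler_pdivrMr // ler_wpM2l ?(ltW e0) //.
  by rewrite lerDl.
have h3 : nr (mu (fmul (bval g - pev q) (pev p))) <= 1 * (eta / 3 * c).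
  apply: mu_bound.2; apply: bfunM; first exact: bval_approx (JA Jg) qb.
  exact: (sbound_bfun p c).1 ps.
apply: le_trans (nrD _ _) _; apply: le_trans (lerD (nrB _ _) (lexx _)) _.
move: h1 h2 h3; move: (nr _) (nr _) (nr _) => x y z; lra.
Qed.

(** Cut-off functions that may be inserted in [mu] at the cost of a functional that
    is small on polynomials of high order. *)
Definition cutoff (t : fct) := [/\ star_mult t, unit_valued t &
  forall h : fct, star_mult h -> tsmall (fun p => mu (fmul (h - fmul t h) (pev p)))].

Lemma pev1 : pev 1 = (fun=> 1) :> fct.
Proof. by apply/funext => z; rewrite /pev meval1. Qed.

Lemma cutoff1 : cutoff (fun=> 1).
Proof.
split; first by rewrite -pev1; exact: (star_mult_pev d_gt0).
  by move=> z; exists 1 => //; rewrite ler01 lexx.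
move=> h _ eta eta0; exists 0%N => p c _ pc.
rewrite (_ : fmul _ _ = 0); last first.
  by apply/funext => z; change ((h z - 1 * h z) * pev p z = 0 :> C); rewrite mul1r subrr mul0r.
by rewrite linear0 nr0 mulr_ge0 ?(ltW eta0) // (mbound_ge0 w_gt0 iota_norm pc).
Qed.

Lemma cutoffM (t s : fct) : cutoff t -> cutoff s -> cutoff (fmul t s).
Proof.
move=> [t1 t2 t3] [s1 s2 s3]; split; first exact: (star_multM d_gt0 t1 s1).
  move=> z; have [x /andP[x0 x1] tx] := t2 z; have [y /andP[y0 y1] sy] := s2 z.
  by exists (x * y); [rewrite mulr_ge0 //= mulr_ile1|rewrite /fmul tx sy rmorphM].
move=> h hh; have h1 := t3 _ hh; have h2 := s3 _ (star_multM d_gt0 t1 hh).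
apply: (tsmallD h1 h2) => p.
rewrite -fscalarD; congr (mu _); apply/funext => z.
change ((h z - t z * s z * h z) * pev p z =
  (h z - t z * h z) * pev p z + (t z * h z - s z * (t z * h z)) * pev p z :> C).
ring.
Qed.

Definition ideal_cutoff g (B : R) : fct := fun z : sph => (1 - nr (bval g z) ^+ 2 / B ^+ 2)%:C.

(** The removed factor [|g| ^ 2 / B ^ 2] is a multiple of [g], and [g mu] is small on
    polynomials of high order; the band property gives room for the other
    factor. *)
Lemma cutoff_ideal g B : J g -> 0 < B -> bfun (bval g) B -> cutoff (ideal_cutoff g B).
Proof.
move=> Jg B0 hB; have B2 : 0 < B ^+ 2 by rewrite exprn_gt0.
have sg := bval_star (JA Jg); have sgJ := star_multJ sg.
have tE (z : sph) : ideal_cutoff g B z = 1 - ((B ^+ 2)^-1)%:C * (bval g z * (bval g z)^*%C).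
  by rewrite mulcJ -rmorphM mulrC /ideal_cutoff rmorphB rmorph1.
split.
- have -> : ideal_cutoff g B = pev 1 + (- ((B ^+ 2)^-1)%:C) *: fmul (bval g) (fconj (bval g)).
    apply/funext => z; rewrite tE -mulNr pev1 //.
  by apply: (star_multP d_gt0); [exact: (star_mult_pev d_gt0)|exact: (star_multM d_gt0 sg sgJ)].
- move=> z; exists (1 - nr (bval g z) ^+ 2 / B ^+ 2) => //.
  rewrite subr_ge0 ler_pdivrMr // mul1r gerBl divr_ge0 ?sqr_ge0 // andbT.
  by rewrite lerXn2r ?nnegrE ?nr_ge0 // ltW.
move=> h sh; have nuc k : bdd k -> nr (fmulS mu (bval g) k) ^+ 2 <= B ^+ 2 * energy rho k.
  move=> bk; have bgk : bdd (fmul (bval g) k) by apply: bddM => //; exact: star_mult_bdd.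
  apply: le_trans (mu_rho bgk) _; rewrite mul1r -[X in X ^+ 2 * _]gtr0_norm // -(nrC B) -energyZ.
  apply: (energy_le rho_pos) => [|z]; first exact: bddZ.
  change (nr (bval g z * k z) <= nr (B%:C * k z)).
  by rewrite !nrM nrC gtr0_norm // ler_wpM2r ?nr_ge0.
have := band d_gt0 w_gt0 iota_norm mon_bounded mbound_sbound rho_pos (sqr_ge0 B) nuc
  (ideal_tail Jg) (star_multZ d_gt0 ((B ^+ 2)^-1)%:C (star_multM d_gt0 sgJ sh)).
rewrite (_ : (fun p => _) = (fun p => mu (fmul (h - fmul (ideal_cutoff g B) h) (pev p)))) //.
apply/funext => p; rewrite /fmulS; congr (mu _); apply/funext => z.
change (bval g z * (((B ^+ 2)^-1)%:C * ((bval g z)^*%C * h z) * pev p z) =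
  (h z - ideal_cutoff g B z * h z) * pev p z :> C).
rewrite tE; ring.
Qed.

(** [M] is the limit of [mu] multiplied by cut-offs whose integral against [rho] is
    nearly minimal. Comparison with the cut-offs made of a member [g] of the ideal
    shows that the mean square of [g] against them tends to zero; a function that
    vanishes on the zero set is dominated by finitely many members of the ideal. *)
Lemma singular_part : exists M : {scalar mpol},
  [/\ forall p c, sbound p c -> nr (M p) <= c,
      tsmall (fun p => phi p - M p) &
      forall g p c, A_alg H g -> (forall x : sph, (forall g', J g' -> bval g' x = 0) -> bval g x = 0) ->
        gbound (g - pfun p) c -> nr (M p) <= c].
Proof.
have z1 : sph by have /cid[e he] := @sphere_point R D.+1 d_gt0; exists e.
have cut_unit t : cutoff t -> unit_valued t by case.
have [t [tT tsm tC]] := exhaustion z1 rho_pos ler01 mu_rho cutoff1 cutoffM cut_unit.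
have t1 n := unit_valued_bfun (cut_unit _ (tT n)).
have mt n (h : fct) B : bfun h B -> nr (mu (fmul (t n) h)) <= B.
  by move=> hB; have := mu_bound.2 _ _ (bfunM (t1 n) hB); rewrite !mul1r.
have /choice[Mf hM] : forall p, exists l, nlim (fun n => mu (fmul (t n) (pev p)) : C) l.
  move=> p; apply: ncauchyC => e e0; have [B [B0 hB]] := bdd_ge0 (bdd_pev p).
  have B1 : 0 < B + 1 by rewrite ltr_wpDl.
  have [N hN] := tC _ (divr_gt0 e0 B1); exists N => n m Nn Nm.
  apply: le_trans (hN n m Nn Nm _ _ hB) _.
  by rewrite mulrAC ler_pdivrMr // ler_wpM2l ?(ltW e0) // lerDl.
have MfS : scalar Mf.
  move=> c p q; apply: nlim_unique (hM _) _.
  rewrite (_ : (fun n => _) = (fun n => c * mu (fmul (t n) (pev p)) + mu (fmul (t n) (pev q)))).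
    by apply: nlimD (hM q); apply: nlimM.
  apply/funext => n; rewrite -fscalarZ -fscalarD; congr (mu _); apply/funext => z.
  change (t n z * pev (c *: p + q) z = c * (t n z * pev p z) + t n z * pev q z :> C).
  rewrite /pev mevalD mevalZ; ring.
pose M := HB.pack_for {scalar mpol} Mf (GRing.isLinear.Build C mpol C^o *%R Mf MfS).
have unif e : 0 < e -> exists n, forall p c, sbound p c -> nr (mu (fmul (t n) (pev p)) - Mf p) <= e * c.
  move=> e0; have [N hN] := tC _ e0; exists N => p c /sbound_bfun pc.
  have := nlim_lipschitz (f := fun v : C => mu (fmul (t N) (pev p)) - v) ler01 _ (hM p).
  move=> /(_ _)/nlim_bound; apply.
    by move=> v v'; rewrite opprB addrC addrA subrK mul1r nr_dist.
  by exists N => n Nn; exact: hN.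
exists M; split.
- by move=> p c /sbound_bfun pc; apply: nlim_bound (hM p) _; exists 0%N => n _; exact: mt.
- move=> eta eta0; have e0 : 0 < eta / 3 by rewrite divr_gt0.
  have [n hn] := unif _ e0; have [_ _ t3] := tT n.
  have [N1 hN1] := kap_small e0; have [N2 hN2] := t3 _ (star_mult_pev d_gt0 1) _ e0.
  exists (N1 + N2)%N => p c op pc.
  have h1 := hN1 p c (ord_geW (leq_addr _ _) op) pc.
  have h2 := hN2 p c (ord_geW (leq_addl _ _) op) pc.
  have h3 := hn p c (mbound_sbound pc).
  have -> : phi p - M p = kap p + mu (fmul (pev 1 - fmul (t n) (pev 1)) (pev p)) +
      (mu (fmul (t n) (pev p)) - Mf p).
    rewrite (_ : fmul (pev 1 - _) _ = pev p - fmul (t n) (pev p)); last first.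
      apply/funext => z; change ((pev 1 z - t n z * pev 1 z) * pev p z = pev p z - t n z * pev p z :> C).
      by rewrite pev1; ring.
    by rewrite kapE fscalarB -[M p]/(Mf p); ring.
  apply: le_trans (nrD _ _) _; apply: le_trans (lerD (nrD _ _) (lexx _)) _.
  move: h1 h2 h3; move: (nr _) (nr _) (nr _) => x y z; lra.
move=> g p c gA gJ b.
have bt n : bdd (t n) by exists 1.
have one g' : J g' -> forall e, 0 < e -> exists N, forall n, (N <= n)%N ->
    E (fmul (t n) (fun z : sph => (nr (bval g' z) ^+ 2)%:C)) <= e.
  move=> Jg e e0; have [B' [B'0 hB']] := bdd_ge0 (star_mult_bdd (bval_star (JA Jg))).
  pose B := B' + 1; have B0 : 0 < B by rewrite ltr_wpDl.
  have hB : bfun (bval g') B by apply: bfunW hB'; rewrite lerDl.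
  have B2 : 0 < B ^+ 2 by rewrite exprn_gt0.
  have [N hN] := tsm _ (cutoff_ideal Jg B0 hB) _ (divr_gt0 e0 B2); exists N => n /hN.
  rewrite ler_pdivlMr // mulrC -ReZ -fscalarZ; apply: le_trans.
  rewrite le_eqVlt; apply/orP; left; apply/eqP; congr (E _); apply/funext => z.
  change (t n z * (nr (bval g' z) ^+ 2)%:C = (B ^+ 2)%:C * (t n z - t n z * ideal_cutoff g' B z) :> C).
  rewrite /ideal_cutoff; move: (nr (bval g' z) ^+ 2) => x.
  rewrite [RHS](_ : _ = t n z * (B ^+ 2 * (1 - (1 - x / B ^+ 2)))%:C); last first.
    by rewrite rmorphM rmorphB rmorph1; ring.
  by congr (_ * _%:C); field; rewrite gt_eqF.
have S0 (l : seq (T -> C)) (z : sph) : 0 <= \sum_(g' <- l) nr (bval g' z) ^+ 2.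
  by apply: sumr_ge0 => g' _; rewrite sqr_ge0.
have many l : List.Forall J l -> forall e, 0 < e -> exists N, forall n, (N <= n)%N ->
    E (fmul (t n) (fun z : sph => (\sum_(g' <- l) nr (bval g' z) ^+ 2)%:C)) <= e.
  elim: l => [|g' l IH] lJ0 e e0; last first.
    have /List.Forall_cons_iff[Jg' lJ] := lJ0; have e2 : 0 < e / 2 by rewrite divr_gt0.
    have [N1 h1] := one _ Jg' _ e2; have [N2 h2] := IH lJ _ e2; exists (N1 + N2)%N => n nN.
    have := lerD (h1 n (leq_trans (leq_addr _ _) nN)) (h2 n (leq_trans (leq_addl _ _) nN)).
    rewrite -ReD -fscalarD -splitr; apply: le_trans.
    rewrite le_eqVlt; apply/orP; left; apply/eqP; congr (E _); apply/funext => z.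
    change (t n z * (\sum_(g0 <- g' :: l) nr (bval g0 z) ^+ 2)%:C =
      t n z * (nr (bval g' z) ^+ 2)%:C + t n z * (\sum_(g0 <- l) nr (bval g0 z) ^+ 2)%:C :> C).
    by rewrite big_cons rmorphD mulrDr.
  exists 0%N => n _; rewrite (_ : fmul _ _ = 0) ?linear0 ?ltW //.
  by apply/funext => z; rewrite /fmul big_nil rmorph0 mulr0.
have bg := star_mult_bdd (bval_star gA).
have lim0 : nlim (fun n => mu (fmul (t n) (bval g)) : C) 0.
  move=> e e0; have e2 : 0 < e / 2 by rewrite divr_gt0.
  have [l [K [K0 lJ dom]]] := boundary_domination JA gA gJ e2.
  have K1 : 0 < K + 1 by rewrite ltr_wpDl.
  have [N hN] := many l lJ _ (divr_gt0 (exprn_gt0 2 e2) K1); exists N => n /hN {}hN.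
  rewrite subr0 -(@ler_pXn2r _ 2) ?nnegrE ?nr_ge0 ?(ltW e0) //.
  have btg : bdd (fmul (t n) (bval g)) by exact: bddM.
  apply: le_trans (mu_rho btg) _; rewrite mul1r.
  have bS : bdd (fun z : sph => (\sum_(g' <- l) nr (bval g' z) ^+ 2)%:C).
    elim: l lJ {dom hN} => [_|g' l IH /List.Forall_cons_iff[Jg' lJ]].
      by exists 0 => z; rewrite big_nil nr0.
    have [B hB] := IH lJ; have [B' [B'0 hB']] := bdd_ge0 (star_mult_bdd (bval_star (JA Jg'))).
    exists (B' ^+ 2 + B) => z; rewrite big_cons rmorphD; apply: le_trans (nrD _ _) (lerD _ (hB z)).
    by rewrite nrC ger0_norm ?sqr_ge0 // lerXn2r ?nnegrE ?nr_ge0.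
  pose F : fct := ((e / 2) ^+ 2)%:C *: ((fun=> 1) : fct) +
    K%:C *: (fmul (t n) (fun z : sph => (\sum_(g' <- l) nr (bval g' z) ^+ 2)%:C)).
  apply: le_trans (_ : E F <= _).
    apply: (rho_mono rho_pos) => [||z].
    - by apply: bddM => //; exact: bddJ.
    - by apply: bddD; apply: bddZ; [exists 1 => z; rewrite nr1|exact: bddM].
    rewrite [X in _ <= complex.Re X](_ : _ = ((e / 2) ^+ 2)%:C * 1 +
      K%:C * (t n z * (\sum_(g' <- l) nr (bval g' z) ^+ 2)%:C)) // /fmul /fconj mulcJ.
    have [r /andP[r0 r1] ->] := cut_unit _ (tT n) z.
    rewrite nrM nrC ger0_norm // exprMn mulr1 -!rmorphM -rmorphD /=.
    have h1 := ler_wpM2l (sqr_ge0 r) (dom z); apply: le_trans h1 _.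
    have rr : r ^+ 2 <= r by rewrite expr2 ler_piMr.
    have r21 : r ^+ 2 <= 1 by apply: le_trans r1.
    rewrite mulrDr lerD //; first by rewrite ler_piMl ?sqr_ge0.
    by rewrite mulrCA ler_wpM2l // ler_wpM2r.
  rewrite fscalarD !fscalarZ ReD !ReZ.
  have E1 : E (fun=> 1) <= 1 * 1.
    by apply: rho_pos.2 => [|z //]; exists 1 => z; rewrite nr1.
  have -> : e ^+ 2 = (e / 2) ^+ 2 + (e / 2) ^+ 2 + 2 * (e / 2) ^+ 2 by field.
  have h1 := ler_wpM2l (sqr_ge0 (e / 2)) E1.
  have h2 : K * E (fmul (t n) (fun z : sph => (\sum_(g' <- l) nr (bval g' z) ^+ 2)%:C)) <= (e / 2) ^+ 2.
    apply: le_trans (ler_wpM2l K0 hN) _; rewrite mulrCA ler_piMr ?sqr_ge0 //.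
    by rewrite ler_pdivrMr // mul1r lerDl.
  have h3 := sqr_ge0 (e / 2); move: h1 h2; rewrite !mulr1; lra.
apply/ler_addgt0Pr => e e0; have [N hN] := lim0 _ e0.
apply: nlim_bound (hM p) _; exists N => n /hN; rewrite subr0 => h.
have -> : mu (fmul (t n) (pev p)) = mu (fmul (t n) (bval g)) - mu (fmul (t n) (bval g - pev p)).
  rewrite -fscalarB; congr (mu _); apply/funext => z.
  change (t n z * pev p z = t n z * bval g z - t n z * (bval g z - pev p z) :> C); ring.
by apply: le_trans (nrB _ _) _; rewrite addrC lerD // mt //; exact: bval_approx.
Qed.

End Singular.

(** ** Membership in the ideal *)

Lemma multiplier_bounded_op g c : gbound g c -> bounded_op (mult_op (H := H) g) c.
Proof.
move=> b; have mg := gbound_multiplier b; split=> [k u v|u].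
  apply: (hev_inj (h := H)); rewrite (mult_opE _ mg); apply/funext => z.
  change (g z * hev H (k *: u + v) z = hev H (k *: mult_op g u + mult_op g v) z :> C).
  rewrite !hevD !hevZ !(mult_opE _ mg).
  change (g z * (k * hev H u z + hev H v z) = k * (g z * hev H u z) + g z * hev H v z :> C).
  ring.
have [v [hv hn]] := b u; rewrite (_ : mult_op g u = v) //.
by apply: (hev_inj (h := H)); rewrite mult_opE.
Qed.

Lemma mult_op_poly p q : mult_op (H := H) (pfun p) (iota q) = iota (p * q).
Proof.
have [c b] := gbound_poly p; apply: (hev_inj (h := H)).
by rewrite (mult_opE _ (gbound_multiplier b)) !hev_iota pfunM.
Qed.

Lemma mult_op_diff g g' c u : multiplier H g -> multiplier H g' -> gbound (g - g') c ->
  nr (mult_op (H := H) g u - mult_op (H := H) g' u) <= c * nr u.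
Proof.
move=> mg mg' b; have [v [hv hn]] := b u; rewrite (_ : _ - _ = v) //.
by apply: (hev_inj (h := H)); rewrite linearB /= !mult_opE // hv mulrBl.
Qed.

(** Otherwise a functional separates [f] from the ideal. Once the part of it that
    is carried by the zero set is removed, what remains is given by a trace class
    operator; the weak star closure condition makes this vanish at [f], and the
    removed part vanishes at [f] because [f] does so on the zero set. *)
Lemma ideal_membership f : A_alg H f -> weak_star_closure H J f ->
  (forall x : sph, (forall g, J g -> bval g x = 0) -> bval f x = 0) -> J f.
Proof.
move=> fA fW fJ; apply: contrapT => nJ; have [del d0 gap] := ideal_gap fA nJ.
have d4 : 0 < del / 4 by rewrite divr_gt0.
have [p0 hp0] := (A_algP f).1 fA _ d4.
have [phi [phiJ phi0]] := separating_functional d0 gap hp0.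
have phib p c : mbound iota p c -> nr (phi p) <= c.
  by move=> pc; apply: (phiJ _ 0 _ J0); rewrite subr0; exact: mbound_gbound.
have [mu [mub [kap [kapE kaps]]]] := boundary_part phib.
have z1 : sph by have /cid[e he] := @sphere_point R D.+1 d_gt0; exists e.
have [rho [rp mur]] := dominating_positive z1 mub.
have [M [Mb Mt Mf]] := singular_part phiJ mub kapE kaps rp mur.
pose psf p : C := phi p - M p.
have psS : scalar psf by move=> c p q; rewrite /psf [phi _]linearP [M _]linearP /=; ring.
pose psi := HB.pack_for {scalar mpol} psf (GRing.isLinear.Build C mpol C^o *%R psf psS).
have psib p c : mbound iota p c -> nr (psi p) <= 2 * c.
  move=> pc; apply: le_trans (nrB (phi p) (M p)) _.
  by have := phib p c pc; have := Mb p c (mbound_sbound pc); lra.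
have [s [[A hA] hs]] := trace_class_repr w_gt0 iota_norm iota_CS mon_bounded (ler0n R 2) psib Mt.
have A0 : 0 <= A.
  have := hA 0%N; rewrite expr0 mulr1; apply: le_trans.
  apply: sumr_ge0 => xy _; rewrite -!iota_norm addr_ge0 ?sqr_ge0 //.
pose S k := [seq (iota xy.1, iota xy.2) | xy <- s k].
have massS j : \sum_(xy <- S j) (nr xy.1 ^+ 2 + nr xy.2 ^+ 2) <= A * 2^-1 ^+ j.
  by rewrite big_map; under eq_bigr do rewrite !iota_norm; exact: hA.
pose blk g j := \sum_(xy <- S j) hdot H (mult_op g xy.1) xy.2.
pose Psi g k := \sum_(j < k) blk g j.
have lim_psi p : nlim (Psi (pfun p)) (psi p : C).
  have [B hB] := hs p; have B0 : 0 <= B.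
    by have := le_trans (nr_ge0 _) (hB 0%N); rewrite expr0 mulr1.
  move=> e e0; have [N hN] := geo_small B0 e0; exists N.+1 => [[//|n]] nN.
  rewrite nr_dist; apply: le_trans (hN n nN).
  rewrite (_ : Psi (pfun p) n.+1 = \sum_(k < n.+1) rank_form w (s k) p); first exact: hB.
  apply: eq_bigr => k _; rewrite /blk big_map; apply: eq_bigr => xy _.
  by rewrite mult_op_poly iota_dot.
have Psi_diff g p e k : A_alg H g -> gbound (g - pfun p) e ->
    nr (Psi g k - Psi (pfun p) k) <= 2 * (A * e).
  move=> gA b; have e0 := gbound_ge0 b; have [c gc] := A_alg_bounded gA; have [c' pc] := gbound_poly p.
  have hb j : nr (blk g j - blk (pfun p) j) <= (A * e) * 2^-1 ^+ j.
    rewrite /blk -sumrB; apply: le_trans (nr_sum _ _ _) _.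
    rewrite mulrAC mulrC; apply: le_trans (ler_wpM2l e0 (massS j)); rewrite mulr_sumr.
    apply: ler_sum => xy _; rewrite -hdotBl; apply: le_trans (hdot_CS _ _) _.
    apply: le_trans (ler_wpM2r (nr_ge0 _) (mult_op_diff _ (gbound_multiplier gc) (gbound_multiplier pc) b)) _.
    rewrite -mulrA ler_wpM2l //; have := sqr_ge0 (nr xy.1 - nr xy.2); rewrite sqrrB.
    by have := sqr_ge0 (nr xy.1); have := sqr_ge0 (nr xy.2); rewrite mulr2n; lra.
  have := geo_tail (mulr_ge0 A0 e0) hb (leq0n k).
  by rewrite big_ord0 subr0 sumrB expr0 mulr1.
have Jv g : J g -> forall x : sph, (forall g', J g' -> bval g' x = 0) -> bval g x = 0.
  by move=> Jg x; apply.
have cl0 : nlim (Psi f) (0 : C).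
  apply: (weak_star_vanish onb_basis (J := J) (s := S) (A := A)) => //.
    move=> g hg; have gA : A_alg H g by case: hg => [/JA|->].
    have [c b] := A_alg_bounded gA; exists c; split; first exact: gbound_ge0 b.
    exact: multiplier_bounded_op.
  move=> g Jg e e0; have den : 0 < 2 * A + 3 by rewrite ltr_wpDl ?mulr_ge0.
  have e1 : 0 < e / (2 * A + 3) by rewrite divr_gt0.
  set e' := e / _ in e1; have eE : e = 2 * (A * e') + e' + (e' + e') by rewrite /e'; field; rewrite gt_eqF.
  have [q qb] := (A_algP g).1 (JA Jg) _ e1; have [N hN] := lim_psi q _ e1.
  exists N => n /hN h; rewrite subr0 -[X in nr X](subrK (Psi (pfun q) n)) eE.
  rewrite -[X in _ + X](subrK (psi q : C)) addrA; apply: le_trans (nrD _ _) _.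
  apply: lerD; first by apply: le_trans (nrD _ _) (lerD (Psi_diff _ _ _ n (JA Jg) qb) h).
  apply: le_trans (nrB _ _) (lerD _ (Mf _ _ _ (JA Jg) (Jv _ Jg) qb)).
  by apply: (phiJ _ g) => //; rewrite -opprB; exact: gboundN.
have den : 0 < 2 * A + 3 by rewrite ltr_wpDl ?mulr_ge0.
(* The mass [A] of the trace class operator depends on [phi], hence on [p0]; the
   approximation of [f] is therefore refined to a polynomial [p]. *)
have e1 : 0 < del / 4 / (2 * A + 3) by rewrite !divr_gt0.
set e' := _ / (2 * A + 3) in e1.
have eE : del / 4 = 2 * (A * e') + 3 * e' by rewrite /e'; field; rewrite gt_eqF.
have [p pb] := (A_algP f).1 fA _ e1.
have h1 : nr (psi p : C) <= 2 * (A * e').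
  apply: (@nlim_bound _ _ (fun n => Psi (pfun p) n - Psi f n)).
    rewrite -[psi p : C]subr0; apply: nlimD (lim_psi p) _.
    rewrite -[- 0]mulN1r; under eq_fun do rewrite -mulN1r; exact: nlimM.
  by exists 0%N => n _; rewrite nr_dist; exact: Psi_diff.
have h2 := Mf _ _ _ fA fJ pb.
have h3 : nr (phi (p0 - p)) <= e' + del / 4.
  apply/phib/gbound_mbound; rewrite pfunB.
  rewrite (_ : _ - _ = (f - pfun p) - (f - pfun p0)); first exact: gboundB.
  by rewrite opprB [RHS]addrC addrA subrK.
have h4 : nr (phi p0) <= nr (phi (p0 - p)) + (nr (psi p) + nr (M p)).
  rewrite (_ : phi p0 = phi (p0 - p) + (psi p + M p)).
    by apply: le_trans (nrD _ _) (lerD (lexx _) (nrD _ _)).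
  have -> : psi p = phi p - M p by [].
  by rewrite linearB /= !subrK.
have arith (x1 x2 x3 x4 y e b : R) : x1 <= 2 * y -> x2 <= e -> x3 <= e + b -> x4 <= x3 + (x1 + x2) ->
  2 * b <= x4 -> b = 2 * y + 3 * e -> 0 < e -> False by lra.
apply: (arith _ _ _ _ _ _ _ h1 h2 h3 h4 _ eE e1).
by apply: le_trans phi0; rewrite le_eqVlt; apply/orP; left; apply/eqP; field.
Qed.

Lemma ideal_characterization :
  J = weak_star_closure H J `&` vanishing_ideal H (zero_set J `&` unit_sphere R D.+1).
Proof.
apply/seteqP; split=> [f Jf|f [fW [fA fE]]].
  have [c b] := A_alg_bounded (JA Jf); split; last by split=> [|z [[_ zJ] _]]; [exact: JA|exact: zJ].
  split; first exact: gbound_multiplier b.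
  exact: (@subset_closure (initial_topology (@trace_pairing _ _ H)) J f Jf).
apply: ideal_membership => // x hx; apply: fE; split; last exact: row_of_sphere (svalP x).
by split=> [|g /hx //]; exact: row_of_closed (svalP x).
Qed.

End Ideal.

End MonomialModel.

Theorem theorem1p6 (R : realType) (d : nat) (hd : (0 < d)%N)
    (H : hilbertFunctionSpace R (unit_ball R d))
    (hH : regular_unitarily_invariant H)
    (J : set (unit_ball R d -> R[i])) (hJ : closed_ideal H J) :
  let E := zero_set J `&` unit_sphere R d in
  J = weak_star_closure H J `&` vanishing_ideal H E.
Proof.
case: d hd H hH J hJ => // D _ H [a [K [_ a_gt0 a_ratio K_series K_kernel]]] J hJ /=.
have [iota [iota_hev iota_monomial iota_complete]] := monomial_model a_gt0 K_series K_kernel.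
have eval_bounded z : exists k : H, forall u, hev H u z = hdot H u k.
  by have [k [_ hk]] := K_kernel z; exists k.
exact: (ideal_characterization a_gt0 a_ratio eval_bounded iota_hev iota_monomial iota_complete hJ).
Qed.
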